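(* Let $\alpha\in[0,d)$ and let $f$ be an SGF on $\mathbb{R}^d$ or $\mathbb{Z}^d$ with covariance kernel $K$ and spectral measure $\mu$, satisfying one of the following conditions: (i) $K(x)/k_\alpha(x)$ is slowly varying as $x\to\infty$; (ii) $\alpha>0$ and $\mu$ has a density $\rho$ in a neighbourhood of the origin such that $\rho(\lambda)/\rho_\alpha(\lambda)$ is slowly varying as $\lambda\to0$; (iii) $\mu$ is radial (i.e. the field $f$ is isotropic) and $\mu[B(\delta)]/\mu_\alpha[B(\delta)]$ is slowly varying as $\delta\to0$; (iv) $\alpha=0$ and $\mu$ has an atom at the origin. Then: (1) $\delta\mapsto\delta^{-\alpha}\mu[B(\delta)]$ is slowly varying as $\delta\to0$; and (2) $T\mapsto T^{-\alpha}\,\mathrm{Cap}_f(B(T))$ is slowly varying as $T\to\infty$. In particular: $\lim_{\delta\to0}\frac{\log\mu[B(\delta)]}{\log\delta}=\alpha$; for every $\epsilon>0$, $\mathrm{Cap}_f(B(T+T^{1-\epsilon}))\sim\mathrm{Cap}_f(B(T))$ as $T\to\infty$; and there is $c>0$ such that $\mu[B(2\delta)]\le c\,\mu[B(\delta)]$ for all $\delta>0$.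
   Context: An SGF on $\mathbb{R}^d$ or $\mathbb{Z}^d$ is a continuous (in the case of $\mathbb{R}^d$), centred, non-degenerate, stationary Gaussian field $f$. Its covariance kernel is $K(x)=\mathbb{E}[f(0)f(x)]$; its spectral measure $\mu$ is the unique non-negative, finite, symmetric measure with $K=\mathcal{F}[\mu]$, where $\mathcal{F}[\mu](x)=\int e^{-2\pi i\langle\lambda,x\rangle}d\mu(\lambda)$. It lives on $\mathbb{R}^d$ for fields on $\mathbb{R}^d$, and on the torus $\mathbb{R}^d/\mathbb{Z}^d$ (regarded as included in $\mathbb{R}^d$ as $[-1/2,1/2)^d$) for fields on $\mathbb{Z}^d$. $B(r)$ is the closed Euclidean ball of radius $r$ about the origin; for fields on $\mathbb{Z}^d$, a spatial domain $B(T)$ is understood as $B(T)\cap\mathbb{Z}^d$. Radial means depending only on the distance from the origin (rotation invariant). Capacity: for compact $D$, $$\mathrm{Cap}_f(D)=\Big(\min_{\nu\in\mathcal{P}(D)}\int_D\int_DK(x-y)\,d\nu(x)\,d\nu(y)\Big)^{-1}\in(0,\infty],$$ where $\mathcal{P}(D)$ is the set of Borel probability measures on $D$. Riesz kernel: for $\alpha\in[0,d)$, $k_\alpha(x)=B_{\alpha,d}|x|^{-\alpha}$ with $B_{\alpha,d}=\frac{\Gamma(1+\alpha/2)\Gamma(d/2)}{\pi^\alpha\Gamma((d-\alpha)/2)}$. Its spectral measure $\mu_\alpha$ is, for $\alpha\in(0,d)$, the absolutely continuous measure on $\mathbb{R}^d$ with density $\rho_\alpha(\lambda)=A_{\alpha,d}|\lambda|^{\alpha-d}$,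 $A_{\alpha,d}=\frac{\alpha\Gamma(d/2)}{2\pi^{d/2}}$, and $\mu_0=\delta_0$; thus $\mu_\alpha[B(\delta)]=\delta^\alpha$. A function $w:\mathbb{R}^+\to\mathbb{R}^+$ is slowly varying as $x\to x_0$ ($x_0\in\{0,\infty\}$) if $w(ux)/w(x)\to1$ as $x\to x_0$ for all $u>0$. A real-valued function $W$ on (a subset of) $\mathbb{R}^d$ or $\mathbb{Z}^d$ is slowly varying as $x\to x_0$ if there is a slowly varying $w:\mathbb{R}^+\to\mathbb{R}^+$ with $W(x)\sim w(|x|)$ as $x\to x_0$. $a\sim b$ means $a/b\to1$.
   Formalization: Slowly varying functions w are required to be measurable (the usual Karamata convention); without this, condition (i) for fields on Z^d admits non-measurable w for which the conclusions fail, while on R^d and in (ii), (iii) it is no restriction. *)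

(* Defs.v *)
From HB Require Import structures.
From mathcomp Require Import all_boot all_order all_algebra.
From mathcomp Require Import all_classical all_reals all_analysis.
From mathcomp.real_closed Require Import complex.

Set Implicit Arguments.
Unset Strict Implicit.
Unset Printing Implicit Defensive.

Import Order.TTheory GRing.Theory Num.Theory.
Import numFieldNormedType.Exports.

Local Open Scope classical_set_scope.
Local Open Scope ring_scope.

Section euclidean.
Context {R : realType}.

Definition Borel (d : nat) := g_sigma_algebraType (@open 'rV[R]_d).

Definition dotp d (x y : 'rV[R]_d) : R := \sum_i x 0 i * y 0 i.

(* The library norm on ['rV[R]_d] is the sup norm. *)
Definition enorm d (x : 'rV[R]_d) : R := Num.sqrt (dotp x x).

Definition eball {d} (r : R) : set 'rV[R]_d := [set x | enorm x <= r].

(* d-dimensional Lebesgue measure as an iterated product: on Borel sets each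
   step is [product_measure1 lebesgue_measure (lebesgue_rV d')], along
   R^(1 + d') = R * R^d'. *)
Fixpoint lebesgue_rV {d : nat} : set (Borel d) -> \bar R :=
  match d with
  | 0 => fun A => \d_(0 : Borel 0) A
  | d'.+1 => fun A : set 'rV[R]_(1 + d') =>
      (\int[lebesgue_measure]_t
         lebesgue_rV [set y : 'rV[R]_d' | A (row_mx (t%:M : 'rV[R]_1) y)])%E
  end.

End euclidean.

Arguments Borel R d : clear implicits.

Section regular_variation.
Context {R : realType}.

(* [F] is [pinfty_nbhs R] or [at_right 0]. As usual in Karamata's theory,
   measurability is part of the definition. *)
Definition slowly_varying (F : set_system R) (w : R -> R) : Prop :=
  [/\ measurable_fun (`]0, +oo[ : set R) w,
      forall x, 0 < x -> 0 < w x
    & forall u, 0 < u -> w (u * x) / w x @[x --> F] --> (1 : R)].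

(* [x] tends to infinity inside [S]. *)
Definition infinity_within d (S : set 'rV[R]_d) : set_system 'rV[R]_d :=
  filter_from [set: R] (fun M => S `&` [set x | M < enorm x]).

(* [G] is [infinity_within S] or [0^'], with [F] the corresponding filter on
   the positive reals. *)
Definition slowly_varying_rV d (G : set_system 'rV[R]_d) (F : set_system R)
    (W : 'rV[R]_d -> R) : Prop :=
  exists2 w, slowly_varying F w & W x / w (enorm x) @[x --> G] --> (1 : R).

End regular_variation.

Section fields.
Context {R : realType}.

Variant site_type := Continuum | IntLattice.

Definition sites {d} (D : site_type) : set 'rV[R]_d :=
  match D with
  | Continuum => setT
  | IntLattice => [set x | forall i, x 0 i \is a Num.int]
  end.

(* The torus R^d / Z^d is the cube [-1/2, 1/2)^d of R^d. *)
Definition frequencies {d} (D : site_type) : set 'rV[R]_d :=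
  match D with
  | Continuum => setT
  | IntLattice => [set l | forall i, - 2^-1 <= l 0 i < 2^-1]
  end.

(* Negation on the torus fixes the coordinate -1/2. *)
Definition freq_opp {d} (D : site_type) (l : 'rV[R]_d) : 'rV[R]_d :=
  match D with
  | Continuum => - l
  | IntLattice => \row_i (if l 0 i == - 2^-1 then - 2^-1 else - l 0 i)
  end.

Definition ball_in {d} (D : site_type) (T : R) : set 'rV[R]_d :=
  eball T `&` sites D.

(* [normal_prob m 0] is not a Dirac mass in the library. *)
Definition gaussian_law (m s : R) : set R -> \bar R :=
  if s == 0 then \d_(m : measurableTypeR R) else normal_prob m s.

Section random_field.
Context {dO : measure_display} {Omega : measurableType dO}
        {P : probability Omega R} {d : nat}.
Implicit Type f : 'rV[R]_d -> {RV P >-> R}.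

Definition covariance_kernel f (x : 'rV[R]_d) : R :=
  fine ('E_P[fun w => (f 0%R w * f x w)%R])%E.

(* A field on Z^d is a family on R^d whose values off [sites IntLattice] are
   ignored. *)
Record SGF (D : site_type) f : Prop := {
  SGF_gaussian : forall n (x : 'I_n -> 'rV[R]_d) (a : 'I_n -> R),
    (forall i, sites D (x i)) ->
    exists m s : R, forall A : set (measurableTypeR R), measurable A ->
      P [set w | A (\sum_i a i * f (x i) w)] = gaussian_law m s A;
  SGF_centred : forall x, sites D x -> ('E_P[f x] = 0)%E;
  SGF_stationary : forall n (x : 'I_n -> 'rV[R]_d) (h : 'rV[R]_d),
    (forall i, sites D (x i)) -> sites D h ->
    forall A : set (n.-tuple (measurableTypeR R)), measurable A ->
      P [set w | A [tuple f (x i + h) w | i < n]] =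
      P [set w | A [tuple f (x i) w | i < n]];
  SGF_nondegenerate : (0 < 'V_P[f 0%R])%E;
  SGF_continuous : D = Continuum ->
    {ae P, forall w, continuous (fun x => f x w)}
}.

End random_field.

Section spectral.
Context {d : nat}.
Implicit Types (K : 'rV[R]_d -> R) (mu : {finite_measure set (Borel R d) -> \bar R}).

(* \int exp(- 2 i pi <l, x>) dmu(l) *)
Definition fourier mu (x : 'rV[R]_d) : R[i] :=
  Complex (\int[mu]_l cos (2 * pi * dotp l x))
          (- \int[mu]_l sin (2 * pi * dotp l x)).

Record spectral_measure (D : site_type) K mu : Prop := {
  spectral_carrier : mu (~` frequencies D) = 0%E;
  spectral_symmetric : forall A : set (Borel R d),
    measurable A -> A `<=` frequencies D ->
    mu (frequencies D `&` freq_opp D @^-1` A) = mu A;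
  spectral_fourier : forall x, sites D x -> Complex (K x) 0 = fourier mu x
}.

(* Invariance under SO(d). For d = 1, where SO(d) is trivial, dependence on
   |l| only is [spectral_symmetric]. *)
Definition radial mu : Prop :=
  forall O : 'M[R]_d, O *m O^T = 1%:M -> \det O = 1 ->
  forall A : set (Borel R d), measurable A ->
    mu ((fun l : 'rV[R]_d => l *m O) @^-1` A) = mu A.

(* [mu] has the density [rho] on the open set [U]. *)
Definition has_density_on mu (U : set 'rV[R]_d) (rho : 'rV[R]_d -> R) : Prop :=
  [/\ measurable_fun (U : set (Borel R d)) rho,
      forall l, U l -> 0 <= rho l
    & forall A : set (Borel R d), measurable A -> A `<=` U ->
        mu A = (\int[lebesgue_rV]_(l in A) (rho l)%:E)%E].

Definition energy K (D : set 'rV[R]_d) (nu : probability (Borel R d) R) :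
    \bar R :=
  (\int[nu]_(x in (D : set (Borel R d)))
     \int[nu]_(y in (D : set (Borel R d))) (K (x - y)%R)%:E)%E.

(* The probability measures on [D] are the Borel probability measures on R^d
   that give mass 1 to [D]. The infimum is attained for compact [D], and
   0^-1 = +oo. Since [fine +oo = 0], positivity of [fine (capacity K D)], as
   required by [slowly_varying], also says that the capacity is finite. *)
Definition capacity K (D : set 'rV[R]_d) : \bar R :=
  ((ereal_inf [set energy K D nu | nu in
      [set nu : probability (Borel R d) R | nu D = 1%E]])^-1)%E.

End spectral.

Section riesz.

Definition Gamma (s : R) : R :=
  \int[lebesgue_measure]_(t in `]0, +oo[) (t `^ (s - 1) * expR (- t)).

Definition riesz_B (alpha : R) (d : nat) : R :=
  Gamma (1 + alpha / 2) * Gamma (d%:R / 2) /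
  (pi `^ alpha * Gamma ((d%:R - alpha) / 2)).

Definition riesz_A (alpha : R) (d : nat) : R :=
  alpha * Gamma (d%:R / 2) / (2 * pi `^ (d%:R / 2)).

Definition riesz_kernel (alpha : R) d (x : 'rV[R]_d) : R :=
  riesz_B alpha d * enorm x `^ (- alpha).

Definition riesz_density (alpha : R) d (l : 'rV[R]_d) : R :=
  riesz_A alpha d * enorm l `^ (alpha - d%:R).

Definition riesz_measure (alpha : R) d (A : set (Borel R d)) : \bar R :=
  if alpha == 0 then \d_(0 : Borel R d) A
  else (\int[lebesgue_rV]_(l in A) (riesz_density alpha l)%:E)%E.

End riesz.

Section conditions.
Context {d : nat} (D : site_type) (alpha : R) (K : 'rV[R]_d -> R)
        (mu : {finite_measure set (Borel R d) -> \bar R}).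

Definition kernel_condition : Prop :=
  slowly_varying_rV (infinity_within (sites D)) (pinfty_nbhs R)
    (fun x => K x / riesz_kernel alpha x).

Definition density_condition : Prop :=
  0 < alpha /\
  exists (U : set 'rV[R]_d) (rho : 'rV[R]_d -> R),
    [/\ open U, U 0, has_density_on mu U rho
      & slowly_varying_rV (dnbhs (0 : 'rV[R]_d)) (at_right 0)
          (fun l => rho l / riesz_density alpha l)].

Definition radial_condition : Prop :=
  radial mu /\
  slowly_varying (at_right 0)
    (fun r => fine (mu (eball r)) / fine (riesz_measure alpha (eball r : set 'rV[R]_d))).

Definition atom_condition : Prop :=
  alpha = 0 /\ (0 < mu [set 0%R])%E.

End conditions.

End fields.

(* Main.v *)
Require Import Defs.
From HB Require Import structures.
From mathcomp Require Import all_boot all_order all_algebra.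
From mathcomp Require Import all_classical all_reals all_analysis.
From mathcomp Require Import measurable_realfun ring lra.

Set Implicit Arguments.
Unset Strict Implicit.
Unset Printing Implicit Defensive.

Import Order.TTheory GRing.Theory Num.Theory.
Import numFieldNormedType.Exports.

Local Open Scope classical_set_scope.
Local Open Scope ring_scope.

(** By Plancherel, the energy of a probability measure [nu] is the integral of
    |nu^|^2 against [mu], and the least energy on B(T) is approached by finitely
    supported [nu].  It is at least a constant times mu(B(1/T)), because |nu^|^2
    is bounded below on frequencies of order 1/T.  The dilation [x |-> u x]
    carries a measure on B(T) to one on B(uT); when [mu] scales like r^alpha near
    the origin, this multiplies the energy by u^-alpha up to o(mu(B(1/T))).
    Frequencies far above 1/T are first damped by convolving [nu] with a measure
    of much smaller support whose transform decays fast, and on Z^d the dilated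
    points are rounded to the lattice.  Hence the least energy is regularly
    varying with index -alpha.

    For a spectral atom or density the scaling of [mu] is checked directly.  For
    radial [mu], averaging |nu^|^2 over finitely many rotations makes it almost
    radial, so only the masses of balls matter.  If the kernel is regularly
    varying, the energies dilate correctly for any family of signed measures of
    bounded mass, since both energies are double sums of the kernel; applied to
    trigonometric polynomials that are almost indicators of balls, this also
    gives the regular variation of mu(B(1/T)). *)

(** Errors are additive multiples of mu(B(1/T)); the lower bound for the least energy turns them
    into relative ones. The obstacle is that a measure on a grid of step h has a periodic transform,
    so convolution damps frequencies only in the cell |l_i| <= 1/(2h). On Z^d, h = 1 and the torus
    lies in this cell; on R^d, h depends on T and is taken so small that the mass of [mu] off the
    cell is negligible, all constants being independent of h. Convolution and rounding enlarge the
    support slightly; the resulting factor 1 + g is removed by continuity of powers. For a regularly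
    varying kernel nothing is known about ball masses beforehand. Errors are then measured against
    G(T) = T^(-alpha) w(T), which is compared with mu(B(1/T)) from both sides through the energy of
    a mollifier. The asymptotics of the kernel hold at large distances only; near pairs are
    dominated by G(T) (T/(|x| + 1))^beta with alpha < beta < d, and since beta < d, convolution
    makes their total weight small, whatever the signs of the measures. *)

Section bounded_measurable.
Context {disp : measure_display} {T : measurableType disp} {R : realType}.
Implicit Types (f g : T -> R).

(** A class stable under sums and products whose members are integrable over every measurable set
    for every finite measure, so that the integral lemmas below carry no integrability
    conditions. *)
Definition bm f : Prop :=
  measurable_fun setT f /\ exists M, forall x, `|f x| <= M.

Lemma bm_cst c : bm (fun=> c).
Proof. by split; [exact: measurable_cst|exists `|c|]. Qed.

Lemma bmD f g : bm f -> bm g -> bm (fun x => f x + g x).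
Proof.
move=> [mf [M hM]] [mg [N hN]]; split; first exact: measurable_funD.
by exists (M + N) => x; rewrite (le_trans (ler_normD _ _))// lerD.
Qed.

Lemma bmN f : bm f -> bm (fun x => - f x).
Proof.
move=> [mf [M hM]]; split; first exact: measurableT_comp.
by exists M => x; rewrite normrN.
Qed.

Lemma bmB f g : bm f -> bm g -> bm (fun x => f x - g x).
Proof. by move=> hf /bmN; exact: bmD. Qed.

Lemma bmM f g : bm f -> bm g -> bm (fun x => f x * g x).
Proof.
move=> [mf [M hM]] [mg [N hN]]; split; first exact: measurable_funM.
by exists (M * N) => x; rewrite normrM ler_pM.
Qed.

Lemma bmZ c f : bm f -> bm (fun x => c * f x).
Proof. exact/bmM/bm_cst. Qed.

Lemma bm_norm f : bm f -> bm (fun x => `|f x|).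
Proof.
move=> [mf [M hM]]; split; first exact: measurableT_comp.
by exists M => x; rewrite normr_id.
Qed.

Lemma bm_sum (I : Type) (s : seq I) (F : I -> T -> R) :
  (forall i, bm (F i)) -> bm (fun x => \sum_(i <- s) F i x).
Proof.
move=> hF; elim: s => [|i s ih].
  by under eq_fun do rewrite big_nil; exact: bm_cst.
by under eq_fun do rewrite big_cons; exact: bmD.
Qed.

Context (mu : {finite_measure set T -> \bar R}).

Lemma bm_integrable A f : measurable A -> bm f ->
  mu.-integrable A (EFin \o f).
Proof.
move=> mA [mf [M hM]]; apply: measurable_bounded_integrable => //.
- by rewrite ltey_eq fin_num_measure.
- exact: measurable_funS mf.
- exists M; split; first exact: num_real.
  by move=> N MN x _; exact: le_trans (hM x) (ltW MN).
Qed.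

Lemma RintD A f g : measurable A -> bm f -> bm g ->
  \int[mu]_(x in A) (f x + g x) =
  \int[mu]_(x in A) f x + \int[mu]_(x in A) g x.
Proof. by move=> mA hf hg; rewrite RintegralD//; exact: bm_integrable. Qed.

Lemma RintZ A c f : measurable A -> bm f ->
  \int[mu]_(x in A) (c * f x) = c * \int[mu]_(x in A) f x.
Proof. by move=> mA hf; rewrite RintegralZl//; exact: bm_integrable. Qed.

Lemma Rint_sum (I : Type) (s : seq I) (F : I -> T -> R) A : measurable A ->
  (forall i, bm (F i)) ->
  \int[mu]_(x in A) (\sum_(i <- s) F i x) = \sum_(i <- s) \int[mu]_(x in A) F i x.
Proof.
move=> mA hF; elim: s => [|i s ih].
  rewrite big_nil; under eq_Rintegral do rewrite big_nil.
  by rewrite Rintegral_cst// mul0r.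
rewrite big_cons -ih -RintD//; last exact: bm_sum.
by under eq_Rintegral do rewrite big_cons.
Qed.

Lemma Rint_le A f g : measurable A -> bm f -> bm g ->
  (forall x, A x -> f x <= g x) ->
  \int[mu]_(x in A) f x <= \int[mu]_(x in A) g x.
Proof. by move=> mA hf hg fg; apply: le_Rintegral => //; exact: bm_integrable. Qed.

Lemma Rint_le_cst A f c : measurable A -> bm f ->
  (forall x, A x -> f x <= c) -> \int[mu]_(x in A) f x <= c * fine (mu A).
Proof. by move=> mA hf fc; rewrite -Rintegral_cst// Rint_le//; exact: bm_cst. Qed.

Lemma Rint_ge_cst A f c : measurable A -> bm f ->
  (forall x, A x -> c <= f x) -> c * fine (mu A) <= \int[mu]_(x in A) f x.
Proof. by move=> mA hf fc; rewrite -Rintegral_cst// Rint_le//; exact: bm_cst. Qed.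

Lemma Rint_split A B f : measurable A -> measurable B -> bm f ->
  \int[mu]_(x in A) f x =
  \int[mu]_(x in A `&` B) f x + \int[mu]_(x in A `\` B) f x.
Proof.
move=> mA mB hf; rewrite -Rintegral_setU//.
- by rewrite setUIDK.
- exact: measurableI.
- exact: measurableD.
- by rewrite setUIDK; exact: bm_integrable.
- by apply/disj_setPS => x [[_ ?] []].
Qed.

Lemma Rint_subset A B f : measurable A -> measurable B -> bm f ->
  A `<=` B -> (forall x, B x -> 0 <= f x) ->
  \int[mu]_(x in A) f x <= \int[mu]_(x in B) f x.
Proof.
move=> mA mB hf AB f0; rewrite (Rint_split mB mA hf) setIidr// lerDl.
by apply: Rintegral_ge0 => x [Bx _]; exact: f0.
Qed.

Lemma fine_mu_le A B : measurable A -> measurable B -> A `<=` B ->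
  fine (mu A) <= fine (mu B).
Proof.
move=> mA mB AB; rewrite fine_le ?fin_num_measure//.
by apply: le_measure; rewrite ?inE.
Qed.

Lemma fine_mu_ge0 A : 0 <= fine (mu A).
Proof. by rewrite fine_ge0. Qed.

Lemma fine_muD A B : measurable A -> measurable B ->
  fine (mu A) = fine (mu (A `&` B)) + fine (mu (A `\` B)).
Proof.
move=> mA mB; have := @Rint_split A B (fun=> 1) mA mB (bm_cst 1).
rewrite !Rintegral_cst ?mul1r//; [exact: measurableD|exact: measurableI].
Qed.

End bounded_measurable.

(** * Euclidean norm and Borel structure on row vectors *)

Section euclidean_geometry.
Context {R : realType} {d : nat}.
Implicit Types x y z : 'rV[R]_d.

Lemma dotpC x y : dotp x y = dotp y x.
Proof. by apply: eq_bigr => i _; rewrite mulrC. Qed.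

Lemma dotpDl x y z : dotp (x + y) z = dotp x z + dotp y z.
Proof. by rewrite -big_split; apply: eq_bigr => i _; rewrite mxE mulrDl. Qed.

Lemma dotpZl c x y : dotp (c *: x) y = c * dotp x y.
Proof. by rewrite mulr_sumr; apply: eq_bigr => i _; rewrite mxE mulrA. Qed.

Lemma dotpNl x y : dotp (- x) y = - dotp x y.
Proof. by rewrite -scaleN1r dotpZl mulN1r. Qed.

Lemma dotpBl x y z : dotp (x - y) z = dotp x z - dotp y z.
Proof. by rewrite dotpDl dotpNl. Qed.

Lemma dotpDr x y z : dotp x (y + z) = dotp x y + dotp x z.
Proof. by rewrite dotpC dotpDl !(dotpC x). Qed.

Lemma dotpZr c x y : dotp x (c *: y) = c * dotp x y.
Proof. by rewrite dotpC dotpZl dotpC. Qed.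

Lemma dotpNr x y : dotp x (- y) = - dotp x y.
Proof. by rewrite dotpC dotpNl dotpC. Qed.

Lemma dotpBr x y z : dotp x (y - z) = dotp x y - dotp x z.
Proof. by rewrite dotpDr dotpNr. Qed.

Lemma dotp0l x : dotp 0 x = 0.
Proof. by rewrite -(scale0r (0 : 'rV[R]_d)) dotpZl mul0r. Qed.

Lemma dotp_ge0 x : 0 <= dotp x x.
Proof. by apply: sumr_ge0 => i _; rewrite -expr2 sqr_ge0. Qed.

Lemma enorm_ge0 x : 0 <= enorm x. Proof. exact: sqrtr_ge0. Qed.

Lemma enorm_sqr x : enorm x ^+ 2 = dotp x x.
Proof. by rewrite sqr_sqrtr// dotp_ge0. Qed.

Lemma enormZ c x : enorm (c *: x) = `|c| * enorm x.
Proof.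
rewrite /enorm dotpZl dotpZr mulrA -expr2 sqrtrM ?sqr_ge0//.
by rewrite sqrtr_sqr.
Qed.

Lemma enormN x : enorm (- x) = enorm x.
Proof. by rewrite -scaleN1r enormZ normrN1 mul1r. Qed.

Lemma enorm0 : enorm (0 : 'rV[R]_d) = 0.
Proof. by rewrite -(scale0r (0 : 'rV[R]_d)) enormZ normr0 mul0r. Qed.

Lemma coord_le_enorm x i : `|x 0 i| <= enorm x.
Proof.
rewrite -sqrtr_sqr ler_wsqrtr// /dotp (bigD1 i)//= -expr2 lerDl.
by apply: sumr_ge0 => j _; rewrite -expr2 sqr_ge0.
Qed.

Lemma enorm_eq0 x : (enorm x == 0) = (x == 0).
Proof.
apply/eqP/eqP => [x0|->]; last exact: enorm0.
apply/rowP => i; rewrite mxE; apply/eqP; rewrite -normr_le0 -x0.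
exact: coord_le_enorm.
Qed.

Lemma enorm_gt0 x : (0 < enorm x) = (x != 0).
Proof. by rewrite lt_def enorm_eq0 enorm_ge0 andbT. Qed.

(** The squared norm of |y|^2 x - <x,y> y is non-negative and equals |y|^2 (|x|^2 |y|^2 -
    <x,y>^2). *)
Lemma CauchySchwarz_dotp x y : `|dotp x y| <= enorm x * enorm y.
Proof.
have [->|y0] := eqVneq y 0; first by rewrite dotpC dotp0l normr0 enorm0 mulr0.
have yy : 0 < enorm y ^+ 2 by rewrite exprn_gt0 ?enorm_gt0.
rewrite -(@ler_pXn2r _ 2) ?nnegrE ?mulr_ge0 ?enorm_ge0//.
rewrite exprMn real_normK ?num_real// -(ler_pM2l yy).
have := dotp_ge0 (enorm y ^+ 2 *: x - dotp x y *: y).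
rewrite !(dotpBl, dotpBr, dotpZl, dotpZr) -!enorm_sqr (dotpC y x) => h.
rewrite -subr_ge0; apply: le_trans h _; rewrite le_eqVlt; apply/orP; left.
by apply/eqP; ring.
Qed.

Lemma enormD x y : enorm (x + y) <= enorm x + enorm y.
Proof.
rewrite -(@ler_pXn2r _ 2) ?nnegrE ?addr_ge0 ?enorm_ge0//.
rewrite enorm_sqr dotpDl !dotpDr -!enorm_sqr (dotpC y x).
have := le_trans (ler_norm _) (CauchySchwarz_dotp x y).
by rewrite sqrrD; lra.
Qed.

Lemma enormB x y : enorm (x - y) <= enorm x + enorm y.
Proof. by rewrite -(enormN y) enormD. Qed.

Lemma enorm_distC x y : enorm (x - y) = enorm (y - x).
Proof. by rewrite -enormN opprB. Qed.

Lemma enorm_lerB x y : `|enorm x - enorm y| <= enorm (x - y).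
Proof.
have h (a b : 'rV[R]_d) : enorm a - enorm b <= enorm (a - b).
  by rewrite lerBlDr -{1}(subrK b a) enormD.
by rewrite ler_norml h andbT lerNl opprB enorm_distC h.
Qed.

Lemma enorm_le_coord x c : 0 <= c -> (forall i, `|x 0 i| <= c) ->
  enorm x <= Num.sqrt d%:R * c.
Proof.
move=> c0 h; rewrite -[X in _ * X](ger0_norm c0) -sqrtr_sqr -sqrtrM ?ler0n//.
apply: ler_wsqrtr; rewrite /dotp.
apply: (@le_trans _ _ (\sum_(i < d) c ^+ 2)); last first.
  by rewrite sumr_const card_ord mulr_natl.
apply: ler_sum => i _; rewrite -expr2 -real_normK ?num_real//.
by rewrite ler_pXn2r ?nnegrE.
Qed.

Lemma enorm_delta (i : 'I_d) : enorm (delta_mx 0 i : 'rV[R]_d) = 1.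
Proof.
rewrite /enorm /dotp (bigD1 i)//= mxE !eqxx mulr1 big1 ?addr0 ?sqrtr1// => j ji.
by rewrite mxE (negbTE ji) andbF mulr0.
Qed.

Lemma sum_continuous (I : Type) (s : seq I) (T : topologicalType)
    (F : I -> T -> R) : (forall i, continuous (F i : T -> R)) ->
  continuous (fun t => \sum_(i <- s) F i t).
Proof.
move=> hF; elim: s => [|i s ih] x.
  by under eq_fun do rewrite big_nil; exact: cst_continuous.
under eq_fun do rewrite big_cons; apply: continuousD; [exact: hF|exact: ih].
Qed.

Lemma continuous_add (T : topologicalType) (f g : T -> R) :
  continuous f -> continuous g -> continuous (fun t => f t + g t).
Proof. by move=> cf cg t; apply: continuousD; [exact: cf|exact: cg]. Qed.

Lemma continuous_mul (T : topologicalType) (f g : T -> R) :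
  continuous f -> continuous g -> continuous (fun t => f t * g t).
Proof. by move=> cf cg t; apply: continuousM; [exact: cf|exact: cg]. Qed.

Lemma continuous_dotp y : continuous (fun x => dotp x y).
Proof.
apply: sum_continuous => i x; apply: continuousM; last exact: cst_continuous.
exact: coord_continuous.
Qed.

Lemma continuous_enorm : continuous (@enorm R d).
Proof.
have h : continuous (fun x => dotp x x).
  by apply: sum_continuous => i x; apply: continuousM; exact: coord_continuous.
by move=> x; apply: (continuous_comp (h x)); exact: sqrt_continuous.
Qed.

Lemma continuous_enorm_sub (v : 'rV[R]_d) : continuous (fun x => enorm (x - v)).
Proof.
move=> x; apply: continuous_comp; last exact: continuous_enorm.
by apply: (@continuousB _ _ _ id (cst v)); [exact: cvg_id|exact: cst_continuous].
Qed.

Lemma continuous_Borel (f : 'rV[R]_d -> R) : continuous f ->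
  measurable_fun setT (f : Borel R d -> R).
Proof.
move=> cf; apply: (measurability _ (RGenOpens.measurableE R)) => //.
move=> _ [_ [a [b ->] <-]]; rewrite setTI.
apply: sub_sigma_algebra; move/continuousP: cf; apply.
exact: interval_open.
Qed.

Lemma continuous_Borel_map (g : 'rV[R]_d -> 'rV[R]_d) : continuous g ->
  measurable_fun setT (g : Borel R d -> Borel R d).
Proof.
move=> cg; apply: (@measurability _ _ (Borel R d) (Borel R d) setT g (@open 'rV[R]_d)) => //.
move=> _ [A oA <-]; rewrite setTI.
by apply: sub_sigma_algebra; move/continuousP: cg; apply.
Qed.

Lemma measurable_eball (r : R) : measurable (eball r : set (Borel R d)).
Proof.
rewrite (_ : eball r = setT `&` (@enorm R d : Borel R d -> R) @^-1` `]-oo, r]).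
  by apply: (continuous_Borel continuous_enorm) => //; exact: measurable_itv.
by rewrite setTI; apply/seteqP; split => x /=; rewrite in_itv.
Qed.

Lemma continuous_bm (f : 'rV[R]_d -> R) M : continuous f ->
  (forall x, `|f x| <= M) -> bm (f : Borel R d -> R).
Proof. by move=> cf hM; split; [exact: continuous_Borel|exists M]. Qed.

End euclidean_geometry.

(** * Lipschitz bounds for sine and cosine *)

Section trigonometric_bounds.
Context {R : realType}.
Implicit Types x y : R.

Lemma abs_sin_le x : `|sin x| <= `|x|.
Proof.
have h (t : R) : 0 <= t -> `|sin t| <= t.
  rewrite le_eqVlt => /predU1P[<-|t0]; first by rewrite sin0 normr0.
  have [c _] : exists2 c, c \in `]0, t[ & sin t - sin 0 = cos c * (t - 0).
    by apply: MVT => //; exact/continuous_subspaceT/continuous_sin.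
  rewrite sin0 !subr0 => ->; rewrite normrM (gtr0_norm t0).
  by rewrite ler_piMl ?cos_max// ltW.
have [x0|x0] := leP 0 x; first by rewrite (ger0_norm x0) h.
by rewrite (ltr0_norm x0) -normrN -sinN h// oppr_ge0 ltW.
Qed.

Lemma cos_lipschitz x y : `|cos x - cos y| <= `|x - y|.
Proof.
have -> : cos x - cos y = -2 * (sin ((x + y) / 2) * sin ((x - y) / 2)).
  have [hx hy] : x = (x + y) / 2 + (x - y) / 2 /\ y = (x + y) / 2 - (x - y) / 2.
    by split; lra.
  by rewrite [in LHS]hx [X in _ - cos X]hy cosD cosB; ring.
rewrite 2!normrM normrN (ger0_norm (ler0n _ 2)).
have h1 := sin_max ((x + y) / 2); have h2 := abs_sin_le ((x - y) / 2).
have -> : `|x - y| = 2 * (1 * `|(x - y) / 2|).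
  by rewrite mul1r normrM [`|2^-1|]ger0_norm// mulrCA divff ?mulr1.
by rewrite ler_pM2l// ler_pM.
Qed.

Lemma sin_lipschitz x y : `|sin x - sin y| <= `|x - y|.
Proof.
rewrite -!cosBpihalf (le_trans (cos_lipschitz _ _))//.
by have -> : x - pi / 2 - (y - pi / 2) = x - y by ring.
Qed.

End trigonometric_bounds.

(** * Energies of finitely supported measures *)

Section weighted_points.
Context {R : realType} {d : nat}.
Implicit Types (s t : seq (R * 'rV[R]_d)) (l x : 'rV[R]_d).

(* A list of weighted points stands for the signed measure
   [\sum_a a.1 delta_(a.2)]; [pow s] is the squared modulus of its transform. *)
Definition csum s l : R := \sum_(a <- s) a.1 * cos (2 * pi * dotp l a.2).
Definition ssum s l : R := \sum_(a <- s) a.1 * sin (2 * pi * dotp l a.2).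
Definition pow s l : R := csum s l ^+ 2 + ssum s l ^+ 2.
Definition mass s : R := \sum_(a <- s) `|a.1|.
Definition weighted_prob s : Prop :=
  (forall a, a \in s -> 0 <= a.1) /\ \sum_(a <- s) a.1 = 1.
Definition supp_in s (A : set 'rV[R]_d) : Prop := forall a, a \in s -> A a.2.
Definition conv s t := [seq (a.1 * b.1, a.2 + b.2) | a <- s, b <- t].
Definition push (f : 'rV[R]_d -> 'rV[R]_d) s := [seq (a.1, f a.2) | a <- s].

Lemma big_conv (F : R * 'rV[R]_d -> R) s t :
  \sum_(c <- conv s t) F c =
  \sum_(a <- s) \sum_(b <- t) F (a.1 * b.1, a.2 + b.2).
Proof. by rewrite /conv big_allpairs_dep. Qed.

Lemma csum_conv s t l :
  csum (conv s t) l = csum s l * csum t l - ssum s l * ssum t l.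
Proof.
rewrite /csum big_conv /ssum !mulr_suml -sumrB; apply: eq_bigr => a _.
rewrite ![_ * (\sum_(_ <- t) _)]mulr_sumr -sumrB; apply: eq_bigr => b _ /=.
by rewrite dotpDr mulrDr cosD; ring.
Qed.

Lemma ssum_conv s t l :
  ssum (conv s t) l = ssum s l * csum t l + csum s l * ssum t l.
Proof.
rewrite /ssum big_conv /csum !mulr_suml -big_split; apply: eq_bigr => a _ /=.
rewrite ![_ * (\sum_(_ <- t) _)]mulr_sumr -big_split; apply: eq_bigr => b _ /=.
by rewrite dotpDr mulrDr sinD; ring.
Qed.

Lemma pow_conv s t l : pow (conv s t) l = pow s l * pow t l.
Proof. by rewrite /pow csum_conv ssum_conv; ring. Qed.

Lemma pow_ge0 s l : 0 <= pow s l.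
Proof. by rewrite addr_ge0// sqr_ge0. Qed.

Lemma pow_double_sum s l : pow s l =
  \sum_(a <- s) \sum_(b <- s) a.1 * b.1 * cos (2 * pi * dotp l (a.2 - b.2)).
Proof.
rewrite /pow !expr2 !mulr_suml -big_split; apply: eq_bigr => a _ /=.
rewrite ![_ * (\sum_(_ <- s) _)]mulr_sumr -big_split; apply: eq_bigr => b _ /=.
by rewrite dotpBr mulrBr cosB; ring.
Qed.

Lemma mass_ge0 s : 0 <= mass s.
Proof. by apply: sumr_ge0 => a _; exact: normr_ge0. Qed.

Lemma pow_le_mass s l : pow s l <= mass s ^+ 2.
Proof.
rewrite pow_double_sum expr2 mulr_suml; apply: ler_sum => a _.
rewrite mulr_sumr; apply: ler_sum => b _; apply: le_trans (ler_norm _) _.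
by rewrite !normrM ler_piMr// ?mulr_ge0// cos_max.
Qed.

Lemma mass_prob s : weighted_prob s -> mass s = 1.
Proof.
move=> [s0 <-]; rewrite /mass !big_seq; apply: eq_bigr => a /s0.
exact: ger0_norm.
Qed.

Lemma pow_le1 s l : weighted_prob s -> pow s l <= 1.
Proof. by move=> /mass_prob ps; rewrite -(expr1n _ 2) -ps pow_le_mass. Qed.

Lemma csum_le_mass s l : `|csum s l| <= mass s.
Proof.
apply: le_trans (ler_norm_sum _ _ _) _; apply: ler_sum => a _.
by rewrite normrM ler_piMr// cos_max.
Qed.

Lemma ssum_le_mass s l : `|ssum s l| <= mass s.
Proof.
apply: le_trans (ler_norm_sum _ _ _) _; apply: ler_sum => a _.
by rewrite normrM ler_piMr// sin_max.
Qed.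

Lemma pow_even s l : pow s (- l) = pow s l.
Proof.
rewrite !pow_double_sum; apply: eq_bigr => a _; apply: eq_bigr => b _.
by rewrite dotpNl mulrN cosN.
Qed.

Lemma csum0 s : csum s 0 = \sum_(a <- s) a.1.
Proof. by apply: eq_bigr => a _; rewrite dotp0l mulr0 cos0 mulr1. Qed.

Lemma pow0 s : weighted_prob s -> pow s 0 = 1.
Proof.
move=> [_ ps]; rewrite /pow csum0 ps /ssum big1 ?expr0n ?addr0 ?expr1n// => a _.
by rewrite dotp0l mulr0 sin0 mulr0.
Qed.

Lemma dotp_phase l x (M : R) : enorm x <= M ->
  `|2 * pi * dotp l x| <= 2 * pi * M * enorm l.
Proof.
move=> xM; have pi0 : 0 <= 2 * (pi : R) by rewrite mulr_ge0 ?pi_ge0.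
rewrite normrM (ger0_norm pi0) -mulrA ler_wpM2l//.
apply: le_trans (CauchySchwarz_dotp _ _) _.
by rewrite mulrC ler_wpM2r// enorm_ge0.
Qed.

Lemma csum_lipschitz s l l' (M : R) : supp_in s (eball M) ->
  `|csum s l - csum s l'| <= 2 * pi * M * mass s * enorm (l - l').
Proof.
move=> hs; rewrite /csum -sumrB; apply: le_trans (ler_norm_sum _ _ _) _.
rewrite /mass mulrAC mulr_sumr big_seq [leRHS]big_seq; apply: ler_sum => a /hs aM.
rewrite -mulrBr normrM mulrC ler_wpM2r//.
apply: le_trans (cos_lipschitz _ _) _.
by rewrite -mulrBr -dotpBl dotp_phase.
Qed.

Lemma ssum_lipschitz s l l' (M : R) : supp_in s (eball M) ->
  `|ssum s l - ssum s l'| <= 2 * pi * M * mass s * enorm (l - l').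
Proof.
move=> hs; rewrite /ssum -sumrB; apply: le_trans (ler_norm_sum _ _ _) _.
rewrite /mass mulrAC mulr_sumr big_seq [leRHS]big_seq; apply: ler_sum => a /hs aM.
rewrite -mulrBr normrM mulrC ler_wpM2r//.
apply: le_trans (sin_lipschitz _ _) _.
by rewrite -mulrBr -dotpBl dotp_phase.
Qed.

Lemma sqr_diff_le (a b C e : R) : `|a| <= C -> `|b| <= C -> `|a - b| <= e ->
  `|a ^+ 2 - b ^+ 2| <= 2 * C * e.
Proof.
move=> ha hb hab; rewrite subr_sqr mulrC normrM ler_pM// (le_trans (ler_normD _ _))//.
by rewrite mulr_natl mulr2n lerD.
Qed.

(** [csum] and [ssum] are bounded by 1 and Lipschitz with constant 2 pi M, so each square has
    constant 4 pi M. *)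
Lemma pow_lipschitz s l l' (M : R) : weighted_prob s -> supp_in s (eball M) ->
  `|pow s l - pow s l'| <= 8 * pi * M * enorm (l - l').
Proof.
move=> ps hs.
have := sqr_diff_le (csum_le_mass s l) (csum_le_mass s l') (csum_lipschitz l l' hs).
have := sqr_diff_le (ssum_le_mass s l) (ssum_le_mass s l') (ssum_lipschitz l l' hs).
rewrite mass_prob// /pow => h1 h2.
rewrite opprD addrACA (le_trans (ler_normD _ _))// (le_trans (lerD h2 h1))//.
by rewrite le_eqVlt; apply/orP; left; apply/eqP; ring.
Qed.

Lemma csum_ge_prob s l (M : R) : weighted_prob s -> supp_in s (eball M) ->
  1 - 2 * pi * M * enorm l <= csum s l.
Proof.
move=> ps hs; have := csum_lipschitz 0 l hs.
rewrite csum0 (proj2 ps) mass_prob// mulr1 sub0r enormN.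
by move/(le_trans (ler_norm _)); rewrite lerBlDr addrC lerBlDr.
Qed.

(** [f] stands for the dilation by [u] followed by rounding to a grid. Rounding moves every point by
    at most [e], hence every phase by at most 2 pi e |l|. *)
Lemma csum_push s l (u e : R) (f : 'rV[R]_d -> 'rV[R]_d) :
  (forall a, a \in s -> enorm (f a.2 - u *: a.2) <= e) ->
  `|csum (push f s) l - csum s (u *: l)| <= 2 * pi * e * mass s * enorm l.
Proof.
move=> hf; rewrite /csum big_map -sumrB; apply: le_trans (ler_norm_sum _ _ _) _.
rewrite /mass mulrAC mulr_sumr big_seq [leRHS]big_seq; apply: ler_sum => a /hf ae.
rewrite /= -mulrBr normrM mulrC ler_wpM2r//.
apply: le_trans (cos_lipschitz _ _) _.
by rewrite -mulrBr dotpZl -dotpZr -dotpBr dotp_phase.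
Qed.

Lemma ssum_push s l (u e : R) (f : 'rV[R]_d -> 'rV[R]_d) :
  (forall a, a \in s -> enorm (f a.2 - u *: a.2) <= e) ->
  `|ssum (push f s) l - ssum s (u *: l)| <= 2 * pi * e * mass s * enorm l.
Proof.
move=> hf; rewrite /ssum big_map -sumrB; apply: le_trans (ler_norm_sum _ _ _) _.
rewrite /mass mulrAC mulr_sumr big_seq [leRHS]big_seq; apply: ler_sum => a /hf ae.
rewrite /= -mulrBr normrM mulrC ler_wpM2r//.
apply: le_trans (sin_lipschitz _ _) _.
by rewrite -mulrBr dotpZl -dotpZr -dotpBr dotp_phase.
Qed.

Lemma mass_push f s : mass (push f s) = mass s.
Proof. by rewrite /mass big_map. Qed.

Lemma prob_push f s : weighted_prob s -> weighted_prob (push f s).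
Proof.
move=> [s0 s1]; split; last by rewrite big_map.
by move=> _ /mapP[a /s0 a0 ->].
Qed.

Lemma prob_conv s t : weighted_prob s -> weighted_prob t ->
  weighted_prob (conv s t).
Proof.
move=> [s0 s1] [t0 t1]; split.
  by move=> _ /allpairsP[[a b] /= [/s0 a0 /t0 b0 ->]]; rewrite mulr_ge0.
rewrite big_conv -[RHS]s1; apply: eq_bigr => a _ /=.
by rewrite -mulr_sumr t1 mulr1.
Qed.

Lemma mass_conv s t : mass (conv s t) = mass s * mass t.
Proof.
rewrite /mass big_conv mulr_suml; apply: eq_bigr => a _; rewrite mulr_sumr.
by apply: eq_bigr => b _; rewrite normrM.
Qed.

Lemma pow_push s l (u e : R) (f : 'rV[R]_d -> 'rV[R]_d) : weighted_prob s ->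
  (forall a, a \in s -> enorm (f a.2 - u *: a.2) <= e) ->
  `|pow (push f s) l - pow s (u *: l)| <= 8 * pi * e * enorm l.
Proof.
move=> ps hf.
have := csum_le_mass (push f s) l; have := ssum_le_mass (push f s) l.
rewrite mass_push => hS hC.
have := sqr_diff_le hC (csum_le_mass s _) (csum_push l hf).
have := sqr_diff_le hS (ssum_le_mass s _) (ssum_push l hf).
rewrite mass_prob// /pow => h1 h2.
rewrite opprD addrACA (le_trans (ler_normD _ _))// (le_trans (lerD h2 h1))//.
by rewrite le_eqVlt; apply/orP; left; apply/eqP; ring.
Qed.

Lemma continuous_cos_dotp x : continuous (fun l => cos (2 * pi * dotp l x) : R).
Proof.
move=> l; apply: continuous_comp; last exact: continuous_cos.
by apply: continuousM; [exact: cst_continuous|exact: continuous_dotp].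
Qed.

Lemma continuous_sin_dotp x : continuous (fun l => sin (2 * pi * dotp l x) : R).
Proof.
move=> l; apply: continuous_comp; last exact: continuous_sin.
by apply: continuousM; [exact: cst_continuous|exact: continuous_dotp].
Qed.

Lemma continuous_csum s : continuous (csum s).
Proof.
apply: (sum_continuous (F := fun (a : R * 'rV[R]_d) (l : 'rV[R]_d) =>
  a.1 * cos (2 * pi * dotp l a.2))) => a.
apply: continuous_mul; [exact: cst_continuous|exact: continuous_cos_dotp].
Qed.

Lemma continuous_ssum s : continuous (ssum s).
Proof.
apply: (sum_continuous (F := fun (a : R * 'rV[R]_d) (l : 'rV[R]_d) =>
  a.1 * sin (2 * pi * dotp l a.2))) => a.
apply: continuous_mul; [exact: cst_continuous|exact: continuous_sin_dotp].
Qed.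

Lemma continuous_pow s : continuous (pow s).
Proof.
rewrite (_ : pow s = fun l => csum s l * csum s l + ssum s l * ssum s l); last first.
  by apply/funext => l; rewrite /pow !expr2.
by apply: continuous_add; apply: continuous_mul;
  (exact: continuous_csum || exact: continuous_ssum).
Qed.

Lemma bm_pow s : bm (pow s : Borel R d -> R).
Proof.
apply: (@continuous_bm _ _ _ (mass s ^+ 2)); first exact: continuous_pow.
by move=> l; rewrite ger0_norm ?pow_ge0// pow_le_mass.
Qed.

Lemma bm_cos x : bm ((fun l => cos (2 * pi * dotp l x)) : Borel R d -> R).
Proof.
by apply: (@continuous_bm _ _ _ 1); [exact: continuous_cos_dotp|move=> l; exact: cos_max].
Qed.

Lemma bm_pow_scale s u : bm ((fun l => pow s (u *: l)) : Borel R d -> R).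
Proof.
apply: (@continuous_bm _ _ _ (mass s ^+ 2)) => [l|l]; last first.
  by rewrite ger0_norm ?pow_ge0// pow_le_mass.
by apply: continuous_comp; [exact: scaler_continuous|exact: continuous_pow].
Qed.

Context (mu : {finite_measure set (Borel R d) -> \bar R}).

(** The real part of the Fourier transform of [mu], defined and continuous on all of R^d even for a
    field on Z^d; the covariance kernel is identified with it at sites only. *)
Definition coskernel x : R := \int[mu]_l cos (2 * pi * dotp l x).

(** Plancherel for finitely supported measures: expanding the square leaves a finite double sum, so
    only linearity of the integral enters. *)
Lemma Rint_pow s : \int[mu]_l pow s l =
  \sum_(a <- s) \sum_(b <- s) a.1 * b.1 * coskernel (a.2 - b.2).
Proof.
rewrite (@eq_Rintegral _ _ _ mu setT (fun l : Borel R d => \sum_(a <- s) \sum_(b <- s)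
   a.1 * b.1 * cos (2 * pi * dotp l (a.2 - b.2)))); last first.
  by move=> l _; exact: pow_double_sum.
rewrite Rint_sum//; last by move=> a; apply: bm_sum => b; exact/bmZ/bm_cos.
apply: eq_bigr => a _; rewrite Rint_sum//; last by move=> b; exact/bmZ/bm_cos.
by apply: eq_bigr => b _; rewrite RintZ//; exact: bm_cos.
Qed.

Lemma coskernel_even x : coskernel (- x) = coskernel x.
Proof. by apply: eq_Rintegral => l _; rewrite dotpNr mulrN cosN. Qed.

Lemma coskernel_bound x : `|coskernel x| <= fine (mu setT).
Proof.
apply: le_trans (le_normr_Rintegral _ _) _ => //.
  exact/bm_integrable/bm_cos.
rewrite -[leRHS]mul1r; apply: Rint_le_cst => //; first exact/bm_norm/bm_cos.
by move=> l _; exact: cos_max.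
Qed.

End weighted_points.

(** * Tail estimates over dyadic shells *)

Section tail.
Context {R : realType} {d : nat}.
Implicit Type mu : {finite_measure set (Borel R d) -> \bar R}.

Lemma half_pow_small (X e : R) : 0 < e -> exists J : nat, X / 2 ^+ J < e.
Proof.
move=> e0; have [J hJ] : exists J : nat, `|X| / e < J%:R.
  by exists (Num.bound (`|X| / e)); apply: archi_boundP; rewrite divr_ge0// ltW.
exists J; rewrite ltr_pdivrMr ?exprn_gt0// (le_lt_trans (ler_norm _))//.
rewrite mulrC -ltr_pdivrMr// (lt_le_trans hJ)//.
by rewrite -natrX ler_nat ltnW// ltn_expl.
Qed.

(** On the shell between 2^j A r0 and 2^(j+1) A r0 the function is at most (c / (2^j A))^p and the
    mass at most M (2^(j+1) A)^b. As b < p, the shells are dominated by a geometric series of ratio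
    1/2. *)
Lemma tail_bound mu (f : 'rV[R]_d -> R) (S : set (Borel R d)) (r0 c A M : R)
    (b p : nat) :
  0 < r0 -> 0 < A -> 0 <= M -> 0 <= c -> bm (f : Borel R d -> R) ->
  measurable S -> (b < p)%N ->
  (forall l, S l -> A * r0 < enorm l -> f l <= (c * r0 / enorm l) ^+ p) ->
  (forall r, A * r0 <= r -> fine (mu (eball r)) <= M * (r / r0) ^+ b) ->
  \int[mu]_(l in S `\` eball (A * r0)) f l <=
    2 ^+ b.+1 * c ^+ p * M * A ^+ b / A ^+ p.
Proof.
move=> r00 A0 M0 c0 bf mS bp hf hm.
have mB (r : R) : measurable (eball r : set (Borel R d)) by exact: measurable_eball.
pose K := 2 ^+ b * c ^+ p * M * A ^+ b / A ^+ p.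
have K0 : 0 <= K by rewrite /K divr_ge0 ?mulr_ge0 ?exprn_ge0// ltW.
pose G j := \int[mu]_(l in S `\` eball (2 ^+ j * A * r0)) f l.
have e1 (j : nat) : 1 <= (2 : R) ^+ j by rewrite exprn_ege1// ler1n.
have e0 (j : nat) : 0 < (2 : R) ^+ j by rewrite exprn_gt0.
have rad0 j : 0 < 2 ^+ j * A * r0 by rewrite !mulr_gt0.
have f_le j l : S l -> 2 ^+ j * A * r0 < enorm l -> f l <= (c / (2 ^+ j * A)) ^+ p.
  move=> Sl lj; have l0 : 0 < enorm l by exact: lt_trans lj.
  apply: le_trans (hf l Sl _) _.
    by apply: le_lt_trans lj; rewrite -mulrA ler_peMl// mulr_ge0// ltW.
  have jA0 : 0 < 2 ^+ j * A by rewrite mulr_gt0.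
  apply: lerXn2r; rewrite ?nnegrE.
  - by rewrite divr_ge0 ?mulr_ge0 ?enorm_ge0 ?(ltW r00).
  - by rewrite divr_ge0 ?(ltW jA0).
  - rewrite -mulrA ler_wpM2l// ler_pdivrMr// mulrC ler_pdivlMr//.
    by rewrite mulrC ltW.
have ring j : G j <= K / 2 ^+ j + G j.+1.
  rewrite /G (@Rint_split _ _ _ mu _ (eball (2 ^+ j.+1 * A * r0)))//; last exact: measurableD.
  rewrite setDDl (setUidr (A := eball (2 ^+ j * A * r0))); last first.
    move=> l /=; rewrite /eball /= => /le_trans; apply.
    by rewrite -!mulrA exprS -mulrA ler_peMl// ?ler1n// !mulr_ge0// ltW.
  rewrite lerD2r.
  pose q := (c / (2 ^+ j * A)) ^+ p.
  have q0 : 0 <= q by rewrite exprn_ge0// divr_ge0// mulr_ge0// ltW.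
  apply: (@le_trans _ _ (q * fine (mu ((S `\` eball (2 ^+ j * A * r0)) `&`
      eball (2 ^+ j.+1 * A * r0))))).
    apply: Rint_le_cst => //; first by apply: measurableI => //; exact: measurableD.
    by move=> l [[Sl] /=] /negP; rewrite -ltNge => lj _; exact: f_le.
  apply: (@le_trans _ _ (q * (M * (2 ^+ j.+1 * A) ^+ b))).
    rewrite ler_wpM2l//; apply: (@le_trans _ _ (fine (mu (eball (2 ^+ j.+1 * A * r0))))).
      apply: fine_mu_le; [|exact: mB|by move=> ? []].
      by apply: measurableI => //; exact: measurableD.
    rewrite -{2}(mulfK (lt0r_neq0 r00) (2 ^+ j.+1 * A)); apply: hm.
    by rewrite -mulrA ler_peMl// mulr_ge0// ltW.
  have -> : q * (M * (2 ^+ j.+1 * A) ^+ b) = K * ((2 ^+ j) ^+ b / (2 ^+ j) ^+ p).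
    rewrite /q /K exprS !(exprMn, exprVn).
    have h1 := lt0r_neq0 A0; have h2 := lt0r_neq0 (e0 j).
    by field; rewrite !expf_neq0.
  rewrite ler_wpM2l// ler_pdivrMr ?exprn_gt0//.
  rewrite -(subnKC bp) exprD exprS -!mulrA mulKf ?lt0r_neq0//.
  by rewrite ler_peMr ?exprn_ge0// ?(ltW (e0 j))// exprn_ege1.
have total J : G 0%N <= 2 * K - 2 * K / 2 ^+ J + G J.
  elim: J => [|J ih]; first by rewrite expr0 divr1 subrr add0r.
  apply: le_trans ih _; have := ring J; rewrite exprS.
  have -> : 2 * K / (2 * 2 ^+ J) = K / 2 ^+ J by field; rewrite lt0r_neq0.
  have -> : 2 * K / 2 ^+ J = 2 * (K / 2 ^+ J) by rewrite mulrA.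
  by lra.
have -> : 2 ^+ b.+1 * c ^+ p * M * A ^+ b / A ^+ p = 2 * K.
  by rewrite /K exprS; ring.
have -> : \int[mu]_(l in S `\` eball (A * r0)) f l = G 0%N by rewrite /G expr0 mul1r.
apply/ler_addgt0Pr => e e_gt0.
(* What lies beyond [J] shells is bounded by the total mass times the bound on [f] there. It becomes
   smaller than [e], so the series stays finite and no limit of integrals occurs. *)
pose X := (c / A) ^+ p * fine (mu setT).
have [J hJ] := half_pow_small X e_gt0.
apply: le_trans (total J) _; rewrite -addrA lerD2l.
have GJ : G J <= X / 2 ^+ J.
  apply: (@le_trans _ _ ((c / (2 ^+ J * A)) ^+ p * fine (mu (S `\` eball (2 ^+ J * A * r0))))).
    apply: Rint_le_cst => //; first exact: measurableD.
    by move=> l [Sl /=] /negP; rewrite -ltNge => lj; exact: f_le.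
  apply: (@le_trans _ _ ((c / (2 ^+ J * A)) ^+ p * fine (mu setT))).
    rewrite ler_wpM2l ?exprn_ge0 ?divr_ge0 ?mulr_ge0 ?(ltW A0) ?(ltW (e0 J))//.
    by apply: fine_mu_le => //; exact: measurableD.
  rewrite /X mulrAC ler_wpM2r ?fine_mu_ge0// invfM mulrA mulrAC exprMn.
  rewrite ler_wpM2l ?exprn_ge0 ?divr_ge0 ?(ltW A0)//.
  rewrite exprVn lef_pV2 ?posrE ?exprn_gt0//.
  rewrite -(prednK (leq_ltn_trans (leq0n b) bp)) exprS ler_peMr ?exprn_ege1 ?ler1n ?(ltW (e0 J))//.
have : 0 <= 2 * K / 2 ^+ J.
  exact: divr_ge0 (mulr_ge0 (ler0n _ 2) K0) (ltW (e0 J)).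
by move: hJ GJ; lra.
Qed.

End tail.

(** * Mollifiers on grids *)

Section grids.
Context {R : realType} {d : nat}.
Implicit Types (x : 'rV[R]_d) (h : R).

Definition grid h : set 'rV[R]_d :=
  [set x | forall i, exists z : int, x 0 i = h * z%:~R].

Definition round h x : 'rV[R]_d := \row_i (h * (Num.floor (x 0 i / h))%:~R).

Lemma grid0 h : grid h 0.
Proof. by move=> i; exists 0; rewrite mxE mulr0. Qed.

Lemma gridD h x y : grid h x -> grid h y -> grid h (x + y).
Proof.
move=> gx gy i; have [a ha] := gx i; have [b hb] := gy i.
by exists (a + b); rewrite mxE ha hb intrD mulrDr.
Qed.

Lemma grid_round h x : grid h (round h x).
Proof. by move=> i; eexists; rewrite mxE. Qed.

Lemma round_dist h x : 0 < h -> h <= 1 -> enorm (round h x - x) <= Num.sqrt d%:R.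
Proof.
move=> h0 h1; rewrite -[leRHS]mulr1; apply: enorm_le_coord => // i.
rewrite !mxE; set y := x 0 i; set n := Num.floor _.
have /andP[n1 n2] : (n%:~R <= y / h < (n + 1)%:~R) by exact: floor_itv.
move: n1 n2; rewrite ler_pdivlMr// ltr_pdivrMr// intrD mulrDl mul1r => n1 n2.
by rewrite (mulrC h) ler_norml; apply/andP; split; lra.
Qed.

(** On R^d every step in ]0, 1] qualifies; on Z^d, in positive dimension, only h = 1. The bound h <=
    1 makes the rounding error independent of h. *)
Definition grid_for (D : site_type) h : Prop :=
  [/\ 0 < h, h <= 1 & grid h `<=` sites D].

Lemma grid_for_lattice : grid_for IntLattice 1.
Proof.
split=> // x gx i; have [z ->] := gx i; rewrite mul1r; exact: intr_int.
Qed.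

Lemma sitesB D x y : sites D x -> sites D y -> sites D (x - y).
Proof. by case: D => //= sx sy i; rewrite !mxE rpredB. Qed.

Lemma sitesD D x y : sites D x -> sites D y -> sites D (x + y).
Proof. by case: D => //= sx sy i; rewrite !mxE rpredD. Qed.

Lemma sites0 D : sites D (0 : 'rV[R]_d).
Proof. by case: D => //= i; rewrite mxE. Qed.

(** The closed dual cell: transforms of measures on [grid h] have period 1/h in each coordinate, so
    their decay can only be asked for here. For h = 1 it contains the torus. *)
Definition cube h : set 'rV[R]_d := [set l | forall i, `|l 0 i| <= (2 * h)^-1].

Lemma measurable_cube h : measurable (cube h : set (Borel R d)).
Proof.
rewrite (_ : cube h = \bigcap_(i in [set: 'I_d])
    ((fun l : Borel R d => (l : 'rV[R]_d) 0 i) @^-1` `[- (2 * h)^-1, (2 * h)^-1])).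
  apply: fin_bigcap_measurable => // i _; rewrite -[X in measurable X]setTI.
  have mf : measurable_fun setT ((fun l : 'rV[R]_d => l 0 i) : Borel R d -> R).
    by apply: continuous_Borel; exact: coord_continuous.
  by apply: mf => //; exact: measurable_itv.
apply/seteqP; split => l hl i.
  by move=> _; rewrite /= in_itv /= -ler_norml.
by have := hl i I; rewrite /= in_itv /= -ler_norml.
Qed.

End grids.

Section mollifier.
Context {R : realType} {d : nat}.
Implicit Types (s t : seq (R * 'rV[R]_d)) (l x c : 'rV[R]_d).

(* The transform of equally weighted points on a line is a geometric sum. *)
Definition line (n : nat) (h : R) (i : 'I_d) : seq (R * 'rV[R]_d) :=
  [seq (n%:R^-1, (h * k%:R) *: delta_mx 0 i) | k <- iota 0 n].

Lemma prob_line n h i : (0 < n)%N -> weighted_prob (line n h i).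
Proof.
move=> n0; split; first by move=> _ /mapP[k _ ->] /=; rewrite invr_ge0.
rewrite big_map /= big_const_seq count_predT size_iota iter_addr addr0.
by rewrite -[_ *+ n]mulr_natr mulVf// pnatr_eq0 -lt0n.
Qed.

(** Multiplication by 1 - e^(it) telescopes the sum of e^(ikt) to 1 - e^(int), whose modulus is at
    most 2, and |1 - e^(it)| = 2 |sin(t/2)|. The identities [hC] and [hS] are the real and imaginary
    parts. *)
Lemma geometric_phase (n : nat) (t : R) :
  ((\sum_(k <- iota 0 n) cos (k%:R * t)) ^+ 2 +
   (\sum_(k <- iota 0 n) sin (k%:R * t)) ^+ 2) * (2 * sin (t / 2)) ^+ 2 <= 4.
Proof.
set C := \sum_(k <- _) cos _; set S := \sum_(k <- _) sin _.
have [hC hS] : (1 - cos t) * C + sin t * S = 1 - cos (n%:R * t) /\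
    (1 - cos t) * S - sin t * C = - sin (n%:R * t).
  rewrite {}/C {}/S; elim: n => [|n [ih1 ih2]].
    by rewrite /= !big_nil mul0r cos0 sin0; split; ring.
  rewrite -addn1 iotaD !big_cat /= !big_seq1 add0n.
  have -> : (n + 1)%:R * t = n%:R * t + t by rewrite natrD mulrDl mul1r.
  rewrite cosD sinD; split.
    move: ih1; set A := \sum_(_ <- _) _; set B := \sum_(_ <- _) _.
    move=> ih1; transitivity (((1 - cos t) * A + sin t * B) +
      (1 - cos t) * cos (n%:R * t) + sin t * sin (n%:R * t)); first by ring.
    by rewrite ih1; ring.
  move: ih2; set A := \sum_(_ <- _) _; set B := \sum_(_ <- _) _.
  move=> ih2; transitivity (((1 - cos t) * A - sin t * B) +
    (1 - cos t) * sin (n%:R * t) - sin t * cos (n%:R * t)); first by ring.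
  by rewrite ih2; ring.
have half : (2 * sin (t / 2)) ^+ 2 = (1 - cos t) ^+ 2 + sin t ^+ 2.
  have e : t = t / 2 + t / 2 by lra.
  have -> : cos t = cos (t / 2) ^+ 2 - sin (t / 2) ^+ 2 by rewrite {1}e cosD !expr2.
  have -> : sin t = 2 * sin (t / 2) * cos (t / 2) by rewrite {1}e sinD; ring.
  by rewrite !exprMn cos2sin2; ring.
have -> : (C ^+ 2 + S ^+ 2) * (2 * sin (t / 2)) ^+ 2 =
    ((1 - cos t) * C + sin t * S) ^+ 2 + ((1 - cos t) * S - sin t * C) ^+ 2.
  by rewrite half; ring.
rewrite hC hS sqrrN sin2cos2.
have := cos_geN1 (n%:R * t); set y := cos _ => hy.
by rewrite (_ : (1 - y) ^+ 2 + (1 - y ^+ 2) = 2 - 2 * y); [lra|ring].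
Qed.

(** A crude Jordan inequality. Up to 1 the mean value theorem applies with cos >= 1/2; from 1 to
    pi/2 one has sin y = cos(pi/2 - y) >= 1/2 >= y/4. *)
Lemma abs_sin_ge (x : R) : `|x| <= pi / 2 -> `|x| / 4 <= `|sin x|.
Proof.
have cos_ge (y : R) : 1 - y ^+ 2 / 2 <= cos y.
  have e : y = y / 2 + y / 2 by lra.
  rewrite [in leRHS]e cosD -!expr2 cos2sin2.
  have := abs_sin_le (y / 2); rewrite -(@ler_pXn2r _ 2) ?nnegrE//.
  by rewrite !real_normK ?num_real// expr_div_n; lra.
have pos (y : R) : 0 <= y -> y <= pi / 2 -> y / 4 <= sin y.
  move=> y0 y2; have /andP[_ pi2] := pihalf_02 R.
  have [y1|y1] := leP y 1.
    have [<-|y0'] := eqVneq 0 y; first by rewrite sin0 mul0r.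
    have yp : 0 < y by rewrite lt_def eq_sym y0' y0.
    have [c] : exists2 c, c \in `]0, y[ & sin y - sin 0 = cos c * (y - 0).
      by apply: MVT => //; exact/continuous_subspaceT/continuous_sin.
    rewrite in_itv /= => /andP[c0 cy]; rewrite sin0 !subr0 => ->.
    have c1 : c ^+ 2 <= 1 by rewrite expr_le1// ?ltW// (lt_le_trans cy).
    by rewrite mulrC ler_wpM2r//; have := cos_ge c; lra.
  have -> : sin y = cos (pi / 2 - y) by rewrite -cosN opprB cosBpihalf.
  have := cos_ge (pi / 2 - y).
  have : (pi / 2 - y) ^+ 2 <= 1 by rewrite expr_le1//; lra.
  by lra.
move=> hx; have [x0|x0] := leP 0 x.
  by rewrite (ger0_norm x0) in hx *; rewrite (le_trans (pos _ x0 hx))// ler_norm.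
rewrite (ltr0_norm x0) in hx *; rewrite -normrN -sinN.
by rewrite (le_trans (pos _ _ hx))// ?ler_norm// oppr_ge0 ltW.
Qed.

Lemma pi_ge1 : 1 <= pi :> R.
Proof.
have := abs_sin_le (pi / 2 : R); rewrite sin_pihalf normr1 ger0_norm ?divr_ge0 ?pi_ge0//.
by have := pi_ge0 R; lra.
Qed.

(** The bound on [l 0 i] keeps the half phase pi h |l_i| within [0, pi/2], where the sine in the
    denominator of the geometric sum is at least a quarter of its argument. *)
Lemma pow_line n h i l : (0 < n)%N -> 0 < h -> `|l 0 i| <= (2 * h)^-1 ->
  l 0 i != 0 -> pow (line n h i) l <= (4 / (n%:R * h * `|l 0 i|)) ^+ 2.
Proof.
move=> n0 h0 li l0; set t := 2 * pi * h * l 0 i.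
have npos : 0 < n%:R :> R by rewrite ltr0n.
have lpos : 0 < `|l 0 i| by rewrite normr_gt0.
have ph k : 2 * pi * dotp l ((h * k%:R) *: delta_mx 0 i) = k%:R * t.
  rewrite dotpZr (_ : dotp l (delta_mx 0 i) = l 0 i) ?/t; first by ring.
  rewrite /dotp (bigD1 i)//= mxE !eqxx mulr1 big1 ?addr0// => j ji.
  by rewrite mxE (negbTE ji) andbF mulr0.
have -> : pow (line n h i) l = ((\sum_(k <- iota 0 n) cos (k%:R * t)) ^+ 2 +
   (\sum_(k <- iota 0 n) sin (k%:R * t)) ^+ 2) / n%:R ^+ 2.
  rewrite /pow /csum /ssum !big_map /=.
  under eq_bigr do rewrite ph; rewrite -mulr_sumr.
  under [in X in _ + X]eq_bigr do rewrite ph; rewrite -mulr_sumr.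
  by rewrite !exprMn -mulrDr mulrC exprVn.
have := geometric_phase n t; set Q := (X in X * _ <= _) => hQ.
have Q0 : 0 <= Q by rewrite addr_ge0// sqr_ge0.
have th : `|t / 2| = pi * h * `|l 0 i|.
  have -> : t / 2 = pi * h * l 0 i by rewrite /t; field.
  by rewrite normrM (ger0_norm (mulr_ge0 (pi_ge0 R) (ltW h0))).
have t2 : `|t / 2| <= pi / 2.
  rewrite th -mulrA ler_wpM2l ?pi_ge0// -ler_pdivlMl// -invfM.
  by rewrite mulrC.
have hs := abs_sin_ge t2.
have hs2 : h * `|l 0 i| / 4 <= `|sin (t / 2)|.
  apply: le_trans hs; rewrite th ler_wpM2r// ler_wpM2r// ler_peMl ?(ltW h0)//.
  exact: pi_ge1.
have hs3 : (h * `|l 0 i| / 2) ^+ 2 <= (2 * sin (t / 2)) ^+ 2.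
  rewrite -[leRHS]real_normK ?num_real// lerXn2r// ?nnegrE//.
    by rewrite divr_ge0// mulr_ge0// ltW.
  by rewrite normrM ger0_norm//; lra.
have hQ2 : Q * (h * `|l 0 i| / 2) ^+ 2 <= 4.
  by apply: le_trans hQ; rewrite ler_wpM2l.
rewrite ler_pdivrMr ?exprn_gt0//.
have -> : (4 / (n%:R * h * `|l 0 i|)) ^+ 2 * n%:R ^+ 2 = 4 / (h * `|l 0 i| / 2) ^+ 2.
  by field; rewrite !lt0r_neq0.
by rewrite ler_pdivlMr// exprn_gt0// divr_gt0// mulr_gt0.
Qed.

End mollifier.

Section mollifier_construction.
Context {R : realType} {d : nat}.
Implicit Types (s t : seq (R * 'rV[R]_d)) (l x c : 'rV[R]_d).

(** The mass of the ball of radius [r] about [- c]. Bounds uniform in the translation [c] pass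
    through convolutions. *)
Definition smass s c (r : R) : R :=
  \sum_(b <- s) b.1 * (enorm (c + b.2) <= r)%R%:R.

Definition unit_point : seq (R * 'rV[R]_d) := [:: (1, 0)].

Lemma prob_unit : weighted_prob unit_point.
Proof. by split; [move=> a; rewrite inE => /eqP ->|rewrite big_seq1]. Qed.

Lemma pow_unit l : pow unit_point l = 1.
Proof.
rewrite /pow /csum /ssum !big_seq1 /= dotpC dotp0l mulr0 cos0 sin0.
by rewrite !mul1r expr1n expr0n addr0.
Qed.

(** For [cs] without repetition, the uniform measure on a box of grid points with [n] points along
    each direction of [cs]. *)
Definition block (n : nat) (h : R) (cs : seq 'I_d) : seq (R * 'rV[R]_d) :=
  foldr (fun i s => conv (line n h i) s) unit_point cs.

Lemma prob_block n h cs : (0 < n)%N -> weighted_prob (block n h cs).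
Proof.
move=> n0; elim: cs => [|i cs ih] /=; first exact: prob_unit.
exact: prob_conv (prob_line _ _ n0) ih.
Qed.

Lemma pow_block n h cs i l : (0 < n)%N -> i \in cs ->
  pow (block n h cs) l <= pow (line n h i) l.
Proof.
move=> n0; elim: cs => // j cs ih; rewrite inE /= pow_conv => /predU1P[->|/ih h1].
  by rewrite ler_piMr ?pow_ge0// pow_le1//; exact: prob_block.
apply: le_trans h1; rewrite ler_piMl ?pow_ge0// pow_le1//; exact: prob_line.
Qed.

Lemma supp_block n h cs : 0 <= h ->
  supp_in (block n h cs) (eball ((size cs)%:R * (n%:R * h))).
Proof.
move=> h0; elim: cs => [|i cs ih] /=.
  by move=> a; rewrite inE => /eqP ->; rewrite /eball /= enorm0 mul0r.
move=> _ /allpairsP[[a b] /= [/mapP[k kn ->] /ih hb ->]].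
move: kn; rewrite mem_iota add0n => /andP[_ kn].
rewrite /eball /= (le_trans (enormD _ _))// -natr1 mulrDl mul1r addrC lerD//.
rewrite enormZ enorm_delta mulr1 ger0_norm ?mulr_ge0// mulrC ler_wpM2r//.
by rewrite ler_nat ltnW.
Qed.

Lemma grid_block n h cs : supp_in (block n h cs) (grid h).
Proof.
elim: cs => [|i cs ih] /=.
  by move=> a; rewrite inE => /eqP ->; exact: grid0.
move=> _ /allpairsP[[a b] /= [/mapP[k _ ->] /ih hb ->]]; apply: gridD => // j.
by exists (k%:Z * ((j == i) : nat)%:Z); rewrite !mxE eqxx /= intrM mulrA.
Qed.

Lemma block_coord0 n h cs a i : a \in block n h cs -> i \notin cs -> a.2 0 i = 0.
Proof.
elim: cs a => [|j cs ih] a /=; first by rewrite inE => /eqP ->; rewrite mxE.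
move=> /allpairsP[[b e] /= [/mapP[k _ ->] he ->]]; rewrite inE negb_or => /andP[ij ics].
by rewrite !mxE (ih _ he ics) eqxx (negbTE ij) mulr0 addr0.
Qed.

(** The indices counted lie in a window of [m.+1] consecutive integers that starts at the smallest
    of them. *)
Lemma count_interval (n : nat) (h y r : R) : 0 < h -> 0 <= r ->
  \sum_(k <- iota 0 n) (`|y + h * k%:R| <= r)%R%:R <= 2 * r / h + 1 :> R.
Proof.
move=> h0 r0; set P := fun k : nat => `|y + h * k%:R| <= r.
have -> : \sum_(k <- iota 0 n) (P k)%:R = (size (seq.filter P (iota 0 n)))%:R :> R.
  by rewrite -sum1_size natr_sum [RHS]big_filter [RHS]big_mkcond; apply: eq_bigr => k _; case: (P k).
have srt : sorted leq (seq.filter P (iota 0 n)).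
  by apply: sorted_filter; [exact: leq_trans|exact: iota_sorted].
have un : uniq (seq.filter P (iota 0 n)) by rewrite filter_uniq ?iota_uniq.
have Pall : {in seq.filter P (iota 0 n), forall k, P k}.
  by move=> k; rewrite mem_filter => /andP[].
case: (seq.filter P (iota 0 n)) srt un Pall => [|k0 s] srt un Pall.
  by rewrite addr_ge0// divr_ge0 ?mulr_ge0 ?(ltW h0).
pose m := Num.truncn (2 * r / h).
have m2 : 2 * r / h < m.+1%:R by apply: truncnS_gt.
have m1 : m%:R <= 2 * r / h by rewrite truncn_le divr_ge0 ?mulr_ge0 ?(ltW h0).
have Pk0 : P k0 by apply: Pall; rewrite mem_head.
have sub : {subset k0 :: s <= iota k0 m.+1}.
  move=> k ks; rewrite mem_iota.
  have k0k : (k0 <= k)%N.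
    move: ks; rewrite inE => /predU1P[->//|ks].
    by move: srt => /= /(order_path_min leq_trans)/allP/(_ k ks).
  rewrite k0k /= -ltn_subLR// -(ltr_nat R) natrB// (le_lt_trans _ m2)//.
  rewrite ler_pdivlMr//; move: Pk0 (Pall k ks); rewrite /P !ler_norml.
  by move=> /andP[a1 a2] /andP[b1 b2]; rewrite mulrBl; lra.
rewrite (@le_trans _ _ m.+1%:R)//; last by rewrite -natr1 lerD2r.
by rewrite ler_nat -(size_iota k0 m.+1) uniq_leq_size.
Qed.

Lemma boolM (b1 b2 : bool) : (b1 && b2)%:R = b1%:R * b2%:R :> R.
Proof. by case: b1 b2 => [] []; rewrite /= ?mul1r ?mul0r. Qed.

(** For a cube in place of a ball the indicator factorises over the coordinates, and the mass is a
    product of one-dimensional counts. *)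
Lemma block_small_ball n h cs c r : (0 < n)%N -> 0 < h -> 0 <= r -> uniq cs ->
  \sum_(b <- block n h cs) b.1 * (all (fun i => `|c 0 i + b.2 0 i| <= r)%R cs)%:R <=
  ((2 * r / h + 1) / n%:R) ^+ size cs.
Proof.
move=> n0 h0 r0; elim: cs => [|i cs ih] /=; first by rewrite big_seq1 mulr1.
move=> /andP[ics ucs]; rewrite big_conv.
have B0 : 0 <= (2 * r / h + 1) / n%:R.
  by rewrite divr_ge0// addr_ge0// divr_ge0 ?mulr_ge0 ?(ltW h0).
have -> : \sum_(a <- line n h i) \sum_(b <- block n h cs)
    a.1 * b.1 * ((`|c 0 i + (a.2 + b.2) 0 i| <= r)%R &&
      all (fun j => `|c 0 j + (a.2 + b.2) 0 j| <= r)%R cs)%:R =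
  (\sum_(a <- line n h i) a.1 * (`|c 0 i + a.2 0 i| <= r)%R%:R) *
  \sum_(b <- block n h cs) b.1 * (all (fun j => `|c 0 j + b.2 0 j| <= r)%R cs)%:R.
  rewrite mulr_suml big_seq [RHS]big_seq; apply: eq_bigr => a /mapP[k _ ->] /=.
  rewrite mulr_sumr big_seq [RHS]big_seq; apply: eq_bigr => b hb.
  rewrite boolM mulrACA; congr (_ * _ * (_ * _)); congr (nat_of_bool _)%:R.
    by rewrite !mxE (block_coord0 hb ics) addr0.
  apply: eq_in_all => j jcs; rewrite !mxE eqxx /=.
  by rewrite (_ : j == i = false) ?mulr0 ?add0r//; apply: contraNF ics => /eqP <-.
rewrite exprS; apply: ler_pM; last exact: ih.
- by rewrite big_seq; apply: sumr_ge0 => a /mapP[k _ ->]; rewrite mulr_ge0// invr_ge0.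
- rewrite big_seq; apply: sumr_ge0 => b hb; rewrite mulr_ge0//.
  exact: (proj1 (prob_block h cs n0)).
rewrite big_map /= -mulr_sumr mulrC ler_wpM2r ?invr_ge0//.
apply: le_trans (count_interval n (c 0 i) h0 r0).
by apply: ler_sum => k _; rewrite !mxE !eqxx mulr1.
Qed.

Lemma smass_conv s t c r (B : R) : weighted_prob s ->
  (forall c', smass t c' r <= B) -> smass (conv s t) c r <= B.
Proof.
move=> [s0 s1] hB; rewrite /smass big_conv.
have -> : B = \sum_(a <- s) a.1 * B by rewrite -mulr_suml s1 mul1r.
rewrite big_seq [leRHS]big_seq; apply: ler_sum => a /s0 a0.
apply: le_trans (ler_wpM2l a0 (hB (c + a.2))); rewrite /smass mulr_sumr.
by apply: ler_sum => b _; rewrite addrA mulrA.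
Qed.

(** Each of the [k] factors contributes 2 to the order of decay of [pow]; a single factor already
    bounds the mass of small balls. *)
Definition moll (k n : nat) (h : R) :=
  iter k (fun s => conv s (block n h (enum 'I_d))) unit_point.

Lemma prob_moll k n h : (0 < n)%N -> weighted_prob (moll k n h).
Proof.
move=> n0; elim: k => [|k ih]; first exact: prob_unit.
exact: prob_conv ih (prob_block h _ n0).
Qed.

Lemma grid_moll k n h : supp_in (moll k n h) (grid h).
Proof.
elim: k => [|k ih]; first by move=> a; rewrite inE => /eqP ->; exact: grid0.
move=> _ /allpairsP[[a b] /= [/ih ha /grid_block hb ->]]; exact: gridD.
Qed.

Lemma supp_moll k n h : 0 <= h ->
  supp_in (moll k n h) (eball (k%:R * d%:R * (n%:R * h))).
Proof.
move=> h0; elim: k => [|k ih].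
  by move=> a; rewrite inE => /eqP ->; rewrite /eball /= enorm0 !mul0r.
move=> _ /allpairsP[[a b] /= [/ih ha /(supp_block h0) hb ->]].
rewrite /eball /= (le_trans (enormD _ _))// -natr1 !mulrDl lerD// mul1r.
by move: hb; rewrite size_enum_ord.
Qed.

Lemma pow_moll k n h l : pow (moll k n h) l = pow (block n h (enum 'I_d)) l ^+ k.
Proof.
elim: k => [|k ih]; first by rewrite pow_unit expr0.
by rewrite [LHS]pow_conv ih exprSr.
Qed.

Lemma moll_small_ball k n h c r : (0 < n)%N -> 0 < h -> 0 <= r -> (0 < k)%N ->
  smass (moll k n h) c r <= ((2 * r / h + 1) / n%:R) ^+ d.
Proof.
case: k => // k n0 h0 r0 _; apply: smass_conv => [|c']; first exact: prob_moll.
have := block_small_ball c' n0 h0 r0 (enum_uniq 'I_d); rewrite size_enum_ord.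
apply: le_trans; rewrite /smass big_seq [leRHS]big_seq; apply: ler_sum => b hb.
apply: ler_wpM2l; first exact: (proj1 (prob_block h _ n0) _ hb).
rewrite ler_nat; case: (boolP (enorm _ <= r)) => //= br; rewrite lt0n eqb0 negbK.
apply/allP => i _; apply: le_trans br; rewrite (le_trans _ (coord_le_enorm _ i))//.
by rewrite mxE.
Qed.

Lemma large_coord l : l != 0 ->
  exists i, enorm l / (2 * Num.sqrt d%:R) <= `|l 0 i|.
Proof.
move=> l0; have lp : 0 < enorm l by rewrite enorm_gt0.
apply: contrapT => /forallNP hn.
have dpos : 0 < Num.sqrt (d%:R : R).
  rewrite sqrtr_gt0 ltr0n lt0n; apply: contra l0 => /eqP d0.
  apply/eqP/rowP => i; exfalso; by move: (ltn_ord i); rewrite [X in (_ < X)%N]d0.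
have : enorm l <= Num.sqrt d%:R * (enorm l / (2 * Num.sqrt d%:R)).
  apply: enorm_le_coord => [|i]; first by rewrite divr_ge0 ?ltW ?mulr_gt0.
  by have /negP := hn i; rewrite -ltNge => /ltW.
have -> : Num.sqrt d%:R * (enorm l / (2 * Num.sqrt d%:R)) = enorm l / 2.
  by field; rewrite lt0r_neq0.
by lra.
Qed.

(** A discrete bump at scale [L] on the grid of step [h], with [C] independent of both: the [k]-fold
    convolution of the uniform measure on a box of side about n h, between L and 2L. Some coordinate
    of [l] is at least |l| / (2 sqrt d), and the line in that direction provides the decay. *)
Lemma mollifier (k : nat) : (0 < k)%N -> (0 < d)%N ->
  exists2 C : R, 0 < C & forall L h : R, 1 <= L -> 0 < h -> h <= 1 ->
  exists m, [/\ weighted_prob m, supp_in m (grid h), supp_in m (eball (C * L)),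
    forall c r, 0 <= r -> smass m c r <= C * ((r + 1) / L) ^+ d &
    forall l, cube h l -> l != 0 -> pow m l <= (C / (L * enorm l)) ^+ (2 * k)].
Proof.
move=> k0 d0; pose sd := Num.sqrt (d%:R : R).
have sd0 : 0 <= sd by exact: sqrtr_ge0.
have e0 : 0 < (2 : R) ^+ d by rewrite exprn_gt0.
have kd0 : 0 <= 2 * k%:R * d%:R :> R by rewrite !mulr_ge0.
(* The three terms serve the support, the mass of small balls and the decay of the transform,
   respectively. *)
exists (2 * k%:R * d%:R + 2 ^+ d + 8 * sd); first by rewrite ltr_wpDr ?mulr_ge0// ltr_wpDl.
set C := _ + _ + _ => L h L1 h0 h1.
have L0 : 0 < L by lra.
have [L0' h0'] := (ltW L0, ltW h0).
pose n := (Num.truncn (L / h)).+1.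
have Lh0 : 0 <= L / h by rewrite divr_ge0.
have n1 : L < n%:R * h by rewrite -ltr_pdivrMr//; exact: truncnS_gt.
have n2 : n%:R * h <= 2 * L.
  have -> : n%:R = (Num.truncn (L / h))%:R + 1 :> R by rewrite natr1.
  rewrite mulrDl mul1r; have : (Num.truncn (L / h))%:R <= L / h by rewrite truncn_le.
  by rewrite ler_pdivlMr//; lra.
have n0 : (0 < n)%N by [].
have nR0 : 0 < n%:R :> R by rewrite ltr0n.
exists (moll k n h); split.
- exact: prob_moll.
- exact: grid_moll.
- move=> a /(supp_moll (ltW h0)); rewrite /eball /= => /le_trans; apply.
  apply: (@le_trans _ _ (2 * k%:R * d%:R * L)).
    have -> : 2 * k%:R * d%:R * L = k%:R * d%:R * (2 * L) :> R by ring.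
    by rewrite ler_wpM2l ?mulr_ge0.
  by rewrite ler_wpM2r// /C; lra.
- move=> c r r0; apply: le_trans (moll_small_ball c n0 h0 r0 k0) _.
  have r1 : 0 <= (r + 1) / L by rewrite divr_ge0 ?addr_ge0.
  apply: (@le_trans _ _ (2 ^+ d * ((r + 1) / L) ^+ d)); last first.
    by rewrite ler_wpM2r ?exprn_ge0// /C; lra.
  rewrite -exprMn lerXn2r ?nnegrE//.
  + by rewrite divr_ge0// addr_ge0// divr_ge0 ?mulr_ge0.
  + by rewrite mulr_ge0.
  rewrite ler_pdivrMr// [2 * (_ / _)]mulrA [leRHS]mulrAC ler_pdivlMr//.
  apply: (@le_trans _ _ ((2 * r / h + 1) * (n%:R * h))).
    by rewrite ler_wpM2l ?(ltW n1)// addr_ge0// divr_ge0 ?mulr_ge0.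
  have -> : (2 * r / h + 1) * (n%:R * h) = (2 * r + h) * n%:R by field; rewrite lt0r_neq0.
  by rewrite ler_wpM2r//; lra.
move=> l cl l0; have [i li] := large_coord l0.
have lp : 0 < enorm l by rewrite enorm_gt0.
have sdp : 0 < sd by rewrite sqrtr_gt0 ltr0n.
have lip : 0 < `|l 0 i| by apply: lt_le_trans li; rewrite divr_gt0// mulr_gt0.
rewrite pow_moll exprM lerXn2r ?nnegrE ?pow_ge0 ?sqr_ge0//.
apply: le_trans (pow_block h l n0 (mem_enum _ i)) _.
apply: le_trans (pow_line n0 h0 (cl i) _) _; first by rewrite -normr_gt0.
rewrite lerXn2r ?nnegrE ?divr_ge0 ?mulr_ge0 ?enorm_ge0// ?(ltW h0) ?(ltW L0)//.
  by rewrite /C; lra.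
apply: (@le_trans _ _ (8 * sd / (L * enorm l))); last first.
  rewrite ler_wpM2r ?invr_ge0 ?mulr_ge0 ?(ltW L0) ?(ltW lp)//.
  by rewrite /C; lra.
rewrite ler_pdivrMr ?mulr_gt0// mulrAC ler_pdivlMr ?mulr_gt0//.
have h3 : L * enorm l <= n%:R * h * (2 * sd * `|l 0 i|).
  apply: ler_pM; rewrite ?(ltW n1) ?(ltW lp)//; move: li; rewrite ler_pdivrMr ?mulr_gt0//.
  by rewrite mulrC.
by move: h3; set a := L * _; set b := n%:R * h; nra.
Qed.

End mollifier_construction.

(** * Frequencies off the dual cell *)

Section frequency_grid.
Context {R : realType} {d : nat}.
Context (mu : {finite_measure set (Borel R d) -> \bar R}).

Lemma measurable_coord_itv (i : 'I_d) (I : interval R) :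
  measurable ([set l : 'rV[R]_d | l 0 i \in I] : set (Borel R d)).
Proof.
have mf : measurable_fun setT ((fun l : 'rV[R]_d => l 0 i) : Borel R d -> R).
  by apply: continuous_Borel; exact: coord_continuous.
rewrite -[X in measurable X]setTI.
exact: (mf measurableT [set` I] (measurable_itv I)).
Qed.

Lemma measurable_frequencies D : measurable (frequencies D : set (Borel R d)).
Proof.
case: D; first exact: measurableT.
rewrite (_ : frequencies _ = \bigcap_(i in [set: 'I_d])
    [set l : 'rV[R]_d | l 0 i \in `[- 2^-1, 2^-1[]).
  by apply: fin_bigcap_measurable => // i _; exact: measurable_coord_itv.
apply/seteqP; split => l hl i; first by move=> _; rewrite /= in_itv /=; exact: hl.
by have := hl i I; rewrite /= in_itv.
Qed.

(** On R^d the cubes exhaust the space as the step tends to 0, and [mu] is finite. On Z^d the step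
    is 1, whose cube contains the carrier. *)
Lemma grid_fine D (e : R) : mu (~` frequencies D) = 0%E -> 0 < e ->
  exists h, grid_for (d := d) D h /\ fine (mu (~` cube h)) <= e.
Proof.
case: D => [_|carr] e0; last first.
  exists 1; split; first exact: grid_for_lattice.
  apply: (@le_trans _ _ 0); last exact: ltW.
  have -> : (0 : R) = fine (mu (~` frequencies IntLattice)) by rewrite carr.
  apply: fine_mu_le.
  - by apply: measurableC; exact: measurable_cube.
  - by apply: measurableC; exact: measurable_frequencies.
  apply: subsetC => l hl i; rewrite mulr1 ler_norml; have /andP[-> /ltW ->] := hl i.
  by [].
pose F n : set (Borel R d) := ~` cube (n.+1%:R^-1 : R).
have mF n : measurable (F n) by apply: measurableC; exact: measurable_cube.
have F0 : \bigcap_n F n = set0.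
  apply/seteqP; split => // l hl.
  have [n hn] : exists n, forall i, `|(l : 'rV[R]_d) 0 i| <= n.+1%:R / 2.
    have [n hn] : exists n : nat, 2 * enorm (l : 'rV[R]_d) < n%:R.
      exists (Num.bound (2 * enorm (l : 'rV[R]_d))); apply: archi_boundP.
      by rewrite mulr_ge0// enorm_ge0.
    exists n => i; have := coord_le_enorm (l : 'rV[R]_d) i.
    by rewrite -natr1; lra.
  apply: (hl n I) => i; rewrite invfM invrK mulrC; exact: hn.
have cvgF : mu (F n) @[n --> \oo] --> mu (\bigcap_n F n).
  apply: nonincreasing_cvg_mu => //.
  - by rewrite ltey_eq fin_num_measure.
  - by rewrite F0.
  apply/nonincreasing_seqP => n; apply/subsetPset; apply: subsetC => l hl i.
  apply: le_trans (hl i) _; rewrite !invfM !invrK ler_wpM2l// ler_nat//.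
rewrite F0 measure0 in cvgF.
have : \forall n \near \oo, (mu (F n) < e%:E)%E.
  move/fine_cvgP : cvgF => [_] /cvgrPdist_lt /(_ e e0) /= hn.
  near=> n; rewrite -(@fineK _ (mu (F n))) ?fin_num_measure// lte_fin.
  have : `|0 - fine (mu (F n))| < e by near: n.
  by rewrite sub0r normrN ger0_norm ?fine_mu_ge0.
move=> [n _ /(_ n (leqnn n)) hn].
exists n.+1%:R^-1; split; first split => //.
- by rewrite invf_le1// ler1n.
- by rewrite -lee_fin fineK; [exact: ltW|exact: (fin_num_measure _ _ (mF n))].
Unshelve. all: by end_near. Qed.

End frequency_grid.

(** * Dilation of measures *)

Lemma exp_ratio_le (R : realType) (A : R) (b p : nat) : 1 <= A -> (b < p)%N ->
  A ^+ b / A ^+ p <= A^-1.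
Proof.
move=> A1 bp; have A0 : 0 < A by lra.
rewrite ler_pdivrMr ?exprn_gt0// -(subnKC bp) exprD exprS -!mulrA mulKf ?lt0r_neq0//.
by rewrite ler_peMr ?exprn_ge0 ?(ltW A0)// exprn_ege1.
Qed.

Section transfer.
Context {R : realType} {d : nat} (D : site_type) (alpha : R).
Context (mu : {finite_measure set (Borel R d) -> \bar R}).
Hypothesis d0 : (0 < d)%N.
Hypothesis carrier : mu (~` frequencies D) = 0%E.

Let m (r : R) : R := fine (mu (eball r)).

(* The factor [1 + g] leaves room for mollifying [p]. *)
Definition transfer : Prop := forall u e g : R, 0 < u -> 0 < e -> 0 < g ->
  exists T0, 0 < T0 /\ forall T, T0 <= T -> forall p, weighted_prob p ->
  supp_in p (ball_in D T) ->
  exists p', [/\ weighted_prob p', supp_in p' (ball_in D (u * (1 + g) * T)) &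
    \int[mu]_l pow p' l <= u `^ (- alpha) * \int[mu]_l pow p l + e * m T^-1].

(* The upper half of the vague convergence of [mu (./T) / m (1/T)], tested on
   squared transforms only. *)
Definition vague_scaling : Prop := forall u A e : R, 0 < u -> 0 < A -> 0 < e ->
  exists T0, 0 < T0 /\ forall T, T0 <= T -> forall p, weighted_prob p ->
  supp_in p (eball T) ->
  \int[mu]_(l in eball (A / T)) pow p (u *: l) <=
    u `^ (- alpha) * \int[mu]_l pow p l + e * m T^-1.

(** The doubling property in iterated form. The exponent [b] is what the decay of a mollifier has to
    beat. *)
Definition poly_growth : Prop := exists b : nat, exists2 C : R, 0 < C &
  forall r0 r, 0 < r0 -> r0 <= r -> m r <= C * (r / r0) ^+ b * m r0.

Lemma m_ge0 r : 0 <= m r. Proof. exact: fine_mu_ge0. Qed.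

Lemma m_le r s : r <= s -> m r <= m s.
Proof.
move=> rs; apply: fine_mu_le; [exact: measurable_eball|exact: measurable_eball|].
by move=> l /= /le_trans; exact.
Qed.

(** The new measure is the rounded dilation of [p], convolved with a mollifier at scale eta T.
    Frequencies up to A/T are handled by [vague_scaling], those between A/T and the boundary of the
    cell by the decay of the mollifier, the rest by the choice of [h]. With rounding, this makes
    four errors of e/4 each. *)
Lemma vague_transfer : (forall r, 0 < r -> 0 < m r) -> poly_growth ->
  vague_scaling -> transfer.
Proof.
move=> mpos [b [C C0 growth]] hV u e g u0 e0 g0.
have bk : (b < 2 * b.+1)%N by rewrite mul2n -addnn addSn ltnS leq_addr.
have [Cm Cm0 hmoll] := @mollifier R d b.+1 isT d0.
(* The mollifier then reaches Cm eta T = u g T / 2, half of the room left by the factor 1 + g;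
   rounding takes the other half. *)
pose eta := u * g / (2 * Cm).
have eta0 : 0 < eta by rewrite divr_gt0 ?mulr_gt0.
pose c := Cm / eta; have c0 : 0 < c by rewrite divr_gt0.
have [K K0 KE] : exists2 K, 0 < K & K = 2 ^+ b.+1 * c ^+ (2 * b.+1) * C.
  by eexists; last reflexivity; rewrite !mulr_gt0 ?exprn_gt0.
have Ke0 : 0 < K / e by rewrite divr_gt0.
(* Large enough for the tail K A^b / A^(2b+2) <= K / A to be below e/4. *)
have [A [A1 AE]] : exists A, 1 <= A /\ A = 1 + 4 * (K / e).
  by eexists; split; last reflexivity; lra.
have A0 : 0 < A by lra.
have tailK : K * (A ^+ b / A ^+ (2 * b.+1)) <= e / 4.
  have h1 : A ^+ b / A ^+ (2 * b.+1) <= A^-1.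
    exact: exp_ratio_le.
  apply: le_trans (ler_wpM2l (ltW K0) h1) _.
  rewrite ler_pdivrMr// AE.
  have -> : e / 4 * (1 + 4 * (K / e)) = e / 4 + K by field; rewrite lt0r_neq0.
  by lra.
pose sd := Num.sqrt (d%:R : R).
have sd0 : 0 <= sd by exact: sqrtr_ge0.
have e40 : 0 < e / 4 by rewrite divr_gt0.
have [T1 [T10 hT1]] := hV u A (e / 4) u0 A0 e40.
have [X X0 XE] : exists2 X, 0 <= X & X = 8 * pi * sd * A * (C * A ^+ b).
  eexists; last reflexivity.
  by rewrite !mulr_ge0 ?exprn_ge0 ?pi_ge0 ?(ltW A0) ?(ltW C0).
(* In this order: the mollifier has scale at least 1, rounding by [sd] fits into the support, and
   the rounding error on |l| <= A/T is at most e/4. *)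
pose T2 := eta^-1 + 2 * sd / (u * g) + 4 * X / e.
have [q1 q2 q3] : [/\ 0 < eta^-1, 0 <= 2 * sd / (u * g) & 0 <= 4 * X / e].
  split; [by rewrite invr_gt0|by rewrite divr_ge0 ?mulr_ge0 ?(ltW u0) ?(ltW g0)|].
  by rewrite divr_ge0 ?mulr_ge0 ?(ltW e0).
exists (T1 + T2); split; first by rewrite /T2; lra.
move=> T TT p pp sp.
have [T10' TT1 TT2 TT3] : [/\ T1 <= T, eta^-1 <= T, 2 * sd / (u * g) <= T & 4 * X / e <= T].
  by move: TT T10 q1 q2 q3; rewrite /T2; clear; split; lra.
have T0 : 0 < T by exact: lt_le_trans T10'.
have L1 : 1 <= eta * T by rewrite mulrC -ler_pdivrMr// div1r.
have m0 : 0 < m T^-1 by rewrite mpos// invr_gt0.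
have [h [[h0 h1 hsites] hcube]] := @grid_fine _ _ mu D (e / 4 * m T^-1) carrier (mulr_gt0 e40 m0).
have [M [pM gM sM _ fM]] := hmoll (eta * T) h L1 h0 h1.
pose p1 := push (fun x => round h (u *: x)) p.
have pp1 : weighted_prob p1 by exact: prob_push.
exists (conv p1 M); split.
- exact: prob_conv.
- move=> _ /allpairsP[[a y] /= [/mapP[x xp ->] yM ->]] /=; split; last first.
    by apply: sitesD; apply: hsites; [exact: grid_round|exact: gM].
  have [xT _] := sp _ xp; have yT := sM _ yM.
  rewrite /eball /= in xT yT *.
  have r1 := round_dist (u *: x.2) h0 h1.
  have r2 : enorm (round h (u *: x.2)) <= u * T + sd.
    rewrite -[round _ _](subrK (u *: x.2)) (le_trans (enormD _ _))// addrC lerD//.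
    by rewrite enormZ gtr0_norm// ler_wpM2l// ltW.
  apply: le_trans (enormD _ _) _; apply: le_trans (lerD r2 yT) _.
  have -> : Cm * (eta * T) = u * g * T / 2 by rewrite /eta; field; rewrite lt0r_neq0.
  by move: TT2; rewrite ler_pdivrMr ?mulr_gt0//; clear -d0 carrier; lra.
have mB : measurable (eball (A / T) : set (Borel R d)) by exact: measurable_eball.
have mC : measurable (cube h : set (Borel R d)) by exact: measurable_cube.
have pw_le l : pow (conv p1 M) l <= pow M l.
  by rewrite pow_conv ler_piMl ?pow_ge0// pow_le1.
rewrite (@Rint_split _ _ _ mu setT (eball (A / T)))//; last exact: bm_pow.
rewrite setTI setTD.
rewrite (@Rint_split _ _ _ mu (~` eball (A / T)) (cube h))//; [|exact: measurableC|exact: bm_pow].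
have I1 : \int[mu]_(l in eball (A / T)) pow (conv p1 M) l <=
    u `^ (- alpha) * \int[mu]_l pow p l + e / 4 * m T^-1 + e / 4 * m T^-1.
  pose z := 8 * pi * sd * (A / T).
  apply: (@le_trans _ _ (\int[mu]_(l in eball (A / T)) (pow p (u *: l) + z))).
    apply: Rint_le => //; first exact: bm_pow.
      by apply: bmD; [exact: bm_pow_scale|exact: bm_cst].
    move=> l lA; rewrite pow_conv (@le_trans _ _ (pow p1 l))//.
      by rewrite ler_piMr ?pow_ge0// pow_le1.
    have := @pow_push _ _ p l u sd (fun x => round h (u *: x)) pp
      (fun a _ => round_dist (u *: a.2) h0 h1).
    move/(le_trans (ler_norm _)); rewrite lerBlDl => /le_trans; apply.
    rewrite lerD2l /z ler_wpM2l// !mulr_ge0 ?pi_ge0//.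
  rewrite RintD//; [|exact: bm_pow_scale|exact: bm_cst].
  rewrite Rintegral_cst// lerD//.
    apply: hT1 => // a ap; exact: (proj1 (sp _ ap)).
  have : m (A / T) <= C * A ^+ b * m T^-1.
    have := growth T^-1 (A / T); rewrite invrK divfK ?lt0r_neq0//; apply.
      by rewrite invr_gt0.
    by rewrite -[leLHS]mul1r ler_wpM2r// invr_ge0 ltW.
  have z0 : 0 <= z by rewrite !mulr_ge0 ?pi_ge0 ?invr_ge0 ?(ltW A0) ?(ltW T0).
  move=> /(ler_wpM2l z0) /le_trans; apply.
  rewrite mulrA ler_wpM2r ?m_ge0//.
  have -> : z * (C * A ^+ b) = X / T by rewrite /z XE; ring.
  by rewrite ler_pdivrMr//; move: TT3; rewrite ler_pdivrMr//; clear -d0 carrier; lra.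
have I2 : \int[mu]_(l in ~` eball (A / T) `&` cube h) pow (conv p1 M) l <=
    e / 4 * m T^-1.
  rewrite setIC -setDE.
  apply: le_trans (@tail_bound _ _ mu _ _ T^-1 c A (C * m T^-1) b (2 * b.+1) _ _ _ _ _ _ _ _ _) _ => //.
  - by rewrite invr_gt0.
  - by rewrite mulr_ge0 ?(ltW C0) ?m_ge0.
  - exact: ltW.
  - exact: bm_pow.
  - move=> l cl hl; apply: le_trans (pw_le l) _.
    have lp : 0 < enorm (l : 'rV[R]_d) by apply: le_lt_trans hl; rewrite divr_ge0 ?ltW.
    apply: le_trans (fM l cl _) _; first by rewrite -enorm_gt0.
    rewrite /c le_eqVlt; apply/orP; left; apply/eqP; congr (_ ^+ _).
    by field; rewrite !lt0r_neq0.
  - move=> r rA; rewrite mulrAC; apply: growth; first by rewrite invr_gt0.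
    by apply: le_trans rA; rewrite -[leLHS]mul1r ler_wpM2r// invr_ge0 ltW.
  have -> : 2 ^+ b.+1 * c ^+ (2 * b.+1) * (C * m T^-1) * A ^+ b / A ^+ (2 * b.+1) =
    K * (A ^+ b / A ^+ (2 * b.+1)) * m T^-1 by rewrite KE; ring.
  by rewrite ler_wpM2r ?m_ge0.
have I3 : \int[mu]_(l in ~` eball (A / T) `\` cube h) pow (conv p1 M) l <=
    e / 4 * m T^-1.
  apply: le_trans hcube; rewrite -[leRHS]mul1r.
  apply: (@le_trans _ _ (1 * fine (mu (~` eball (A / T) `\` cube h)))).
    apply: Rint_le_cst.
    - by apply: measurableD => //; exact: measurableC.
    - exact: bm_pow.
    - by move=> l _; rewrite pow_le1//; exact: prob_conv.
  rewrite !mul1r; apply: fine_mu_le.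
  - by apply: measurableD => //; exact: measurableC.
  - exact: measurableC.
  by move=> l [].
by move: I1 I2 I3; clear; lra.
Qed.

End transfer.

(** * Regular variation *)

Section regular_variation_tools.
Context {R : realType}.
Implicit Types (G : R -> R) (a e u v T x y : R).

(* Only the upper half of regular variation with index [a]: the lower half
   follows by exchanging [v] and [v^-1]. *)
Definition RVup G a : Prop := forall v e, 0 < v -> 0 < e ->
  exists T0, 0 < T0 /\ forall T, T0 <= T -> G (v * T) <= (v `^ a + e) * G T.

Lemma powR_near1 a e : 0 <= a -> 0 < e ->
  exists2 g, 0 < g & (1 + g) `^ a <= 1 + e.
Proof.
move=> a0 e0; have a1 : 0 < a + 1 by lra.
(* The exponent 1/(a + 1) in place of 1/a covers a = 0. *)
exists ((1 + e) `^ (a + 1)^-1 - 1).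
  have one : 1 = 1 `^ (a + 1)^-1 :> R by rewrite powR1.
  rewrite subr_gt0 [ltLHS]one; apply: gt0_ltr_powR.
  - by rewrite invr_gt0.
  - by rewrite nnegrE.
  - by rewrite nnegrE; lra.
  - by lra.
rewrite addrC subrK -powRrM -[leRHS]powRr1; last by lra.
by apply: ler_powR; [lra|rewrite mulrC ler_pdivrMr//; lra].
Qed.

Lemma powR_inv_base v a : 0 < v -> v^-1 `^ a = v `^ (- a).
Proof. by move=> v0; rewrite -[v^-1]powR_inv1 ?ltW// -powRrM mulN1r. Qed.

Lemma powR_mulN v a : 0 < v -> v `^ a * v `^ (- a) = 1.
Proof. by move=> v0; rewrite powRN divff// lt0r_neq0// powR_gt0. Qed.

Lemma RVup_lower G a u e : (forall T, 0 < T -> 0 < G T) -> RVup G a ->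
  0 < u -> 0 < e ->
  exists T0, 0 < T0 /\ forall T, T0 <= T -> (u `^ a - e) * G T <= G (u * T).
Proof.
move=> Gpos hG u0 e0.
have ua : 0 < u `^ (- a) by rewrite powR_gt0.
have ua' : 0 < u `^ a by rewrite powR_gt0.
(* With this tolerance, (u^a - e) (u^(-a) + e u^(-2a)) = 1 - e^2 u^(-2a) <= 1. *)
have e'0 : 0 < e * u `^ (- a) * u `^ (- a) by rewrite !mulr_gt0.
have [T0 [T00 hT]] := hG u^-1 _ (ltac:(by rewrite invr_gt0)) e'0.
exists (T0 / u); split; first by rewrite divr_gt0.
move=> T TT; have {}TT : T0 <= u * T by rewrite mulrC -ler_pdivrMr.
have uT0 : 0 < u * T by apply: lt_le_trans TT.
have := hT _ TT; rewrite mulKf ?lt0r_neq0// powR_inv_base//.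
have [h|h] := lerP (u `^ a - e) 0 => hG1.
  apply: le_trans (ltW (Gpos _ uT0)); apply: mulr_le0_ge0 => //.
  by apply/ltW/Gpos; rewrite -(pmulr_rgt0 _ u0).
apply: le_trans (ler_wpM2l (ltW h) hG1) _; rewrite mulrA ler_piMl ?(ltW (Gpos _ uT0))//.
have -> : (u `^ a - e) * (u `^ (- a) + e * u `^ (- a) * u `^ (- a)) =
  u `^ a * u `^ (- a) + e * u `^ (- a) * (u `^ a * u `^ (- a)) - e * u `^ (- a)
  - e * (e * u `^ (- a) * u `^ (- a)) by ring.
by rewrite powR_mulN// mulr1 addrK gerBl mulr_ge0 ?(ltW e0)// ltW.
Qed.

Lemma RVup_dist G a u e : (forall T, 0 < T -> 0 < G T) -> RVup G a ->
  0 < u -> 0 < e ->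
  exists T0, 0 < T0 /\ forall T, T0 <= T -> `|G (u * T) / G T - u `^ a| <= e.
Proof.
move=> Gpos hG u0 e0.
have [T1 [T10 h1]] := hG u e u0 e0.
have [T2 [T20 h2]] := RVup_lower Gpos hG u0 e0.
exists (T1 + T2); split; first by rewrite addr_gt0.
move=> T TT; have GT : 0 < G T by apply: Gpos; lra.
have k1 : G (u * T) / G T <= u `^ a + e by rewrite ler_pdivrMr// h1//; lra.
have k2 : u `^ a - e <= G (u * T) / G T by rewrite ler_pdivlMr// h2//; lra.
by rewrite ler_norml; apply/andP; split; lra.
Qed.

Lemma RVup_inv G a : (forall T, 0 < T -> 0 < G T) -> RVup G a ->
  RVup (fun T => (G T)^-1) (- a).
Proof.
move=> Gpos hG v e v0 e0.
have [T0 [T00 hT]] := hG v^-1 e (ltac:(by rewrite invr_gt0)) e0.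
exists (T0 / v); split; first by rewrite divr_gt0.
move=> T TT; have {}TT : T0 <= v * T by rewrite mulrC -ler_pdivrMr.
have vT0 : 0 < v * T by apply: lt_le_trans TT.
have T_gt0 : 0 < T by rewrite -(pmulr_rgt0 _ v0).
have := hT _ TT; rewrite mulKf ?lt0r_neq0// powR_inv_base// => h.
by rewrite ler_pdivlMr ?Gpos// mulrC ler_pdivrMr ?Gpos.
Qed.

Lemma pow2_bracket x y : 0 < x -> x <= y ->
  exists n : nat, 2 ^+ n * x <= y /\ y <= 2 ^+ n.+1 * x.
Proof.
move=> x0 xy.
have ex : exists n : nat, y <= 2 ^+ n * x.
  exists (Num.bound (y / x)); rewrite -ler_pdivrMr//.
  apply: le_trans (ltW (archi_boundP _)) _; first by rewrite divr_ge0 ?(ltW x0) ?(le_trans (ltW x0)).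
  by rewrite -natrX ler_nat ltnW// ltn_expl.
case: (ex_minnP ex) => -[|n] hn mn.
  exists 0%N; rewrite expr0 mul1r expr1; split => //.
  by move: hn; rewrite expr0 mul1r; lra.
exists n; split => //; rewrite leNgt; apply/negP => h.
by have := mn n (ltW h); rewrite ltnn.
Qed.

(** Potter's bound. With 2^n x <= y <= 2^(n+1) x, the inequality at ratio 2 is iterated [n] times
    and one step of ratio in [1, 2] follows; the factor 2^|a| pays for replacing 2^n by y/x. *)
Lemma potter G a x0 K : 0 < x0 -> 0 <= K ->
  (forall T, x0 <= T -> 0 <= G T) ->
  (forall T v, x0 <= T -> 1 <= v -> v <= 2 -> G (v * T) <= K * G T) ->
  (forall T, x0 <= T -> G (2 * T) <= 2 `^ a * G T) ->
  forall x y, x0 <= x -> x <= y ->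
  G y <= K * 2 `^ `|a| * (y / x) `^ a * G x.
Proof.
move=> x00 K0 G0 hK h2 x y x0x xy.
have xp : 0 < x by lra.
have [n [n1 n2]] := pow2_bracket xp xy.
have e0 (j : nat) : 0 < (2 : R) ^+ j by rewrite exprn_gt0.
have step (j : nat) : G (2 ^+ j * x) <= (2 `^ a) ^+ j * G x.
  elim: j => [|j ih]; first by rewrite !expr0 !mul1r.
  rewrite exprS -mulrA; apply: le_trans (h2 _ _) _.
    by rewrite (le_trans x0x)// ler_peMl ?(ltW xp)// exprn_ege1// ler1n.
  by rewrite exprS -mulrA ler_wpM2l// powR_ge0.
pose v := y / (2 ^+ n * x).
have zx : 0 < 2 ^+ n * x by rewrite mulr_gt0.
have v1 : 1 <= v by rewrite /v ler_pdivlMr// mul1r.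
have v2 : v <= 2 by rewrite /v ler_pdivrMr// mulrA -exprS.
have yv : y = v * (2 ^+ n * x) by rewrite /v divfK// lt0r_neq0.
have zx0 : x0 <= 2 ^+ n * x.
  by rewrite (le_trans x0x)// ler_peMl ?(ltW xp)// exprn_ege1// ler1n.
rewrite {1}yv; apply: le_trans (hK _ _ zx0 v1 v2) _.
rewrite -!mulrA ler_wpM2l//; apply: le_trans (step n) _.
rewrite mulrA ler_wpM2r ?G0//.
have -> : y / x = v * 2 ^+ n by rewrite {1}yv; field; rewrite lt0r_neq0.
have vp : 0 < v by lra.
rewrite powRM ?(ltW (e0 n)) ?(ltW vp)// -powR_mulrn// -powRrM mulrC powRrM powR_mulrn ?powR_ge0//.
rewrite mulrA ler_peMl ?exprn_ge0 ?powR_ge0//.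
have [a0|a0] := leP 0 a.
  rewrite (ger0_norm a0) -[leLHS]mulr1 ler_pM//.
    by rewrite -[leLHS](powRr0 2) ler_powR// ler1n.
  by rewrite -[leLHS](powRr0 v) ler_powR.
have -> : v `^ a = (v `^ (- a))^-1 by rewrite -powRN opprK.
rewrite (ltr0_norm a0) ler_pdivlMr ?powR_gt0// mul1r.
by apply: ge0_ler_powR; rewrite ?nnegrE ?oppr_ge0 ?(ltW a0) ?(ltW vp).
Qed.

End regular_variation_tools.

Lemma ln_prod_le (R : realType) (a k x q c : R) : 0 < a -> 0 < k -> 0 < x ->
  0 < c -> a <= k * x `^ q * c -> ln a <= ln k + q * ln x + ln c.
Proof.
move=> a0 k0 x0 c0; have xq : 0 < x `^ q by rewrite powR_gt0.
by rewrite -ler_ln ?posrE ?mulr_gt0// !lnM ?posrE ?mulr_gt0// ln_powR.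
Qed.

(** * Consequences of the regular variation of ball masses *)

Section from_transfer.
Context {R : realType} {d : nat} (D : site_type) (alpha : R).
Context (mu : {finite_measure set (Borel R d) -> \bar R}).
Hypothesis alpha0 : 0 <= alpha.

Let m (r : R) : R := fine (mu (eball r)).
Let M (T : R) : R := m T^-1.

Hypothesis mpos : forall r, 0 < r -> 0 < m r.
Hypothesis RVM : RVup M (- alpha).

Let Mpos T : 0 < T -> 0 < M T.
Proof. by move=> T0; apply: mpos; rewrite invr_gt0. Qed.

(** Regular variation speaks of radii up to 1/T0. For larger ones the mass lies between [M T0] and
    the total mass, whence [c2]. *)
Lemma doubling_of_RVup :
  exists2 c : R, 0 < c & forall r : R, 0 < r -> m (2 * r) <= c * m r.
Proof.
have [T0 [T00 hT]] := RVM (ltac:(by []) : 0 < 2^-1 :> R) ltr01.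
pose c1 := 2^-1 `^ (- alpha) + 1 : R.
pose c2 := fine (mu setT) / M T0.
have c10 : 0 < c1 by rewrite ltr_wpDl ?powR_ge0.
have c20 : 0 <= c2 by rewrite divr_ge0 ?fine_mu_ge0 ?ltW ?Mpos.
exists (c1 + c2); first by lra.
move=> r r0; have mr := mpos r0.
have [rT|rT] := leP T0 r^-1.
  have := hT _ rT; rewrite /M invfM !invrK => /le_trans; apply.
  by rewrite ler_wpM2r ?(ltW mr)// lerDl.
apply: (@le_trans _ _ (c2 * m r)); last by rewrite ler_wpM2r ?(ltW mr)// lerDr ltW.
apply: (@le_trans _ _ (fine (mu setT))).
  by apply: fine_mu_le => //; exact: measurable_eball.
rewrite /c2 mulrAC ler_pdivlMr ?Mpos// ler_wpM2l ?fine_mu_ge0//.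
by apply: m_le; rewrite -[leRHS]invrK lef_pV2 ?posrE ?invr_gt0// ltW.
Qed.

Lemma poly_growth_of_RVup : poly_growth mu.
Proof.
have [c c0 hc] := doubling_of_RVup.
have [b hb] : exists b : nat, c <= 2 ^+ b.
  exists (Num.bound c); apply: le_trans (ltW (archi_boundP (ltW c0))) _.
  by rewrite -natrX ler_nat ltnW// ltn_expl.
exists b; exists (2 ^+ b); first by rewrite exprn_gt0.
move=> r0 r r00 r0r; have [n [n1 n2]] := pow2_bracket r00 r0r.
have step (j : nat) : m (2 ^+ j * r0) <= (2 ^+ b) ^+ j * m r0.
  elim: j => [|j ih]; first by rewrite !expr0 !mul1r.
  rewrite exprS -mulrA; apply: le_trans (hc _ _) _.
    by rewrite mulr_gt0// exprn_gt0.
  apply: le_trans (ler_wpM2l (ltW c0) ih) _.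
  by rewrite exprS -!mulrA ler_wpM2r// mulr_ge0 ?exprn_ge0 ?m_ge0.
apply: le_trans (m_le mu n2) _; apply: le_trans (step _) _.
rewrite ler_wpM2r ?m_ge0// exprS ler_wpM2l ?exprn_ge0//.
rewrite exprAC lerXn2r ?nnegrE ?exprn_ge0//.
  by rewrite divr_ge0 ?(ltW r00)// (le_trans (ltW r00)).
by rewrite ler_pdivlMr.
Qed.

Lemma slowly_varying_ball :
  slowly_varying (at_right 0) (fun r => r `^ (- alpha) * m r).
Proof.
split.
- apply: measurable_funM.
    exact: measurable_funS (measurable_powR _).
  by apply: nondecreasing_measurable => // r s rs; exact: m_le.
- by move=> r r0; rewrite mulr_gt0 ?powR_gt0// mpos.
move=> u u0; apply/cvgrPdist_le => e e0.
have ua : 0 < u `^ alpha by rewrite powR_gt0.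
have [T0 [T00 hT]] := RVup_dist Mpos RVM (ltac:(by rewrite invr_gt0) : 0 < u^-1)
  (mulr_gt0 e0 ua).
near=> r.
have r0 : 0 < r by [].
have rT : T0 <= r^-1.
  rewrite -[leLHS]invrK lef_pV2 ?posrE ?invr_gt0//; near: r.
  by apply: nbhs_right_le; rewrite invr_gt0.
have := hT _ rT; rewrite /M invfM !invrK powR_inv_base// opprK => h.
rewrite powRM ?(ltW u0) ?(ltW r0)//.
have mr := mpos r0; have rp : 0 < r `^ (- alpha) by rewrite powR_gt0.
have -> : u `^ (- alpha) * r `^ (- alpha) * m (u * r) / (r `^ (- alpha) * m r) =
    m (u * r) / m r / u `^ alpha.
  by rewrite powRN; field; rewrite !lt0r_neq0.
rewrite -(ler_pM2r ua) -{2}(gtr0_norm ua) -normrM mulrBl divfK ?lt0r_neq0// mul1r.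
by rewrite distrC.
Unshelve. all: by end_near. Qed.

(** Potter bounds for [M] and for its inverse, started from a fixed [T0], give |ln M(T) + alpha ln
    T| <= e ln T + C; the constant disappears after division by ln r. *)
Lemma log_ball_cvg : ln (m r) / ln r @[r --> 0^'+] --> alpha.
Proof.
have main (e : R) : 0 < e -> exists T0 C : R, 0 < T0 /\ forall T, T0 <= T ->
    `|ln (M T) + alpha * ln T| <= e * ln T + C.
  move=> e0.
  have half e' : 0 < e' -> 0 < 2 `^ (- alpha + e') - 2 `^ (- alpha) :> R.
    move=> e'0; rewrite subr_gt0 /powR (negbTE (_ : 2 != 0 :> R))//.
    by rewrite ltr_expR ltr_pM2r ?ln_gt0 ?ltr1n//; lra.
  (* The tolerance makes the factor at ratio 2 exactly 2^(-alpha + e), the form that [potter]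
     expects. *)
  have [T1 [T10 h1]] := RVM (ltac:(by []) : 0 < 2 :> R) (half _ e0).
  have half2 e' : 0 < e' -> 0 < 2 `^ (alpha + e') - 2 `^ alpha :> R.
    move=> e'0; rewrite subr_gt0 /powR (negbTE (_ : 2 != 0 :> R))//.
    by rewrite ltr_expR ltr_pM2r ?ln_gt0 ?ltr1n//; lra.
  have := RVup_inv Mpos RVM; rewrite opprK => RVMi.
  have [T2 [T20 h2]] := RVMi _ _ (ltac:(by []) : 0 < 2 :> R) (half2 _ e0).
  pose T0 := T1 + T2 + 1; have T00 : 0 < T0 by rewrite /T0; lra.
  have T0M T : T0 <= T -> 0 <= M T by move=> h; apply/ltW/Mpos; lra.
  have Mdec T v : T0 <= T -> 1 <= v -> M (v * T) <= M T.
    move=> TT v1; apply: m_le; rewrite lef_pV2 ?posrE; last by lra.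
      by rewrite ler_peMl//; lra.
    by rewrite mulr_gt0//; lra.
  have P1 := @potter _ M (- alpha + e) T0 1 T00 ler01 T0M.
  have P2 := @potter _ (fun T => (M T)^-1) (alpha + e) T0
    (2 `^ (alpha + e)) T00 (powR_ge0 _ _).
  have {}P1 T : T0 <= T -> M T <= 1 * 2 `^ `|- alpha + e| * (T / T0) `^ (- alpha + e) * M T0.
    apply: P1 => // [T' v TT v1 _|T' TT].
      by rewrite mul1r Mdec.
    by rewrite (le_trans (h1 _ _))//; [rewrite /T0 in TT; lra|rewrite addrC subrK].
  have {}P2 T : T0 <= T -> (M T)^-1 <= 2 `^ (alpha + e) * 2 `^ `|alpha + e| *
      (T / T0) `^ (alpha + e) * (M T0)^-1.
    have two T' : T0 <= T' -> (M (2 * T'))^-1 <= 2 `^ (alpha + e) * (M T')^-1.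
      move=> TT; have := h2 T' (ltac:(rewrite /T0 in TT; lra)).
      by rewrite addrC subrK.
    apply: P2 => // [T' TT|T' v TT v1 v2].
      by rewrite invr_ge0 T0M.
    apply: le_trans (two T' TT).
    have Tp : 0 < T' by lra.
    rewrite lef_pV2 ?posrE ?Mpos ?mulr_gt0//; last by lra.
    by apply: m_le; rewrite lef_pV2 ?posrE ?mulr_gt0 ?ler_pM2r//; lra.
  pose C1 := ln (2 `^ `|- alpha + e|) - (- alpha + e) * ln T0 + ln (M T0).
  pose C2 := ln (2 `^ (alpha + e) * 2 `^ `|alpha + e|) - (alpha + e) * ln T0 - ln (M T0).
  exists T0, (`|C1| + `|C2|); split => // T TT.
  have Tp : 0 < T by lra.
  have lnTT : ln (T / T0) = ln T - ln T0 by rewrite lnM ?posrE ?invr_gt0// lnV ?posrE.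
  have p2 a : 0 < 2 `^ a :> R by rewrite powR_gt0.
  have q2 a : 0 < (T / T0) `^ a by rewrite powR_gt0// divr_gt0.
  have [MT MT0] := (Mpos Tp, Mpos T00).
  have TT0 : 0 < T / T0 by rewrite divr_gt0.
  have p22 : 0 < 2 `^ (alpha + e) * 2 `^ `|alpha + e| by rewrite mulr_gt0.
  have := P1 T TT; rewrite mul1r => /(ln_prod_le MT (p2 _) TT0 MT0).
  have MV (x : R) : 0 < x -> 0 < x^-1 by move=> ?; rewrite invr_gt0.
  have := P2 T TT => /(ln_prod_le (MV _ MT) p22 TT0 (MV _ MT0)).
  rewrite lnTT (lnV MT) (lnV MT0) => k2 k1.
  have := ler_norm C1; have := ler_norm C2.
  have := normr_ge0 C1; have := normr_ge0 C2.
  move: k1 k2; rewrite /C1 /C2 ler_norml => k1 k2 *; apply/andP; split; lra.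
apply/cvgrPdist_le => e e0.
have [T0 [C [T00 hT]]] := main _ (divr_gt0 e0 (ltr0Sn R 1)).
near=> r.
have r0 : 0 < r by [].
have rT : T0 <= r^-1.
  rewrite -[leLHS]invrK lef_pV2 ?posrE ?invr_gt0//; near: r.
  by apply: nbhs_right_le; rewrite invr_gt0.
have lr : ln r <= - (1 + 2 * `|C| / e).
  have : r <= expR (- (1 + 2 * `|C| / e)).
    by near: r; apply: nbhs_right_le; rewrite expR_gt0.
  by rewrite -ler_ln ?posrE ?expR_gt0// expRK.
have Ce : 0 <= 2 * `|C| / e by rewrite divr_ge0 ?mulr_ge0 ?(ltW e0).
have lr0 : ln r < 0 by lra.
have := hT _ rT; rewrite /M invrK lnV ?posrE// => h.
rewrite -(ler_pM2r (ltac:(lra) : 0 < - ln r)) -{1}(ltr0_norm lr0) -normrM.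
rewrite mulrBl divfK ?ltr0_neq0// distrC -mulNr.
have : 2 * `|C| <= e * - ln r.
  have : 2 * `|C| / e <= - ln r by lra.
  by rewrite ler_pdivrMr// [_ * e]mulrC.
have := ler_norm C; move: h; rewrite mulrN.
by rewrite mulNr; lra.
Unshelve. all: by end_near. Qed.

End from_transfer.

(** * Regular variation of the capacity *)

Section capacity_from_transfer.
Context {R : realType} {d : nat} (D : site_type) (alpha : R).
Context (mu : {finite_measure set (Borel R d) -> \bar R}).
Hypothesis alpha0 : 0 <= alpha.

Let m (r : R) : R := fine (mu (eball r)).

Hypothesis mpos : forall r, 0 < r -> 0 < m r.
Hypothesis growth : poly_growth mu.
Hypothesis htransfer : transfer D alpha mu.

Variable I : R -> R.
Hypothesis I_le : forall T p, 0 < T -> weighted_prob p -> supp_in p (ball_in D T) ->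
  I T <= \int[mu]_l pow p l.
Hypothesis I_approx : forall T e, 0 < T -> 0 < e -> exists p,
  [/\ weighted_prob p, supp_in p (ball_in D T) & \int[mu]_l pow p l <= I T + e].

(** For |l| <= 1/(16T) all phases are at most pi/8 <= 1/2, so the real part of the transform is at
    least 1/2. *)
Lemma pow_int_ge T p : 0 < T -> weighted_prob p -> supp_in p (eball T) ->
  4^-1 * m (16 * T)^-1 <= \int[mu]_l pow p l.
Proof.
move=> T0 pp sp.
have mB : measurable (eball (16 * T)^-1 : set (Borel R d)) by exact: measurable_eball.
apply: (@le_trans _ _ (\int[mu]_(l in eball (16 * T)^-1) pow p l)); last first.
  by apply: Rint_subset => //; [exact: bm_pow|move=> l _; exact: pow_ge0].
apply: Rint_ge_cst => //; first exact: bm_pow.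
move=> l; rewrite /eball /= => lT.
have := csum_ge_prob l pp sp.
have : 2 * pi * T * enorm l <= 2^-1.
  apply: (@le_trans _ _ (2 * pi * T * (16 * T)^-1)).
    by rewrite ler_wpM2l// !mulr_ge0 ?pi_ge0 ?(ltW T0).
  have -> : 2 * pi * T * (16 * T)^-1 = pi / 8 by field; rewrite lt0r_neq0.
  by have /andP[_] := pihalf_02 R; lra.
move=> h1 h2; have h3 : 2^-1 <= csum p l by lra.
rewrite /pow (@le_trans _ _ (csum p l ^+ 2))//; last by rewrite lerDl sqr_ge0.
have -> : 4^-1 = 2^-1 ^+ 2 :> R by field.
by rewrite lerXn2r ?nnegrE//; lra.
Qed.

Lemma I_ge T : 0 < T -> 4^-1 * m (16 * T)^-1 <= I T.
Proof.
move=> T0; apply/ler_addgt0Pr => e e0.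
have [p [pp sp hp]] := I_approx T0 e0.
by apply: le_trans hp; apply: pow_int_ge => // a /sp[].
Qed.

Lemma I_pos T : 0 < T -> 0 < I T.
Proof.
move=> T0; apply: lt_le_trans (I_ge T0).
by rewrite mulr_gt0 ?mpos// invr_gt0 mulr_gt0.
Qed.

Lemma I_decr T T' : 0 < T -> T <= T' -> I T' <= I T.
Proof.
move=> T0 TT; apply/ler_addgt0Pr => e e0.
have [p [pp sp hp]] := I_approx T0 e0.
apply: le_trans hp; apply: I_le => //; first by lra.
by move=> a /sp[h1 h2]; split => //; apply: le_trans TT.
Qed.

(** [transfer] is applied to a nearly optimal measure on B(T), with u (1 + g) = v. Its additive
    errors are relative ones because c m(1/T) <= I(T), by growth over the ratio 16. *)
Lemma RV_I : RVup I (- alpha).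
Proof.
move=> v e v0 e0; have [b [C C0 hC]] := growth.
pose c := 4^-1 / (C * 16 ^+ b).
have c0 : 0 < c by rewrite divr_gt0 ?mulr_gt0 ?exprn_gt0.
have Ic T : 0 < T -> c * m T^-1 <= I T.
  move=> T0; apply: le_trans (I_ge T0).
  have h16 : (16 * T)^-1 <= T^-1.
    by rewrite lef_pV2 ?posrE ?mulr_gt0// ler_peMl ?(ltW T0)// ler1n.
  have := hC (16 * T)^-1 T^-1 (ltac:(by rewrite invr_gt0 mulr_gt0)) h16.
  have -> : T^-1 / (16 * T)^-1 = 16 by field; rewrite lt0r_neq0.
  move=> /(ler_wpM2l (ltW c0)) /le_trans; apply.
  rewrite mulrA ler_wpM2r ?m_ge0// /c divfK//.
  by rewrite lt0r_neq0// mulr_gt0 ?exprn_gt0.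
have va : 0 < v `^ (- alpha) by rewrite powR_gt0.
have e1 : 0 < e / (2 * v `^ (- alpha)) by rewrite divr_gt0// mulr_gt0.
have [g g0 hg] := powR_near1 alpha0 e1.
pose u := v / (1 + g); have g1 : 0 < 1 + g by lra.
have u0 : 0 < u by rewrite divr_gt0.
have ua : u `^ (- alpha) <= v `^ (- alpha) + e / 2.
  rewrite /u powRM ?invr_ge0 ?(ltW v0) ?(ltW g1)// powR_inv_base// opprK.
  apply: le_trans (ler_wpM2l (ltW va) hg) _.
  rewrite mulrDr mulr1 lerD2l [leLHS](_ : _ = e / 2)//.
  by field; rewrite lt0r_neq0.
have uap : 0 <= u `^ (- alpha) by exact: powR_ge0.
(* Serves the slack of the near-minimiser, which gets multiplied by u^(-alpha), and the error of
   [transfer]; together they cost (e/2) c m(1/T). *)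
pose e' := e * c / (2 * (u `^ (- alpha) + 1)).
have u1 : 0 < u `^ (- alpha) + 1 by lra.
have e'0 : 0 < e'.
  by apply: divr_gt0; apply: mulr_gt0.
have [T0 [T00 hT]] := htransfer u0 e'0 g0.
exists T0; split => // T TT; have Tp : 0 < T by lra.
have mT : 0 < m T^-1 by rewrite mpos// invr_gt0.
have [p [pp sp hp]] := I_approx Tp (mulr_gt0 e'0 mT).
have [p' [pp' sp' hp']] := hT T TT p pp sp.
have -> : v * T = u * (1 + g) * T by rewrite /u divfK// lt0r_neq0.
have uT0 : 0 < u * (1 + g) * T by exact: mulr_gt0 (mulr_gt0 u0 g1) Tp.
apply: le_trans (I_le uT0 pp' sp') _.
apply: le_trans hp' _.
apply: le_trans (lerD (ler_wpM2l uap hp) (lexx _)) _.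
have -> : u `^ (- alpha) * (I T + e' * m T^-1) + e' * m T^-1 =
    u `^ (- alpha) * I T + (e / 2) * (c * m T^-1).
  by rewrite /e'; field; rewrite lt0r_neq0//; lra.
have IT := ltW (I_pos Tp).
apply: le_trans (lerD (ler_wpM2r IT ua) (ler_wpM2l _ (Ic T Tp))) _.
  by rewrite divr_ge0 ?(ltW e0).
by rewrite -mulrDl -addrA -splitr.
Qed.

Let Cap T : R := (I T)^-1.

Lemma RV_Cap : RVup Cap alpha.
Proof. by have := RVup_inv I_pos RV_I; rewrite opprK. Qed.

Lemma Cap_pos T : 0 < T -> 0 < Cap T.
Proof. by move=> T0; rewrite invr_gt0 I_pos. Qed.

Lemma Cap_incr T T' : 0 < T -> T <= T' -> Cap T <= Cap T'.
Proof.
move=> T0 TT; rewrite lef_pV2 ?posrE ?I_pos ?I_decr//.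
exact: lt_le_trans TT.
Qed.

Lemma slowly_varying_capacity (F : R -> R) : (forall T, 0 < T -> F T = Cap T) ->
  slowly_varying (pinfty_nbhs R) (fun T => T `^ (- alpha) * F T).
Proof.
move=> FE; split.
- apply: measurable_funM.
    exact: measurable_funS (measurable_powR _).
  (* Monotonicity is available for positive [T] only; the extension by 0 is monotone on the whole
     line, hence measurable. *)
  suff mG : measurable_fun (`]0, +oo[ : set R) (fun T : R => if 0 < T then Cap T else 0).
    apply: eq_measurable_fun mG => T.
    by rewrite inE /= in_itv /= andbT => T0; rewrite T0 FE.
  apply: nondecreasing_measurable => // r s rs.
  case: ifPn => [r0|_]; first by rewrite (lt_le_trans r0 rs) Cap_incr.
  by case: ifPn => // s0; exact/ltW/Cap_pos.
- by move=> T T0; rewrite FE// mulr_gt0 ?powR_gt0// Cap_pos.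
move=> u u0; apply/cvgrPdist_le => e e0.
have ua : 0 < u `^ alpha by rewrite powR_gt0.
have [T0 [T00 hT]] := RVup_dist Cap_pos RV_Cap u0 (mulr_gt0 e0 ua).
near=> T.
have TT : T0 <= T by near: T; apply: nbhs_pinfty_ge; exact: num_real.
have Tp : 0 < T by lra.
have := hT _ TT => h.
rewrite !FE ?mulr_gt0// powRM ?(ltW u0) ?(ltW Tp)//.
have cT := Cap_pos Tp; have rp : 0 < T `^ (- alpha) by rewrite powR_gt0.
have -> : u `^ (- alpha) * T `^ (- alpha) * Cap (u * T) / (T `^ (- alpha) * Cap T) =
    Cap (u * T) / Cap T / u `^ alpha.
  by rewrite powRN; field; rewrite !lt0r_neq0.
rewrite -(ler_pM2r ua) -{2}(gtr0_norm ua) -normrM mulrBl divfK ?lt0r_neq0// mul1r.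
by rewrite distrC.
Unshelve. all: by end_near. Qed.

(** Eventually T^(1 - eps) <= g T for any fixed g > 0, so monotonicity puts the capacity between
    those at T and (1 + g) T, whose ratio is close to (1 + g)^alpha. *)
Lemma capacity_window (F : R -> R) (eps : R) : (forall T, 0 < T -> F T = Cap T) ->
  0 < eps -> F (T + T `^ (1 - eps)) / F T @[T --> +oo] --> (1 : R).
Proof.
move=> FE eps0; apply/cvgrPdist_le => e e0.
have e20 : 0 < e / 2 by rewrite divr_gt0.
have [g g0 hg] := powR_near1 alpha0 e20.
have g1 : 0 < 1 + g by lra.
have [T0 [T00 hT]] := RV_Cap g1 e20.
near=> T.
have TT : T0 <= T by near: T; apply: nbhs_pinfty_ge; exact: num_real.
have Tp : 0 < T by lra.
have Tg : T `^ (- eps) <= g.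
  have : (g^-1) `^ (eps^-1) <= T by near: T; apply: nbhs_pinfty_ge; exact: num_real.
  move=> h; rewrite powRN -[leRHS]invrK lef_pV2 ?posrE ?invr_gt0 ?powR_gt0//.
  have -> : g^-1 = ((g^-1) `^ (eps^-1)) `^ eps.
    by rewrite -powRrM mulVf ?lt0r_neq0// powRr1// invr_ge0 ltW.
  by apply: ge0_ler_powR; rewrite ?nnegrE ?powR_ge0 ?(ltW eps0) ?(ltW Tp).
have Te : 0 <= T `^ (1 - eps) by exact: powR_ge0.
have Te2 : T + T `^ (1 - eps) <= (1 + g) * T.
  have -> : T `^ (1 - eps) = T * T `^ (- eps).
    by rewrite powRD ?powRr1 ?(ltW Tp)//; apply/implyP => _; rewrite lt0r_neq0.
  by rewrite mulrDl mul1r lerD2l mulrC ler_wpM2r// ltW.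
rewrite !FE//; last by lra.
have cT := Cap_pos Tp.
have h1 : 1 <= Cap (T + T `^ (1 - eps)) / Cap T.
  by rewrite ler_pdivlMr// mul1r Cap_incr// lerDl.
have h2 : Cap (T + T `^ (1 - eps)) / Cap T <= 1 + e.
  rewrite ler_pdivrMr//; apply: (@le_trans _ _ (Cap ((1 + g) * T))).
    by apply: Cap_incr => //; lra.
  apply: le_trans (hT _ TT) _; rewrite ler_wpM2r ?(ltW cT)//; lra.
by rewrite ler_norml; apply/andP; split; lra.
Unshelve. all: by end_near. Qed.

End capacity_from_transfer.

Lemma set0_or_ex (T : Type) (A : set T) : A = set0 \/ exists x, A x.
Proof. by have [->|/set0P] := eqVneq A set0; [left|right]. Qed.

(** * The least energy *)

Section list_measure.
Context {R : realType} {d : nat} (p : seq (R * 'rV[R]_d)).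
Hypothesis pp : weighted_prob p.

(** The absolute value yields a non-negative scalar without reference to [pp], so that
    [list_measure] depends on the list alone. *)
Let w (n : nat) : {nonneg R} := NngNum (normr_ge0 (nth (0, 0) p n).1).
Let pt (n : nat) : Borel R d := (nth (0, 0) p n).2.

Let point_mass (n : nat) : {measure set (Borel R d) -> \bar R} :=
  mscale (w n) (dirac (pt n)).

Definition list_measure : set (Borel R d) -> \bar R := msum point_mass (size p).

HB.instance Definition _ := Measure.on list_measure.

Lemma big_nth_list (F : R * 'rV[R]_d -> R) :
  \sum_(i < size p) F (nth (0, 0) p i) = \sum_(a <- p) F a.
Proof. by rewrite (big_nth (0, 0)) big_mkord. Qed.

Let wE (i : 'I_(size p)) : (w i)%:num = (nth (0, 0) p i).1.
Proof. by rewrite /= ger0_norm// (proj1 pp)// mem_nth. Qed.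

Lemma list_measure_in (B : set (Borel R d)) : supp_in p B -> list_measure B = 1%E.
Proof.
move=> sp; rewrite /list_measure /msum -(proj2 pp) -big_nth_list -sumEFin.
apply: eq_bigr => i _.
have -> : point_mass i B = ((w i)%:num%:E * \d_(pt i) B)%E by [].
rewrite wE diracE mem_set ?mule1//.
by apply: sp; exact: mem_nth.
Qed.

Lemma list_measureT : list_measure setT = 1%E.
Proof. exact: list_measure_in. Qed.

(** The proof is an argument of the constant so that the probability instance can be attached to
    it. *)
Definition list_probability of weighted_prob p := list_measure.

HB.instance Definition _ := Measure.on (list_probability pp).
HB.instance Definition _ :=
  Measure_isProbability.Build _ _ _ (list_probability pp) list_measureT.

Lemma ge0_integral_list (B : set (Borel R d)) (g : Borel R d -> R) : measurable B ->
  supp_in p B -> measurable_fun setT g -> (forall x, 0 <= g x) ->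
  (\int[list_probability pp]_(x in B) (g x)%:E = (\sum_(a <- p) a.1 * g a.2)%:E)%E.
Proof.
move=> mB sp mg g0.
have mgB : measurable_fun B (EFin \o g).
  by apply/measurable_EFinP; exact: measurable_funS mg.
rewrite /list_probability /list_measure ge0_integral_measure_sum//; last by move=> x _; rewrite lee_fin.
rewrite -big_nth_list -sumEFin; apply: eq_bigr => i _.
rewrite ge0_integral_mscale//; last by move=> x _; rewrite lee_fin.
rewrite integral_dirac// wE diracE mem_set ?mul1e//.
by apply: sp; exact: mem_nth.
Qed.

Lemma Rintegral_list (B : set (Borel R d)) (g : Borel R d -> R) : measurable B ->
  supp_in p B -> bm g ->
  \int[list_probability pp]_(x in B) g x = \sum_(a <- p) a.1 * g a.2.
Proof.
move=> mB sp bg; have [mg [C hC]] := bg.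
(* Adding the bound reduces to non-negative functions, for which the integral splits over the point
   masses. *)
have g0 x : 0 <= g x + C.
  by have := hC x; rewrite ler_norml => /andP[]; lra.
have := @ge0_integral_list B (fun x => g x + C) mB sp.
move=> /(_ (measurable_funD mg (measurable_cst C)) g0) /(congr1 fine) /=.
rewrite -[LHS]/(\int[list_probability pp]_(x in B) (g x + C)) RintD//; last exact: bm_cst.
rewrite Rintegral_cst// [X in C * X](_ : _ = 1) ?mulr1; last first.
  by rewrite -[RHS]/(fine 1%E); congr fine; exact: list_measure_in.
have -> : \sum_(a <- p) a.1 * (g a.2 + C) = \sum_(a <- p) a.1 * g a.2 + C.
  rewrite -[X in _ + X]mul1r -(proj2 pp) mulr_suml -big_split.
  by apply: eq_bigr => a _; rewrite mulrDr.
by move/addIr.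
Qed.

End list_measure.

(** * Discretisation of probability measures *)

Section discretisation.
Context {R : realType} {d : nat}.
Context (mu : {finite_measure set (Borel R d) -> \bar R}).

(** A cube carries all but e/4 of the mass. On it the phases are Lipschitz in the point, and off it
    two cosines differ by at most 2. *)
Lemma coskernel_uniformly_continuous (e : R) : 0 < e -> exists2 del : R, 0 < del &
  forall x y : 'rV[R]_d, enorm (x - y) <= del ->
  `|coskernel mu x - coskernel mu y| <= e.
Proof.
move=> e0; have e40 : 0 < e / 4 by rewrite divr_gt0.
have [h [[h0 _ _] hh]] := @grid_fine _ _ mu Continuum (e / 4)
  (ltac:(by rewrite setCT measure0)) e40.
pose L := Num.sqrt d%:R * (2 * h)^-1.
have L0 : 0 <= L by rewrite mulr_ge0 ?sqrtr_ge0// invr_ge0 mulr_ge0 ?(ltW h0).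
pose K := 2 * pi * L * fine (mu setT).
have K0 : 0 <= K by apply: mulr_ge0 (fine_mu_ge0 _ _); apply: mulr_ge0 L0; rewrite mulr_ge0 ?pi_ge0.
have K1 : 0 < K + 1 by exact: ltr_wpDl.
exists (e / 2 / (K + 1)); first by rewrite !divr_gt0.
move=> x y xy; have xy0 := enorm_ge0 (x - y).
rewrite /coskernel -RintegralB//; try by exact/bm_integrable/bm_cos.
have bd : bm ((fun l => cos (2 * pi * dotp l x) - cos (2 * pi * dotp l y)) : Borel R d -> R).
  by apply: bmB; exact: bm_cos.
apply: le_trans (le_normr_Rintegral _ _) _ => //; first exact: bm_integrable.
have mC : measurable (cube h : set (Borel R d)) by exact: measurable_cube.
rewrite (@Rint_split _ _ _ mu setT (cube h))//; last exact: bm_norm.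
rewrite setTI setTD.
have I1 : \int[mu]_(l in cube h) `|cos (2 * pi * dotp l x) - cos (2 * pi * dotp l y)|
    <= e / 2.
  pose c := 2 * pi * enorm (x - y) * L.
  have c0 : 0 <= c.
    by apply: mulr_ge0 L0; rewrite !mulr_ge0 ?pi_ge0.
  apply: (@le_trans _ _ (c * fine (mu (cube h)))).
    apply: Rint_le_cst => //; first exact: bm_norm.
    move=> l cl; apply: le_trans (cos_lipschitz _ _) _.
    rewrite -mulrBr -dotpBr; apply: le_trans (dotp_phase _ (lexx _)) _.
    rewrite /c ler_wpM2l// ?mulr_ge0 ?pi_ge0//.
    by apply: enorm_le_coord => //; rewrite invr_ge0 mulr_ge0 ?(ltW h0).
  apply: (@le_trans _ _ (c * fine (mu setT))).
    by rewrite ler_wpM2l//; exact: fine_mu_le.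
  have -> : c * fine (mu setT) = K * enorm (x - y) by rewrite /c /K; ring.
  move: xy; rewrite ler_pdivlMr// => xy; apply: le_trans xy.
  by rewrite mulrC ler_wpM2l// lerDl.
have I2 : \int[mu]_(l in ~` cube h) `|cos (2 * pi * dotp l x) - cos (2 * pi * dotp l y)|
    <= 2 * (e / 4).
  apply: (@le_trans _ _ (2 * fine (mu (~` cube h)))); last by rewrite ler_wpM2l.
  apply: Rint_le_cst; [exact: measurableC|exact: bm_norm|].
  move=> l _; apply: le_trans (ler_normB _ _) _.
  by have := cos_max (2 * pi * dotp l x); have := cos_max (2 * pi * dotp l y); lra.
by move: I1 I2; lra.
Qed.

Lemma uniformly_continuous_continuous (f : 'rV[R]_d -> R) :
  (forall e, 0 < e -> exists2 del : R, 0 < del &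
    forall x y, enorm (x - y) <= del -> `|f x - f y| <= e) -> continuous f.
Proof.
move=> hf x; have FF : Filter (nbhs (x : 'rV[R]_d)) by exact: nbhs_filter.
apply/(@cvgrPdist_le _ _ _ _ FF) => e e0.
have [del del0 hd] := hf e e0.
have cN0 : continuous (fun y : 'rV[R]_d => enorm (y - (x : 'rV[R]_d))).
  exact: continuous_enorm_sub.
have := cN0 x.
move/(@cvgrPdist_lt _ _ _ _ FF)/(_ del del0); rewrite subrr enorm0 => cN.
near=> y; apply: hd; apply/ltW; rewrite enorm_distC.
have : `|0 - enorm (y - x)| < del by near: y.
by rewrite sub0r normrN ger0_norm// enorm_ge0.
Unshelve. all: by end_near. Qed.

Lemma ball_net (T del : R) : 0 < del -> exists V : seq 'rV[R]_d,
  forall x, enorm x <= T -> exists2 v, v \in V & enorm (x - v) <= del.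
Proof.
move=> del0; pose h := del / (Num.sqrt d%:R + 1).
have sd0 : 0 <= Num.sqrt (d%:R : R) by exact: sqrtr_ge0.
have h0 : 0 < h by rewrite divr_gt0// ltr_wpDl.
pose N := Num.truncn (2 * T / h).
pose g (f : {ffun 'I_d -> 'I_N.+1}) : 'rV[R]_d := \row_i (h * (f i : nat)%:R - T).
exists (codom g) => x xT.
have T0 : 0 <= T by apply: le_trans xT; exact: enorm_ge0.
pose k i := Num.truncn ((x 0 i + T) / h).
have xi i : 0 <= (x 0 i + T) / h <= 2 * T / h.
  have := le_trans (coord_le_enorm x i) xT; rewrite ler_norml => /andP[x1 x2].
  by rewrite divr_ge0 ?(ltW h0)/= ?ler_wpM2r ?invr_ge0 ?(ltW h0)//; lra.
pose f : {ffun 'I_d -> 'I_N.+1} := [ffun i => inord (k i)].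
exists (g f); first exact: codom_f.
apply: (@le_trans _ _ (Num.sqrt d%:R * h)); last first.
  by rewrite /h mulrA ler_pdivrMr ?ltr_wpDl// mulrC ler_wpM2l ?(ltW del0)// lerDl.
apply: enorm_le_coord => [|i]; first exact: ltW.
have /andP[x0 x2] := xi i.
have kN : (k i < N.+1)%N by rewrite ltnS le_truncn.
rewrite !mxE ffunE inordK//.
have k1 : (k i)%:R <= (x 0 i + T) / h by rewrite truncn_le.
have k2 : (x 0 i + T) / h < (k i).+1%:R by exact: truncnS_gt.
move: k1 k2; rewrite ler_pdivlMr// ltr_pdivrMr// -natr1 mulrDl mul1r => k1 k2.
by rewrite (mulrC h) ler_norml; apply/andP; split; lra.
Qed.

(** Pieces of [S] near one net point after another are split off. The mass of a piece is put at one
    of its own points and not at the net point, which keeps the support in [S] (in the lattice, say)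
    at the price of distances up to 2 del. *)
Lemma discretise (del : R) (nu : {finite_measure set (Borel R d) -> \bar R})
    (V : seq 'rV[R]_d) (S : set (Borel R d)) : measurable S ->
  (forall x, S x -> exists2 v, v \in V & enorm ((x : 'rV[R]_d) - v) <= del) ->
  exists p : seq (R * 'rV[R]_d), [/\ forall a, a \in p -> 0 <= a.1,
    \sum_(a <- p) a.1 = fine (nu S), supp_in p S &
    forall (f : Borel R d -> R) e, bm f ->
      (forall x y : 'rV[R]_d, enorm (x - y) <= 2 * del -> `|f x - f y| <= e) ->
      `|\int[nu]_(x in S) f x - \sum_(a <- p) a.1 * f a.2| <= e * fine (nu S)].
Proof.
elim: V S => [|v V ih] S mS cov.
  have -> : S = set0 by apply/seteqP; split => // x /cov[].
  exists [::]; split => [//||//|f e _ _]; first by rewrite big_nil measure0.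
  by rewrite Rintegral_set0 big_nil measure0 mulr0 subrr normr0.
pose A : set (Borel R d) := [set x | enorm (x - v) <= del].
have mA : measurable A.
  have cA : continuous (fun x : 'rV[R]_d => enorm (x - v)).
    exact: continuous_enorm_sub.
  have := continuous_Borel cA measurableT (measurable_itv `]-oo, del]).
  by rewrite setTI; congr measurable; apply/seteqP; split => x /=; rewrite in_itv.
have [|p [p0 pS sp hp]] := ih (S `\` A) (measurableD mS mA).
  by move=> x [/cov[w]]; rewrite inE => /predU1P[->//|wV] xw xA; exists w.
have [SA0|[x0 [Sx0 Ax0]]] := set0_or_ex (S `&` A).
  have SE : S `\` A = S.
    by apply/seteqP; split => [x []//|x Sx]; split => // Ax; rewrite -[False]/(set0 x) -SA0.
  by exists p; rewrite SE in pS sp hp.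
exists ((fine (nu (S `&` A)), x0) :: p); split.
- by move=> a; rewrite inE => /predU1P[->|/p0//]; exact: fine_mu_ge0.
- by rewrite big_cons pS -fine_muD.
- by move=> a; rewrite inE => /predU1P[->//|/sp[]].
move=> f e bf hf; rewrite (Rint_split nu mS mA)// big_cons (fine_muD nu mS mA) mulrDr.
rewrite opprD addrACA (le_trans (ler_normD _ _))// lerD//; last exact: hp.
have mSA : measurable (S `&` A) by exact: measurableI.
have dist x : (S `&` A) x -> `|f x - f x0| <= e.
  move=> [_ Ax]; apply: hf; rewrite -(subrK v x) -addrA.
  apply: le_trans (enormD _ _) _; rewrite mulr_natl mulr2n lerD//.
  by rewrite -enormN opprB.
rewrite /= mulrC -(Rintegral_cst nu mSA) -RintegralB//; last 2 first.
- exact: bm_integrable.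
- exact/bm_integrable/bm_cst.
have bd : bm (fun x => f x - f x0) by apply: bmB => //; exact: bm_cst.
apply: le_trans (le_normr_Rintegral _ _) _ => //; first exact: bm_integrable.
by apply: Rint_le_cst => //; exact: bm_norm.
Qed.

End discretisation.

(** * Energies of arbitrary probability measures *)

Section energy.
Context {R : realType} {d : nat} (D : site_type) (K : 'rV[R]_d -> R).
Context (mu : {finite_measure set (Borel R d) -> \bar R}).
Hypothesis hK : forall x, sites D x -> K x = coskernel mu x.

Let F : 'rV[R]_d -> R := coskernel mu.

Lemma measurable_ball_in T : measurable (ball_in D T : set (Borel R d)).
Proof.
apply: measurableI; first exact: measurable_eball.
case: D; first exact: measurableT.
rewrite (_ : sites IntLattice = \bigcap_(i in [set: 'I_d]) \bigcup_(z : int)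
    [set l : 'rV[R]_d | l 0 i \in `[z%:~R, z%:~R]]).
  apply: fin_bigcap_measurable => // i _; apply: countable_bigcupT_measurable => // z.
  exact: measurable_coord_itv.
apply/seteqP; split => x hx i.
  by move=> _; have /intrP[z hz] := hx i; exists z => //=; rewrite hz in_itv /= lexx.
by have [z _ /=] := hx i I; rewrite itvxx inE => /eqP ->; exact: intr_int.
Qed.

Lemma bm_shift_kernel x : bm ((fun y => F (x - y)) : Borel R d -> R).
Proof.
apply: (@continuous_bm _ _ _ (fine (mu setT))) => [|y]; last exact: coskernel_bound.
apply: uniformly_continuous_continuous => e e0.
have [del del0 hd] := coskernel_uniformly_continuous mu e0.
exists del => // y z yz; apply: hd.
by rewrite opprB addrC addrA subrK enorm_distC.
Qed.

Section one_measure.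
Context (nu : probability (Borel R d) R) (T : R).
Hypothesis nuB : nu (ball_in D T) = 1%E.

Let B : set (Borel R d) := ball_in D T.
Let potential (x : 'rV[R]_d) : R := \int[nu]_(y in B) F (x - y).

Let mB : measurable B. Proof. exact: measurable_ball_in. Qed.
Let nuB1 : fine (nu B) = 1. Proof. by rewrite /B nuB. Qed.

Let potential_uc e : 0 < e -> exists2 del : R, 0 < del &
  forall x y, enorm (x - y) <= del -> `|potential x - potential y| <= e.
Proof.
move=> e0; have [del del0 hd] := coskernel_uniformly_continuous mu e0.
exists del => // x y xy; rewrite /potential -RintegralB//; try exact/bm_integrable/bm_shift_kernel.
have bd : bm ((fun t => F (x - t) - F (y - t)) : Borel R d -> R).
  by apply: bmB; exact: bm_shift_kernel.
apply: le_trans (le_normr_Rintegral _ _) _ => //; first exact: bm_integrable.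
rewrite -[leRHS]mulr1 -nuB1; apply: Rint_le_cst => //; first exact: bm_norm.
by move=> t _; apply: hd; rewrite opprB addrA subrK.
Qed.

Let bm_potential : bm (potential : Borel R d -> R).
Proof.
apply: (@continuous_bm _ _ _ (fine (mu setT))) => [|x].
  exact: uniformly_continuous_continuous.
apply: le_trans (le_normr_Rintegral _ _) _ => //.
  exact/bm_integrable/bm_shift_kernel.
rewrite -[leRHS]mulr1 -nuB1; apply: Rint_le_cst => //.
  exact/bm_norm/bm_shift_kernel.
by move=> y _; exact: coskernel_bound.
Qed.

Lemma energyE : energy K B nu = (\int[nu]_(x in B) \int[nu]_(y in B) F (x - y))%:E.
Proof.
have fin (g : Borel R d -> R) : bm g ->
    (\int[nu]_(x in B) (g x)%:E)%E = (\int[nu]_(x in B) g x)%:E.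
  move=> bg; rewrite /Rintegral fineK//.
  exact/integrable_fin_num/bm_integrable.
rewrite -(fin potential)//; apply: eq_integral => x; rewrite inE => -[_ sx].
rewrite -fin; last exact: bm_shift_kernel.
apply: eq_integral => y; rewrite inE => -[_ sy].
by rewrite hK//; exact: sitesB.
Qed.

(** The point masses replace [nu] in the outer integral, where the potential is uniformly
    continuous, and then in the inner one, where the kernel is; each replacement costs e/2. *)
Lemma energy_discretise e : 0 < e -> exists p,
  [/\ weighted_prob p, supp_in p (ball_in D T) &
    \int[mu]_l pow p l <= fine (energy K (ball_in D T) nu) + e].
Proof.
move=> e0; have e20 : 0 < e / 2 by rewrite divr_gt0.
have [d1 d10 h1] := coskernel_uniformly_continuous mu e20.
have [d2 d20 h2] := potential_uc e20.
pose del := Num.min d1 d2 / 2.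
have del0 : 0 < del by rewrite divr_gt0// lt_min d10.
have [V hV] := @ball_net R d T del del0.
have [p [p0 pS sp hp]] := @discretise _ _ del nu V B mB (fun x Bx => hV x (proj1 Bx)).
exists p; split => //; first by split => //; rewrite pS.
have del2 : 2 * del = Num.min d1 d2 by rewrite /del; field.
rewrite energyE /= Rint_pow.
have nB e' : e' * fine (nu B) = e' by rewrite nuB1 mulr1.
have k1 : `|\int[nu]_(x in B) potential x - \sum_(a <- p) a.1 * potential a.2| <= e / 2.
  rewrite -[leRHS]nB; apply: hp bm_potential _ => x y.
  by rewrite del2 le_min => /andP[_]; exact: h2.
have k2 a : `|potential a - \sum_(b <- p) b.1 * F (a - b.2)| <= e / 2.
  rewrite -[leRHS]nB; apply: (hp (fun y => F (a - y))); first exact: bm_shift_kernel.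
  move=> x y; rewrite del2 le_min => /andP[xy _]; apply: h1.
  by rewrite opprB addrC addrA subrK enorm_distC.
have k3 : \sum_(a <- p) \sum_(b <- p) a.1 * b.1 * coskernel mu (a.2 - b.2) <=
    \sum_(a <- p) a.1 * potential a.2 + e / 2.
  rewrite -[X in _ + X]nB -pS mulr_sumr -big_split.
  rewrite big_seq [leRHS]big_seq; apply: ler_sum => a /p0 a0 /=.
  have -> : \sum_(b <- p) a.1 * b.1 * coskernel mu (a.2 - b.2) =
      a.1 * \sum_(b <- p) b.1 * F (a.2 - b.2).
    by rewrite mulr_sumr; apply: eq_bigr => b _; rewrite mulrA.
  rewrite [e / 2 * _]mulrC -mulrDr ler_wpM2l//.
  by have := k2 a.2; rewrite ler_norml => /andP[]; lra.
have := ler_norm (- (\int[nu]_(x in B) potential x - \sum_(a <- p) a.1 * potential a.2)).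
by rewrite normrN; move: k1 k3; rewrite /potential; lra.
Qed.

(** Positive definiteness of the kernel is visible on point masses, where the energy is the integral
    of [pow], and passes to [nu] by approximation. *)
Lemma energy_ge0 : 0 <= fine (energy K (ball_in D T) nu).
Proof.
apply/ler_addgt0Pr => e e0; have [p [_ _]] := energy_discretise e0.
by apply: le_trans; apply: Rintegral_ge0 => l _; exact: pow_ge0.
Qed.

End one_measure.

Lemma energy_list p T (pp : weighted_prob p) : supp_in p (ball_in D T) ->
  exists nu : probability (Borel R d) R, nu (ball_in D T) = 1%E /\
    energy K (ball_in D T) nu = (\int[mu]_l pow p l)%:E.
Proof.
move=> sp; have := list_measureT pp => LT.
pose nu := [the probability (Borel R d) R of list_probability pp].
have nu1 : nu (ball_in D T) = 1%E by exact: list_measure_in.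
exists nu; split => //; rewrite (energyE nu1) Rint_pow; congr (_%:E).
have mB := measurable_ball_in T.
transitivity (\int[nu]_(x in ball_in D T) \sum_(b <- p) b.1 * F (x - b.2)).
  by apply: eq_Rintegral => x _; apply: Rintegral_list => //; exact: bm_shift_kernel.
rewrite Rintegral_list//; last first.
  apply: bm_sum => b; apply: bmZ.
  rewrite (_ : (fun x => F (x - b.2)) = fun x => F (b.2 - x)); last first.
    by apply/funext => x; rewrite /F -coskernel_even opprB.
  exact: bm_shift_kernel.
apply: eq_bigr => a _; rewrite mulr_sumr; apply: eq_bigr => b _.
by rewrite mulrA.
Qed.

Definition least_energy T : R := fine (ereal_inf [set energy K (ball_in D T) nu | nu in
  [set nu : probability (Borel R d) R | nu (ball_in D T) = 1%E]]).

Let prob_point0 T : 0 <= T -> weighted_prob (@unit_point R d) /\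
  supp_in (@unit_point R d) (ball_in D T).
Proof.
move=> T0; split; first exact: prob_unit.
move=> a; rewrite inE => /eqP ->; split; last exact: sites0.
by rewrite /eball /= enorm0.
Qed.

Lemma energy_fin_num (nu : probability (Borel R d) R) T : nu (ball_in D T) = 1%E ->
  energy K (ball_in D T) nu = (fine (energy K (ball_in D T) nu))%:E.
Proof. by move=> nuB; rewrite (energyE nuB). Qed.

Lemma least_energyE T : 0 <= T -> ereal_inf [set energy K (ball_in D T) nu | nu in
  [set nu : probability (Borel R d) R | nu (ball_in D T) = 1%E]] = (least_energy T)%:E.
Proof.
move=> T0; rewrite /least_energy fineK// fin_numElt; apply/andP; split.
  apply: (@lt_le_trans _ _ 0%E) => //; apply: le_ereal_inf_tmp => _ [nu nuB <-].
  by rewrite energy_fin_num// lee_fin energy_ge0.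
have [pp sp] := prob_point0 T0; have [nu [nuB nuE]] := energy_list pp sp.
apply: (@le_lt_trans _ _ (energy K (ball_in D T) nu)).
  by apply: ereal_inf_lbound; exists nu.
by rewrite nuE ltry.
Qed.

Lemma least_energy_le T p : 0 < T -> weighted_prob p -> supp_in p (ball_in D T) ->
  least_energy T <= \int[mu]_l pow p l.
Proof.
move=> T0 pp sp; have [nu [nuB nuE]] := energy_list pp sp.
by rewrite -lee_fin -least_energyE ?(ltW T0)// -nuE; apply: ereal_inf_lbound; exists nu.
Qed.

Lemma least_energy_approx T e : 0 < T -> 0 < e -> exists p,
  [/\ weighted_prob p, supp_in p (ball_in D T) & \int[mu]_l pow p l <= least_energy T + e].
Proof.
move=> T0 e0; have e20 : 0 < e / 2 by rewrite divr_gt0.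
have : (ereal_inf [set energy K (ball_in D T) nu | nu in
    [set nu : probability (Borel R d) R | nu (ball_in D T) = 1%E]] <
    (least_energy T + e / 2)%:E)%E.
  by rewrite least_energyE ?(ltW T0)// lte_fin ltrDl.
move=> /ereal_inf_lt[_ [nu nuB <-]]; rewrite energy_fin_num// lte_fin => hnu.
have [p [pp sp hp]] := energy_discretise nuB e20.
by exists p; split => //; lra.
Qed.

Lemma capacityE T : 0 < T -> 0 < least_energy T ->
  fine (capacity K (ball_in D T)) = (least_energy T)^-1.
Proof.
move=> T0 I0; rewrite /capacity least_energyE ?(ltW T0)// inver.
by rewrite (negbTE (lt0r_neq0 I0)).
Qed.

End energy.

(** * Lebesgue measure on the line under translations and dilations *)

Section affine_lebesgue.
Context {R : realType}.
Local Notation leb := (@lebesgue_measure R).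

Lemma lebesgue_measure_shift (c : R) (A : set R) : measurable A ->
  pushforward leb (fun x : R => (x + c : measurableTypeR R)) A = leb A.
Proof.
move=> mA; have mf : measurable_fun setT (fun x : measurableTypeR R => (x + c : measurableTypeR R)).
  by apply: measurable_funD; [exact: measurable_id|exact: measurable_cst].
pose mix := isMeasurableFun.Build _ _ _ _ _ mf.
pose f : {mfun (measurableTypeR R) >-> (measurableTypeR R)} := HB.pack (fun x : measurableTypeR R => (x + c : measurableTypeR R)) mix.
apply/esym/(@lebesgue_measure_unique R (pushforward leb f)) => //= _ [[a b]] _ <-.
rewrite /pushforward /=.
have -> : (fun x : R => x + c) @^-1` `]a, b]%classic = `]a - c, b - c]%classic.
  by apply/seteqP; split => x /=; rewrite !in_itv /= ltrBlDr lerBrDr.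
rewrite !lebesgue_measure_itv /= !lte_fin ltrD2r; case: ifP => // _.
by rewrite -!EFinB; congr (_%:E); ring.
Qed.

Lemma lebesgue_measure_scale (u : R) (A : set R) : 0 < u -> measurable A ->
  leb ((fun x : R => u * x) @^-1` A) = ((u^-1)%:E * leb A)%E.
Proof.
move=> u0 mA; have mf : measurable_fun setT (fun x : measurableTypeR R => (u * x : measurableTypeR R)).
  by apply: measurable_funM; [exact: measurable_cst|exact: measurable_id].
pose mix := isMeasurableFun.Build _ _ _ _ _ mf.
pose f : {mfun (measurableTypeR R) >-> (measurableTypeR R)} := HB.pack (fun x : measurableTypeR R => (u * x : measurableTypeR R)) mix.
have nu0 : 0 <= u by exact: ltW.
pose k : {nonneg R} := NngNum nu0.
have h (nu : {measure set (measurableTypeR R) -> \bar R}) :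
    (forall B, nu B = pushforward leb f B) -> leb A = mscale k nu A.
  move=> nuE; apply: lebesgue_measure_unique => //= _ [[a b]] _ <-.
  rewrite /mscale nuE /pushforward /=.
  have -> : (fun x : R => u * x) @^-1` `]a, b]%classic = `]a / u, b / u]%classic.
    apply/seteqP; split => x /=; rewrite !in_itv /=.
      by rewrite ltr_pdivrMr// ler_pdivlMr// mulrC.
    by rewrite ltr_pdivrMr// ler_pdivlMr// mulrC.
  rewrite !lebesgue_measure_itv /= !lte_fin ltr_pM2r ?invr_gt0//; case: ifP => _.
    rewrite -!EFinB -EFinM; congr (_%:E); field; exact: lt0r_neq0.
  by rewrite mule0.
have -> := h (measure_function_pushforward__canonical__measure_function_Measure leb mf) (fun=> erefl).
by rewrite /mscale /pushforward /= muleA -EFinM mulVf ?lt0r_neq0// mul1e.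
Qed.

End affine_lebesgue.

(** * Karamata's uniform convergence theorem *)

Section uniform_convergence.
Context {R : realType}.
Local Notation leb := (@lebesgue_measure R).
Implicit Types (f : R -> R).

Lemma set_measure_close (V : (set R)^nat) (L e : R) : 0 < L -> 0 < e ->
  (forall n, measurable (V n)) -> {homo V : n m / (n <= m)%N >-> n `<=` m} ->
  \bigcup_n V n = `[0, L]%classic ->
  exists N, forall n, (N <= n)%N -> ((L - e)%:E < leb (V n))%E.
Proof.
move=> L0 e0 mV ndV covV.
have cvgV : leb (V n) @[n --> \oo] --> leb (\bigcup_n V n).
  apply: nondecreasing_cvg_mu => //; first exact: bigcupT_measurable.
  by move=> n m nm; apply/subsetPset; exact: ndV.
rewrite covV lebesgue_measure_itv /= lte_fin L0 -EFinB subr0 in cvgV.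
have LeL : L - e < L by rewrite ltrBlDr ltrDl.
move: cvgV => /fine_cvgP[[N1 _ hN1] /cvgr_gt/(_ _ LeL)[N2 _ hN2]].
exists (maxn N1 N2) => n; rewrite geq_max => /andP[n1 n2].
have := hN2 n n2; rewrite /= -lte_fin fineK//; exact: hN1.
Qed.

(** If uniformity fails along points x_n and increments t_n, consider the r in [0, 2c] for which the
    increments by r from x_n, respectively from x_n + t_n, have settled below e/2. Both sets
    eventually have measure above 3c/2. The translate of the second by t_n lies in [0, 3c] with the
    first, so they meet, and a common point bounds the increment from x_n to x_n + t_n by e. *)
Lemma additive_uniform_convergence f (c : R) : 0 < c -> measurable_fun setT f ->
  (forall t, f (x + t) - f x @[x --> +oo] --> (0 : R)) ->
  forall e, 0 < e -> exists X, forall x t, X <= x -> 0 <= t -> t <= c ->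
    `|f (x + t) - f x| <= e.
Proof.
move=> c0 mf hf e e0; apply: contrapT => /forallNP hN.
have step n : exists xt : R * R, [/\ n%:R <= xt.1, 0 <= xt.2, xt.2 <= c &
    e < `|f (xt.1 + xt.2) - f xt.1|].
  apply: contrapT => /forallNP hn; apply: (hN n%:R) => x t nx t0 tc.
  by rewrite leNgt; apply/negP => h; apply: (hn (x, t)).
have [s hs] := choice step.
pose x n := (s n).1; pose t n := (s n).2.
have e20 : 0 < e / 2 by rewrite divr_gt0.
(* Asking for all indices from [n] on makes the sets increase with [n] to the whole interval. *)
pose V (y : nat -> R) n : set R := [set r | 0 <= r <= 2 * c /\
  forall m, (n <= m)%N -> `|f (y m + r) - f (y m)| < e / 2].
have mV y n : measurable (V y n).
  rewrite (_ : V y n = `[0, 2 * c]%classic `&` \bigcap_(m in [set m | (n <= m)%N])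
      [set r | `|f (y m + r) - f (y m)| < e / 2]).
    apply: measurableI; first exact: measurable_itv.
    apply: bigcap_measurable; first by exists n => /=.
    move=> m _.
    have mg : measurable_fun setT (fun r => `|f (y m + r) - f (y m)|).
      apply: measurableT_comp => //; apply: measurable_funD; last exact: measurable_cst.
      apply: measurableT_comp => //; apply: measurable_funD; last exact: measurable_id.
      exact: measurable_cst.
    have := mg measurableT _ (measurable_itv `]-oo, (e / 2)[).
    by rewrite setTI; congr measurable; apply/seteqP; split => r /=; rewrite in_itv.
  apply/seteqP; split => r /=; rewrite in_itv /=.
    by move=> [r1 r2]; split.
  by move=> [r1 r2]; split.
have ndV y : {homo V y : n m / (n <= m)%N >-> n `<=` m}.
  by move=> n m nm r [r1 r2]; split => // k mk; apply: r2; exact: leq_trans mk.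
have covV y : (forall n, n%:R <= y n) -> \bigcup_n V y n = `[0, 2 * c]%classic.
  move=> hy; apply/seteqP; split => r; first by move=> [n _ [r1 _]]; rewrite /= in_itv.
  rewrite /= in_itv /= => r1.
  move: (hf r) => /cvgrPdist_lt/(_ _ e20)[X [_ hX]].
  exists (Num.truncn `|X|).+1 => //; split => // m nm.
  rewrite -normrN -sub0r; apply: hX; apply: lt_le_trans (hy m).
  apply: (@lt_le_trans _ _ (Num.truncn `|X|).+1%:R); last by rewrite ler_nat.
  by apply: le_lt_trans (truncnS_gt _); exact: ler_norm.
have c20 : 0 < 2 * c by rewrite mulr_gt0.
have c40 : 0 < c / 2 by rewrite divr_gt0.
have xn n : n%:R <= x n by have [] := hs n.
have xtn n : n%:R <= x n + t n by have [h1 h2 _ _] := hs n; rewrite (le_trans h1)// lerDl.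
have [N1 hN1] := set_measure_close c20 c40 (mV x) (@ndV x) (covV x xn).
have [N2 hN2] := set_measure_close c20 c40 (mV (fun n => x n + t n)) (@ndV _) (covV _ xtn).
pose n := maxn N1 N2.
have {hN1} A1 := hN1 n (leq_maxl _ _); have {hN2} A2 := hN2 n (leq_maxr _ _).
pose W : set R := (fun r => r + - t n) @^-1` V (fun n => x n + t n) n.
have mW : measurable W.
  have mg : measurable_fun setT (fun r : R => r + - t n).
    by apply: measurable_funD; [exact: measurable_id|exact: measurable_cst].
  by rewrite -[W]setTI; exact: mg.
have WE : leb W = leb (V (fun n => x n + t n) n) by exact: lebesgue_measure_shift.
have [_ tn0 tnc hbad] := hs n.
have VW : V x n `&` W = set0.
  apply/seteqP; split => // r [[_ r1] [_ r2]].
  have := r1 n (leqnn n); have := r2 n (leqnn n).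
  rewrite (_ : x n + t n + (r + - t n) = x n + r); last by ring.
  move=> k1 k2; move: hbad; apply/negP; rewrite -leNgt.
  rewrite -/(x n) -/(t n) (_ : f (x n + t n) - f (x n) =
    (f (x n + r) - f (x n)) - (f (x n + r) - f (x n + t n))); last by ring.
  by rewrite (le_trans (ler_normB _ _))//; lra.
have sub : V x n `|` W `<=` `[0, 3 * c]%classic.
  move=> r [[/andP[r1 r2] _]|[/andP[r1 r2] _]]; rewrite /= in_itv /=; apply/andP; split.
  - by [].
  - by lra.
  - by rewrite /t in r1 *; lra.
  - by rewrite /t in r2 *; lra.
have : (leb (V x n `|` W) <= leb (`[0%R, (3 * c)%R]%classic : set R))%E.
  have mU : measurable (V x n `|` W) by exact: measurableU.
  exact: (le_measure leb (mem_set mU) (mem_set (measurable_itv `[0, 3 * c])) sub).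
have c30 : 0 < 3 * c by rewrite mulr_gt0.
have -> : leb `[0, 3 * c]%classic = (3 * c)%:E.
  by rewrite lebesgue_measure_itv /= lte_fin c30 -EFinB subr0.
have -> : leb (V x n `|` W) = (leb (V x n) + leb W)%E; first exact: (measureU leb (mV x n) mW VW).
have -> : leb W = leb (V (fun n => x n + t n) n) := WE.
rewrite leNgt => /negP; apply.
have := lteD A1 A2; rewrite -EFinD.
by have -> : 2 * c - c / 2 + (2 * c - c / 2) = 3 * c by field.
Qed.

Lemma cvgpinfty_expR : expR x @[x --> +oo] --> (+oo : set_system R).
Proof.
apply/cvgryPge => A; apply: filterS (nbhs_pinfty_ge (num_real A)) => x Ax.
by apply: le_trans (expR_ge1Dx x); rewrite (le_trans Ax)// lerDr ler01.
Qed.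

Lemma slowly_varying_uniform (w : R -> R) (b : R) : 1 < b ->
  slowly_varying (pinfty_nbhs R) w ->
  forall e, 0 < e -> exists2 X, 0 < X & forall x y, X <= x -> X <= y ->
    x <= b * y -> y <= b * x -> `|w y / w x - 1| <= e.
Proof.
move=> b1 [mw wpos hw] e e0; pose f (s : R) := ln (w (expR s)).
have b0 : 0 < b by lra.
have lb : 0 < ln b by rewrite ln_gt0.
have mf : measurable_fun setT f.
  apply: measurableT_comp; first exact: measurable_ln.
  have h : measurable_fun setT (@expR R) by exact: measurable_expR.
  apply: (@measurable_comp _ _ _ _ _ _ (`]0, +oo[%classic : set R) w setT expR) => //.
  by move=> _ [s _ <-]; rewrite /= in_itv /= expR_gt0.
have hf t : f (x + t) - f x @[x --> +oo] --> (0 : R).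
  have -> : (fun x => f (x + t) - f x) = (@ln R) \o (fun x => w (expR t * x) / w x) \o (@expR R).
    apply/funext => x; rewrite /f /= expRD mulrC lnM ?posrE ?invr_gt0 ?wpos ?mulr_gt0 ?expR_gt0//.
    by rewrite lnV// posrE wpos// expR_gt0.
  have h1 : w (expR t * x) / w x @[x --> +oo] --> (1 : R) by apply: hw; exact: expR_gt0.
  have h2 : (fun x => w (expR t * x) / w x) (expR x) @[x --> +oo] --> (1 : R).
    exact: (cvg_comp _ _ cvgpinfty_expR h1).
  rewrite -ln1; apply: (cvg_comp _ _ h2); by apply: continuous_ln.
(* |ln q| <= e1 implies |q - 1| <= e; the minimum with 1/2 keeps the argument of the logarithm
   positive. *)
pose e1 := Num.min (ln (1 + e)) (- ln (1 - Num.min e 2^-1)).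
have m0 : 0 < Num.min e 2^-1 by rewrite lt_min e0 /=.
have m1 : Num.min e 2^-1 <= 2^-1 by rewrite ge_min lexx orbT.
have m2 : Num.min e 2^-1 <= e by rewrite ge_min lexx.
have e10 : 0 < e1.
  by rewrite lt_min ln_gt0 ?ltrDl//= oppr_gt0 -ln1 ltr_ln ?posrE//; lra.
have [X hX] := additive_uniform_convergence lb mf hf e10.
have key x y : expR X <= x -> x <= y -> y <= b * x -> `|ln (w y) - ln (w x)| <= e1.
  move=> Xx xy yb; have x0 : 0 < x by apply: lt_le_trans Xx; exact: expR_gt0.
  have y0 : 0 < y by lra.
  have := hX (ln x) (ln y - ln x); rewrite /f (addrC (ln x)) subrK !lnK ?posrE//.
  apply.
  - by rewrite -(expRK X) ler_ln ?posrE ?expR_gt0.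
  - by rewrite subr_ge0 ler_ln ?posrE.
  - by rewrite lerBlDr -lnM ?posrE// ler_ln ?posrE ?mulr_gt0.
exists (expR X); first exact: expR_gt0.
move=> x y Xx Xy xy yx.
have x0 : 0 < x by apply: lt_le_trans Xx; exact: expR_gt0.
have y0 : 0 < y by apply: lt_le_trans Xy; exact: expR_gt0.
have : `|ln (w y) - ln (w x)| <= e1.
  have [h|h] := leP x y; first exact: key.
  by rewrite distrC; apply: key => //; exact: ltW.
have [wx wy] := (wpos x x0, wpos y y0).
have wyx : 0 < w y / w x by rewrite divr_gt0.
rewrite -ln_div ?posrE// ler_norml => /andP[k1 k2].
have k3 : ln (w y / w x) <= ln (1 + e) by apply: le_trans k2 _; rewrite ge_min lexx.
have k4 : ln (1 - Num.min e 2^-1) <= ln (w y / w x).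
  by apply: le_trans k1; rewrite lerNr ge_min lexx orbT.
move: k3 k4; rewrite !ler_ln ?posrE//; [move=> k3 k4|lra|lra].
by rewrite ler_norml; apply/andP; split; lra.
Qed.

End uniform_convergence.

(** * Atom at the origin *)

Section atom.
Context {R : realType} {d : nat} (alpha : R).
Context (mu : {finite_measure set (Borel R d) -> \bar R}).

Let m (r : R) : R := fine (mu (eball r)).
Let a : R := fine (mu [set 0%R]).

Lemma eball0 : eball 0 = [set 0 : 'rV[R]_d].
Proof.
rewrite /eball; apply/seteqP; split => x /=; last by move=> ->; rewrite /eball /= enorm0.
by rewrite le_eqVlt ltNge enorm_ge0 orbF enorm_eq0 => /eqP.
Qed.

Lemma measurable_origin : measurable ([set 0] : set (Borel R d)).
Proof. by rewrite -eball0; exact: measurable_eball. Qed.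

Lemma atom_le_ball r : 0 <= r -> a <= m r.
Proof.
move=> r0; rewrite /a -eball0; exact: m_le.
Qed.

Lemma ball_atom_approx e : 0 < e -> exists2 r, 0 < r & m r <= a + e.
Proof.
move=> e0; pose F n : set (Borel R d) := eball n.+1%:R^-1.
have capF : \bigcap_n F n = [set 0].
  rewrite -eball0; apply/seteqP; split => x /=; last first.
    by move=> x0 n _; rewrite /F /eball /= (le_trans x0)// invr_ge0.
  move=> h; rewrite /eball /= leNgt; apply/negP => x0.
  have := h (Num.truncn (enorm x)^-1) I; rewrite /F /eball /= leNgt => /negP; apply.
  rewrite invf_plt ?posrE//; exact: truncnS_gt.
have cvgF : mu (F n) @[n --> \oo] --> mu (\bigcap_n F n).
  apply: nonincreasing_cvg_mu.
  - by rewrite ltey_eq fin_num_measure//; exact: measurable_eball.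
  - by move=> n; exact: measurable_eball.
  - by rewrite capF; exact: measurable_origin.
  - move=> n k nk; apply/subsetPset => x /= /le_trans; apply.
    by rewrite lef_pV2 ?posrE// ler_nat.
rewrite capF -(fineK (fin_num_measure mu _ measurable_origin)) -/a in cvgF.
have ae : a < a + e by rewrite ltrDl.
move: cvgF => /fine_cvgP[_ /cvgr_lt/(_ _ ae)[N _ hN]].
exists N.+1%:R^-1; first by rewrite invr_gt0.
exact/ltW/(hN N (leqnn N)).
Qed.

Hypothesis a0 : 0 < a.

Lemma atom_ball_pos r : 0 < r -> 0 < m r.
Proof. by move=> /ltW/atom_le_ball; exact: lt_le_trans. Qed.

Lemma atom_eventually v e : 0 < v -> 0 < e ->
  exists T0, 0 < T0 /\ forall T, T0 <= T -> m (v / T) <= a + e * a.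
Proof.
move=> v0 e0; have [r r0 hr] := ball_atom_approx (mulr_gt0 e0 a0).
exists (v / r); split; first by rewrite divr_gt0.
move=> T TT; have T0 : 0 < T by apply: lt_le_trans TT; rewrite divr_gt0.
apply: le_trans hr; apply: m_le.
by rewrite ler_pdivrMr// mulrC -ler_pdivrMr.
Qed.

Lemma atom_RVup : RVup (fun T => m T^-1) (- 0).
Proof.
move=> v e v0 e0; have vi : 0 < v^-1 by rewrite invr_gt0.
have [T0 [T00 hT]] := atom_eventually vi e0.
exists T0; split => // T TT; have T_gt0 : 0 < T by apply: lt_le_trans TT.
rewrite oppr0 powRr0 invfM (le_trans (hT T TT))//.
rewrite -{1}[a]mul1r -mulrDl ler_pM2l ?addr_gt0//.
by apply: atom_le_ball; rewrite invr_ge0 ltW.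
Qed.

(** On B(A/T) [pow] is at most 1, and the mass of this ball exceeds that of the atom by little; the
    atom itself contributes its full mass to every energy, since [pow p 0 = 1]. *)
Lemma atom_vague_scaling : vague_scaling 0 mu.
Proof.
move=> u A e u0 A0 e0; have [T0 [T00 hT]] := atom_eventually A0 e0.
exists T0; split => // T TT p pp _; have T_gt0 : 0 < T by apply: lt_le_trans TT.
rewrite oppr0 powRr0 mul1r.
have mB r : measurable (eball r : set (Borel R d)) by exact: measurable_eball.
apply: (@le_trans _ _ (1 * m (A / T))).
  by apply: Rint_le_cst => // [|l _]; [exact: bm_pow_scale|exact: pow_le1].
rewrite mul1r (le_trans (hT T TT))// lerD//.
  apply: (@le_trans _ _ (\int[mu]_(l in [set 0]) pow p l)).
    rewrite -[a]mul1r; apply: Rint_ge_cst; [exact: measurable_origin|exact: bm_pow|].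
    by move=> l ->; rewrite pow0.
  apply: Rint_subset => //; [exact: measurable_origin|exact: bm_pow|].
  by move=> l _; exact: pow_ge0.
by rewrite ler_pM2l// atom_le_ball// invr_ge0 ltW.
Qed.

End atom.

(* Regular variation of index [- alpha], uniform for [x / T] in compact sets. *)
Definition gauge (R : realType) (alpha : R) (G : R -> R) : Prop :=
  forall s C e, 0 < s -> 0 < C -> 0 < e -> exists X, 0 < X /\
  forall T x, X <= T -> s * T <= x -> x <= C * T ->
  `|G x - (x / T) `^ (- alpha) * G T| <= e * G T.

Section gauge.
Context {R : realType} (alpha : R).
Hypothesis alpha0 : 0 <= alpha.

Lemma slowly_varying_gauge (w : R -> R) : slowly_varying (pinfty_nbhs R) w ->
  gauge alpha (fun t => t `^ (- alpha) * w t).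
Proof.
move=> sw s C e s0 C0 e0; pose b := C + s^-1 + 1.
have si : 0 < s^-1 by rewrite invr_gt0.
have b1 : 1 < b by rewrite /b; lra.
have sa : 0 < s `^ (- alpha) by rewrite powR_gt0.
have [X X0 hX] := slowly_varying_uniform b1 sw (divr_gt0 e0 sa).
have [_ wpos _] := sw.
exists (X + X / s); split; first by rewrite addr_gt0// divr_gt0.
move=> T x XT sx xC.
have Xs : 0 < X / s by rewrite divr_gt0.
have T0 : 0 < T by lra.
have XsT : X <= s * T by rewrite mulrC -ler_pdivrMr//; lra.
have x0 : 0 < x by lra.
have XT' : X <= T by lra.
have Xx : X <= x by lra.
have Tbx : T <= b * x.
  have : T <= s^-1 * x by rewrite mulrC ler_pdivlMr// mulrC.
  rewrite /b; have : 0 <= C * x by rewrite mulr_ge0 ?ltW.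
  lra.
have xbT : x <= b * T.
  rewrite /b; have : 0 <= s^-1 * T by rewrite mulr_ge0 ?ltW.
  lra.
have := hX T x XT' Xx Tbx xbT.
have wT := wpos _ T0; have wx := wpos _ x0.
have Ta : 0 < T `^ (- alpha) by rewrite powR_gt0.
have xT : 0 < x / T by rewrite divr_gt0.
have xaE : x `^ (- alpha) = (x / T) `^ (- alpha) * T `^ (- alpha).
  by rewrite -powRM ?(ltW xT) ?(ltW T0)// divfK// lt0r_neq0.
have xTa : (x / T) `^ (- alpha) <= s `^ (- alpha).
  rewrite !powRN lef_pV2 ?posrE ?powR_gt0//.
  by apply: ge0_ler_powR; rewrite ?nnegrE ?(ltW s0) ?(ltW xT)// ler_pdivlMr.
move=> h; rewrite xaE.
have -> : (x / T) `^ (- alpha) * T `^ (- alpha) * w x -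
  (x / T) `^ (- alpha) * (T `^ (- alpha) * w T) =
  (x / T) `^ (- alpha) * (T `^ (- alpha) * w T) * (w x / w T - 1).
  by field; rewrite lt0r_neq0.
have TwT : 0 < T `^ (- alpha) * w T by rewrite mulr_gt0.
rewrite normrM ger0_norm ?mulr_ge0 ?powR_ge0 ?(ltW TwT)//.
apply: le_trans (ler_pM _ _ (ler_wpM2r (ltW TwT) xTa) h) _ => //.
- by rewrite mulr_ge0 ?powR_ge0 ?(ltW TwT).
- rewrite le_eqVlt; apply/orP; left; apply/eqP.
  by field; rewrite lt0r_neq0.
- exact: ltW.
Qed.

Variable G : R -> R.
Hypothesis Gpos : forall t, 0 < t -> 0 < G t.
Hypothesis hG : gauge alpha G.

Lemma gauge_le s C : 0 < s -> 0 < C -> exists X B, [/\ 0 < X, 0 < B &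
  forall T x, X <= T -> s * T <= x -> x <= C * T -> G x <= B * G T].
Proof.
move=> s0 C0; have [X [X0 hX]] := hG s0 C0 ltr01.
exists X, (s `^ (- alpha) + 1); split => //; first by rewrite ltr_wpDl ?powR_ge0.
move=> T x XT sx xC; have T0 : 0 < T by lra.
have x0 : 0 < x by apply: lt_le_trans sx; rewrite mulr_gt0.
have := hX T x XT sx xC; rewrite ler_norml => /andP[_]; rewrite lerBlDr.
move=> /le_trans; apply; rewrite addrC mulrDl lerD2r ler_wpM2r ?(ltW (Gpos T0))//.
rewrite !powRN lef_pV2 ?posrE ?powR_gt0//; last by rewrite divr_gt0.
by apply: ge0_ler_powR; rewrite ?nnegrE ?(ltW s0)//; [rewrite divr_ge0 ?ltW|rewrite ler_pdivlMr].
Qed.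

Lemma gauge_ge s C : 0 < s -> 0 < C -> exists X, 0 < X /\
  forall T x, X <= T -> s * T <= x -> x <= C * T ->
  C `^ (- alpha) / 2 * G T <= G x.
Proof.
move=> s0 C0; have Ca : 0 < C `^ (- alpha) by rewrite powR_gt0.
have C2 : 0 < C `^ (- alpha) / 2 by rewrite divr_gt0.
have [X [X0 hX]] := hG s0 C0 C2.
exists X; split => // T x XT sx xC; have T0 : 0 < T by lra.
have x0 : 0 < x by apply: lt_le_trans sx; rewrite mulr_gt0.
have := hX T x XT sx xC; rewrite ler_norml => /andP[h _]; move: h.
have : C `^ (- alpha) * G T <= (x / T) `^ (- alpha) * G T.
  rewrite ler_wpM2r ?(ltW (Gpos T0))//.
  rewrite !powRN lef_pV2 ?posrE ?powR_gt0//; last by rewrite divr_gt0.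
  by apply: ge0_ler_powR; rewrite ?nnegrE ?(ltW C0)// ?ler_pdivrMr// divr_ge0 ?ltW.
lra.
Qed.

(** The bound of [potter] for 1/G. The gap between 2^(-alpha) and 2^(-beta) is the tolerance at
    ratio 2, which is why [beta] has to exceed [alpha]. *)
Lemma gauge_potter beta : alpha < beta -> exists X C, [/\ 0 < X, 0 < C &
  forall T x, X <= x -> x <= T -> G x <= C * (T / x) `^ beta * G T].
Proof.
move=> ab; have s0 : 0 < 2^-1 :> R by [].
have t0 : 0 < 2 :> R by [].
have gap : 0 < 2 `^ (- alpha) - 2 `^ (- beta) :> R.
  by rewrite subr_gt0 /powR (negbTE (_ : 2 != 0 :> R))// ltr_expR ltr_pM2r ?ln_gt0 ?ltr1n//; lra.
have [X1 [X10 h1]] := hG t0 t0 gap.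
have [X2 [B [X20 B0 h2]]] := gauge_le s0 t0.
pose X := X1 + X2; pose I t := (G t)^-1.
have h t : X <= t -> 0 < t by rewrite /X; lra.
exists X, (B * 2 `^ `|beta|); split; [by rewrite addr_gt0|by rewrite mulr_gt0 ?powR_gt0|].
move=> T x Xx xT.
have := @potter R I beta X B (addr_gt0 X10 X20) (ltW B0) _ _ _ x T Xx xT.
have x0 := h _ Xx; have T0 : 0 < T by lra.
rewrite /I => H.
have : (G T)^-1 <= B * 2 `^ `|beta| * (T / x) `^ beta * (G x)^-1.
  apply: H.
  - by move=> t /h t0'; rewrite invr_ge0 (ltW (Gpos t0')).
  - move=> t v Xt v1 v2; have tp := h _ Xt; have v0 : 0 < v by lra.
    have vt : 0 < v * t by rewrite mulr_gt0.
    rewrite ler_pdivlMr ?Gpos// mulrC ler_pdivrMr ?Gpos//.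
    have q1 : t <= v * t by rewrite -[leLHS]mul1r ler_wpM2r// ltW.
    have q2 : v * t <= 2 * t by rewrite ler_wpM2r// ltW.
    by apply: h2; rewrite /X in Xt; lra.
  - move=> t Xt; have tp := h _ Xt; have tt : 0 < 2 * t by lra.
    rewrite ler_pdivlMr ?Gpos// mulrC ler_pdivrMr ?Gpos//.
    have Xt1 : X1 <= t by rewrite /X in Xt; lra.
    have := h1 t (2 * t) Xt1 (lexx _) (lexx _).
    rewrite mulfK ?lt0r_neq0// ler_norml => /andP[k _].
    have k' : 2 `^ (- beta) * G t <= G (2 * t) by move: k; rewrite mulrBl; lra.
    rewrite -ler_pdivrMl ?powR_gt0// -powRN//.
move=> H'; have := H'; rewrite ler_pdivlMr ?Gpos// mulrC ler_pdivrMr ?Gpos//.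
Qed.

End gauge.

(** * Regularly varying kernels *)

Section trigonometric_steps.
Context {R : realType} {d : nat}.

(* Frequencies in Z^d make [g] a function on the torus. *)
Definition trig_poly (g : 'rV[R]_d -> R) : Prop :=
  exists t : seq (R * 'rV[R]_d), [/\ forall l, csum t l = g l,
    forall l, ssum t l = 0 & supp_in t (grid 1)].

Lemma trig_poly_cst c : trig_poly (fun=> c).
Proof.
exists [:: (c, 0)]; split => [l|l|a].
- by rewrite /csum big_seq1 /= dotpC dotp0l mulr0 cos0 mulr1.
- by rewrite /ssum big_seq1 /= dotpC dotp0l mulr0 sin0 mulr0.
- by rewrite inE => /eqP -> /=; exact: grid0.
Qed.

Lemma trig_polyD f g : trig_poly f -> trig_poly g -> trig_poly (fun l => f l + g l).
Proof.
move=> [s [sf s0 sg]] [t [tf t0 tg]]; exists (s ++ t); split => [l|l|a].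
- by rewrite /csum big_cat /= -/(csum s l) -/(csum t l) sf tf.
- by rewrite /ssum big_cat /= -/(ssum s l) -/(ssum t l) s0 t0 addr0.
- by rewrite mem_cat => /orP[/sg|/tg].
Qed.

Lemma trig_polyM f g : trig_poly f -> trig_poly g -> trig_poly (fun l => f l * g l).
Proof.
move=> [s [sf s0 sg]] [t [tf t0 tg]]; exists (conv s t); split => [l|l|a].
- by rewrite csum_conv s0 mul0r subr0 sf tf.
- by rewrite ssum_conv s0 t0 mul0r mulr0 addr0.
- by move=> /allpairsP[[x y] /= [/sg xs /tg yt ->]]; exact: gridD.
Qed.

Lemma trig_polyX f n : trig_poly f -> trig_poly (fun l => f l ^+ n).
Proof.
move=> hf; elim: n => [|n ih]; first exact: trig_poly_cst.
by under eq_fun do rewrite exprS; exact: trig_polyM.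
Qed.

Lemma trig_polyB f g : trig_poly f -> trig_poly g -> trig_poly (fun l => f l - g l).
Proof.
move=> hf hg; under eq_fun do rewrite -mulN1r.
by apply: trig_polyD => //; apply: trig_polyM => //; exact: trig_poly_cst.
Qed.

Lemma trig_poly_sum (I : Type) (r : seq I) (f : I -> 'rV[R]_d -> R) :
  (forall i, trig_poly (f i)) -> trig_poly (fun l => \sum_(i <- r) f i l).
Proof.
move=> hf; elim: r => [|i r ih].
  by under eq_fun do rewrite big_nil; exact: trig_poly_cst.
by under eq_fun do rewrite big_cons; exact: trig_polyD.
Qed.

Lemma dotp_delta (l : 'rV[R]_d) i : dotp l (delta_mx 0 i) = l 0 i.
Proof.
rewrite /dotp (bigD1 i)//= mxE !eqxx mulr1 big1 ?addr0// => j ji.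
by rewrite mxE (negbTE ji) andbF mulr0.
Qed.

Lemma trig_poly_cos i : trig_poly (fun l => cos (2 * pi * l 0 i)).
Proof.
exists [:: (2^-1, delta_mx 0 i); (2^-1, - delta_mx 0 i)]; split => [l|l|a].
- rewrite /csum big_cons big_seq1 /= dotpNr dotp_delta mulrN cosN; lra.
- rewrite /ssum big_cons big_seq1 /= dotpNr dotp_delta mulrN sinN; lra.
- rewrite !inE => /orP[] /eqP -> /= j.
    by exists ((j == i)%:Z); rewrite mxE eqxx /= mul1r; case: (j == i).
  by exists (- (j == i)%:Z); rewrite !mxE eqxx /= mul1r; case: (j == i); rewrite ?mulrN1z ?oppr0.
Qed.

(** A trigonometric polynomial in disguise, since 2 sin^2 is 1 minus the cosine of the double angle.
    In positive dimension it vanishes exactly on Z^d and behaves like (pi^2 / d) |l|^2 at 0, so its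
    small sublevel sets are nearly Euclidean balls modulo Z^d. *)
Definition defect (l : 'rV[R]_d) : R := d%:R^-1 * \sum_i sin (pi * l 0 i) ^+ 2.

Lemma trig_poly_step n M : trig_poly (fun l => 1 - (1 - (1 - defect l) ^+ n) ^+ M).
Proof.
have h : trig_poly defect.
  apply: trig_polyM; first exact: trig_poly_cst.
  apply: trig_poly_sum => i.
  have -> : (fun l : 'rV[R]_d => sin (pi * l 0 i) ^+ 2) =
      (fun l => 2^-1 * (1 - cos (2 * pi * l 0 i))).
    apply/funext => l; have -> : 2 * pi * l 0 i = pi * l 0 i + pi * l 0 i by ring.
    by rewrite cosD -!expr2 cos2sin2; field.
  apply: trig_polyM; first exact: trig_poly_cst.
  by apply: trig_polyB; [exact: trig_poly_cst|exact: trig_poly_cos].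
have cst := trig_poly_cst.
apply: trig_polyB; first exact: cst.
apply: trig_polyX; apply: trig_polyB; first exact: cst.
by apply: trig_polyX; exact: trig_polyB (cst 1) h.
Qed.

Hypothesis d0 : (0 < d)%N.
Let dR : 0 < d%:R :> R. Proof. by rewrite ltr0n. Qed.

Lemma defect_ge0 l : 0 <= defect l.
Proof. by rewrite mulr_ge0 ?invr_ge0 ?(ltW dR)// sumr_ge0// => i _; rewrite sqr_ge0. Qed.

Lemma defect_le1 l : defect l <= 1.
Proof.
rewrite /defect ler_pdivrMl// mulr1.
apply: (@le_trans _ _ (\sum_(i < d) 1)); last by rewrite sumr_const card_ord.
by apply: ler_sum => i _; rewrite sin2cos2 lerBlDr lerDl sqr_ge0.
Qed.

Lemma defect_le (l : 'rV[R]_d) : defect l <= d%:R^-1 * (pi * enorm l) ^+ 2.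
Proof.
rewrite ler_wpM2l ?invr_ge0 ?(ltW dR)// exprMn enorm_sqr /dotp mulr_sumr.
apply: ler_sum => i _; rewrite -expr2 -exprMn.
rewrite -[leLHS]real_normK ?num_real// -[leRHS]real_normK ?num_real//.
by rewrite ler_pXn2r ?nnegrE// abs_sin_le.
Qed.

Lemma sin_ge_cubic (x : R) : 0 <= x -> x * (1 - x ^+ 2 / 2) <= sin x.
Proof.
rewrite le_eqVlt => /predU1P[<-|x0]; first by rewrite sin0 mul0r.
have [c cx h] : exists2 c, c \in `]0, x[ & sin x - sin 0 = cos c * (x - 0).
  by apply: MVT => //; exact/continuous_subspaceT/continuous_sin.
move: cx; rewrite in_itv /= => /andP[c0 cx].
move: h; rewrite sin0 !subr0 => ->; rewrite mulrC ler_wpM2r ?(ltW x0)//.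
have : cos c = 1 - 2 * sin (c / 2) ^+ 2.
  have {1}-> : c = c / 2 + c / 2 by lra.
  by rewrite cosD -!expr2 cos2sin2; ring.
move=> ->; have : sin (c / 2) ^+ 2 <= (x / 2) ^+ 2.
  rewrite -[leLHS]real_normK ?num_real// ler_pXn2r ?nnegrE ?divr_ge0 ?(ltW x0)//.
  by rewrite (le_trans (abs_sin_le _))// gtr0_norm ?divr_gt0//; lra.
by rewrite expr_div_n; lra.
Qed.

Lemma sin_mono (x y : R) : 0 <= x -> x <= y -> y <= pi / 2 -> sin x <= sin y.
Proof.
move=> x0 xy yp; have p := pi_gt0 R.
by rewrite le_eqVlt; move: xy; rewrite le_eqVlt => /predU1P[->|xy];
  [rewrite eqxx|rewrite ltr_sin ?xy ?orbT// in_itv /=; apply/andP; split; lra].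
Qed.

(** Shrinking [l] to norm [tau] decreases every |l_i|, hence every sine on [0, pi/2]; at norm [tau]
    the cubic bound gives the factor 1 - (pi tau)^2 / 2. *)
Lemma defect_ge (l : 'rV[R]_d) tau : (forall i, `|l 0 i| <= 2^-1) ->
  0 < tau -> tau <= enorm l -> (pi * tau) ^+ 2 <= 1 ->
  d%:R^-1 * (pi * tau * (1 - (pi * tau) ^+ 2 / 2)) ^+ 2 <= defect l.
Proof.
move=> hl t0 tl pt1; have p := pi_gt0 R.
have l0 : 0 < enorm l by lra.
rewrite ler_wpM2l ?invr_ge0 ?(ltW dR)//.
set z := 1 - _; have z0 : 0 <= z by rewrite /z; lra.
have -> : (pi * tau * z) ^+ 2 = \sum_i (pi * (tau / enorm l) * `|l 0 i| * z) ^+ 2.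
  have -> : (pi * tau * z) ^+ 2 = (pi * (tau / enorm l) * z) ^+ 2 * enorm l ^+ 2.
    by rewrite -exprMn; congr (_ ^+ _); field; rewrite lt0r_neq0.
  rewrite enorm_sqr /dotp mulr_sumr; apply: eq_bigr => i _.
  by rewrite -expr2 -[l 0 i ^+ 2]real_normK ?num_real// -exprMn; congr (_ ^+ _); ring.
apply: ler_sum => i _; rewrite -[leRHS]real_normK ?num_real//.
set x := tau / enorm l * `|l 0 i|.
have r1 : tau / enorm l <= 1 by rewrite ler_pdivrMr// mul1r.
have r0 : 0 <= tau / enorm l by rewrite divr_ge0 ?ltW.
have x0 : 0 <= x by rewrite mulr_ge0.
have xl : x <= `|l 0 i| by rewrite ler_piMl.
have xt : x <= tau.
  rewrite /x mulrAC ler_pdivrMr// ler_wpM2l ?(ltW t0)//; exact: coord_le_enorm.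
have -> : pi * (tau / enorm l) * `|l 0 i| * z = pi * x * z by rewrite /x; ring.
have px0 : 0 <= pi * x := mulr_ge0 (ltW p) x0.
apply: lerXn2r; [by rewrite nnegrE; exact: mulr_ge0|by rewrite nnegrE|].
have sE : `|sin (pi * l 0 i)| = sin (pi * `|l 0 i|).
  have [k|k] := leP 0 (l 0 i).
    have k2 : 0 <= sin (pi * l 0 i).
      apply: sin_ge0_pi; rewrite mulr_ge0 ?(ltW p)//=.
      have := hl i; rewrite ger0_norm// => ki.
      by apply: le_trans (ler_wpM2l (ltW p) ki) _; lra.
    by rewrite !ger0_norm.
  have k2 : 0 <= sin (pi * - l 0 i).
    apply: sin_ge0_pi; rewrite mulr_ge0 ?(ltW p) ?oppr_ge0 ?(ltW k)//=.
    have := hl i; rewrite ltr0_norm// => ki.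
    by apply: le_trans (ler_wpM2l (ltW p) ki) _; lra.
  by rewrite (ltr0_norm k) -[X in `|X|]opprK normrN -sinN -mulrN ger0_norm.
rewrite sE; apply: (@le_trans _ _ (sin (pi * x))); last first.
  apply: sin_mono => //.
    by rewrite ler_wpM2l ?(ltW p).
  by rewrite ler_wpM2l ?(ltW p)// hl.
apply: le_trans (sin_ge_cubic px0).
rewrite /z; apply: ler_wpM2l => //.
have : (pi * x) ^+ 2 <= (pi * tau) ^+ 2.
  have k : pi * x <= pi * tau by rewrite ler_wpM2l ?(ltW p).
  have k' : 0 <= pi * x := mulr_ge0 (ltW p) x0.
  by rewrite !expr2; exact: ler_pM.
lra.
Qed.

(* [1 - (1 - x ^+ n) ^+ M] is almost a step function on [0, 1]. *)
Lemma step_exponents (x0 x1 e : R) : 0 <= x0 -> x0 < x1 -> x1 <= 1 ->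
  0 < e -> e <= 1 -> exists n M : nat, forall x, 0 <= x -> x <= 1 ->
  [/\ 0 <= 1 - (1 - x ^+ n) ^+ M, 1 - (1 - x ^+ n) ^+ M <= 1,
      x <= x0 -> 1 - (1 - x ^+ n) ^+ M <= e &
      x1 <= x -> 1 - e <= 1 - (1 - x ^+ n) ^+ M].
Proof.
move=> x00 x01 x11 e0 e1; have x1p : 0 < x1 by lra.
have bern (y : R) (M : nat) : 0 <= y -> y <= 1 -> 1 - M%:R * y <= (1 - y) ^+ M.
  move=> y0 y1; elim: M => [|M ih]; first by rewrite mul0r subr0 expr0.
  rewrite exprS; have y1' : 0 <= 1 - y by lra.
  apply: le_trans (ler_wpM2l y1' ih); rewrite -[X in X%:R]addn1 natrD.
  have : 0 <= M%:R * y ^+ 2 by rewrite mulr_ge0 ?sqr_ge0.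
  by rewrite expr2 mulrA; lra.
have bern2 (y : R) (M : nat) : 0 <= y -> y <= 1 -> (1 - y) ^+ M * (1 + M%:R * y) <= 1.
  move=> y0 y1; elim: M => [|M ih]; first by rewrite mul0r addr0 expr0 mulr1.
  apply: le_trans ih; rewrite exprS.
  have -> : (1 - y) * (1 - y) ^+ M * (1 + M.+1%:R * y) =
    (1 - y) ^+ M * ((1 - y) * (1 + M.+1%:R * y)) by ring.
  apply: ler_wpM2l; first by rewrite exprn_ge0//; lra.
  rewrite -[X in X%:R]addn1 natrD.
  have : 0 <= M%:R * y ^+ 2 by rewrite mulr_ge0 ?sqr_ge0.
  have : 0 <= y ^+ 2 by exact: sqr_ge0.
  by rewrite !expr2 !mulrA; lra.
have [n hn] : exists n : nat, (x0 / x1) ^+ n <= e ^+ 2 / 2.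
  have q0 : 0 <= x0 / x1 by rewrite divr_ge0 ?(ltW x1p).
  have q1 : `|x0 / x1| < 1 by rewrite ger0_norm// ltr_pdivrMr// mul1r.
  have e2 : 0 < e ^+ 2 / 2 by rewrite divr_gt0 ?exprn_gt0.
  have /cvgrPdist_le/(_ _ e2)[n _ hn] := cvg_expr q1.
  exists n; have := hn n (leqnn n); rewrite sub0r normrN /= => h.
  exact: le_trans (ler_norm _) h.
have xn : 0 < x1 ^+ n by rewrite exprn_gt0.
(* [M] lies between w and 2w. Then M x1^n >= 1/e makes the function close to 1 above [x1], and M
   x0^n <= (2/e) (x0/x1)^n <= e makes it small below [x0], both by inequalities of Bernoulli
   type. *)
pose w := (e * x1 ^+ n)^-1; have w0 : 0 < w by rewrite invr_gt0 mulr_gt0.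
pose M := (Num.truncn w).+1.
have Mw : w <= M%:R by apply/ltW; exact: truncnS_gt.
have wM : M%:R <= 2 * w.
  have h1 : (Num.truncn w)%:R <= w by have /andP[] := truncn_itv (ltW w0).
  have h2 : 1 <= w.
    rewrite /w invf_ge1 ?mulr_gt0// mulr_ile1 ?(ltW e0) ?(ltW xn)// exprn_ile1 ?(ltW x1p)//.
  by rewrite -[X in X%:R]addn1 natrD; lra.
exists n, M => x xp xle1.
have y0 : 0 <= x ^+ n by rewrite exprn_ge0.
have y1 : x ^+ n <= 1 by rewrite exprn_ile1.
have z0 : 0 <= (1 - x ^+ n) ^+ M by rewrite exprn_ge0//; lra.
split.
- by rewrite subr_ge0 exprn_ile1//; lra.
- by rewrite lerBlDr lerDl.
- move=> xx0; have := bern _ M y0 y1.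
  have : x ^+ n <= x0 ^+ n by apply: lerXn2r; rewrite ?nnegrE.
  have k : M%:R * x0 ^+ n <= e.
    apply: (@le_trans _ _ (2 * w * ((x0 / x1) ^+ n * x1 ^+ n))).
      by rewrite expr_div_n divfK ?lt0r_neq0// ler_wpM2r ?exprn_ge0.
    apply: (@le_trans _ _ (2 * w * (e ^+ 2 / 2 * x1 ^+ n))).
      by rewrite ler_wpM2l ?mulr_ge0 ?(ltW w0)// ler_wpM2r ?(ltW xn).
    rewrite /w le_eqVlt; apply/orP; left; apply/eqP; field; rewrite !lt0r_neq0//.
  move=> /(ler_wpM2l (ler0n R M)); lra.
- move=> x1x; have := bern2 _ M y0 y1.
  have x1n : x1 ^+ n <= x ^+ n.
    by apply: lerXn2r; rewrite ?nnegrE ?(ltW x1p).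
  have k : e^-1 <= 1 + M%:R * x ^+ n.
    apply: (@le_trans _ _ (w * x1 ^+ n)).
      by rewrite /w invfM mulfVK ?lt0r_neq0.
    apply: (@le_trans _ _ (M%:R * x ^+ n)); last by rewrite lerDr.
    by rewrite ler_pM ?(ltW w0) ?(ltW xn).
  have := ler_wpM2l z0 k; move=> /le_trans h /h.
  by rewrite ler_pdivrMr// mul1r; lra.
Qed.

Lemma csum_push_scale (s : seq (R * 'rV[R]_d)) (N : R) (l : 'rV[R]_d) :
  csum (push (fun x => N *: x) s) l = csum s (N *: l).
Proof. by rewrite /csum big_map; apply: eq_bigr => a _ /=; rewrite dotpZr dotpZl. Qed.

Lemma ssum_push_scale (s : seq (R * 'rV[R]_d)) (N : R) (l : 'rV[R]_d) :
  ssum (push (fun x => N *: x) s) l = ssum s (N *: l).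
Proof. by rewrite /ssum big_map; apply: eq_bigr => a _ /=; rewrite dotpZr dotpZl. Qed.

Lemma supp_radius (s : seq (R * 'rV[R]_d)) :
  exists2 J, 0 < J & forall a, a \in s -> enorm a.2 <= J.
Proof.
elim: s => [|x s [J J0 hJ]]; first by exists 1.
exists (enorm x.2 + J); first by rewrite ltr_wpDl// enorm_ge0.
move=> a; rewrite inE => /predU1P[->|/hJ aJ]; first by rewrite lerDl ltW.
by rewrite (le_trans aJ)// lerDr enorm_ge0.
Qed.

(* A trigonometric polynomial that is almost the indicator of the ball of
   radius [th^2] on the torus. *)
Lemma ball_step (rho rho' th e : R) : 0 < rho -> rho < rho' -> 0 < th ->
  (pi * (rho' * th ^+ 2)) ^+ 2 <= 1 ->
  rho < rho' * (1 - (pi * (rho' * th ^+ 2)) ^+ 2 / 2) -> 0 < e -> e <= 1 ->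
  exists t : seq (R * 'rV[R]_d), [/\ forall l, ssum t l = 0, supp_in t (grid 1),
    forall l, 0 <= csum t l <= 1,
    forall l : 'rV[R]_d, enorm l <= rho * th ^+ 2 -> 1 - e <= csum t l &
    forall l : 'rV[R]_d, (forall i, `|l 0 i| <= 2^-1) -> rho' * th ^+ 2 <= enorm l ->
      csum t l <= e].
Proof.
move=> rho0 rr th0 p1 gap e0 e1; have p := pi_gt0 R.
have rho'0 : 0 < rho' by lra.
have th2 : 0 < th ^+ 2 by rewrite exprn_gt0.
have di : 0 < d%:R^-1 :> R by rewrite invr_gt0 ltr0n.
set tau := rho' * th ^+ 2 in p1 gap *.
have tau0 : 0 < tau by rewrite mulr_gt0.
set z := 1 - _ / 2 in gap.
have z0 : 0 < z by rewrite -(pmulr_rgt0 _ rho'0) (lt_trans rho0).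
have a1 : 0 <= pi * (rho * th ^+ 2) := mulr_ge0 (ltW p) (mulr_ge0 (ltW rho0) (ltW th2)).
have a2 : 0 <= pi * tau * z := mulr_ge0 (mulr_ge0 (ltW p) (ltW tau0)) (ltW z0).
(* In the smaller ball the defect is at most [S1], off the larger one at least [S2]; [gap] separates
   the two values. *)
have [S1 S1E] : exists S, S = d%:R^-1 * (pi * (rho * th ^+ 2)) ^+ 2 by eexists.
have [S2 S2E] : exists S, S = d%:R^-1 * (pi * tau * z) ^+ 2 by eexists.
have S12 : S1 < S2.
  rewrite S1E S2E ltr_pM2l// ltr_pXn2r ?nnegrE//.
  by rewrite -mulrA ltr_pM2l// /tau mulrAC ltr_pM2r.
have S10 : 0 <= S1 by rewrite S1E mulr_ge0 ?sqr_ge0 ?(ltW di).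
have S21 : S2 <= 1.
  rewrite S2E -[leRHS]mulr1 ler_pM ?sqr_ge0 ?(ltW di)//.
    by rewrite invf_le1 ?ltr0n// ler1n.
  rewrite exprMn -[leRHS]mulr1 ler_pM ?sqr_ge0// exprn_ile1 ?(ltW z0)//.
  by rewrite /z lerBlDr lerDl divr_ge0 ?sqr_ge0.
have [x00 x01 x11] : [/\ 0 <= 1 - S2, 1 - S2 < 1 - S1 & 1 - S1 <= 1] by split; lra.
have [n [M hq]] := step_exponents x00 x01 x11 e0 e1.
have [t [tc ts tg]] := trig_poly_step n M.
have D0 := defect_ge0; have D1 := defect_le1.
have P0 l : 0 <= 1 - defect l by rewrite subr_ge0.
have P1 l : 1 - defect l <= 1 by rewrite lerBlDr lerDl.
exists t; split => // [l|l lr|l li lr]; rewrite tc; have [q1 q2 q3 q4] := hq _ (P0 l) (P1 l).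
- by rewrite q1.
- apply: q4; rewrite lerD2l lerN2 S1E; apply: le_trans (defect_le l) _.
  rewrite ler_wpM2l ?(ltW di)//; apply: lerXn2r; rewrite ?nnegrE//; first by rewrite mulr_ge0 ?enorm_ge0 ?(ltW p).
  by rewrite ler_wpM2l ?(ltW p).
- by apply: q3; rewrite lerD2l lerN2 S2E; exact: defect_ge.
Qed.

End trigonometric_steps.

Lemma powR_continuity_pt (R : realType) (u a e : R) : 0 < u -> 0 < e ->
  exists2 g, 0 < g & forall r, 0 < r -> `|r - u| <= g -> `|r `^ a - u `^ a| <= e.
Proof.
move=> u0 e0; pose f (r : R) := expR (a * ln r).
have cf : f r @[r --> u] --> f u.
  apply: (@continuous_comp _ _ _ (fun r => a * ln r) (@expR R)); last exact: continuous_expR.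
  by apply: cvgM; [exact: cvg_cst|exact: continuous_ln].
have fE r : 0 < r -> f r = r `^ a by move=> r0; rewrite /powR gt_eqF.
move/cvgrPdist_le : cf => /(_ e e0)[g /= g0 hg].
exists (g / 2); first by rewrite divr_gt0.
move=> r r0 rg; rewrite -!fE// distrC; apply: hg; rewrite /= distrC.
by apply: le_lt_trans rg _; rewrite ltr_pdivrMr// ltr_pMr// ltr1n.
Qed.

(** * Sums of a singular weight against a mollifier *)

Section singular_weight.
Context {R : realType} {d : nat} (beta : R).
Hypothesis beta0 : 0 < beta.
Hypothesis betad : beta < d%:R.

(** Up to a constant and the factor G(T), a Potter majorant of the kernel at distances of order at
    most T; adding 1 to the norm bounds it near the origin. *)
Definition sing (T : R) (x : 'rV[R]_d) : R := (T / (enorm x + 1)) `^ beta.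

Lemma sing_ge0 T x : 0 <= sing T x. Proof. exact: powR_ge0. Qed.

Let e1 (x : 'rV[R]_d) : 0 < enorm x + 1.
Proof. by rewrite ltr_wpDl ?enorm_ge0. Qed.

Lemma sing_le (c T : R) (x y : 'rV[R]_d) : 0 < c -> 0 < T ->
  enorm x + 1 <= c * (enorm y + 1) -> sing T y <= c `^ beta * sing T x.
Proof.
move=> c0 T0 h; rewrite /sing -powRM ?(ltW c0) ?divr_ge0 ?(ltW T0) ?(ltW (e1 _))//.
apply: ge0_ler_powR; first exact: ltW.
- by rewrite nnegrE divr_ge0 ?(ltW T0) ?(ltW (e1 _)).
- by rewrite nnegrE mulr_ge0 ?(ltW c0) ?divr_ge0 ?(ltW T0) ?(ltW (e1 _)).
rewrite ler_pdivrMr//.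
have -> : c * (T / (enorm x + 1)) * (enorm y + 1) = T * (c * (enorm y + 1) / (enorm x + 1)).
  by ring.
by rewrite ler_peMr ?(ltW T0)// ler_pdivlMr// mul1r.
Qed.

Lemma sing_le_pow (rho T : R) (x : 'rV[R]_d) : 0 < rho -> 0 < T ->
  rho <= enorm x + 1 -> sing T x <= (T / rho) `^ beta.
Proof.
move=> r0 T0 h; apply: ge0_ler_powR; first exact: ltW.
- by rewrite nnegrE divr_ge0 ?(ltW T0) ?(ltW (e1 _)).
- by rewrite nnegrE divr_ge0 ?(ltW T0) ?(ltW r0).
by rewrite ler_wpM2l ?(ltW T0)// lef_pV2 ?posrE.
Qed.

Let gain : 0 < 1 - (2^-1 : R) `^ (d%:R - beta).
Proof.
have h : 0 < d%:R - beta by rewrite subr_gt0.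
have := @gt0_ltr_powR R _ h 2^-1 1; rewrite !nnegrE powR1 subr_gt0; apply => //.
by rewrite invf_lt1// ltr1n.
Qed.

(* Dyadic shells: the shell of radius [rho] contributes at most
   [(T / rho)^beta (rho / L)^d], a geometric series because [beta < d]. *)
Lemma singular_sum (Cm : R) : 0 < Cm -> exists2 K : R, 0 < K &
  forall (T L : R) (t : seq (R * 'rV[R]_d)), 0 < T -> 0 < L -> weighted_prob t ->
  (forall c r, 0 <= r -> smass t c r <= Cm * ((r + 1) / L) ^+ d) ->
  forall c rho, 1 <= rho ->
  \sum_(b <- t) b.1 * ((enorm (c + b.2) + 1 <= rho)%R%:R * sing T (c + b.2)) <=
  K * (T / L) ^+ d * (rho / T) `^ (d%:R - beta).
Proof.
move=> Cm0; have := gain; set q := (2^-1 : R) `^ (d%:R - beta) => gain'.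
have p2 : 0 < (2 : R) `^ beta by rewrite powR_gt0.
(* Solves K = 2^beta Cm + q K: one shell costs 2^beta Cm, and halving the radius multiplies the
   bound by q. *)
pose K := 2 `^ beta * Cm / (1 - q).
have K0 : 0 < K by rewrite divr_gt0 ?mulr_gt0.
exists K => // T L t T0 L0 pt hm c rho rho1.
have t0 := proj1 pt.
pose f r := \sum_(b <- t) b.1 * ((enorm (c + b.2) + 1 <= r)%R%:R * sing T (c + b.2)).
have f0 r : r < 1 -> f r = 0.
  move=> r1; rewrite /f big1// => b _.
  rewrite leNgt (_ : r < _) ?mul0r ?mulr0//=.
  by apply: lt_le_trans r1 _; rewrite lerDr enorm_ge0.
have TL : 0 <= K * (T / L) ^+ d by rewrite mulr_ge0 ?(ltW K0)// exprn_ge0// divr_ge0 ?ltW.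
have step r : 1 <= r -> f r <= f (r / 2) +
    (1 - q) * (K * (T / L) ^+ d * (r / T) `^ (d%:R - beta)).
  move=> r1; have r0 : 0 < r by lra.
  have r20 : 0 < r / 2 by lra.
  have rT : 0 < r / T by rewrite divr_gt0.
  apply: (@le_trans _ _ (f (r / 2) + (T / (r / 2)) `^ beta * smass t c (r - 1))).
    rewrite /f /smass mulr_sumr -big_split /= big_seq [leRHS]big_seq.
    apply: ler_sum => b /t0 b0; rewrite lerBrDr.
    have [k|k] := leP (enorm (c + b.2) + 1) (r / 2).
      have -> : enorm (c + b.2) + 1 <= r by lra.
      by rewrite lerDl !mulr_ge0 ?powR_ge0.
    rewrite mul0r mulr0 add0r [leRHS]mulrCA; apply: ler_wpM2l => //.
    have [_|_] := leP (enorm (c + b.2) + 1) r; last by rewrite mul0r mulr0.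
    by rewrite mul1r mulr1; apply: sing_le_pow => //; exact: ltW.
  rewrite lerD2l; apply: le_trans (ler_wpM2l _ (hm c (r - 1) _)) _.
  - exact: powR_ge0.
  - by lra.
  rewrite subrK /K.
  have -> : (1 - q) * (2 `^ beta * Cm / (1 - q) * (T / L) ^+ d * (r / T) `^ (d%:R - beta)) =
    2 `^ beta * Cm * (T / L) ^+ d * (r / T) `^ (d%:R - beta).
    by field; rewrite lt0r_neq0.
  rewrite powRB; last by apply/implyP => _; rewrite lt0r_neq0.
  rewrite powR_mulrn ?(ltW rT)//.
  have -> : T / (r / 2) = 2 * (r / T)^-1 by field; rewrite !lt0r_neq0.
  rewrite powRM ?invr_ge0 ?(ltW rT)//.
  have -> : (r / T)^-1 `^ beta = ((r / T) `^ beta)^-1.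
    by rewrite powR_inv_base// powRN.
  rewrite le_eqVlt; apply/orP; left; apply/eqP.
  rewrite !expr_div_n; field.
  by rewrite !lt0r_neq0 ?exprn_gt0 ?powR_gt0.
have half r : 0 < r -> (r / 2 / T) `^ (d%:R - beta) = q * (r / T) `^ (d%:R - beta).
  move=> r0; rewrite /q -powRM ?divr_ge0 ?(ltW r0) ?(ltW T0)//; congr (_ `^ _).
  by field; rewrite lt0r_neq0.
suff main n r : r < 2 ^+ n -> 0 < r -> f r <= K * (T / L) ^+ d * (r / T) `^ (d%:R - beta).
  have [n hn] : exists n : nat, rho < 2 ^+ n.
    exists (Num.bound rho); apply: lt_trans (archi_boundP _) _; first lra.
    by rewrite -natrX ltr_nat ltn_expl.
  by apply: (main n) => //; lra.
elim: n r => [|n ih] r rn r0.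
  by rewrite f0// mulr_ge0// powR_ge0.
have [r1|r1] := leP 1 r; last by rewrite f0// mulr_ge0// powR_ge0.
apply: le_trans (step r r1) _.
have r20 : 0 < r / 2 by lra.
have r2n : r / 2 < 2 ^+ n by rewrite ltr_pdivrMr// mulrC -exprS.
have := ih _ r2n r20; rewrite half// => h.
apply: le_trans (lerD h (lexx _)) _.
rewrite le_eqVlt; apply/orP; left; apply/eqP; ring.
Qed.

End singular_weight.

(** * Energies and ball masses for a regularly varying kernel *)

Section kernel_bounds.
Context {R : realType} {d : nat} (D : site_type) (alpha beta : R).
Context (mu : {finite_measure set (Borel R d) -> \bar R}) (G : R -> R).
Hypothesis alpha0 : 0 <= alpha.
Hypothesis alphabeta : alpha < beta.
Hypothesis betad : beta < d%:R.
Hypothesis Gpos : forall t, 0 < t -> 0 < G t.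
Hypothesis hG : gauge alpha G.

Local Notation F := (coskernel mu).

Definition kernel_gauge : Prop := forall e, 0 < e -> exists X, 0 < X /\
  forall x, sites D x -> X <= enorm x -> `|F x - G (enorm x)| <= e * G (enorm x).

Hypothesis hF : kernel_gauge.

Let beta0 : 0 < beta. Proof. exact: le_lt_trans alphabeta. Qed.

Let potterG := gauge_potter alpha0 Gpos hG alphabeta.

(** Beyond [X] the kernel is at most 2 G(|x|), to which Potter's bound applies. Below [X] it is at
    most the total mass, and Potter's bound at [X] keeps G(T) (T/X)^beta away from 0. *)
Lemma kernel_bound C1 : 0 < C1 -> exists X C, [/\ 0 < X, 0 < C &
  forall T x, X <= T -> sites D x -> enorm x <= C1 * T ->
  `|F x| <= C * G T * sing beta T x].
Proof.
move=> C10; have [X1 [B [X10 B0 h1]]] := potterG.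
have [X2 [X20 h2]] := hF ltr01.
pose c := C1 + 1; have c0 : 0 < c by rewrite /c; lra.
have [X3 [B2 [X30 B20 h3]]] := gauge_le alpha0 Gpos hG c0 c0.
pose X := X1 + X2 + X3 + 1.
have X0 : 0 < X by rewrite /X; lra.
have [K1 K10 K1E] : exists2 K, 0 < K & K = 2 * B * B2 * (2 * c) `^ beta.
  by eexists; last reflexivity; rewrite !mulr_gt0 ?powR_gt0 ?mulr_gt0.
have [K2 K20 K2E] : exists2 K, 0 <= K &
    K = fine (mu setT) / G X * B * ((X + 1) / X) `^ beta.
  eexists; last reflexivity.
  by rewrite !mulr_ge0 ?powR_ge0 ?fine_mu_ge0 ?invr_ge0 ?(ltW B0)// ltW// Gpos.
exists X, (K1 + K2); split => //; first lra.
move=> T x XT sx xC; have T0 : 0 < T by lra.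
have GT := Gpos T0.
have s0 := sing_ge0 beta T x.
have [Xx|xX] := leP X (enorm x).
  have x0 : 0 < enorm x by lra.
  have X2x : X2 <= enorm x by rewrite /X in Xx; lra.
  have X1x : X1 <= enorm x by rewrite /X in Xx; lra.
  have Fx : `|F x| <= 2 * G (enorm x).
    have := h2 x sx X2x; rewrite mul1r => h.
    rewrite -(subrK (G (enorm x)) (F x)) (le_trans (ler_normD _ _))//.
    by rewrite (ger0_norm (ltW (Gpos x0))); lra.
  apply: (@le_trans _ _ (K1 * G T * sing beta T x)); last first.
    by rewrite !ler_wpM2r ?(ltW GT)// lerDl.
  apply: le_trans Fx _.
  have xcT : enorm x <= c * T by rewrite /c; lra.
  have P := h1 (c * T) (enorm x) X1x xcT.
  have X3T : X3 <= T by rewrite /X in XT; lra.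
  have P2 := h3 T (c * T) X3T (lexx _) (lexx _).
  have P3 : (c * T / enorm x) `^ beta <= (2 * c) `^ beta * sing beta T x.
    rewrite /sing -powRM ?divr_ge0 ?mulr_ge0 ?(ltW c0) ?(ltW T0) ?addr_ge0 ?(ltW x0)//.
    apply: ge0_ler_powR; first exact: ltW.
    - by rewrite nnegrE divr_ge0 ?mulr_ge0 ?(ltW c0) ?(ltW T0) ?(ltW x0).
    - by rewrite nnegrE mulr_ge0// ?divr_ge0 ?mulr_ge0 ?(ltW c0) ?(ltW T0) ?addr_ge0 ?(ltW x0).
    have xp : 0 < enorm x + 1 by lra.
    rewrite ler_pdivrMr// mulrA mulrAC ler_pdivlMr//.
    have : c * T * (enorm x + 1) <= c * T * (2 * enorm x).
      rewrite ler_wpM2l ?mulr_ge0 ?(ltW c0) ?(ltW T0)//; rewrite /X in Xx; lra.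
    lra.
  have Q : 0 <= (c * T / enorm x) `^ beta by exact: powR_ge0.
  apply: (@le_trans _ _ (2 * (B * ((2 * c) `^ beta * sing beta T x) * (B2 * G T)))).
    rewrite ler_wpM2l//; apply: le_trans P _.
    apply: ler_pM => //.
    - by rewrite mulr_ge0 ?(ltW B0).
    - by rewrite (ltW (Gpos _))// mulr_gt0.
    - by rewrite ler_wpM2l ?(ltW B0).
  rewrite K1E le_eqVlt; apply/orP; left; apply/eqP; ring.
apply: (@le_trans _ _ (K2 * G T * sing beta T x)); last first.
  by rewrite !ler_wpM2r ?(ltW GT)// lerDr ltW.
apply: le_trans (coskernel_bound _ _) _.
have X1X : X1 <= X by rewrite /X; lra.
have P := h1 T X X1X XT.
have P3 : (T / X) `^ beta <= ((X + 1) / X) `^ beta * sing beta T x.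
  have xp : 0 < enorm x + 1 by rewrite ltr_wpDl ?enorm_ge0.
  have xx : 0 < X + 1 by lra.
  rewrite /sing -powRM ?divr_ge0 ?(ltW xx) ?(ltW X0) ?(ltW T0) ?(ltW xp)//.
  apply: ge0_ler_powR; first exact: ltW.
  - by rewrite nnegrE divr_ge0 ?(ltW T0) ?(ltW X0).
  - by rewrite nnegrE mulr_ge0 ?divr_ge0 ?(ltW xx) ?(ltW X0) ?(ltW T0) ?(ltW xp).
  have -> : (X + 1) / X * (T / (enorm x + 1)) = T / X * ((X + 1) / (enorm x + 1)) by ring.
  rewrite ler_peMr ?divr_ge0 ?(ltW T0) ?(ltW X0)// ler_pdivlMr// mul1r lerD2r; exact: ltW.
have GX := Gpos X0.
have {}P : fine (mu setT) / G X * G X <= fine (mu setT) / G X *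
   (B * (((X + 1) / X) `^ beta * sing beta T x) * G T).
  rewrite ler_wpM2l ?divr_ge0 ?fine_mu_ge0 ?(ltW GX)//; apply: le_trans P _.
  by rewrite ler_wpM2r ?(ltW GT)// ler_wpM2l ?(ltW B0).
rewrite divfK ?lt0r_neq0// in P; apply: le_trans P _.
rewrite K2E le_eqVlt; apply/orP; left; apply/eqP; ring.
Qed.

Local Ltac slra :=
  clear -alpha0 alphabeta betad Gpos hG hF beta0 potterG; intros; lra.

(** Here [y] is [u *: x] up to rounding. At distances above about s T the two values are compared
    through [G]; closer, each is merely bounded by the singular weight. [C] is fixed before [s] and
    [e], so that [s] can later be shrunk against it. *)
Lemma kernel_compare u C1 C3 : 0 < u -> 0 < C1 -> 0 <= C3 -> exists2 C, 0 < C &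
  forall s e, 0 < s -> 0 < e -> exists X, 0 < X /\
  forall T x y, X <= T -> sites D x -> sites D y -> enorm x <= C1 * T ->
  enorm (y - u *: x) <= C3 ->
  `|F y - u `^ (- alpha) * F x| <=
    G T * (e + C * ((enorm x + 1 <= s * T)%R%:R * sing beta T x)).
Proof.
move=> u0 C10 C30.
have ua : 0 < u `^ (- alpha) by rewrite powR_gt0.
have uC : 0 <= u * C1 by rewrite mulr_ge0 ?ltW.
pose C2 := C1 + u * C1 + C3; have C20 : 0 < C2 by rewrite /C2; lra.
have [X1 [Cb [X10 Cb0 hb]]] := kernel_bound C20.
pose c := (1 + C3) / u + 1.
have c0 : 0 < c by rewrite ltr_wpDl// divr_ge0 ?(ltW u0)//; lra.
have cb0 : 0 < c `^ beta by rewrite powR_gt0.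
exists (Cb * (c `^ beta + u `^ (- alpha))); first by rewrite mulr_gt0 ?addr_gt0.
set C := Cb * _ => s e s0 e0.
have s20 : 0 < s / 2 by rewrite divr_gt0.
have [X2 [Bs [X20 Bs0 hs]]] := gauge_le alpha0 Gpos hG s20 C10.
(* The four differences cost eps (u^(-alpha) + 2), eps, eps and eps u^(-alpha), times G(|x|) <= Bs
   G(T). *)
have [eps [eps0 eps1 epsE]] : exists eps, [/\ 0 < eps, eps <= 1 &
    eps * (2 * u `^ (- alpha) + 4) * Bs <= e].
  have k0 : 0 < (2 * u `^ (- alpha) + 4) * Bs by rewrite mulr_gt0//; lra.
  exists (Num.min 1 (e / ((2 * u `^ (- alpha) + 4) * Bs))); split.
  - by rewrite lt_min ltr01 divr_gt0.
  - by rewrite ge_min lexx.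
  - by rewrite -mulrA -ler_pdivlMr// ge_min lexx orbT.
have [X3 [X30 hk]] := hF eps0.
have u20 : 0 < u / 2 by rewrite divr_gt0.
have uu0 : 0 < 2 * u by rewrite mulr_gt0.
have [X4 [X40 hg]] := hG u20 uu0 eps0.
have [g g0 hc] := powR_continuity_pt (- alpha) u0 eps0.
pose Y := X3 + X3 / (u / 2) + X4 + C3 / (u / 2) + C3 / g.
have [q1 q2 q3] : [/\ 0 < X3 / (u / 2), 0 <= C3 / (u / 2) & 0 <= C3 / g].
  by rewrite divr_gt0// !divr_ge0// ltW.
have Y0 : 0 < Y by move: X30 X40 q1 q2 q3; rewrite /Y; slra.
exists (X1 + X2 + 1 + 2 / s + Y / (s / 2)).
have [q4 q5] : 0 < 2 / s /\ 0 < Y / (s / 2) by rewrite !divr_gt0.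
split; first by move: X10 X20 q4 q5; slra.
move=> T x y XT sx sy xC xy.
have [T0 X1T T1 Ts TY] : [/\ 0 < T, X1 <= T, 1 <= T, 2 / s <= T & Y / (s / 2) <= T].
  by split; move: XT X10 X20 q4 q5; slra.
have GT := Gpos T0.
have [xs|xs] := leP (enorm x + 1) (s * T).
  rewrite mul1r.
  have yC : enorm y <= C2 * T.
    rewrite -(subrK (u *: x) y) (le_trans (enormD _ _))// enormZ gtr0_norm//.
    rewrite /C2 !mulrDl; have h1 : 0 <= C1 * T by rewrite mulr_ge0 ?ltW.
    have h2 : u * enorm x <= u * C1 * T by rewrite -mulrA ler_wpM2l// ltW.
    have h3 : C3 <= C3 * T by rewrite ler_peMr.
    by move: xy xC h1 h2 h3; slra.
  have xC2 : enorm x <= C2 * T.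
    apply: le_trans xC _; rewrite ler_wpM2r ?(ltW T0)// /C2.
    by move: uC C30; slra.
  have By := hb T y X1T sy yC; have Bx := hb T x X1T sx xC2.
  have cxy : enorm x + 1 <= c * (enorm y + 1).
    have h1 : u * enorm x <= enorm y + C3.
      have -> : u * enorm x = enorm (u *: x) by rewrite enormZ gtr0_norm.
      have -> : u *: x = y - (y - u *: x) by rewrite subKr.
      by rewrite (le_trans (enormB _ _))// lerD2l.
    have h2 : enorm x <= (enorm y + C3) / u by rewrite ler_pdivlMr// mulrC.
    have h3 : (enorm y + C3) / u <= (1 + C3) / u * (enorm y + 1).
      rewrite mulrAC ler_wpM2r ?invr_ge0 ?(ltW u0)//.
      have k : 0 <= C3 * enorm y by rewrite mulr_ge0 ?enorm_ge0.
      have -> : (1 + C3) * (enorm y + 1) = enorm y + C3 + (C3 * enorm y + 1) by ring.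
      by rewrite lerDl addr_ge0.
    rewrite /c [leRHS]mulrDl mul1r; by rewrite addrA lerD2r (le_trans h2)// (le_trans h3)// lerDl enorm_ge0.
  have Sxy := sing_le (ltac:(exact: beta0)) c0 T0 cxy.
  apply: le_trans (ler_normB _ _) _; rewrite normrM (ger0_norm (ltW ua)).
  apply: (@le_trans _ _ (G T * (C * sing beta T x))); last first.
    by rewrite ler_wpM2l ?(ltW GT)// lerDr ltW.
  have -> : G T * (C * sing beta T x) =
    Cb * G T * (c `^ beta * sing beta T x) + u `^ (- alpha) * (Cb * G T * sing beta T x).
    by rewrite /C; ring.
  rewrite lerD//; last by rewrite ler_wpM2l ?(ltW ua).
  by apply: le_trans By _; rewrite ler_wpM2l// mulr_ge0 ?(ltW Cb0) ?(ltW GT).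
rewrite mul0r mulr0 addr0.
have sT2 : s / 2 * T <= enorm x.
  have : 2 <= s * T by rewrite mulrC -ler_pdivrMr.
  by move: xs; slra.
have YxT : Y <= enorm x by apply: le_trans sT2; rewrite mulrC -ler_pdivrMr.
have x0 : 0 < enorm x by exact: lt_le_trans YxT.
have [X3x Yx2 X4x Yx4 Yx5] : [/\ X3 <= enorm x, X3 / (u / 2) <= enorm x,
    X4 <= enorm x, C3 / (u / 2) <= enorm x & C3 / g <= enorm x].
  by move: YxT; rewrite /Y => YxT; clear -alpha0 alphabeta betad Gpos hG hF beta0 potterG YxT q1 q2 q3 X30 X40; split; lra.
have dxy : `|enorm y - u * enorm x| <= C3.
  apply: le_trans xy; have := enorm_lerB y (u *: x); by rewrite enormZ (gtr0_norm u0).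
have C3x : C3 <= u / 2 * enorm x.
  by rewrite mulrC -ler_pdivrMr.
move: dxy; rewrite ler_norml => /andP[dxy1 dxy2].
have y1 : u / 2 * enorm x <= enorm y by move: dxy1 C3x; slra.
have y2 : enorm y <= 2 * u * enorm x.
  have h : 0 <= u / 2 * enorm x by rewrite mulr_ge0 ?ltW.
  by move: h dxy2 C3x; slra.
have X3y : X3 <= enorm y.
  by apply: le_trans y1; rewrite mulrC -ler_pdivrMr.
have y0 : 0 < enorm y by apply: lt_le_trans X3y.
have [Gx Gy] := (Gpos x0, Gpos y0).
have H1 := hk y sy X3y; have H2 := hk x sx X3x.
have H3 := hg (enorm x) (enorm y) X4x y1 y2.
have rp : 0 < enorm y / enorm x by rewrite divr_gt0.
have H4 : `|(enorm y / enorm x) `^ (- alpha) - u `^ (- alpha)| <= eps.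
  apply: hc => //; have -> : enorm y / enorm x - u = (enorm y - u * enorm x) / enorm x.
    by field; rewrite lt0r_neq0.
  rewrite normrM (gtr0_norm (_ : 0 < (enorm x)^-1)) ?invr_gt0//.
  rewrite ler_pdivrMr// (@le_trans _ _ C3)//; first by rewrite ler_norml dxy1.
  by rewrite mulrC -ler_pdivrMr.
have H5 : G (enorm x) <= Bs * G T.
  by apply: hs => //; move: XT X10 q4 q5; slra.
set r := (enorm y / enorm x) `^ (- alpha) in H3 H4.
have Gyx : G (enorm y) <= (u `^ (- alpha) + 2 * eps) * G (enorm x).
  move: H3; rewrite ler_norml => /andP[_ H3].
  have : r * G (enorm x) <= (u `^ (- alpha) + eps) * G (enorm x).
    rewrite ler_wpM2r ?(ltW Gx)//; move: H4; rewrite ler_norml => /andP[_ H4].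
    by move: H4; slra.
  by move: H3; slra.
have -> : F y - u `^ (- alpha) * F x = (F y - G (enorm y)) +
  (G (enorm y) - r * G (enorm x)) + (r - u `^ (- alpha)) * G (enorm x) -
  u `^ (- alpha) * (F x - G (enorm x)) by ring.
have N1 : `|(r - u `^ (- alpha)) * G (enorm x)| <= eps * G (enorm x).
  by rewrite normrM (ger0_norm (ltW Gx)) ler_wpM2r ?(ltW Gx).
have N2 : `|u `^ (- alpha) * (F x - G (enorm x))| <= u `^ (- alpha) * (eps * G (enorm x)).
  by rewrite normrM (ger0_norm (ltW ua)) ler_wpM2l ?(ltW ua).
have N3 : eps * G (enorm y) <= eps * ((u `^ (- alpha) + 2) * G (enorm x)).
  rewrite ler_wpM2l ?(ltW eps0)//; apply: le_trans Gyx _.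
  by rewrite ler_wpM2r ?(ltW Gx)//; move: eps1; slra.
apply: (@le_trans _ _ (eps * (2 * u `^ (- alpha) + 4) * G (enorm x))).
  rewrite (le_trans (ler_normB _ _))// (le_trans (lerD (ler_normD _ _) (lexx _)))//.
  rewrite (le_trans (lerD (lerD (ler_normD _ _) (lexx _)) (lexx _)))//.
  have := lerD (lerD (lerD (le_trans H1 N3) H3) N1) N2; move=> /le_trans; apply.
  rewrite le_eqVlt; apply/orP; left; apply/eqP; ring.
have e2 : 0 <= eps * (2 * u `^ (- alpha) + 4) by rewrite mulr_ge0 ?(ltW eps0)//; move: ua; slra.
apply: le_trans (ler_wpM2l e2 H5) _.
by rewrite mulrA [leRHS]mulrC ler_wpM2r ?(ltW GT).
Qed.

Definition mollifies (k : nat) (C L h : R) (m : seq (R * 'rV[R]_d)) : Prop :=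
  [/\ weighted_prob m, supp_in m (grid h), supp_in m (eball (C * L)),
    forall c r, 0 <= r -> smass m c r <= C * ((r + 1) / L) ^+ d &
    forall l, cube h l -> l != 0 -> pow m l <= (C / (L * enorm l)) ^+ (2 * k)].

Lemma grid_for1 : grid_for (R := R) (d := d) D 1.
Proof. by case: D; [split|exact: grid_for_lattice]. Qed.

Let gamma0 : 0 < d%:R - beta. Proof. by rewrite subr_gt0. Qed.

Lemma pow_push_energy (f : 'rV[R]_d -> 'rV[R]_d) s :
  \int[mu]_l pow (push f s) l =
  \sum_(a <- s) \sum_(b <- s) a.1 * b.1 * F (f a.2 - f b.2).
Proof.
rewrite Rint_pow /push big_map; apply: eq_bigr => a _; rewrite big_map.
exact: eq_bigr.
Qed.

(** Both energies are double sums over the same pairs, compared term by term in absolute value, so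
    signs do not matter and the mass bound [C0] controls the total. Convolution with [m] spreads the
    points at scale eta T, which bounds the singular weight of near pairs by a constant times
    eta^(-d) sg^(d - beta). *)
Lemma signed_transfer k Cm u C0 C1 eta e : 0 < Cm -> 0 < u -> 0 <= C0 ->
  0 < C1 -> 0 < eta -> 0 < e -> exists X, 0 < X /\
  forall T h t m, X <= T -> grid_for (R := R) (d := d) D h -> mass t <= C0 ->
  supp_in t (ball_in D (C1 * T)) -> mollifies k Cm (eta * T) h m ->
  `|\int[mu]_l pow (push (fun x => round h (u *: x)) (conv t m)) l -
    u `^ (- alpha) * \int[mu]_l pow (conv t m) l| <= e * G T.
Proof.
move=> Cm0 u0 C00 C10 eta0 e0.
pose sd := Num.sqrt (d%:R : R).
have sd0 : 0 <= sd by exact: sqrtr_ge0.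
pose C2 := 2 * (C1 + Cm * eta).
have C20 : 0 < C2 by rewrite mulr_gt0// addr_gt0// mulr_gt0.
have sd20 : 0 <= 2 * sd by rewrite mulr_ge0.
have [C C_0 hC] := kernel_compare u0 C20 sd20.
have [K K0 hK] := singular_sum beta0 betad Cm0.
have c1 : 0 < C0 ^+ 2 + 1 by rewrite ltr_wpDl ?sqr_ge0.
have [e1 e10 e1E] : exists2 e1, 0 < e1 & C0 ^+ 2 * e1 <= e / 2.
  exists (e / 2 / (C0 ^+ 2 + 1)); first by rewrite !divr_gt0.
  rewrite mulrA ler_pdivrMr// mulrC ler_wpM2l ?divr_ge0 ?(ltW e0)//.
  by rewrite lerDl.
have [sg sg0 sgE] : exists2 sg, 0 < sg &
    C0 ^+ 2 * (C * (K * eta^-1 ^+ d * sg `^ (d%:R - beta))) <= e / 2.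
  have z0 : 0 < e / 2 / ((C0 ^+ 2 + 1) * (C * (K * eta^-1 ^+ d))).
    by rewrite !divr_gt0// !mulr_gt0 ?exprn_gt0 ?invr_gt0.
  set z := (_ / _) in z0; exists (z `^ (d%:R - beta)^-1); first by rewrite powR_gt0.
  rewrite -powRrM mulVf ?lt0r_neq0// powRr1 ?(ltW z0)//.
  have -> : C0 ^+ 2 * (C * (K * eta^-1 ^+ d * z)) = e / 2 * (C0 ^+ 2 / (C0 ^+ 2 + 1)).
    by rewrite /z; field; rewrite !lt0r_neq0 ?exprn_gt0 ?invr_gt0.
  by rewrite ler_piMr ?divr_ge0 ?(ltW e0)// ler_pdivrMr// mul1r lerDl.
have [X [X0 hX]] := hC sg e1 sg0 e10.
exists (X + sg^-1); split; first by rewrite addr_gt0// invr_gt0.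
move=> T h t m XT [h0 h1 hs] tC st [pm gm sm smm _].
have sgi : 0 < sg^-1 by rewrite invr_gt0.
have T0 : 0 < T by lra.
have XT' : X <= T by lra.
have sgT : 1 <= sg * T by rewrite mulrC -ler_pdivrMr// div1r; lra.
have GT := Gpos T0.
set s := conv t m.
have ms : mass s = mass t by rewrite mass_conv (mass_prob pm) mulr1.
have ss a : a \in s -> sites D a.2 /\ enorm a.2 <= C2 / 2 * T.
  move=> /allpairsP[[x y] /= [/st [xT xs] ym ->]] /=; split.
    by apply: sitesD => //; exact/hs/gm.
  have -> : C2 / 2 * T = C1 * T + Cm * (eta * T) by rewrite /C2; field.
  by rewrite (le_trans (enormD _ _))// lerD//; exact: sm.
pose g z := (enorm z + 1 <= sg * T)%R%:R * sing beta T (z : 'rV[R]_d).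
have g0 z : 0 <= g z by rewrite mulr_ge0 ?sing_ge0.
have gE z w : g (z - w) = g (w - z) by rewrite /g /sing enorm_distC.
have [S S0 SE] : exists2 S, 0 <= S & S = K * eta^-1 ^+ d * sg `^ (d%:R - beta).
  eexists; last reflexivity.
  by rewrite !mulr_ge0 ?powR_ge0 ?(ltW K0)// exprn_ge0// invr_ge0 ltW.
(* For each point of [t], the sum over its translates by the points of [m] is an instance of
   [singular_sum], with [a.2 - x] as the centre parameter. *)
have inner x : \sum_(b <- s) `|b.1| * g (x - b.2) <= C0 * S.
  rewrite big_conv /=.
  apply: (@le_trans _ _ (\sum_(a <- t) `|a.1| * S)); last first.
    by rewrite -mulr_suml ler_wpM2r.
  apply: ler_sum => a _.
  have := hK T (eta * T) m T0 (mulr_gt0 eta0 T0) pm smm (a.2 - x) (sg * T) sgT.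
  have -> : T / (eta * T) = eta^-1 by field; rewrite !lt0r_neq0.
  rewrite mulfK ?lt0r_neq0// -SE => h'.
  apply: le_trans (ler_wpM2l (normr_ge0 a.1) h').
  rewrite mulr_sumr !big_seq; apply: ler_sum => b bm.
  rewrite normrM (ger0_norm (proj1 pm _ bm)) -mulrA gE.
  by rewrite -/(g (a.2 - x + b.2)) addrAC.
rewrite pow_push_energy Rint_pow mulr_sumr -sumrB.
apply: le_trans (ler_norm_sum _ _ _) _.
apply: (@le_trans _ _ (\sum_(a <- s) `|a.1| * (G T * (C0 * e1 + C * (C0 * S))))); last first.
  rewrite -mulr_suml -/(mass s) ms.
  apply: (@le_trans _ _ (C0 * (G T * (C0 * e1 + C * (C0 * S))))).
    by rewrite ler_wpM2r// mulr_ge0 ?(ltW GT)// addr_ge0 ?mulr_ge0 ?(ltW e10) ?(ltW C_0).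
  have -> : C0 * (G T * (C0 * e1 + C * (C0 * S))) =
    (C0 ^+ 2 * e1 + C0 ^+ 2 * (C * S)) * G T by ring.
  by rewrite ler_wpM2r ?(ltW GT)// [leRHS]splitr lerD// SE.
rewrite big_seq [leRHS]big_seq; apply: ler_sum => a /ss[sa aT].
rewrite mulr_sumr -sumrB; apply: le_trans (ler_norm_sum _ _ _) _.
apply: (@le_trans _ _ (\sum_(b <- s) `|a.1| * (G T * (`|b.1| * e1 + C * (`|b.1| * g (a.2 - b.2)))))).
  rewrite big_seq [leRHS]big_seq; apply: ler_sum => b /ss[sb bT].
  rewrite mulrCA -mulrBr normrM normrM -mulrA ler_wpM2l//.
  have xT : enorm (a.2 - b.2) <= C2 * T.
    by rewrite (le_trans (enormB _ _))// (le_trans (lerD aT bT))//; lra.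
  have r2 : enorm (round h (u *: a.2) - round h (u *: b.2) - u *: (a.2 - b.2)) <= 2 * sd.
    have -> : round h (u *: a.2) - round h (u *: b.2) - u *: (a.2 - b.2) =
      (round h (u *: a.2) - u *: a.2) - (round h (u *: b.2) - u *: b.2).
      by apply/rowP => i; rewrite !mxE; ring.
    have := round_dist (u *: a.2) h0 h1; have := round_dist (u *: b.2) h0 h1.
    by move=> r1 r2; rewrite (le_trans (enormB _ _))// (le_trans (lerD r2 r1))// mulr_natl mulr2n.
  have sr (x : 'rV[R]_d) : sites D (round h x) by apply: hs; exact: grid_round.
  have := hX T _ _ XT' (sitesB sa sb) (sitesB (sr (u *: a.2)) (sr (u *: b.2))) xT r2.
  move=> /(ler_wpM2l (normr_ge0 b.1))/le_trans; apply.
  rewrite -/(g (a.2 - b.2)) le_eqVlt; apply/orP; left; apply/eqP; ring.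
rewrite -!mulr_sumr big_split /= -mulr_suml -mulr_sumr -/(mass s) ms.
rewrite ler_wpM2l// ler_wpM2l ?(ltW GT)// lerD//.
  by rewrite ler_wpM2r// ltW.
by rewrite ler_wpM2l ?(ltW C_0).
Qed.

Let m (r : R) : R := fine (mu (eball r)).

Let d0 : (0 < d)%N.
Proof. by rewrite -(ltr_nat R) (lt_trans beta0 betad). Qed.

(** A mollifier at scale T has energy at most a multiple of G(T), by the singular sum, and the real
    part of its transform is at least 1/2 on B(del/T); a change of scale in [G] turns del/T into
    1/T. *)
Lemma ball_upper : exists X C, [/\ 0 < X, 0 < C &
  forall T, X <= T -> m T^-1 <= C * G T].
Proof.
have [Cm Cm0 hm] := @mollifier R d 1 isT d0.
pose c := 2 * Cm + 1; have c0 : 0 < c by rewrite /c; lra.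
have [X1 [Cb [X10 Cb0 hb]]] := kernel_bound c0.
have [K K0 hK] := singular_sum beta0 betad Cm0.
have [C' C'0 C'E] : exists2 C', 0 < C' & C' = Cb * K * c `^ (d%:R - beta).
  by eexists; last reflexivity; rewrite !mulr_gt0 ?powR_gt0.
have pi0 := pi_gt0 R.
have [P P0 PE] : exists2 P, 0 < P & P = 2 * pi * Cm.
  by eexists; last reflexivity; rewrite !mulr_gt0.
pose del := (2 * P)^-1.
have del0 : 0 < del by rewrite invr_gt0 !mulr_gt0.
have main T : X1 + 1 <= T -> m (del / T) <= 4 * C' * G T.
  move=> XT; have T1 : 1 <= T by lra.
  have T0 : 0 < T by lra.
  have X1T : X1 <= T by lra.
  have GT := Gpos T0.
  have [mm [pm gm sm smm _]] := hm T 1 T1 ltr01 (lexx _).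
  have mm0 := proj1 pm.
  have E : \int[mu]_l pow mm l <= C' * G T.
    rewrite Rint_pow.
    apply: (@le_trans _ _ (\sum_(a <- mm) a.1 * (C' * G T))); last first.
      by rewrite -mulr_suml (proj2 pm) mul1r.
    rewrite big_seq [leRHS]big_seq; apply: ler_sum => a am.
    have cT1 : 1 <= c * T.
      have : 0 <= Cm * T by rewrite mulr_ge0 ?ltW.
      rewrite /c; lra.
    have := hK T T mm T0 T0 pm smm (- a.2) (c * T) cT1.
    rewrite divff ?lt0r_neq0// expr1n mulr1 mulfK ?lt0r_neq0// => h.
    apply: (@le_trans _ _ (a.1 * (Cb * G T * (K * c `^ (d%:R - beta))))); last first.
      rewrite ler_wpM2l ?mm0// C'E le_eqVlt; apply/orP; left; apply/eqP; ring.
    have CG : 0 <= Cb * G T by rewrite mulr_ge0 ?(ltW Cb0) ?(ltW GT).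
    apply: le_trans (ler_wpM2l (mm0 _ am) (ler_wpM2l CG h)).
    rewrite !mulr_sumr big_seq [leRHS]big_seq; apply: ler_sum => b bm.
    rewrite -mulrA ler_wpM2l ?mm0// mulrCA ler_wpM2l ?mm0//.
    have ab : enorm (a.2 - b.2) + 1 <= c * T.
      have := enormB a.2 b.2; have := sm _ am; have := sm _ bm; rewrite /eball /= /c.
      lra.
    rewrite (addrC (- a.2)) /sing (enorm_distC b.2) ab mul1r -/(sing beta T (a.2 - b.2)).
    apply: le_trans (ler_norm _) _; apply: hb => //.
      have [_ _ hs] := grid_for1; apply: sitesB; apply: hs; exact: gm.
    lra.
  have mB : measurable (eball (del / T) : set (Borel R d)) by exact: measurable_eball.
  rewrite -mulrA -ler_pdivrMl//.
  have -> : 4^-1 * m (del / T) = 2^-1 ^+ 2 * m (del / T).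
    by congr (_ * _); field.
  apply: le_trans E.
  apply: (@le_trans _ _ (\int[mu]_(l in eball (del / T)) pow mm l)).
    apply: Rint_ge_cst => // [|l lT]; first exact: bm_pow.
    rewrite /pow -[leLHS]addr0 lerD ?sqr_ge0//.
    have h : 2^-1 <= csum mm l.
      apply: le_trans (csum_ge_prob l pm sm).
      have : 2 * pi * (Cm * T) * enorm l <= 2 * pi * (Cm * T) * (del / T).
        by rewrite ler_wpM2l ?mulr_ge0 ?(ltW pi0) ?(ltW Cm0) ?(ltW T0).
      have -> : 2 * pi * (Cm * T) * (del / T) = 2^-1.
        by rewrite (mulrA _ Cm) -PE /del; field; rewrite !lt0r_neq0.
      lra.
    by rewrite !expr2; apply: ler_pM.
  by apply: Rint_subset => //; [exact: bm_pow|move=> l _; exact: pow_ge0].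
have [X2 [B [X20 B0 h2]]] := gauge_le alpha0 Gpos hG del0 del0.
have XX : 0 < (X1 + 1) / del by rewrite divr_gt0//; lra.
exists (X2 + (X1 + 1) / del), (4 * C' * B); split.
- by rewrite addr_gt0.
- by rewrite !mulr_gt0.
move=> T XT; have T0 : 0 < T by lra.
have dT : X1 + 1 <= del * T by rewrite mulrC -ler_pdivrMr//; lra.
have := main _ dT; rewrite -[del / _]divr1 (_ : del / (del * T) / 1 = T^-1); last first.
  by field; rewrite !lt0r_neq0.
move=> /le_trans; apply; rewrite -(mulrA _ B); apply: ler_wpM2l; first by rewrite mulr_ge0 ?(ltW C'0).
by apply: h2 => //; lra.
Qed.

(** [ball_upper] at 1/r followed by Potter's bound; radii above 1/X are left to the total mass. The
    exponent beta < d is raised to the integer d, the kind of exponent that [tail_bound] takes. *)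
Lemma ball_growth : exists X C, [/\ 0 < X, 0 < C &
  forall T r, X <= T -> T^-1 <= r -> m r <= C * G T * (r * T) ^+ d].
Proof.
have [X1 [C1 [X10 C10 h1]]] := ball_upper.
have [X2 [B [X20 B0 h2]]] := potterG.
pose X := X1 + X2; have X0 : 0 < X by rewrite /X; lra.
have GX := Gpos X0.
have [F0 F00 F0E] : exists2 F0, 0 <= F0 & F0 = fine (mu setT).
  by eexists; last reflexivity; rewrite fine_mu_ge0.
have FG : 0 <= F0 / G X by rewrite divr_ge0 ?(ltW GX).
have pd (y z : R) : 0 < y -> y <= z -> 1 <= z -> y `^ beta <= z ^+ d.
  move=> y0 yz z1; have z0 : 0 <= z by lra.
  apply: (@le_trans _ _ (z `^ beta)).
    by apply: ge0_ler_powR; rewrite ?nnegrE ?(ltW beta0) ?(ltW y0).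
  by rewrite -powR_mulrn// ler_powR// ltW.
exists X, (C1 * B + F0 / G X * B); split => //.
  by rewrite ltr_wpDr ?mulr_gt0// mulr_ge0 ?(ltW B0).
move=> T r XT Tr; have T0 : 0 < T by lra.
have GT := Gpos T0.
have r0 : 0 < r by apply: lt_le_trans Tr; rewrite invr_gt0.
have rT : 1 <= r * T by rewrite -ler_pdivrMr// div1r.
have rTd : 0 <= (r * T) ^+ d by rewrite exprn_ge0// mulr_ge0 ?ltW.
have [rX|rX] := leP r X^-1.
  apply: (@le_trans _ _ (C1 * B * G T * (r * T) ^+ d)); last first.
    by rewrite ler_wpM2r// ler_wpM2r ?(ltW GT)// lerDl mulr_ge0 ?(ltW B0).
  have Xr : X <= r^-1 by rewrite -(invrK X) lef_pV2 ?posrE ?invr_gt0.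
  have rT' : r^-1 <= T by rewrite -(invrK T) lef_pV2 ?posrE ?invr_gt0.
  have X1r : X1 <= r^-1 by rewrite /X in Xr; lra.
  have X2r : X2 <= r^-1 by rewrite /X in Xr; lra.
  have := h1 _ X1r; rewrite invrK => /le_trans; apply.
  rewrite -!mulrA ler_wpM2l ?(ltW C10)//.
  apply: le_trans (h2 T _ X2r rT') _; rewrite -mulrA ler_wpM2l ?(ltW B0)//.
  rewrite mulrC ler_wpM2l ?(ltW GT)// invrK mulrC.
  by apply: pd => //; rewrite mulr_gt0.
apply: (@le_trans _ _ (F0 / G X * B * G T * (r * T) ^+ d)); last first.
  by rewrite ler_wpM2r// ler_wpM2r ?(ltW GT)// lerDr mulr_ge0 ?(ltW B0) ?(ltW C10).
apply: (@le_trans _ _ F0).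
  by rewrite F0E; apply: fine_mu_le => //; exact: measurable_eball.
have X2X : X2 <= X by rewrite /X; lra.
have TX : T / X <= r * T by rewrite mulrC ler_wpM2r ?(ltW T0)// ltW.
have := ler_wpM2l FG (h2 T X X2X XT); rewrite divfK ?lt0r_neq0//.
move=> /le_trans; apply; rewrite -!mulrA ler_wpM2l// ler_wpM2l ?invr_ge0 ?(ltW GX)//.
rewrite ler_wpM2l ?(ltW B0)// mulrC ler_wpM2l ?(ltW GT)//.
by apply: pd => //; rewrite divr_gt0.
Qed.

Lemma mollifier_tail k Cm : 0 < Cm -> (d < 2 * k)%N ->
  exists X C, [/\ 0 < X, 0 < C & forall L A h s, X <= L -> 1 <= A ->
    mollifies k Cm L h s ->
    \int[mu]_(l in cube h `\` eball (A / L)) pow s l <=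
      C * G L * (A ^+ d / A ^+ (2 * k))].
Proof.
move=> Cm0 dk; have [X [C [X0 C0 hX]]] := ball_growth.
exists X, (2 ^+ d.+1 * Cm ^+ (2 * k) * C); split => //.
  by rewrite !mulr_gt0 ?exprn_gt0.
move=> L A h s XL A1 [_ _ _ _ fs]; have L0 : 0 < L by lra.
have A0 : 0 < A by lra.
have GL := Gpos L0.
apply: le_trans (@tail_bound _ _ mu _ _ L^-1 Cm A (C * G L) d (2 * k) _ _ _ _ _ _ _ _ _) _ => //.
- by rewrite invr_gt0.
- by rewrite mulr_ge0 ?(ltW C0) ?(ltW GL).
- exact: ltW.
- exact: bm_pow.
- exact: measurable_cube.
- move=> l cl hl.
  have lp : 0 < enorm (l : 'rV[R]_d) by apply: le_lt_trans hl; rewrite divr_ge0 ?ltW.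
  apply: le_trans (fs l cl _) _; first by rewrite -enorm_gt0.
  rewrite le_eqVlt; apply/orP; left; apply/eqP; congr (_ ^+ _).
  by field; rewrite !lt0r_neq0.
- move=> r rA; rewrite invrK; apply: hX => //.
  by apply: le_trans rA; rewrite -[leLHS]mul1r ler_wpM2r// invr_ge0 ltW.
rewrite le_eqVlt; apply/orP; left; apply/eqP; ring.
Qed.

Lemma Rint_pow_split s h r : (forall l, pow s l <= 1) ->
  \int[mu]_l pow s l <= \int[mu]_(l in eball r) pow s l +
    \int[mu]_(l in cube h `\` eball r) pow s l + fine (mu (~` cube h)).
Proof.
move=> s1; have bs := bm_pow s.
have mB : measurable (eball r : set (Borel R d)) by exact: measurable_eball.
have mC : measurable (cube h : set (Borel R d)) by exact: measurable_cube.
rewrite (@Rint_split _ _ _ mu setT (eball r))// setTI setTD -addrA lerD2l.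
rewrite (@Rint_split _ _ _ mu (~` eball r) (cube h))//; last exact: measurableC.
rewrite setIC -setDE lerD2l.
have mD : measurable (~` eball r `\` cube h : set (Borel R d)).
  by apply: measurableD => //; exact: measurableC.
apply: (@le_trans _ _ (1 * fine (mu (~` eball r `\` cube h)))).
  by apply: Rint_le_cst.
by rewrite mul1r; apply: fine_mu_le => //; first [exact: measurableC|move=> l []].
Qed.

Hypothesis carrier : mu (~` frequencies D) = 0%E.

(** Most pairs of a mollifier at scale T are at distance at least of order sg T, where the kernel
    exceeds G/2; its energy is thus at least (c1/4) G(T). Frequencies above A/T and those off the
    cell account for at most (c1/16) G(T) each, so B(A/T) carries the rest. *)
Lemma ball_lower : exists X c, [/\ 0 < X, 0 < c &
  forall T, X <= T -> c * G T <= m T^-1].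
Proof.
have [Cm Cm0 hm] := @mollifier R d d.+1 isT d0.
have dk : (d < 2 * d.+1)%N by rewrite mul2n -addnn addSn ltnS leq_addr.
pose c := 2 * Cm + 1; have c0 : 0 < c by rewrite /c; lra.
have [X1 [Cb [X10 Cb0 hb]]] := kernel_bound c0.
have [K K0 hK] := singular_sum beta0 betad Cm0.
have [X2 [C2 [X20 C20 htail]]] := mollifier_tail Cm0 dk.
have [c1 c10 c1E] : exists2 c1, 0 < c1 & c1 = c `^ (- alpha) / 4.
  by eexists; last reflexivity; rewrite divr_gt0 ?powR_gt0.
(* At most half of the mass lies within about sg T of any point, and these near pairs lower the
   energy by at most (c1/4) G(T). *)
have [sg [sg0 sg1 sgA sgB]] : exists sg, [/\ 0 < sg, sg <= 1,
    Cm * sg ^+ d <= 2^-1 & Cb * (K * sg `^ (d%:R - beta)) <= c1 / 4].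
  have z0 : 0 < c1 / 4 / (Cb * K) by rewrite !divr_gt0 ?mulr_gt0.
  set z := (_ / (Cb * K)) in z0; pose s1 := z `^ (d%:R - beta)^-1.
  have s10 : 0 < s1 by rewrite powR_gt0.
  pose sg := Num.min 1 (Num.min (2 * Cm)^-1 s1).
  have sg0 : 0 < sg by rewrite !lt_min ltr01 invr_gt0 mulr_gt0.
  have sg1 : sg <= 1 by rewrite ge_min lexx.
  exists sg; split => //.
    apply: (@le_trans _ _ (Cm * sg)).
      by rewrite ler_wpM2l ?(ltW Cm0)// -[leRHS]expr1 ler_wiXn2l ?(ltW sg0).
    apply: (@le_trans _ _ (Cm * (2 * Cm)^-1)).
      by rewrite ler_wpM2l ?(ltW Cm0)// !ge_min lexx orbT.
    rewrite le_eqVlt; apply/orP; left; apply/eqP; field; exact: lt0r_neq0.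
  apply: (@le_trans _ _ (Cb * (K * z))); last first.
    rewrite /z le_eqVlt; apply/orP; left; apply/eqP; field; rewrite !lt0r_neq0//.
  rewrite ler_wpM2l ?(ltW Cb0)// ler_wpM2l ?(ltW K0)//.
  have -> : z = s1 `^ (d%:R - beta).
    by rewrite /s1 -powRrM mulVf ?lt0r_neq0// powRr1 ?(ltW z0).
  by apply: ge0_ler_powR; rewrite ?nnegrE ?(ltW sg0) ?(ltW s10) ?(ltW gamma0)// !ge_min lexx !orbT.
have half0 : 0 < 2^-1 :> R by [].
have [X3 [X30 h3]] := hF half0.
have sg20 : 0 < sg / 2 by rewrite divr_gt0.
have [X4 [X40 h4]] := gauge_ge alpha0 Gpos hG sg20 c0.
have [A [A1 AE]] : exists A, 1 <= A /\ C2 * A^-1 <= c1 / 16.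
  have q : 0 < 16 * C2 / c1 by rewrite divr_gt0 ?mulr_gt0.
  exists (1 + 16 * C2 / c1); split; first by lra.
  rewrite ler_pdivrMr; last by lra.
  have -> : c1 / 16 * (1 + 16 * C2 / c1) = c1 / 16 + C2 by field; exact: lt0r_neq0.
  by rewrite lerDr ltW// divr_gt0.
have A0 : 0 < A by lra.
have main T : X1 + X2 + X4 + 1 + (X3 + 1) / (sg / 2) <= T -> c1 / 8 * G T <= m (A / T).
  have q : 0 < (X3 + 1) / (sg / 2) by rewrite divr_gt0//; lra.
  move=> XT; have [X1T X2T X4T T1 T0] : [/\ X1 <= T, X2 <= T, X4 <= T, 1 <= T & 0 < T].
    by move: XT q X10 X20 X40; clear -alpha0 alphabeta betad Gpos hG hF beta0 potterG carrier; split; lra.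
  have sgT2 : X3 + 1 <= sg / 2 * T by rewrite mulrC -ler_pdivrMr//; lra.
  have sgT : 1 <= sg * T by lra.
  have GT := Gpos T0.
  have c160 : 0 < c1 / 16 * G T by rewrite mulr_gt0// divr_gt0.
  have [h [gh hcube]] := @grid_fine _ _ mu D (c1 / 16 * G T) carrier c160.
  have [h0 h1 hsites] := gh.
  have [mm Mm] := hm T h T1 h0 h1; have [pm gm sm smm fm] := Mm.
  have mm0 := proj1 pm.
  pose ind z := (enorm (z : 'rV[R]_d) + 1 <= sg * T)%R%:R : R.
  have low a b : a \in mm -> b \in mm ->
      c1 * G T * (1 - ind (- a.2 + b.2)) -
      Cb * G T * (ind (- a.2 + b.2) * sing beta T (- a.2 + b.2)) <= F (a.2 - b.2).
    move=> am bm.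
    have sab : sites D (a.2 - b.2) by apply: sitesB; apply: hsites; exact: gm.
    have ab : enorm (a.2 - b.2) <= c * T.
      have := enormB a.2 b.2; have := sm _ am; have := sm _ bm; rewrite /eball /= /c.
      move: T0; slra.
    rewrite /ind (addrC (- a.2)) /sing (enorm_distC b.2) -/(sing beta T (a.2 - b.2)).
    have [k|k] := leP (enorm (a.2 - b.2) + 1) (sg * T).
      rewrite subrr mulr0 sub0r mul1r.
      by have := hb T _ X1T sab ab; rewrite ler_norml => /andP[].
    rewrite subr0 mulr1 mul0r mulr0 subr0.
    have kk : sg / 2 * T <= enorm (a.2 - b.2) by move: k sgT2 X30; slra.
    have X3k : X3 <= enorm (a.2 - b.2) by move: kk sgT2; slra.
    have := h3 _ sab X3k; have := h4 T _ X4T kk ab.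
    rewrite ler_norml => k1 /andP[k2 _]; rewrite c1E.
    by move: k1 k2; slra.
  have E : c1 / 4 * G T <= \int[mu]_l pow mm l.
    rewrite Rint_pow.
    apply: (@le_trans _ _ (\sum_(a <- mm) a.1 * (c1 / 4 * G T))).
      by rewrite -mulr_suml (proj2 pm) mul1r.
    rewrite big_seq [leRHS]big_seq; apply: ler_sum => a am.
    under eq_bigr do rewrite -mulrA; rewrite -mulr_sumr ler_wpM2l ?mm0//.
    apply: (@le_trans _ _ (\sum_(b <- mm) b.1 * (c1 * G T * (1 - ind (- a.2 + b.2)) -
      Cb * G T * (ind (- a.2 + b.2) * sing beta T (- a.2 + b.2))))); last first.
      by rewrite big_seq [leRHS]big_seq; apply: ler_sum => b bm; rewrite ler_wpM2l ?mm0// low.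
    have -> : \sum_(b <- mm) b.1 * (c1 * G T * (1 - ind (- a.2 + b.2)) -
      Cb * G T * (ind (- a.2 + b.2) * sing beta T (- a.2 + b.2))) =
      c1 * G T * (1 - smass mm (- a.2) (sg * T - 1)) -
      Cb * G T * \sum_(b <- mm) b.1 * (ind (- a.2 + b.2) * sing beta T (- a.2 + b.2)).
      rewrite -[X in X - smass _ _ _](proj2 pm) /smass -sumrB !mulr_sumr -sumrB.
      by apply: eq_bigr => b _; rewrite lerBrDr -/(ind _); ring.
    have := smm (- a.2) (sg * T - 1); rewrite subr_ge0 subrK mulfK ?lt0r_neq0// => /(_ sgT) S1.
    have := hK T T mm T0 T0 pm smm (- a.2) (sg * T) sgT.
    rewrite divff ?lt0r_neq0// expr1n mulr1 mulfK ?lt0r_neq0// => S2.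
    have CG : 0 <= Cb * G T by rewrite mulr_ge0 ?(ltW Cb0) ?(ltW GT).
    have cG : 0 <= c1 * G T by rewrite mulr_ge0 ?(ltW c10) ?(ltW GT).
    have {}S2 := ler_wpM2l CG S2.
    have S3 : Cb * G T * (K * sg `^ (d%:R - beta)) <= c1 / 4 * G T.
      by rewrite mulrAC ler_wpM2r ?(ltW GT).
    have S4 : c1 * G T * 2^-1 <= c1 * G T * (1 - smass mm (- a.2) (sg * T - 1)).
      by rewrite ler_wpM2l//; move: S1 sgA; slra.
    by move: S2 S3 S4; rewrite -/(ind _); set z1 := \sum_(_ <- _) _; slra.
  have := Rint_pow_split h (A / T) (fun l => pow_le1 l pm).
  have I1 : \int[mu]_(l in eball (A / T)) pow mm l <= m (A / T).
    rewrite -[leRHS]mul1r; apply: Rint_le_cst; [exact: measurable_eball|exact: bm_pow|].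
    by move=> l _; exact: pow_le1.
  have I2 := htail T A h mm X2T A1 Mm.
  have I3 : C2 * G T * (A ^+ d / A ^+ (2 * d.+1)) <= c1 / 16 * G T.
    rewrite mulrAC ler_wpM2r ?(ltW GT)//; apply: le_trans AE.
    by rewrite ler_wpM2l ?(ltW C20)//; exact: exp_ratio_le.
  by move: E I1 I2 I3 hcube; slra.
have [X5 [X50 h5]] := gauge_ge alpha0 Gpos hG A0 A0.
have q : 0 < (X3 + 1) / (sg / 2) by rewrite divr_gt0//; lra.
pose X := X1 + X2 + X4 + 1 + (X3 + 1) / (sg / 2).
have X0 : 0 < X by move: X10 X20 X40 q; rewrite /X; slra.
exists (X + X5), (c1 / 8 * (A `^ (- alpha) / 2)); split.
- by rewrite addr_gt0.
- by rewrite !mulr_gt0 ?powR_gt0 ?invr_gt0.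
move=> T XT; have [T0 XT' X5T] : [/\ 0 < T, X <= T & X5 <= T].
  by split; move: XT X0 X50; slra.
have XAT : X <= A * T by apply: le_trans XT' _; rewrite ler_peMl ?(ltW T0).
have := main _ XAT.
have -> : A / (A * T) = T^-1 by field; rewrite !lt0r_neq0.
apply: le_trans; rewrite -mulrA ler_wpM2l ?divr_ge0 ?(ltW c10)//.
by apply: h5 => //; lra.
Qed.

(** [signed_transfer] with the grid of step 1, on R^d as well: the comparison takes place in space,
    without a frequency cut-off. [ball_lower] converts the error from G(T) to m(1/T). *)
Lemma kernel_transfer : (forall r, 0 < r -> 0 < m r) -> transfer D alpha mu.
Proof.
move=> mpos; rewrite /transfer; cbv zeta; rewrite -/m => u e g u0 e0 g0.
have [Cm Cm0 hm] := @mollifier R d 1 isT d0.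
have [X1 [c [X10 c0 hl]]] := ball_lower.
pose eta := g / (2 * Cm).
have eta0 : 0 < eta by rewrite divr_gt0 ?mulr_gt0.
have [X2 [X20 hst]] := signed_transfer 1 Cm0 u0 ler01 ltr01 eta0 (mulr_gt0 e0 c0).
pose sd := Num.sqrt (d%:R : R).
have sd0 : 0 <= sd by exact: sqrtr_ge0.
have q1 : 0 < eta^-1 by rewrite invr_gt0.
have q2 : 0 <= sd / (u * g / 2) by rewrite !divr_ge0 ?mulr_ge0 ?(ltW u0) ?(ltW g0).
exists (X1 + X2 + eta^-1 + sd / (u * g / 2)); split; first by lra.
move=> T XT p pp sp; have T0 : 0 < T by lra.
have etaT : 1 <= eta * T by rewrite mulrC -ler_pdivrMr// div1r; move: XT X10 X20 q2; slra.
have [mm Mm] := hm (eta * T) 1 etaT ltr01 (lexx _); have [pm gm sm smm fm] := Mm.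
have gh := grid_for1; have [h0 h1 hsites] := gh.
exists (push (fun x => round 1 (u *: x)) (conv p mm)); split.
- by apply: prob_push; exact: prob_conv.
- move=> _ /mapP[_ /allpairsP[[a y] /= [ap yM ->]] ->] /=; split; last first.
    by apply: hsites; exact: grid_round.
  have [aT _] := sp _ ap; have yT := sm _ yM.
  rewrite /eball /= in aT yT *.
  have r1 := round_dist (u *: (a.2 + y.2)) h0 h1.
  rewrite -[round _ _](subrK (u *: (a.2 + y.2))) (le_trans (enormD _ _))// enormZ (gtr0_norm u0).
  have k1 : u * enorm (a.2 + y.2) <= u * (T + g / 2 * T).
    rewrite ler_wpM2l ?(ltW u0)// (le_trans (enormD _ _))// lerD// (le_trans yT)//.
    rewrite le_eqVlt; apply/orP; left; apply/eqP; rewrite /eta; field; exact: lt0r_neq0.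
  have k2 : sd <= u * g / 2 * T by rewrite mulrC -ler_pdivrMr ?divr_gt0 ?mulr_gt0//; move: XT X10 X20 q1; slra.
  by apply: le_trans (lerD (le_trans r1 k2) k1) _; slra.
have X2T : X2 <= T by move: XT X10 q1 q2; slra.
have mt : mass p <= 1 by rewrite mass_prob.
have sp' : supp_in p (ball_in D (1 * T)) by rewrite mul1r.
have := hst T 1 p mm X2T gh mt sp' Mm.
rewrite ler_norml => /andP[_]; rewrite lerBlDr => /le_trans; apply.
rewrite addrC lerD//; last first.
  by rewrite -mulrA ler_wpM2l ?(ltW e0)//; apply: hl; lra.
rewrite ler_wpM2l ?powR_ge0//; apply: Rint_le => //; [exact: bm_pow|exact: bm_pow|].
by move=> l _; rewrite pow_conv ler_piMr ?pow_ge0// pow_le1.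
Qed.

Local Ltac clra :=
  clear -alpha0 alphabeta betad Gpos hG hF beta0 potterG carrier; intros; lra.

(** [t] plays the role of an almost indicator of B(1/T), controlled up to 1/(2 th^2 T) only, since
    its periodicity may make it recur beyond. The mollifier, at the larger scale th T, has damped
    the frequencies by then, up to a loss of order [th]. *)
Lemma step_energy_upper Cm : 0 < Cm -> exists2 C, 0 < C &
  forall th, 0 < th -> th <= 2^-1 -> exists X, 0 < X /\
  forall T h mm t e, X <= T -> mollifies d.+1 Cm (th * T) h mm -> 0 <= e -> e <= 1 ->
  (forall l, ssum t l = 0) -> (forall l, 0 <= csum t l <= 1) ->
  (forall l, T^-1 < enorm l -> enorm l <= (2 * th)^-1 / (th * T) -> csum t l <= e) ->
  \int[mu]_l pow (conv t mm) l <= m T^-1 +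
    (e * C * (2 * th ^+ 2)^-1 ^+ d + C * th) * G T + fine (mu (~` cube h)).
Proof.
move=> Cm0; have dk : (d < 2 * d.+1)%N by rewrite mul2n -addnn addSn ltnS leq_addr.
have [X1 [C1 [X10 C10 hgrow]]] := ball_growth.
have [X2 [C2 [X20 C20 htail]]] := mollifier_tail Cm0 dk.
have [X3 [B [X30 B0 hB]]] := potterG.
have p0 : 0 < C2 * B * 2 ^+ d.+2 by apply: mulr_gt0; [exact: mulr_gt0|exact: exprn_gt0].
exists (C1 + C2 * B * 2 ^+ d.+2); first by rewrite addr_gt0.
set C := C1 + _ => th th0 th2.
have t20 : 0 < th ^+ 2 by rewrite exprn_gt0.
have q : 0 < (X2 + X3) / th by rewrite divr_gt0// addr_gt0.
exists (X1 + (X2 + X3) / th); split; first by rewrite addr_gt0.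
move=> T h mm t e XT Mm e0 e1 ts tc tout.
have [X1T thT T0] : [/\ X1 <= T, X2 + X3 <= th * T & 0 < T].
  by rewrite (mulrC th) -ler_pdivrMr//; clear -alpha0 alphabeta betad Gpos hG hF beta0 potterG carrier XT q X10; split; lra.
have [X2T X3T] : X2 <= th * T /\ X3 <= th * T.
  by clear -alpha0 alphabeta betad Gpos hG hF beta0 potterG carrier thT X20 X30; split; lra.
have th1 : th <= 1 by move: th2; clra.
have thTT : th * T <= T by rewrite ler_piMl// ltW.
have GT := Gpos T0.
have [pm _ _ _ _] := Mm.
have powE l : pow (conv t mm) l = csum t l ^+ 2 * pow mm l.
  by rewrite pow_conv {1}/pow ts expr0n addr0.
have c2 l : csum t l ^+ 2 <= 1 by have /andP[a b] := tc l; rewrite exprn_ile1.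
have pow_mm l : pow (conv t mm) l <= pow mm l.
  by rewrite powE ler_piMl ?pow_ge0.
have pow_1 l : pow (conv t mm) l <= 1 by rewrite (le_trans (pow_mm l))// pow_le1.
pose A := (2 * th)^-1; have A1 : 1 <= A.
  by rewrite /A invf_ge1 ?mulr_gt0//; move: th2; clra.
have mB r : measurable (eball r : set (Borel R d)) by exact: measurable_eball.
have mC : measurable (cube h : set (Borel R d)) by exact: measurable_cube.
apply: le_trans (Rint_pow_split h (A / (th * T)) pow_1) _.
rewrite lerD2r mulrDl addrA lerD//.
  rewrite (@Rint_split _ _ _ mu _ (eball T^-1))//; last exact: bm_pow.
  rewrite lerD//.
    apply: (@le_trans _ _ (\int[mu]_(l in eball T^-1) pow (conv t mm) l)).
      apply: Rint_subset => //; [exact: measurableI|exact: bm_pow|].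
      by move=> l _; exact: pow_ge0.
    by rewrite -[leRHS]mul1r; apply: Rint_le_cst => //; exact: bm_pow.
  apply: (@le_trans _ _ (e * m (A / (th * T)))).
    apply: (@le_trans _ _ (e * fine (mu (eball (A / (th * T)) `\` eball T^-1)))).
      apply: Rint_le_cst; [exact: measurableD|exact: bm_pow|move=> l [lA /negP lT]].
      rewrite powE -[leRHS]mulr1 ler_pM ?sqr_ge0 ?pow_ge0 ?pow_le1//.
      have ct : csum t l <= e by apply: tout => //; rewrite ltNge.
      have /andP[c0 c1] := tc l.
      by rewrite expr2 -[leRHS]mulr1; apply: ler_pM.
    by rewrite ler_wpM2l//; apply: fine_mu_le => //; first [exact: measurableD|move=> l []].
  rewrite -!mulrA ler_wpM2l//.
  have AT : A / (th * T) * T = (2 * th ^+ 2)^-1.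
    by rewrite /A; field; rewrite !lt0r_neq0.
  apply: le_trans (hgrow T _ X1T _) _.
    rewrite -[leLHS]mul1r -ler_pdivlMr ?invr_gt0// invrK AT.
    rewrite invf_ge1 ?mulr_gt0//.
    have : th ^+ 2 <= th * 2^-1 by rewrite expr2 ler_wpM2l// ltW.
    by move: th1; clra.
  rewrite AT -mulrA (mulrC (G T)); apply: ler_wpM2r; last by rewrite /C lerDl ltW.
  by rewrite mulr_ge0 ?(ltW GT)// exprn_ge0// invr_ge0 mulr_ge0// ltW.
apply: (@le_trans _ _ (\int[mu]_(l in cube h `\` eball (A / (th * T))) pow mm l)).
  by apply: Rint_le => //; [exact: measurableD|exact: bm_pow|exact: bm_pow].
apply: le_trans (htail _ _ _ _ X2T A1 Mm) _.
have GG := hB T (th * T) X3T thTT.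
(* The decay of order 2(d + 1) leaves th^(d + 2), of which th^d compensates the growth of G(th T) /
   G(T). *)
have : A ^+ d / A ^+ (2 * d.+1) = (2 * th) ^+ d.+2.
  rewrite /A (_ : (2 * d.+1 = d + d.+2)%N); last by rewrite mul2n -addnn addSnnS.
  have w0 : 2 * th != 0 by rewrite mulf_neq0// lt0r_neq0.
  rewrite exprD !exprVn; move: (expf_neq0 d w0) (expf_neq0 d.+2 w0).
  move: (_ ^+ d) (_ ^+ d.+2) => a b a0 b0; field.
  by rewrite a0 b0.
move=> ->.
have TT : (T / (th * T)) `^ beta <= th^-1 ^+ d.
  have -> : T / (th * T) = th^-1 by field; rewrite !lt0r_neq0.
  rewrite -powR_mulrn ?invr_ge0 ?(ltW th0)//; apply: ler_powR; last exact: ltW.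
  by rewrite invf_ge1.
have {}GG : G (th * T) <= B * th^-1 ^+ d * G T.
  apply: le_trans GG _; rewrite ler_wpM2r ?(ltW GT)// ler_wpM2l ?(ltW B0)//.
have pt : 0 <= (2 * th) ^+ d.+2 by rewrite exprn_ge0// mulr_ge0// ltW.
apply: (@le_trans _ _ (C2 * (B * th^-1 ^+ d * G T) * (2 * th) ^+ d.+2)).
  by rewrite ler_wpM2r// ler_wpM2l ?(ltW C20).
have -> : C2 * (B * th^-1 ^+ d * G T) * (2 * th) ^+ d.+2 =
   C2 * B * 2 ^+ d.+2 * (th * th) * G T.
  rewrite exprMn (_ : th ^+ d.+2 = th ^+ d * (th * th)); last by rewrite !exprSr mulrA.
  rewrite exprVn; have : th ^+ d != 0 by rewrite expf_neq0// lt0r_neq0.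
  by move: (th ^+ d) => w w0; field.
rewrite ler_wpM2r ?(ltW GT)//.
apply: (@le_trans _ _ (C2 * B * 2 ^+ d.+2 * th)).
  by rewrite ler_wpM2l ?(ltW p0)// ler_piMl// ltW.
by rewrite ler_wpM2r ?(ltW th0)// /C lerDr ltW.
Qed.

(** Three losses in the real part of the transform: [e] from [t], then the phases of the mollifier,
    then rounding. Squaring doubles them. *)
Lemma push_lower Cm L h u e (C0 : R) (t mm : seq (R * 'rV[R]_d)) (l : 'rV[R]_d) : 0 < u -> 0 < h -> h <= 1 ->
  weighted_prob mm -> supp_in mm (eball (Cm * L)) -> mass t <= C0 ->
  (forall l, ssum t l = 0) -> (forall l, 0 <= csum t l <= 1) ->
  1 - e <= csum t (u *: l) ->
  1 - 2 * (e + 2 * pi * (Cm * L) * (u * enorm l) +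
           2 * pi * Num.sqrt d%:R * C0 * enorm l) <=
  pow (push (fun x => round h (u *: x)) (conv t mm)) l.
Proof.
move=> u0 h0 h1 pm sm tC ts tc te; set f := fun x => _.
set sd := Num.sqrt _; have sd0 : 0 <= sd by exact: sqrtr_ge0.
set dl := e + _ + _.
have hc : 1 - dl <= csum (push f (conv t mm)) l.
  have := @csum_push _ _ (conv t mm) l u sd f (fun a _ => round_dist (u *: a.2) h0 h1).
  rewrite mass_conv (mass_prob pm) mulr1 csum_conv ts mul0r subr0.
  rewrite ler_norml => /andP[k1 _].
  have k2 := csum_ge_prob (u *: l) pm sm; rewrite enormZ (gtr0_norm u0) in k2.
  have k3 : `|(1 - csum t (u *: l)) * csum mm (u *: l)| <= e.
    rewrite normrM -[leRHS]mulr1 ler_pM//; last first.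
      by have := csum_le_mass mm (u *: l); rewrite mass_prob.
    have /andP[a b] := tc (u *: l).
    by rewrite ger0_norm ?subr_ge0// lerBlDr addrC -lerBlDr.
  have k4 : 2 * pi * sd * mass t * enorm l <= 2 * pi * sd * C0 * enorm l.
    by rewrite ler_wpM2r ?enorm_ge0// ler_wpM2l// !mulr_ge0 ?pi_ge0.
  move: k3; rewrite mulrBl mul1r ler_norml => /andP[_ k3].
  by rewrite /dl; move: k1 k2 k3 k4; clra.
rewrite /pow; set x := csum _ l in hc *.
have : 0 <= ssum (push f (conv t mm)) l ^+ 2 by exact: sqr_ge0.
have : 1 - 2 * dl <= x ^+ 2.
  have [k|k] := leP dl 1.
    have : (1 - dl) ^+ 2 <= x ^+ 2 by apply: lerXn2r; rewrite ?nnegrE; move: hc k; clra.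
    have : 0 <= dl ^+ 2 by exact: sqr_ge0.
    by rewrite sqrrB expr1n mul1r mulr_natl; clra.
  by apply: le_trans (sqr_ge0 _); move: k; clra.
clra.
Qed.

Lemma small_scale (e C Cm ka : R) : 0 < e -> 0 < C -> 0 < Cm -> 0 < ka ->
  exists th, [/\ 0 < th, th <= 2^-1, C * th <= e / 4, 2 * (2 * pi * Cm * th) <= e / 4
    & (pi * th ^+ 2) ^+ 2 <= ka].
Proof.
move=> e0 C0 Cm0 ka0; have p := pi_gt0 R.
pose P := 2 * (2 * pi * Cm); have P0 : 0 < P by rewrite !mulr_gt0.
pose Q := (pi : R) ^+ 2; have Q0 : 0 < Q by rewrite exprn_gt0.
pose th := Num.min 2^-1 (Num.min (e / 4 / C) (Num.min (e / 4 / P) (ka / Q))).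
have [h1 h2 h3 h4] : [/\ th <= 2^-1, th <= e / 4 / C, th <= e / 4 / P & th <= ka / Q].
  by rewrite !ge_min !lexx ?orbT.
have th0 : 0 < th by rewrite !lt_min invr_gt0 !divr_gt0//= ltr0n.
exists th; split => //.
- by rewrite mulrC -ler_pdivlMr.
- have -> : 2 * (2 * pi * Cm * th) = th * P by rewrite /P; ring.
  by rewrite -ler_pdivlMr.
apply: (@le_trans _ _ (th * Q)); last by rewrite -ler_pdivlMr.
rewrite exprMn mulrC -/Q ler_wpM2r ?(ltW Q0)// -exprM -[leRHS]expr1.
by apply: ler_wiXn2l => //; [exact: ltW|rewrite (le_trans h1)// invf_le1// ler1n].
Qed.

(** With [t] almost 1 on B(rho/T) and almost 0 from norm 1/T on, the measure dilated by u = v rho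
    has a transform almost 1 on B(1/(vT)). Its energy is therefore nearly an upper bound for
    m(1/(vT)), and it is close to u^(-alpha) times an energy that hardly exceeds m(1/T); finally
    [rho] is close to 1. *)
Lemma kernel_RVup : (forall r, 0 < r -> 0 < m r) ->
  RVup (fun T => m T^-1) (- alpha).
Proof.
move=> mpos v e v0 e0; have p := pi_gt0 R.
have va : 0 < v `^ (- alpha) by rewrite powR_gt0.
have e20 : 0 < e / 2 by rewrite divr_gt0.
have [g g0 hg] := powR_continuity_pt (- alpha) v0 e20.
have [rho [rho0 rho1 rhov]] : exists rho, [/\ 0 < rho, rho < 1 &
    (v * rho) `^ (- alpha) <= v `^ (- alpha) + e / 2].
  have [k [k0 k1 k2]] : exists k, [/\ 0 < k, k <= 2^-1 & k <= g / v].
    exists (Num.min 2^-1 (g / v)); split.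
    - by rewrite lt_min invr_gt0 ltr0n divr_gt0.
    - by rewrite ge_min lexx.
    - by rewrite ge_min lexx orbT.
  have kk : 0 < 1 - k by move: k1; clra.
  exists (1 - k); split => //; first by rewrite ltrBlDr ltrDl.
  have vk : 0 < v * (1 - k) by rewrite mulr_gt0.
  have := hg _ vk; rewrite (_ : v * (1 - k) - v = - (k * v)); last by ring.
  rewrite normrN ger0_norm ?mulr_ge0 ?(ltW k0) ?(ltW v0)// -ler_pdivlMr// => /(_ k2).
  by rewrite ler_norml => /andP[_]; clra.
set u := v * rho in rhov; have u0 : 0 < u by rewrite mulr_gt0.
have ua : 0 < u `^ (- alpha) by rewrite powR_gt0.
have [X1 [c [X10 c0 hlow]]] := ball_lower.
have [W W0 WE] : exists2 W, 0 < W & W = (u `^ (- alpha) + 1) / c.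
  by eexists; last reflexivity; rewrite divr_gt0// addr_gt0.
have [a a0 aE] : exists2 a, 0 < a & a = v `^ (- alpha) + e.
  by eexists; last reflexivity; rewrite addr_gt0.
have [ep [ep0 ep1 epE]] : exists ep, [/\ 0 < ep, ep <= 2^-1 & ep * (W + a) <= e / 2].
  exists (Num.min 2^-1 (e / 2 / (W + a))); split.
  - by rewrite lt_min invr_gt0 ltr0n divr_gt0// addr_gt0.
  - by rewrite ge_min lexx.
  - by rewrite -ler_pdivlMr ?addr_gt0// ge_min lexx orbT.
have [Cm Cm0 hm] := @mollifier R d d.+1 isT d0.
have [C1 C10 hup] := step_energy_upper Cm0.
have ka0 : 0 < (1 - rho) / 2 by rewrite divr_gt0// subr_gt0.
have [th [th0 th2 thC thm thk]] := small_scale ep0 C10 Cm0 ka0.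
have t20 : 0 < th ^+ 2 by rewrite exprn_gt0.
have [rho' [rr rho'1 rE]] : exists r, [/\ rho < r, r < 1 & r = (1 + rho) / 2].
  by exists ((1 + rho) / 2); split => //; move: rho1; clra.
have rho'0 : 0 < rho' by rewrite (lt_trans rho0).
have pk : (pi * (rho' * th ^+ 2)) ^+ 2 <= (1 - rho) / 2.
  apply: le_trans thk; apply: lerXn2r; rewrite ?nnegrE.
  - exact: mulr_ge0 (ltW p) (mulr_ge0 (ltW rho'0) (ltW t20)).
  - exact: mulr_ge0 (ltW p) (ltW t20).
  - by rewrite ler_wpM2l ?(ltW p)// ler_piMl ?(ltW t20)// ltW.
have pk1 : (pi * (rho' * th ^+ 2)) ^+ 2 <= 1.
  by apply: le_trans pk _; clear -alpha0 alphabeta betad Gpos hG hF beta0 potterG carrier rho0; lra.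
have gap : rho < rho' * (1 - (pi * (rho' * th ^+ 2)) ^+ 2 / 2).
  have : rho' * (1 - (1 - rho) / 4) <= rho' * (1 - (pi * (rho' * th ^+ 2)) ^+ 2 / 2).
    by rewrite ler_wpM2l ?(ltW rho'0)//; move: pk; clra.
  apply: lt_le_trans; rewrite mulrBr mulr1.
  have : rho' * ((1 - rho) / 4) <= 1 * ((1 - rho) / 4).
    by rewrite ler_wpM2r ?(ltW rho'1)// divr_ge0// subr_ge0 ltW.
  by rewrite mul1r; move: rE rho1; clra.
have [D1 D10 D1E] : exists2 D1, 0 < D1 & D1 = C1 * (2 * th ^+ 2)^-1 ^+ d.
  eexists; last reflexivity; apply: mulr_gt0 => //.
  by rewrite exprn_gt0// invr_gt0 mulr_gt0.
have [eq [eq0 eq1 eqE]] : exists eq, [/\ 0 < eq, eq <= ep / 8 & eq * D1 <= ep / 4].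
  exists (Num.min (ep / 8) (ep / 4 / D1)); split.
  - by rewrite lt_min !divr_gt0.
  - by rewrite ge_min lexx.
  - by rewrite -ler_pdivlMr// ge_min lexx orbT.
have eq11 : eq <= 1 by move: eq1 ep1; clra.
(* [t] is fixed before [T]: its mass and the radius of its support do not vary with [T], as
   [signed_transfer] demands. *)
have [t [ts tg tc tin tout]] := @ball_step R d d0 rho rho' th eq rho0 rr th0 pk1 gap eq0 eq11.
have [J J0 hJ] := supp_radius t.
have [X2 [X20 hX2]] := hup th th0 th2.
have [X3 [X30 hX3]] := signed_transfer d.+1 Cm0 u0 (mass_ge0 t) J0 th0 ep0.
have [q1 q2] : 0 < th^-1 /\ 0 < ((1 - rho') * th ^+ 2)^-1.
  by rewrite !invr_gt0 mulr_gt0// subr_gt0.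
have [Z Z0 ZE] : exists2 Z, 0 <= Z & Z = 2 * (2 * pi * Num.sqrt d%:R * mass t).
  by eexists; last reflexivity; rewrite !mulr_ge0 ?mass_ge0// ltW.
have q3 : 0 <= Z * 4 / (ep * v).
  by rewrite divr_ge0 ?mulr_ge0 ?(ltW ep0) ?(ltW v0).
pose X := X1 + X2 + X3 + th^-1 + ((1 - rho') * th ^+ 2)^-1 + Z * 4 / (ep * v).
exists X; split.
  by rewrite /X; move: X10 X20 X30 q1 q2 q3; clra.
move=> T XT.
have [X1T X2T X3T] : [/\ X1 <= T, X2 <= T & X3 <= T].
  by clear -alpha0 alphabeta betad Gpos hG hF beta0 potterG carrier XT X10 X20 X30 q1 q2 q3;
    rewrite /X in XT; split; lra.
have [X4T X5T X6T T0] : [/\ th^-1 <= T, ((1 - rho') * th ^+ 2)^-1 <= T,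
    Z * 4 / (ep * v) <= T & 0 < T].
  by clear -alpha0 alphabeta betad Gpos hG hF beta0 potterG carrier XT X10 X20 X30 q1 q2 q3;
    rewrite /X in XT; split; lra.
have thT : 1 <= th * T by rewrite mulrC -ler_pdivrMr// div1r.
have GT := Gpos T0.
have epG : 0 < ep / 4 * G T by rewrite mulr_gt0// divr_gt0.
have [h [gh hcube]] := @grid_fine _ _ mu D (ep / 4 * G T) carrier epG.
have [h0 h1 hsites] := gh.
have [mm Mm] := hm (th * T) h thT h0 h1; have [pm gm sm smm fm] := Mm.
(* An integer, so that the dilated points stay in Z^d; the room between [rho'] and 1 absorbs the
   truncation. *)
pose N : nat := Num.truncn (th ^+ 2 * T).
have N1 : N%:R <= th ^+ 2 * T.
  by have /andP[] := truncn_itv (ltW (mulr_gt0 t20 T0)).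
have N2 : th ^+ 2 * T < N%:R + 1 by have := truncnS_gt (th ^+ 2 * T); rewrite -natr1.
pose tN := push (fun x => N%:R *: x) t.
have tNs l : ssum tN l = 0 by rewrite ssum_push_scale.
have tNc l : 0 <= csum tN l <= 1 by rewrite csum_push_scale.
have tN_in l : enorm l <= rho / T -> 1 - eq <= csum tN l.
  move=> lr; rewrite csum_push_scale; apply: tin; rewrite enormZ normr_nat.
  apply: le_trans (ler_pM _ _ N1 lr) _ => //; first exact: enorm_ge0.
  by rewrite le_eqVlt; apply/orP; left; apply/eqP; field; rewrite lt0r_neq0.
have tN_out l : T^-1 < enorm l -> enorm l <= (2 * th)^-1 / (th * T) -> csum tN l <= eq.
  move=> l1 l2; rewrite csum_push_scale; apply: tout => [i|].
    rewrite mxE normrM normr_nat.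
    have l3 := le_trans (coord_le_enorm l i) l2.
    apply: le_trans (ler_pM _ _ N1 l3) _ => //.
    by rewrite le_eqVlt; apply/orP; left; apply/eqP; field; rewrite !lt0r_neq0.
  rewrite enormZ normr_nat; apply: (@le_trans _ _ (N%:R * T^-1)); last first.
    by rewrite ler_wpM2l// ltW.
  rewrite ler_pdivlMr//.
  have : 1 <= (1 - rho') * th ^+ 2 * T.
    by rewrite mulrC -ler_pdivrMr ?mulr_gt0 ?subr_gt0// div1r.
  rewrite mulrBl mul1r mulrBl; move: N2; clra.
have tNm : mass tN <= mass t by rewrite mass_push.
have tNsupp : supp_in tN (ball_in D (J * T)).
  move=> _ /mapP[x xt ->] /=; split.
    rewrite /eball /= enormZ normr_nat mulrC; apply: ler_pM; rewrite ?enorm_ge0//.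
      exact: hJ.
    apply: le_trans N1 _; rewrite ler_piMl ?(ltW T0)// exprn_ile1 ?(ltW th0)//.
    by move: th2; clra.
  have [_ _ hs1] := grid_for1; apply: hs1 => i.
  by have [z hz] := tg _ xt i; exists (N%:Z * z); rewrite mxE hz !mul1r intrM.
have up := hX2 T h mm tN eq X2T Mm (ltW eq0) eq11 tNs tNc tN_out.
have {}up : \int[mu]_l pow (conv tN mm) l <= m T^-1 + ep * G T.
  apply: le_trans up _; rewrite -addrA lerD2l.
  have k1 : (eq * C1 * (2 * th ^+ 2)^-1 ^+ d + C1 * th) * G T <= (ep / 4 + ep / 4) * G T.
    by rewrite ler_wpM2r ?(ltW GT)// lerD// -mulrA -D1E.
  by move: k1 hcube epG; clra.
have := hX3 T h tN mm X3T gh tNm tNsupp Mm.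
rewrite ler_norml => /andP[_]; rewrite lerBlDr => st.
set s' := push _ _ in st.
have vT : 0 < v * T by rewrite mulr_gt0.
have lo : (1 - ep) * m (v * T)^-1 <= \int[mu]_l pow s' l.
  have mB : measurable (eball (v * T)^-1 : set (Borel R d)) by exact: measurable_eball.
  apply: (@le_trans _ _ (\int[mu]_(l in eball (v * T)^-1) pow s' l)); last first.
    by apply: Rint_subset => //; [exact: bm_pow|move=> l _; exact: pow_ge0].
  apply: Rint_ge_cst => // [|l lv]; first exact: bm_pow.
  have ulT : u * enorm (l : 'rV[R]_d) <= rho / T.
    apply: le_trans (ler_wpM2l (ltW u0) lv) _.
    by rewrite le_eqVlt; apply/orP; left; apply/eqP; rewrite /u; field; rewrite !lt0r_neq0.
  have tl : 1 - eq <= csum tN (u *: l) by apply: tN_in; rewrite enormZ (gtr0_norm u0).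
  apply: le_trans (@push_lower Cm (th * T) h u eq (mass t) tN mm l u0 h0 h1 pm sm tNm tNs tNc tl).
  have k1 : 2 * pi * (Cm * (th * T)) * (u * enorm (l : 'rV[R]_d)) <= 2 * pi * Cm * th.
    apply: (@le_trans _ _ (2 * pi * (Cm * (th * T)) * (1 / T))).
      rewrite ler_wpM2l ?mulr_ge0 ?(ltW p) ?(ltW Cm0) ?(ltW th0) ?(ltW T0)//.
      by apply: le_trans ulT _; rewrite ler_wpM2r ?invr_ge0 ?(ltW T0)// ltW.
    by rewrite le_eqVlt; apply/orP; left; apply/eqP; move: (pi : R) => pp; field; rewrite lt0r_neq0.
  have k2 : Z * enorm (l : 'rV[R]_d) <= ep / 4.
    apply: le_trans (ler_wpM2l Z0 lv) _; rewrite ler_pdivrMr//.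
    move: X6T; rewrite ler_pdivrMr ?mulr_gt0// => X6T.
    by move: X6T; clra.
  have k3 : 2 * (2 * pi * Num.sqrt d%:R * mass t * enorm (l : 'rV[R]_d)) <= ep / 4.
    by rewrite mulrA -ZE.
  have gen (y1 y2 y3 : R) : y1 <= y3 -> 2 * y2 <= ep / 4 -> 2 * y3 <= ep / 4 ->
      1 - ep <= 1 - 2 * (eq + y1 + y2) by move: eq1 ep0; clra.
  exact: gen k1 k3 thm.
have GM := hlow T X1T.
have ME : ep * G T * (u `^ (- alpha) + 1) <= ep * W * m T^-1.
  rewrite WE; have -> : ep * ((u `^ (- alpha) + 1) / c) * m T^-1 =
    ep * (u `^ (- alpha) + 1) * (m T^-1 / c) by ring.
  rewrite mulrAC; apply: ler_wpM2l; last by rewrite ler_pdivlMr// mulrC.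
  by rewrite mulr_ge0 ?(ltW ep0)// ltW// addr_gt0.
have MT : 0 < m T^-1 by rewrite mpos// invr_gt0.
have ep2 : 0 < 1 - ep by move: ep1; clra.
rewrite -aE -(ler_pM2l ep2); apply: le_trans lo _.
have {}up := ler_wpM2l (ltW ua) up.
apply: (@le_trans _ _ ((u `^ (- alpha) + ep * W) * m T^-1)).
  by move: st up ME; clra.
rewrite mulrA ler_wpM2r ?(ltW MT)//.
by move: rhov epE aE; clra.
Qed.

End kernel_bounds.

(* [lebesgue_rV] is a bare set function: the change of variables is proved
   without additivity. *)
Section raw_integral.
Context {disp : measure_display} {T : measurableType disp} {R : realType}.
Variable mu : set T -> \bar R.
Hypothesis mu_set0 : mu set0 = 0%E.
Hypothesis mu_ge0 : forall A, (0 <= mu A)%E.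
Import HBSimple HBNNSimple.
Local Open Scope ereal_scope.

Lemma nnsfun_of (h : T -> R) : measurable_fun setT h -> finite_set (range h) ->
  (forall x, 0 <= h x)%R -> exists g : {nnsfun T >-> R}, g = h :> (T -> R).
Proof.
move=> mh fh h0.
pose m1 := isMeasurableFun.Build _ _ _ _ h mh.
pose m2 := FiniteImage.Build _ _ h fh.
pose m3 := isNonNegFun.Build _ _ h h0.
pose g : {nnsfun T >-> R} := HB.pack h m1 m2 m3.
by exists g.
Qed.

Lemma sintegral_term_ge0 (h : {nnsfun T >-> R}) x :
  0 <= x%:E * mu (h @^-1` [set x]).
Proof.
have [x0|x0] := leP 0%R x; first by rewrite mule_ge0.
rewrite (_ : _ @^-1` _ = set0) ?mu_set0 ?mule0//.
apply/seteqP; split => // t /= htx; move: x0; rewrite -htx ltNge => /negP; apply.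
exact: fun_ge0.
Qed.

Lemma sintegral_scale_indic (c : R) A : (0 <= c)%R ->
  sintegral mu (fun x => c * \1_A x)%R = c%:E * mu A.
Proof.
rewrite le_eqVlt => /predU1P[<-|c0].
  rewrite mul0e sintegralET fsbig1// => x _.
  have [->|x0] := eqVneq x 0%R; first by rewrite mul0e.
  rewrite (_ : _ @^-1` _ = set0) ?mu_set0 ?mule0//.
  by apply/seteqP; split => // t /=; rewrite mul0r => /esym/eqP; rewrite (negbTE x0).
rewrite sintegralET -(fsbig_widen [set c]) ?fsbig_set1//.
  congr (_ * mu _); apply/seteqP; split => t /=; rewrite indicE.
    case: (boolP (t \in A)) => [/set_mem//|_]; rewrite mulr0 => /esym/eqP.
    by rewrite gt_eqF.
  by move=> /mem_set ->; rewrite mulr1.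
move=> x [_ /= xc]; have [->|x0] := eqVneq x 0%R; first by rewrite mul0e.
rewrite (_ : _ @^-1` _ = set0) ?mu_set0 ?mule0//.
apply/seteqP; split => // t /=; rewrite indicE; case: (t \in A) => /=.
  by rewrite mulr1 => cx; apply: xc.
by rewrite mulr0 => /esym/eqP; rewrite (negbTE x0).
Qed.

Lemma raw_integralE D f : (forall x, D x -> 0 <= f x) ->
  integral mu D f = ereal_sup [set sintegral mu h |
    h in [set h : {nnsfun T >-> R} | forall x, (h x)%:E <= (f \_ D) x]].
Proof.
move=> f0; have fD x : 0 <= (f \_ D) x.
  by rewrite patchE; case: ifP => // /set_mem/f0.
rewrite /integral.
have -> : (f \_ D)^\+ = f \_ D.
  by apply/funext => x; rewrite (@ge0_funeposE _ _ setT)// inE.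
have -> : (f \_ D)^\- = cst 0.
  by apply/funext => x; rewrite (@ge0_funenegE _ _ setT)// inE.
rewrite [X in _ - X](_ : _ = 0) ?sube0//.
apply/eqP; rewrite eq_le; apply/andP; split.
  apply/ge_ereal_sup => /= _ [h /= h0 <-].
  have hE x : h x = 0%R.
    by apply/eqP; rewrite eq_le fun_ge0 andbT -lee_fin h0.
  rewrite sintegralET fsbig1// => x _.
  have [->|x0] := eqVneq x 0%R; first by rewrite mul0e.
  rewrite (_ : _ @^-1` _ = set0) ?mu_set0 ?mule0//.
  by apply/seteqP; split => // t /=; rewrite hE => /esym/eqP; rewrite (negbTE x0).
apply: ereal_sup_ubound; exists nnsfun0 => //.
rewrite sintegralET fsbig1// => x _.
have [->|x0] := eqVneq x 0%R; first by rewrite mul0e.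
rewrite (_ : _ @^-1` _ = set0) ?mu_set0 ?mule0//.
by apply/seteqP; split => // t /= /esym/eqP; rewrite (negbTE x0).
Qed.

Lemma raw_integral_ge D f (c : R) A : (forall x, D x -> 0 <= f x) -> (0 <= c)%R ->
  measurable A -> A `<=` D -> (forall x, A x -> c%:E <= f x) ->
  c%:E * mu A <= integral mu D f.
Proof.
move=> f0 c0 mA AD fA; rewrite raw_integralE// -sintegral_scale_indic//.
have mh : measurable_fun setT (fun x => c * \1_A x)%R.
  by apply: measurable_funM; [exact: measurable_cst|exact: measurable_indic].
have fh : finite_set (range (fun x => c * \1_A x)%R).
  apply: (@sub_finite_set _ _ ([set 0; c])%R); last exact: finite_set2.
  move=> _ [x _ <-]; rewrite indicE; case: (x \in A) => /=; [right|left].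
    by rewrite mulr1.
  by rewrite mulr0.
have h0 x : (0 <= c * \1_A x)%R by rewrite mulr_ge0.
have [g gE] := nnsfun_of mh fh h0.
apply: ereal_sup_ubound; exists g => /=; last by rewrite gE.
move=> x; rewrite gE indicE patchE; case: (boolP (x \in A)) => xA.
  by rewrite mulr1 mem_set ?fA//; [exact: set_mem|apply: AD; exact: set_mem].
by rewrite mulr0; case: ifP => // /set_mem/f0.
Qed.

Lemma raw_integral_ge0 D f : (forall x, D x -> 0 <= f x) -> 0 <= integral mu D f.
Proof.
move=> f0; have := @raw_integral_ge D f 0%R set0 f0 (lexx _) measurable0.
by rewrite mul0e; apply => // x [].
Qed.

Lemma raw_integral_point p f : mu [set p] = 0 -> 0 <= f p ->
  integral mu [set p] f = 0.
Proof.
move=> mup fp; have f0 x : [set p] x -> 0 <= f x by move=> ->.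
apply/eqP; rewrite eq_le raw_integral_ge0// andbT raw_integralE//.
apply/ge_ereal_sup => /= _ [h /= hf <-]; rewrite sintegralET fsbig1// => x _.
have [->|x0] := eqVneq x 0%R; first by rewrite mul0e.
have hp t : h t = x -> t = p.
  move=> htx; apply: contrapT => tp; have := hf t.
  rewrite patchE memNset//= lee_fin => ht; move/eqP : x0; apply.
  by rewrite -htx; apply/eqP; rewrite eq_le ht fun_ge0.
have [hx|hx] := pselect (h p = x).
  rewrite (_ : _ @^-1` _ = [set p]) ?mup ?mule0//.
  by apply/seteqP; split => [t /= /hp|t /= ->].
rewrite (_ : _ @^-1` _ = set0) ?mu_set0 ?mule0//.
by apply/seteqP; split => // t /= htx; apply: hx; rewrite -(hp _ htx).
Qed.

(** A simple function below [f] is carried by [s'] and divided by [c] to one below [g], and the two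
    sums are compared level by level. Levels of positive value lie in [E], where the bound on [mu]
    applies. *)
Lemma raw_integral_scale (s s' : T -> T) (k c : R) D E f g :
  measurable_fun setT s' -> cancel s s' -> cancel s' s -> (0 <= k)%R -> (0 < c)%R ->
  (forall A, measurable A -> A `<=` E -> mu (s @^-1` A) <= k%:E * mu A) ->
  (forall x, D x -> 0 <= f x) -> (forall x, E x -> 0 <= g x) ->
  (forall x, D x -> E (s x) /\ f x <= c%:E * g (s x)) ->
  integral mu D f <= (k * c)%:E * integral mu E g.
Proof.
move=> ms' sK s'K k0 c0 hk f0 g0 fg; rewrite !raw_integralE//.
apply/ge_ereal_sup => /= _ [h /= hf <-].
have ci : (0 <= c^-1)%R by rewrite invr_ge0 ltW.
have mh : measurable_fun setT (fun y => c^-1 * h (s' y))%R.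
  apply: measurable_funM; first exact: measurable_cst.
  exact: measurableT_comp.
have fh : finite_set (range (fun y => c^-1 * h (s' y))%R).
  apply: (@sub_finite_set _ _ ((fun z => c^-1 * z)%R @` range h)).
    by move=> _ [y _ <-]; exists (h (s' y)) => //; exists (s' y).
  by apply: finite_image; exact: fimfunP.
have h0 y : (0 <= c^-1 * h (s' y))%R by rewrite mulr_ge0.
have [h' h'E] := nnsfun_of mh fh h0.
have key : sintegral mu h <= (k * c)%:E * sintegral mu h'.
  rewrite !sintegralET ge0_mule_fsumr; last exact: sintegral_term_ge0.
  rewrite (reindex_fsbigT ( *%R c))/=; last first.
    by exists ( *%R c^-1)%R; [exact: mulKf (lt0r_neq0 c0)|exact: mulVKf (lt0r_neq0 c0)].
  have hE x : h @^-1` [set (c * x)%R] = s @^-1` (h' @^-1` [set x]).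
    apply/seteqP; split => t /=; rewrite h'E sK.
      by move=> ->; rewrite mulKf// lt0r_neq0.
    by move=> <-; rewrite mulVKf// lt0r_neq0.
  have out x : ~ range h' x -> h' @^-1` [set x] = set0.
    by move=> hx; apply/seteqP; split => // t /= htx; apply: hx; exists t.
  rewrite -(fsbig_widen (range h'))//; last first.
    by move=> x [_ /out h'x] /=; rewrite hE h'x preimage_set0 mu_set0 mule0.
  rewrite -[leRHS](fsbig_widen (range h'))//; last first.
    by move=> x [_ /out h'x] /=; rewrite h'x mu_set0 !mule0.
  apply: lee_fsum; first by rewrite h'E.
  move=> _ [t _ <-]; have [->|x0] := eqVneq (h' t) 0%R; first by rewrite mulr0 !mul0e mule0.
  have xp : (0 < h' t)%R by rewrite lt_def x0/=.
  rewrite hE; set A := h' @^-1` _.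
  have mA : measurable A.
    have mh' : measurable_fun setT h' by rewrite h'E.
    by rewrite -[X in measurable X]setTI; apply: mh' => //; exact: measurable_set1.
  have AE : A `<=` E.
    move=> y /= hy; have : (0 < h (s' y))%R.
      by move: xp; rewrite -hy h'E pmulr_rgt0// invr_gt0.
    rewrite -lte_fin => /lt_le_trans/(_ (hf (s' y))); rewrite patchE.
    by case: ifPn => [/set_mem/fg[]|_]; rewrite ?s'K ?ltxx.
  have cx : 0 <= (c * h' t)%:E by rewrite lee_fin mulr_ge0// ltW.
  apply: le_trans (lee_wpmul2l cx (hk _ mA AE)) _.
  by rewrite !muleA -!EFinM le_eqVlt; apply/orP; left; apply/eqP; congr (_%:E * _); ring.
apply: le_trans key _; rewrite lee_wpmul2l ?lee_fin ?mulr_ge0 ?(ltW c0)//.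
apply: ereal_sup_ubound; exists h' => //= y; rewrite h'E.
have := hf (s' y); rewrite !patchE; case: ifPn => [/set_mem Dy|_] hy.
  have [Ey fy] := fg _ Dy; rewrite s'K in Ey fy; rewrite mem_set//.
  have := lee_wpmul2l (_ : 0 <= c^-1%:E) (le_trans hy fy).
  by rewrite lee_fin muleA -!EFinM mulVf ?lt0r_neq0// mul1e; exact.
apply: (@le_trans _ _ 0); last by case: ifP => // /set_mem/g0.
by rewrite lee_fin mulr_ge0_le0// -lee_fin.
Qed.

End raw_integral.

(** * Dilations of d-dimensional Lebesgue measure *)

Section lebesgue_rV_facts.
Context {R : realType}.
Local Notation leb := (@lebesgue_measure R).

Lemma lebesgue_rV_ge0 d (A : set (Borel R d)) : (0 <= lebesgue_rV A)%E.
Proof.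
elim: d A => [|d ih] A //=; apply: integral_ge0 => t _; exact: ih.
Qed.

Lemma lebesgue_rV_set0 d : lebesgue_rV (set0 : set (Borel R d)) = 0%E.
Proof.
elim: d => [|d ih] /=; first by rewrite measure0.
by under eq_integral do rewrite ih; rewrite integral0.
Qed.

Lemma leb_raw_scale (u : R) : 0 < u -> forall A : set R, measurable A ->
  leb ((fun x : R => u * x) @^-1` A) = ((u^-1)%:E * leb A)%E.
Proof. by move=> u0 A mA; exact: lebesgue_measure_scale. Qed.

(** Induction on the dimension by slices. The measures of the slices are compared pointwise through
    [raw_integral_scale], which allows an arbitrary set [A]. *)
Lemma lebesgue_rV_scale_le d (u : R) (A : set (Borel R d)) : 0 < u ->
  (lebesgue_rV ((fun x : 'rV[R]_d => u *: x) @^-1` A) <=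
   (u^-1 ^+ d)%:E * lebesgue_rV A)%E.
Proof.
move=> u0; elim: d A => [|d ih] A.
  rewrite expr0 mul1e (_ : _ @^-1` A = A)//; apply/seteqP; split => y /=;
    by rewrite (_ : u *: y = y)//; apply/rowP => -[].
rewrite exprS /=.
apply: (@raw_integral_scale _ _ _ leb _ _ (fun t : R => u * t) (fun t : R => u^-1 * t)).
- by rewrite measure0.
- by [].
- by apply: measurable_funM; [exact: measurable_cst|exact: measurable_id].
- exact: mulKf (lt0r_neq0 u0).
- exact: mulVKf (lt0r_neq0 u0).
- by rewrite invr_ge0 ltW.
- by rewrite exprn_gt0// invr_gt0.
- by move=> B mB _; rewrite leb_raw_scale.
- by move=> t _; exact: lebesgue_rV_ge0.
- by move=> t _; exact: lebesgue_rV_ge0.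
move=> t _; split => //.
rewrite (_ : [set y | _] = (fun x : 'rV[R]_d => u *: x) @^-1`
  [set y : 'rV[R]_d | A (row_mx ((u * t)%:M : 'rV[R]_1) y)]); first exact: ih.
have sE y : u *: (row_mx (t%:M : 'rV[R]_1) y) = row_mx ((u * t)%:M : 'rV[R]_1) (u *: y).
  by rewrite scale_row_mx scale_scalar_mx.
by apply/seteqP; split => y /=; [rewrite -sE|rewrite -sE].
Qed.

(** The inequality for [u], together with the one for 1/u on the preimage. *)
Lemma lebesgue_rV_scale d (u : R) (A : set (Borel R d)) : 0 < u ->
  lebesgue_rV ((fun x : 'rV[R]_d => u *: x) @^-1` A) =
   ((u^-1 ^+ d)%:E * lebesgue_rV A)%E.
Proof.
move=> u0; apply/eqP; rewrite eq_le lebesgue_rV_scale_le//=.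
have ui : 0 < u^-1 by rewrite invr_gt0.
have := @lebesgue_rV_scale_le d u^-1 ((fun x : 'rV[R]_d => u *: x) @^-1` A) ui.
rewrite invrK (_ : _ @^-1` _ = A); last first.
  by apply/seteqP; split => y /=; rewrite scalerA divff ?scale1r// lt0r_neq0.
have up : (0 <= (u^-1 ^+ d)%:E)%E by rewrite lee_fin exprn_ge0// ltW.
move=> /(lee_wpmul2l up); rewrite muleA -EFinM -exprMn mulVf ?lt0r_neq0//.
by rewrite expr1n mul1e.
Qed.

Definition box d (a b : R) : set 'rV[R]_d := [set l | forall i, a <= l 0 i <= b].

Lemma measurable_box d a b : measurable (box a b : set (Borel R d)).
Proof.
rewrite (_ : box a b = \bigcap_(i in [set: 'I_d])
    [set l : 'rV[R]_d | l 0 i \in `[a, b]]).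
  by apply: fin_bigcap_measurable => // i _; exact: measurable_coord_itv.
apply/seteqP; split => l hl i; first by move=> _; rewrite /= in_itv /=; exact: hl.
by have := hl i I; rewrite /= in_itv.
Qed.

Lemma lebesgue_rV_box d a b : a <= b ->
  lebesgue_rV (box a b : set (Borel R d)) = ((b - a) ^+ d)%:E.
Proof.
move=> ab; elim: d => [|d ih] /=.
  by rewrite expr0 /dirac indicE mem_set// => -[].
transitivity (\int[leb]_(t in `[a, b]) (((b - a) ^+ d)%:E : \bar R))%E.
  rewrite [RHS]integral_mkcond; apply: eq_integral => t _.
  rewrite patchE; case: ifPn => [|/negP tab]; first rewrite inE /= in_itv /= => tab.
    rewrite (_ : [set y | _] = box a b) ?ih//.
    apply/seteqP; split => y /= hy i.
      by rewrite -(row_mxEr (t%:M : 'rV[R]_1) y 0 i); exact: hy.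
    have [j ->|j ->] := @split_ordP 1 d i; last by move: (hy j); rewrite -(row_mxEr (t%:M : 'rV[R]_1) y 0 j).
    rewrite (ord1 j); have := row_mxEl (t%:M : 'rV[R]_1) y 0 0; rewrite [RHS]mxE eqxx mulr1n => k.
    by move: tab; rewrite -[X in _ <= X <= _]k.
  rewrite (_ : [set y | _] = set0) ?lebesgue_rV_set0//.
  apply/seteqP; split => // y /= hy; apply: tab; apply: mem_set => /=.
  rewrite in_itv /=; have := row_mxEl (t%:M : 'rV[R]_1) y 0 0; rewrite [RHS]mxE eqxx mulr1n => k.
  by rewrite -[X in _ <= X <= _]k; exact: hy.
rewrite integral_cst; last exact: measurable_itv.
have E : leb `[a, b]%classic = (b - a)%:E.
  rewrite lebesgue_measure_itv /= lte_fin -EFinB; case: ltP => // ba.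
  by rewrite (_ : b - a = 0)//; apply/eqP; rewrite subr_eq0 eq_le ba ab.
apply: etrans (congr1 (fun z => (((b - a) ^+ d)%:E * z)%E) E) _.
by rewrite -EFinM mulrC -exprS.
Qed.

Lemma lebesgue_rV_origin d : (0 < d)%N ->
  lebesgue_rV ([set 0] : set (Borel R d)) = 0%E.
Proof.
case: d => // d _; rewrite (_ : [set 0] = box 0 0).
  by rewrite lebesgue_rV_box// subrr exprS mul0r.
apply/seteqP; split => y /=; first by move=> -> i; rewrite mxE lexx.
by move=> h; apply/rowP => i; rewrite mxE; apply/eqP; rewrite eq_le andbC; exact: h.
Qed.

Lemma Gamma_ge0 (s : R) : 0 <= Gamma s.
Proof.
apply: Rintegral_ge0 => t _; rewrite mulr_ge0 ?powR_ge0//; exact: expR_ge0.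
Qed.

Lemma riesz_A_ge0 (alpha : R) d : 0 <= alpha -> 0 <= riesz_A alpha d.
Proof.
move=> a0; rewrite /riesz_A divr_ge0 ?mulr_ge0 ?Gamma_ge0 ?powR_ge0//.
Qed.

Lemma riesz_B_ge0 (alpha : R) d : 0 <= riesz_B alpha d.
Proof. by rewrite /riesz_B divr_ge0 ?mulr_ge0 ?Gamma_ge0 ?powR_ge0. Qed.

Lemma scale_measurable d (u : R) :
  measurable_fun setT ((fun x : 'rV[R]_d => u *: x) : Borel R d -> Borel R d).
Proof. by apply: continuous_Borel_map; exact: scaler_continuous. Qed.

Lemma riesz_measure_ball_le (alpha : R) d (r u : R) : (0 < d)%N -> 0 < alpha ->
  alpha < d%:R -> 0 < u ->
  (riesz_measure alpha (eball (u * r) : set (Borel R d)) <=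
   (u `^ alpha)%:E * riesz_measure alpha (eball r : set (Borel R d)))%E.
Proof.
move=> d0 a0 ad u0; rewrite /riesz_measure gt_eqF//.
have ui : 0 < u^-1 by rewrite invr_gt0.
have -> : u `^ alpha = u^-1^-1 ^+ d * u `^ (alpha - d%:R).
  rewrite invrK -powR_mulrn ?(ltW u0)// -powRD ?subrKC//.
  by apply/implyP => _; rewrite lt0r_neq0.
have rp l : (0 <= (riesz_density alpha (l : 'rV[R]_d))%:E)%E.
  by rewrite lee_fin mulr_ge0 ?powR_ge0 ?riesz_A_ge0// ltW.
apply: (@raw_integral_scale _ _ _ (@lebesgue_rV R d) _ _
  (fun x : 'rV[R]_d => u^-1 *: x) (fun x : 'rV[R]_d => u *: x)) => //.
- exact: lebesgue_rV_set0.
- exact: lebesgue_rV_ge0.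
- exact: scale_measurable.
- by move=> x; rewrite scalerA divff ?scale1r// lt0r_neq0.
- by move=> x; rewrite scalerA mulVf ?scale1r// lt0r_neq0.
- by rewrite exprn_ge0// invrK ltW.
- by rewrite powR_gt0.
- by move=> A mA _; rewrite lebesgue_rV_scale.
move=> l lr; split.
  by rewrite /eball /= enormZ (gtr0_norm ui) mulrC ler_pdivrMr// mulrC.
rewrite -EFinM lee_fin /riesz_density mulrCA ler_wpM2l ?riesz_A_ge0 ?(ltW a0)//.
rewrite enormZ (gtr0_norm ui) powRM ?invr_ge0 ?(ltW u0) ?enorm_ge0// mulrA.
by rewrite -powRM ?invr_ge0 ?(ltW u0)// divff ?lt0r_neq0// powR1 mul1r.
Qed.

End lebesgue_rV_facts.

Lemma nbhs0_eball (R : realType) d (P : set 'rV[R]_d) :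
  nbhs (0 : 'rV[R]_d) P ->
  exists2 r, 0 < r & forall x : 'rV[R]_d, enorm x <= r -> P x.
Proof.
move=> /nbhs_ballP[e /= e0 he]; exists (e / 2); first by rewrite divr_gt0.
move=> x xe; apply: he; split => // i j; rewrite (ord1 i) /ball /= mxE sub0r normrN.
apply: le_lt_trans (coord_le_enorm x j) _; apply: le_lt_trans xe _.
by rewrite ltr_pdivrMr// ltr_pMr// ltr1n.
Qed.

Lemma slowly_varying_inv (R : realType) (w : R -> R) :
  slowly_varying (at_right 0) w -> slowly_varying (pinfty_nbhs R) (fun T => w T^-1).
Proof.
move=> [mw wpos hw]; split.
- apply: (@measurable_comp _ _ _ _ _ _ (`]0, +oo[%classic : set R) w _ (fun x : R => x^-1)) => //.
    by move=> _ [x /= + <-]; rewrite !in_itv /= !andbT invr_gt0.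
  apply: (eq_measurable_fun (fun x : R => x `^ (-1))); last exact: measurable_funTS (measurable_powR _).
  by move=> x; rewrite inE /= in_itv /= andbT => x0; rewrite powR_inv1// ltW.
- by move=> x x0; apply: wpos; rewrite invr_gt0.
move=> u u0; have ui : 0 < u^-1 by rewrite invr_gt0.
apply/cvgrPdist_le => e e0; have /cvgrPdist_le/(_ e e0) := hw _ ui.
move=> [r /= r0 hr]; exists (2 / r); split; first exact: num_real.
move=> T rT; have T0 : 0 < T by apply: lt_trans rT; rewrite divr_gt0.
have := hr T^-1; rewrite /= sub0r normrN gtr0_norm ?invr_gt0// invfM; apply => //.
rewrite invf_plt ?posrE//; apply: lt_trans rT.
by rewrite -[ltLHS]mul1r ltr_pM2r ?invr_gt0// ltr1n.
Qed.

(** * Regularly varying densities *)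

Section density.
Context {R : realType} {d : nat} (alpha : R).
Context (mu : {finite_measure set (Borel R d) -> \bar R}).
Hypothesis d0 : (0 < d)%N.
Hypothesis alpha0 : 0 < alpha.
Hypothesis alphad : alpha < d%:R.
Variables (U : set 'rV[R]_d) (rho : 'rV[R]_d -> R) (w : R -> R).
Hypothesis oU : open U.
Hypothesis U0 : U 0.
Hypothesis hrho : has_density_on mu U rho.
Hypothesis sw : slowly_varying (at_right 0) w.
Hypothesis hW : rho x / riesz_density alpha x / w (enorm x)
  @[x --> dnbhs (0 : 'rV[R]_d)] --> (1 : R).

Let m (r : R) : R := fine (mu (eball r)).
Let A := riesz_A alpha d.

Lemma density_approx e : 0 < e -> exists2 r, 0 < r & forall l : 'rV[R]_d, l != 0 ->
  enorm l <= r -> U l /\ `|rho l / riesz_density alpha l / w (enorm l) - 1| <= e.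
Proof.
move=> e0; move/cvgrPdist_le : hW => /(_ e e0) h.
have [r1 r10 h1] := nbhs0_eball h.
have [r2 r20 h2] := nbhs0_eball (open_nbhs_nbhs (conj oU U0)).
exists (Num.min r1 r2); first by rewrite lt_min r10.
move=> l l0; rewrite le_min => /andP[l1 l2]; split; first exact: h2.
by rewrite distrC; exact: h1.
Qed.

(** Division by 0 gives 0: were the constant zero, the quotient of densities would be 0 near the
    origin and could not tend to 1. *)
Lemma riesz_A_gt0 : 0 < A.
Proof.
rewrite lt_def riesz_A_ge0 ?(ltW alpha0)// andbT; apply/negP => /eqP A0.
have h2 : 0 < 2^-1 :> R by [].
have [r r0 hr] := density_approx h2.
pose l : 'rV[R]_d := r *: delta_mx 0 (Ordinal d0).
have el : enorm l = r by rewrite enormZ enorm_delta mulr1 gtr0_norm.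
have l0 : l != 0 by rewrite -enorm_gt0 el.
have [|_] := hr l l0; first by rewrite el.
rewrite /riesz_density -/A A0 mul0r invr0 mulr0 mul0r sub0r normrN normr1.
by rewrite leNgt invf_lt1// ltr1n.
Qed.

Lemma density_window e : 0 < e -> e <= 1 -> exists2 r, 0 < r & forall l : 'rV[R]_d, l != 0 ->
  enorm l <= r -> [/\ U l,
    rho l <= (1 + e) * (w (enorm l) * (A * enorm l `^ (alpha - d%:R))) &
    (1 - e) * (w (enorm l) * (A * enorm l `^ (alpha - d%:R))) <= rho l].
Proof.
move=> e0 e1; have [r r0 hr] := density_approx e0; exists r => // l l0 lr.
have [Ul] := hr l l0 lr.
have [_ wpos _] := sw.
have ep : 0 < enorm l by rewrite enorm_gt0.
have [z z0 zE] : exists2 z, 0 < z & z = A * enorm l `^ (alpha - d%:R).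
  by eexists; last reflexivity; exact: mulr_gt0 riesz_A_gt0 (powR_gt0 _ ep).
rewrite /riesz_density -/A -zE.
have wz : 0 < w (enorm l) * z by rewrite mulr_gt0 ?wpos.
have -> : rho l / z / w (enorm l) = rho l / (w (enorm l) * z) by rewrite invfM mulrA mulrAC.
rewrite ler_norml => /andP[h1 h2]; split => //.
- by rewrite -ler_pdivrMr//; lra.
- by rewrite -ler_pdivlMr//; lra.
Qed.

Lemma density_ratio u e : 0 < u -> 0 < e -> e <= 1 ->
  exists2 r, 0 < r & forall l : 'rV[R]_d, l != 0 -> enorm l <= r ->
  [/\ U l, U (u *: l) & rho (u *: l) <= (1 + e) * u `^ (alpha - d%:R) * rho l].
Proof.
(* Chosen so that (1 + e2)^2 <= (1 + e) (1 - e2). *)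
move=> u0 e0 e1; have [e2 [e20 e21 e2E]] : exists e2 : R, [/\ 0 < e2, e2 <= 1 / 2 & e2 <= e / 8].
  exists (Num.min (1 / 2) (e / 8)); split.
  - by rewrite lt_min !divr_gt0.
  - by rewrite ge_min lexx.
  - by rewrite ge_min lexx orbT.
have e22 : e2 <= 1 by lra.
have [r1 r10 h1] := density_window e20 e22.
have [_ wpos hw] := sw.
have /cvgrPdist_le/(_ e2 e20)[r2 /= r20 h2] := hw u u0.
have ur : 0 < r1 / u by rewrite divr_gt0.
exists (Num.min (Num.min r1 (r1 / u)) (r2 / 2)); first by rewrite !lt_min r10 ur divr_gt0.
move=> l l0; rewrite !le_min => /andP[/andP[l1 l2] l3].
have lp : 0 < enorm l by rewrite enorm_gt0.
have ul0 : u *: l != 0 by rewrite scaler_eq0 negb_or l0 lt0r_neq0.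
have eul : enorm (u *: l) = u * enorm l by rewrite enormZ gtr0_norm.
have ulr : enorm (u *: l) <= r1 by rewrite eul mulrC -ler_pdivlMr.
have [Ul _ low] := h1 l l0 l1.
have [Uul up _] := h1 _ ul0 ulr.
split => //; apply: le_trans up _; rewrite eul powRM ?(ltW u0) ?(ltW lp)//.
have [z z0 zE] : exists2 z, 0 < z & z = A * enorm l `^ (alpha - d%:R).
  by eexists; last reflexivity; exact: mulr_gt0 riesz_A_gt0 (powR_gt0 _ lp).
rewrite -zE in low.
have uz : 0 < u `^ (alpha - d%:R) by rewrite powR_gt0.
have wl := wpos _ lp.
have wr : w (u * enorm l) <= (1 + e2) * w (enorm l).
  have := h2 (enorm l); rewrite /= sub0r normrN gtr0_norm// => /(_ _ lp).
  have q : enorm l < r2 by rewrite (le_lt_trans l3)// ltr_pdivrMr// ltr_pMr// ltr1n.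
  by move=> /(_ q); rewrite ler_norml => /andP[k _]; rewrite -ler_pdivrMr//; lra.
have e2p : 0 < 1 + e2 by lra.
have -> : (1 + e2) * (w (u * enorm l) * (A * (u `^ (alpha - d%:R) * enorm l `^ (alpha - d%:R)))) =
  u `^ (alpha - d%:R) * ((1 + e2) * (w (u * enorm l) * z)) by rewrite zE; ring.
rewrite [leRHS]mulrAC [leRHS]mulrC ler_wpM2l ?(ltW uz)//.
apply: (@le_trans _ _ ((1 + e2) * ((1 + e2) * w (enorm l) * z))).
  by rewrite ler_wpM2l ?(ltW e2p)// ler_wpM2r ?(ltW z0).
apply: (@le_trans _ _ ((1 + e) * ((1 - e2) * (w (enorm l) * z)))); last first.
  by rewrite ler_wpM2l//; lra.
have -> : (1 + e2) * ((1 + e2) * w (enorm l) * z) = (1 + e2) ^+ 2 * (w (enorm l) * z) by ring.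
rewrite [leRHS]mulrA ler_wpM2r ?mulr_ge0 ?(ltW wl) ?(ltW z0)//.
have q1 : e2 * e2 <= e2 * (1 / 2) by rewrite ler_wpM2l ?(ltW e20).
have q2 : e * e2 <= e * (1 / 2) by rewrite ler_wpM2l ?(ltW e0).
rewrite expr2; lra.
Qed.

Let mB r : measurable (eball r : set (Borel R d)).
Proof. exact: measurable_eball. Qed.

Let mu_origin : mu [set 0] = 0%E.
Proof.
have [mr r0 hr] := hrho; rewrite hr; [|exact: measurable_origin|by move=> x ->].
apply: (raw_integral_point (@lebesgue_rV_set0 R d)).
  exact: lebesgue_rV_origin.
by rewrite lee_fin r0.
Qed.

(** Change of variables in the density. The densities are compared away from 0 only, so the origin,
    a null set here, is first removed on both sides. *)
Lemma density_scale u e : 0 < u -> 0 < e -> e <= 1 -> exists2 r, 0 < r &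
  forall E : set (Borel R d), measurable E -> E `<=` eball r ->
  (mu ((fun x : 'rV[R]_d => (u^-1 *: x : Borel R d)) @^-1` E) <=
    ((1 + e) * u `^ alpha)%:E * mu E)%E.
Proof.
move=> u0 e0 e1; have [r r0 hr] := density_ratio u0 e0 e1; exists r => // E mE Er.
have ui : 0 < u^-1 by rewrite invr_gt0.
have uK (x : 'rV[R]_d) : u^-1 *: (u *: x) = x by rewrite scalerA mulVf ?scale1r// lt0r_neq0.
have Ku (x : 'rV[R]_d) : u *: (u^-1 *: x) = x by rewrite scalerA divff ?scale1r// lt0r_neq0.
have [_ rho0 hr'] := hrho.
pose s (x : Borel R d) : Borel R d := u^-1 *: (x : 'rV[R]_d).
have ms : measurable_fun setT s by exact: scale_measurable.
pose E' := E `\` [set 0 : Borel R d].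
have mE' : measurable E' by apply: measurableD => //; exact: measurable_origin.
have mS B : measurable B -> measurable (s @^-1` B).
  by move=> mB'; rewrite -[X in measurable X]setTI; exact: ms.
have mo : measurable ([set 0] : set (Borel R d)) := measurable_origin.
have drop0 B : measurable B -> mu B = mu (B `\` [set 0]).
  move=> mB'; rewrite -[in LHS](setUIDK B [set 0]) measureU//.
  - rewrite [X in (X + _)%E](_ : _ = 0%E) ?add0e//.
    by apply: (subset_measure0 _ mo _ mu_origin); [exact: measurableI|move=> x []].
  - exact: measurableI.
  - exact: measurableD.
  - by apply/seteqP; split => // x [[_ ?] []].
have E'in x : E' x -> x != 0 /\ enorm (x : 'rV[R]_d) <= r.
  by move=> [/Er xr x0]; split => //; apply/eqP.
rewrite (drop0 E)// (drop0 (s @^-1` E)); last exact: mS.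
rewrite (_ : _ `\` _ = s @^-1` E'); last first.
  apply/seteqP; split => x [Ex x0]; split => //= sx.
    by apply: x0; rewrite -(Ku x); rewrite /s in sx; rewrite sx scaler0.
  by apply: x0; rewrite /s sx scaler0.
rewrite hr'; [|exact: mS|]; last first.
  move=> x /E'in[x0 xr]; have [_ + _] := hr _ x0 xr; by rewrite Ku.
rewrite hr'//; last by move=> x /E'in[x0 xr]; have [] := hr _ x0 xr.
have -> : (1 + e) * u `^ alpha = u^-1^-1 ^+ d * ((1 + e) * u `^ (alpha - d%:R)).
  rewrite invrK mulrCA -powR_mulrn ?(ltW u0)// -powRD ?subrKC//.
  by apply/implyP => _; rewrite lt0r_neq0.
apply: (@raw_integral_scale _ _ _ (@lebesgue_rV R d) _ _ s (fun x : 'rV[R]_d => u *: x)) => //.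
- exact: lebesgue_rV_set0.
- exact: lebesgue_rV_ge0.
- exact: scale_measurable.
- by rewrite exprn_ge0// invrK ltW.
- by rewrite mulr_gt0 ?powR_gt0// addr_gt0.
- by move=> B mB' _; rewrite lebesgue_rV_scale.
- by move=> x /E'in[x0 xr]; rewrite lee_fin rho0//; have [_ + _] := hr _ x0 xr; rewrite Ku.
- by move=> x /E'in[x0 xr]; rewrite lee_fin rho0//; have [] := hr _ x0 xr.
move=> x Ex; split => //; have [x0 xr] := E'in _ Ex.
by have [_ _] := hr _ x0 xr; rewrite Ku -EFinM lee_fin.
Qed.

(** On the box [q, 2q]^d the norm varies by the bounded factor [b], so slow variation is uniform
    there and bounds the density below by [c] > 0; the box has positive volume. *)
Lemma density_ball_pos r : 0 < r -> 0 < m r.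
Proof.
move=> r0; pose b := 2 * Num.sqrt (d%:R : R) + 1.
have dR : 1 <= d%:R :> R by rewrite ler1n.
have sd : 1 <= Num.sqrt (d%:R : R) by rewrite -[leLHS]sqrtr1 ler_wsqrtr.
have b1 : 1 < b by rewrite /b; lra.
have b0 : 0 < b by lra.
have h2 : 0 < 2^-1 :> R by [].
have [X X0 hX] := slowly_varying_uniform b1 (slowly_varying_inv sw) h2.
have h21 : 2^-1 <= 1 :> R by rewrite invf_le1// ler1n.
have [r1 r10 h1] := density_window h2 h21.
pose q := Num.min (Num.min r r1) X^-1 / b.
have q0 : 0 < q by rewrite divr_gt0// !lt_min r0 r10 invr_gt0.
have bq : b * q = Num.min (Num.min r r1) X^-1 by rewrite /q mulrC divfK// lt0r_neq0.
have bqr : b * q <= r by rewrite bq !ge_min lexx.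
have bqr1 : b * q <= r1 by rewrite bq !ge_min lexx orbT.
have bqX : b * q <= X^-1 by rewrite bq !ge_min lexx !orbT.
have [_ wpos _] := sw; have [_ rho0 hr'] := hrho.
pose B : set (Borel R d) := box q (2 * q).
have mBx : measurable B by exact: measurable_box.
have Bin (l : 'rV[R]_d) : B l -> q <= enorm l /\ enorm l <= b * q.
  move=> Bl; split.
    have /andP[k1 _] := Bl (Ordinal d0).
    by apply: le_trans (coord_le_enorm l (Ordinal d0)); rewrite (le_trans k1)// ler_norm.
  have q20 : 0 <= 2 * q by lra.
  apply: le_trans (enorm_le_coord q20 _) _.
    by move=> i; have /andP[k1 k2] := Bl i; rewrite ger0_norm//; lra.
  by rewrite /b; lra.
have qX : q <= X^-1 by rewrite (le_trans _ bqX)// ler_peMl ?(ltW q0)// ltW.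
pose c := 2^-1 * (2^-1 * w q * (A * (b * q) `^ (alpha - d%:R))).
have c0 : 0 < c.
  apply: mulr_gt0 => //; apply: mulr_gt0; first exact: mulr_gt0 (wpos _ q0).
  exact: mulr_gt0 riesz_A_gt0 (powR_gt0 _ (mulr_gt0 b0 q0)).
have low l : B l -> U l /\ c <= rho l.
  move=> Bl; have [l1 l2] := Bin l Bl.
  have lp : 0 < enorm (l : 'rV[R]_d) by apply: lt_le_trans l1.
  have l0 : (l : 'rV[R]_d) != 0 by rewrite -enorm_gt0.
  have [Ul _ k] := h1 l l0 (le_trans l2 bqr1).
  split => //; apply: le_trans k.
  have -> : 1 - 2^-1 = 2^-1 :> R by lra.
  rewrite /c ler_pM2l//; apply: ler_pM.
  - by apply: mulr_ge0 => //; exact: ltW (wpos _ q0).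
  - by apply: mulr_ge0; [exact: ltW riesz_A_gt0|exact: powR_ge0].
  - have Xq : X <= q^-1 by rewrite -(invrK X) lef_pV2 ?posrE ?invr_gt0.
    have Xl : X <= (enorm (l : 'rV[R]_d))^-1.
      by rewrite -(invrK X) lef_pV2 ?posrE ?invr_gt0//; exact: le_trans bqX.
    have k1 : q^-1 <= b * (enorm (l : 'rV[R]_d))^-1.
      by rewrite ler_pdivlMr// mulrC ler_pdivrMr.
    have k2 : (enorm (l : 'rV[R]_d))^-1 <= b * q^-1.
      apply: (@le_trans _ _ q^-1); first by rewrite lef_pV2 ?posrE.
      by rewrite ler_peMl ?invr_ge0 ?(ltW q0)// ltW.
    have := hX _ _ Xq Xl k1 k2; rewrite !invrK ler_norml => /andP[k3 _].
    by rewrite -ler_pdivlMr ?wpos//; lra.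
  - apply: ler_wpM2l; first exact: ltW riesz_A_gt0.
    have -> : alpha - d%:R = - (d%:R - alpha) by rewrite opprB.
    have bq1 : 0 < b * q := mulr_gt0 b0 q0.
    rewrite !powRN lef_pV2 ?posrE ?powR_gt0//.
    have bq0 : 0 <= b * q := mulr_ge0 (ltW b0) (ltW q0).
    by apply: ge0_ler_powR; rewrite ?nnegrE ?subr_ge0 ?(ltW alphad) ?(ltW lp).
have muB : (0 < mu B)%E.
  rewrite hr'//; last by move=> l /low[].
  apply: (@lt_le_trans _ _ (c%:E * lebesgue_rV B)%E).
    rewrite /B lebesgue_rV_box; last by rewrite ler_peMl ?(ltW q0)// ler1n.
    have qq : 0 < 2 * q - q by have -> : 2 * q - q = q by ring.
    by rewrite -EFinM lte_fin; exact: mulr_gt0 c0 (exprn_gt0 _ qq).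
  apply: raw_integral_ge => //.
  - exact: lebesgue_rV_set0.
  - by move=> l /low[Ul _]; rewrite lee_fin rho0.
  - exact: ltW.
  - by move=> l /low[_]; rewrite lee_fin.
rewrite /m fine_gt0// (lt_le_trans muB) ?le_measure ?inE//=.
  by rewrite ltey_eq fin_num_measure.
by move=> l /Bin[_ l2]; exact: le_trans bqr.
Qed.

Lemma density_RVup : RVup (fun T => m T^-1) (- alpha).
Proof.
move=> v e v0 e0; have vi : 0 < v^-1 by rewrite invr_gt0.
have [e1 [e10 e11 e1E]] : exists e1 : R, [/\ 0 < e1, e1 <= 1 & e1 * v `^ (- alpha) <= e].
  have va : 0 < v `^ (- alpha) by rewrite powR_gt0.
  exists (Num.min 1 (e / v `^ (- alpha))); split.
  - by rewrite lt_min ltr01 divr_gt0.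
  - by rewrite ge_min lexx.
  - by rewrite -ler_pdivlMr// ge_min lexx orbT.
have [r r0 hr] := density_scale vi e10 e11.
exists r^-1; split; first by rewrite invr_gt0.
move=> T rT; have T0 : 0 < T by apply: lt_le_trans rT; rewrite invr_gt0.
have := hr (eball T^-1) (mB _); rewrite (_ : _ @^-1` _ = eball (v * T)^-1); last first.
  apply/seteqP; split => x; rewrite /eball /= invrK enormZ gtr0_norm// => h.
    by rewrite invfM -ler_pdivrMl ?invr_gt0// invrK.
  by rewrite -ler_pdivlMl// -invfM.
move=> h; have {}h := h _; rewrite powR_inv_base// in h.
have -> : m (v * T)^-1 = fine (mu (eball (v * T)^-1)) by [].
rewrite -lee_fin fineK ?fin_num_measure// EFinM fineK ?fin_num_measure//.
apply: le_trans (h _) _.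
  by move=> x; rewrite /eball /= => /le_trans; apply; rewrite -(invrK r) lef_pV2 ?posrE ?invr_gt0.
by rewrite lee_wpmul2r// lee_fin mulrDl mul1r; lra.
Qed.

(** The substitution of u l for l multiplies the integral by at most (1 + e1) u^(-alpha). The
    surplus is a multiple of e1 times a ball mass at scale 1/T, absorbed by polynomial growth. *)
Lemma density_vague_scaling : vague_scaling alpha mu.
Proof.
move=> u Q e u0 Q0 e0; have ui : 0 < u^-1 by rewrite invr_gt0.
have [b [C C0 growth]] := poly_growth_of_RVup density_ball_pos density_RVup.
pose c := 1 + u * Q; have c1 : 1 <= c by rewrite /c lerDl mulr_ge0 ?ltW.
have ua : 0 < u `^ (- alpha) by rewrite powR_gt0.
have z0 : 0 < u `^ (- alpha) * (C * c ^+ b).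
  by rewrite mulr_gt0// mulr_gt0// exprn_gt0//; lra.
have [e1 [e10 e11 e1E]] : exists e1 : R, [/\ 0 < e1, e1 <= 1 & e1 * (u `^ (- alpha) * (C * c ^+ b)) <= e].
  exists (Num.min 1 (e / (u `^ (- alpha) * (C * c ^+ b)))); split.
  - by rewrite lt_min ltr01 divr_gt0.
  - by rewrite ge_min lexx.
  - by rewrite -ler_pdivlMr// ge_min lexx orbT.
have [r r0 hr] := density_scale ui e10 e11.
have uQ : 0 < u * Q by rewrite mulr_gt0.
exists (u * Q / r); split; first by rewrite divr_gt0.
move=> T rT p pp _; have T0 : 0 < T by apply: lt_le_trans rT; rewrite divr_gt0.
have uQr : u * Q / T <= r by rewrite ler_pdivrMr// (mulrC r) -ler_pdivrMr.
have main : (\int[mu]_(l in eball (Q / T)) (pow p (u *: l))%:E <=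
    ((1 + e1) * u `^ (- alpha))%:E * \int[mu]_(l in eball (u * Q / T)) (pow p l)%:E)%E.
  rewrite -[X in (X%:E * _)%E]mulr1.
  apply: (@raw_integral_scale _ _ _ mu _ _ (fun x : 'rV[R]_d => u *: x) (fun x : 'rV[R]_d => u^-1 *: x)) => //.
  - exact: scale_measurable.
  - by move=> x; rewrite scalerA mulVf ?scale1r// lt0r_neq0.
  - by move=> x; rewrite scalerA divff ?scale1r// lt0r_neq0.
  - by rewrite mulr_ge0 ?(ltW ua)//; lra.
  - move=> E mE Er; have := hr E mE; rewrite invrK powR_inv_base//; apply.
    by move=> x /Er; rewrite /eball /= => /le_trans; exact.
  - by move=> x _; rewrite lee_fin pow_ge0.
  - by move=> x _; rewrite lee_fin pow_ge0.
  move=> x xQ; split; last by rewrite mul1e.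
  by rewrite /eball /= enormZ (gtr0_norm u0) -mulrA ler_wpM2l ?(ltW u0).
have i1 : mu.-integrable (eball (Q / T)) (fun l : Borel R d => (pow p (u *: l))%:E).
  by apply: bm_integrable => //; exact: bm_pow_scale.
have i2 : mu.-integrable (eball (u * Q / T)) (fun l : Borel R d => (pow p l)%:E).
  by apply: bm_integrable => //; exact: bm_pow.
have {}main : \int[mu]_(l in eball (Q / T)) pow p (u *: l) <=
    (1 + e1) * u `^ (- alpha) * \int[mu]_(l in eball (u * Q / T)) pow p l.
  rewrite /Rintegral -lee_fin EFinM !fineK//; exact: integrable_fin_num.
apply: le_trans main _; rewrite mulrDl mul1r mulrDl lerD//.
  rewrite ler_wpM2l ?(ltW ua)//; apply: Rint_subset => //; first exact: bm_pow.
  by move=> l _; exact: pow_ge0.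
have : \int[mu]_(l in eball (u * Q / T)) pow p l <= C * c ^+ b * m T^-1.
  apply: (@le_trans _ _ (m (c / T))).
    apply: (@le_trans _ _ (m (u * Q / T))).
      by rewrite -[leRHS]mul1r; apply: Rint_le_cst => // [|l _]; [exact: bm_pow|exact: pow_le1].
    by apply: m_le; rewrite ler_wpM2r ?invr_ge0 ?(ltW T0)// /c lerDr.
  have := growth T^-1 (c / T); rewrite invrK divfK ?lt0r_neq0//; apply.
    by rewrite invr_gt0.
  by rewrite -[leLHS]mul1r ler_wpM2r// invr_ge0 ltW.
have q : 0 <= e1 * u `^ (- alpha) by rewrite mulr_ge0 ?(ltW e10) ?(ltW ua).
move=> /(ler_wpM2l q) /le_trans; apply; rewrite mulrA ler_wpM2r ?m_ge0//.
by rewrite -mulrA.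
Qed.

End density.

(** * Isotropic spectral measures *)

Section rotations.
Context {R : realType} {d : nat}.
Implicit Types (x y v : 'rV[R]_d) (O : 'M[R]_d).

Definition rotation O : Prop := O *m O^T = 1%:M /\ \det O = 1.

Definition householder v : 'M[R]_d := 1%:M - 2 *: (v^T *m v).

Lemma mulmx_tr x y : x *m y^T = (dotp x y)%:M :> 'M[R]_1.
Proof.
apply/matrixP => i j; rewrite !ord1 !mxE eqxx mulr1n.
by apply: eq_bigr => k _; rewrite mxE.
Qed.

Lemma dotp_mulmx O x y : O *m O^T = 1%:M -> dotp (x *m O) (y *m O) = dotp x y.
Proof.
move=> OO; have := mulmx_tr (x *m O) (y *m O).
rewrite trmx_mul mulmxA -(mulmxA x) OO mulmx1 mulmx_tr => /matrixP/(_ 0 0).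
by rewrite !mxE eqxx !mulr1n.
Qed.

Lemma enorm_mulmx O x : O *m O^T = 1%:M -> enorm (x *m O) = enorm x.
Proof. by move=> OO; rewrite /enorm dotp_mulmx. Qed.

Lemma rotation1 : rotation 1%:M.
Proof. by split; rewrite ?trmx1 ?mulmx1// det1. Qed.

Lemma rotation_tr O : rotation O -> rotation O^T.
Proof. by move=> [OO O1]; split; rewrite ?trmxK ?det_tr//; exact: mulmx1C. Qed.

Lemma mul_householder x v : x *m householder v = x - (2 * dotp x v) *: v.
Proof.
rewrite /householder mulmxBr mulmx1 -scalemxAr mulmxA mulmx_tr mul_scalar_mx.
by rewrite scalerA.
Qed.

Lemma householder_tr v : (householder v)^T = householder v.
Proof. by rewrite /householder linearB linearZ /= trmx1 trmx_mul trmxK. Qed.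

Lemma householder_sqr v : dotp v v = 1 -> householder v *m householder v = 1%:M.
Proof.
move=> v1; rewrite {2}/householder mulmxBr mulmx1 -scalemxAr mulmxA.
have -> : householder v *m v^T = - v^T.
  rewrite -{1}[householder v]householder_tr -trmx_mul mul_householder v1 mulr1.
  have -> : v - 2 *: v = - v by rewrite scaler_nat mulr2n opprD addrA subrr sub0r.
  by rewrite linearN.
by rewrite mulNmx scalerN opprK /householder subrK.
Qed.

(** Both sides come from block triangular factorisations of the same matrix [M], one for each order
    of elimination. *)
Lemma det_rank1 (u : 'cV[R]_d) v : \det (1%:M + u *m v) = 1 + (v *m u) 0 0.
Proof.
pose M := block_mx (1%:M : 'M[R]_1) (- v) u (1%:M : 'M[R]_d).
have M1 : M = block_mx 1%:M 0 u 1%:M *m block_mx 1%:M (- v) 0 (1%:M + u *m v).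
  rewrite mulmx_block !mul1mx !mul0mx !mulmx1 ?mulmx0 !addr0.
  by rewrite mulmxN addrCA addNr addr0.
have M2 : M = block_mx (1%:M + v *m u) (- v) 0 1%:M *m block_mx 1%:M 0 u 1%:M.
  rewrite mulmx_block !mulmx1 !mul1mx !mul0mx ?mulmx0 !add0r.
  by rewrite mulNmx addrK.
have : \det M = \det M by [].
rewrite {1}M1 M2 !det_mulmx !det_lblock !det_ublock !det1 !mul1r !mulr1 => ->.
by rewrite det_mx11 !mxE eqxx.
Qed.

Lemma det_householder v : dotp v v = 1 -> \det (householder v) = -1.
Proof.
move=> v1; rewrite /householder -scaleNr scalemxAl det_rank1 -scalemxAr mulmx_tr v1.
by rewrite !mxE eqxx mulr1n; ring.
Qed.

(** A product of two reflections, hence of determinant 1: the one along [x] sends x to -x, the one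
    along x + y sends -x to y. *)
Lemma rotation_exists x y : dotp x x = 1 -> dotp y y = 1 -> x + y != 0 ->
  exists2 O, rotation O & x *m O = y.
Proof.
move=> x1 y1 xy; pose n := enorm (x + y); have n0 : 0 < n by rewrite enorm_gt0.
have n2 : n ^+ 2 = 2 * dotp x (x + y).
  by rewrite enorm_sqr dotpDl !dotpDr x1 y1 (dotpC y x); ring.
pose v := n^-1 *: (x + y).
have v1 : dotp v v = 1.
  rewrite dotpZl dotpZr -enorm_sqr -/n expr2 mulKf ?mulVf// lt0r_neq0//.
have H z : dotp z z = 1 -> householder z *m (householder z)^T = 1%:M.
  by move=> z1; rewrite householder_tr householder_sqr.
exists (householder x *m householder v).
  split; last by rewrite det_mulmx !det_householder// mulrNN mulr1.
  by rewrite trmx_mul mulmxA -(mulmxA (householder x)) H// mulmx1 H.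
rewrite mulmxA (mul_householder x) x1 mulr1.
have -> : x - 2 *: x = - x by rewrite scaler_nat mulr2n opprD addrA subrr sub0r.
rewrite mulNmx mul_householder opprB /v dotpZr scalerA.
have -> : 2 * (n^-1 * dotp x (x + y)) / n = 1.
  have -> : 2 * (n^-1 * dotp x (x + y)) / n = (2 * dotp x (x + y)) / n ^+ 2.
    by field; rewrite lt0r_neq0.
  by rewrite -n2 divff// lt0r_neq0// exprn_gt0.
by rewrite scale1r addrC addKr.
Qed.

(* The second alternative is for nearly antipodal points. *)
Lemma rotation_net del : 0 < del -> del <= 1 -> exists W : seq 'M[R]_d,
  [/\ 1%:M \in W, forall O, O \in W -> rotation O &
    forall x y, enorm x = enorm y -> exists2 O, O \in W &
      enorm (x *m O - y) <= del * enorm x \/ enorm (x *m O + y) <= del * enorm x].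
Proof.
move=> del0 del1; have de4 : 0 < del / 4 by rewrite divr_gt0.
have [S hS] := @ball_net R d 1 (del / 4) de4.
pose nrm (a : 'rV[R]_d) := (enorm a)^-1 *: a.
have nrm1 a : a != 0 -> dotp (nrm a) (nrm a) = 1.
  move=> a0; have ea : 0 < enorm a by rewrite enorm_gt0.
  by rewrite dotpZl dotpZr -enorm_sqr expr2 mulKf ?mulVf// lt0r_neq0.
have ex (p : 'rV[R]_d * 'rV[R]_d) : exists O, rotation O /\
    (p.1 != 0 -> p.2 != 0 -> nrm p.1 + nrm p.2 != 0 -> nrm p.1 *m O = nrm p.2).
  have [[a0 b0 ab]|h] := pselect [/\ p.1 != 0, p.2 != 0 & nrm p.1 + nrm p.2 != 0].
    have [Q rQ hQ] := rotation_exists (nrm1 _ a0) (nrm1 _ b0) ab.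
    by exists Q.
  by exists 1%:M; split => [|a0 b0 ab]; [exact: rotation1|case: h].
have [rot hrot] := choice ex.
exists (1%:M :: [seq rot (a, b) | a <- S, b <- S]); split.
- by rewrite inE eqxx.
- move=> O; rewrite inE => /predU1P[->|/allpairsP[[a b] /= [_ _ ->]]].
    exact: rotation1.
  exact: (hrot (a, b)).1.
move=> x y xy; have [x0|x0] := eqVneq x 0.
  exists 1%:M; first by rewrite inE eqxx.
  left; move: xy; rewrite x0 enorm0 => /esym/eqP; rewrite enorm_eq0 => /eqP ->.
  by rewrite mulmx1 subrr enorm0 mulr0.
have ex0 : 0 < enorm x by rewrite enorm_gt0.
have y0 : y != 0 by rewrite -enorm_gt0 -xy.
have near z : z != 0 -> exists2 a, a \in S &
    a != 0 /\ enorm (nrm z - nrm a) <= del / 2.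
  move=> z0; have ez : 0 < enorm z by rewrite enorm_gt0.
  have nz : enorm (nrm z) = 1.
    by rewrite enormZ gtr0_norm ?invr_gt0// mulVf// lt0r_neq0.
  have [|a aS za] := hS (nrm z); first by rewrite /eball /= nz.
  exists a => //; have a0 : a != 0.
    apply/eqP => a0; move: za; rewrite a0 subr0 nz; lra.
  split => //; have ea : 0 < enorm a by rewrite enorm_gt0.
  have -> : nrm z - nrm a = (nrm z - a) + (a - nrm a) by rewrite addrA subrK.
  apply: le_trans (enormD _ _) _; rewrite [leRHS](_ : _ = del / 4 + del / 4); last by field.
  rewrite lerD//; apply: le_trans za.
  (* Normalising the net point [a] moves it by the difference of |a| and 1, which is at most its
     distance to the unit vector [nrm z], that is del/4. *)
  have -> : a - nrm a = (enorm a - 1) *: nrm a.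
    by rewrite scalerBl scale1r /nrm scalerA divff ?scale1r// lt0r_neq0.
  rewrite enormZ; have -> : enorm (nrm a) = 1.
    by rewrite enormZ gtr0_norm ?invr_gt0// mulVf// lt0r_neq0.
  by rewrite mulr1 -nz (le_trans (enorm_lerB _ _))// enorm_distC.
have [a aS [a0 xa]] := near x x0; have [b bS [b0 yb]] := near y y0.
have xE : x = enorm x *: nrm x by rewrite scalerA divff ?scale1r// lt0r_neq0.
have yE : y = enorm x *: nrm y by rewrite xy scalerA divff ?scale1r// lt0r_neq0// -xy.
have [ab|ab] := eqVneq (nrm a + nrm b) 0.
  exists 1%:M; first by rewrite inE eqxx.
  right; rewrite mulmx1 {1}xE {1}yE -scalerDr enormZ gtr0_norm// mulrC ler_wpM2r ?enorm_ge0//.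
  have -> : nrm x + nrm y = (nrm x - nrm a) + (nrm y - nrm b).
    by rewrite addrACA -opprD ab subr0.
  by apply: le_trans (enormD _ _) _; rewrite [leRHS]splitr lerD.
exists (rot (a, b)).
  by rewrite inE; apply/orP; right; apply/allpairsP; exists (a, b).
have [[OO _] /= hO] := hrot (a, b); have {}hO := hO a0 b0 ab.
left; rewrite {1}xE {1}yE -scalemxAl -scalerBr enormZ gtr0_norm// mulrC ler_wpM2r ?enorm_ge0//.
have -> : nrm x *m rot (a, b) - nrm y = (nrm x - nrm a) *m rot (a, b) + (nrm b - nrm y).
  by rewrite mulmxBl hO addrA subrK.
apply: le_trans (enormD _ _) _; rewrite enorm_mulmx// [leRHS]splitr lerD//.
by rewrite enorm_distC.
Qed.

End rotations.

(** * Averaging over finitely many rotations *)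

Section averaging.
Context {R : realType} {d : nat}.
Implicit Types (g : 'rV[R]_d -> R) (W : seq 'M[R]_d) (L : R).

(** The properties of [pow p], with L = 8 pi T for [p] on B(T), that survive averaging over
    rotations. Evenness takes care of nearly antipodal pairs. *)
Definition tame L g : Prop :=
  [/\ bm (g : Borel R d -> R), forall l, 0 <= g l <= 1, forall l, g (- l) = g l &
    forall l l', `|g l - g l'| <= L * enorm (l - l')].

Definition average W g : 'rV[R]_d -> R :=
  fun l => (size W)%:R^-1 * \sum_(O <- W) g (l *m O).

Definition oscillation g r (om : R) : Prop := forall x y,
  enorm x = enorm y -> enorm x <= r -> g x - g y <= om.

Lemma measurable_mulmx (O : 'M[R]_d) :
  measurable_fun setT ((fun l : 'rV[R]_d => l *m O) : Borel R d -> Borel R d).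
Proof.
apply: continuous_Borel_map => l; have FF' : Filter (nbhs (l : 'rV[R]_d)) by exact: nbhs_filter.
apply/(@cvgrPdist_lt _ _ _ _ FF') => e e0.
have cO : continuous (fun l : 'rV[R]_d => enorm ((l : 'rV[R]_d) *m O)).
  have -> : (fun l : 'rV[R]_d => enorm (l *m O)) =
      (fun l => Num.sqrt (\sum_i (\sum_j l 0 j * O j i) * (\sum_j l 0 j * O j i))).
    apply/funext => z; rewrite /enorm /dotp; congr (Num.sqrt _).
    by apply: eq_bigr => i _; rewrite mxE.
  have h i : continuous (fun l : 'rV[R]_d => \sum_j l 0 j * O j i).
    apply: sum_continuous => j; apply: continuous_mul; last exact: cst_continuous.
    exact: coord_continuous.
  have h2 : continuous (fun l : 'rV[R]_d => \sum_i (\sum_j l 0 j * O j i) * (\sum_j l 0 j * O j i)).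
    by apply: sum_continuous => i; exact: continuous_mul.
  by move=> z; apply: (continuous_comp (h2 z)); exact: sqrt_continuous.
have := cO 0; rewrite /continuous_at mul0mx enorm0.
have FF : Filter (nbhs (0 : 'rV[R]_d)) by exact: nbhs_filter.
move/(@cvgrPdist_lt _ _ _ _ FF)/(_ e e0) => /nbhs0_eball[r r0 hr].
apply/nbhs_ballP; exists (r / (Num.sqrt d%:R + 1)) => /=.
  by rewrite divr_gt0// ltr_wpDl// sqrtr_ge0.
move=> y [_ hy]; rewrite -mulmxBl.
have sd0 : 0 <= Num.sqrt (d%:R : R) by exact: sqrtr_ge0.
have k : enorm (l - y) <= r.
  apply: (@le_trans _ _ (Num.sqrt d%:R * (r / (Num.sqrt d%:R + 1)))).
    apply: enorm_le_coord => [|i]; first by rewrite divr_ge0 ?(ltW r0)// addr_ge0.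
    by rewrite !mxE; have := hy 0 i; rewrite /ball /= => /ltW.
  rewrite mulrA ler_pdivrMr ?ltr_wpDl// mulrC ler_wpM2l ?(ltW r0)// lerDl//.
have := hr _ k; rewrite sub0r normrN ger0_norm ?enorm_ge0// => h.
rewrite /Num.norm /= mx_normrE; apply: le_lt_trans h.
apply: bigmax_le => [|[i j] _]; first exact: enorm_ge0.
by rewrite /= (ord1 i); exact: coord_le_enorm.
Qed.

Lemma bm_rotate g (O : 'M[R]_d) : bm (g : Borel R d -> R) ->
  bm ((fun l => g (l *m O)) : Borel R d -> R).
Proof.
move=> [mg [M hM]]; split; last by exists M => x; exact: hM.
exact: (measurableT_comp mg (measurable_mulmx O)).
Qed.

Lemma tame_average L W g : 0 <= L -> (0 < size W)%N ->
  (forall O, O \in W -> rotation O) -> tame L g -> tame L (average W g).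
Proof.
move=> L0 W0 hW [bg g01 ge gL]; have W0' : 0 < (size W)%:R :> R by rewrite ltr0n.
have Wi : 0 <= (size W)%:R^-1 :> R by rewrite invr_ge0 ltW.
split.
- rewrite /average; apply: bmZ.
  apply: (@bm_sum _ (Borel R d) R _ W (fun (Q : 'M[R]_d) (l : 'rV[R]_d) => g (l *m Q))).
  by move=> Q; exact: bm_rotate.
- move=> l; apply/andP; split.
    by rewrite mulr_ge0// sumr_ge0// => O _; have /andP[] := g01 (l *m O).
  rewrite /average ler_pdivrMl// mulr1.
  apply: (@le_trans _ _ (\sum_(O <- W) 1)).
    by apply: ler_sum => O _; have /andP[] := g01 (l *m O).
  by rewrite big_const_seq count_predT iter_addr addr0.
- move=> l; rewrite /average; congr (_ * _); apply: eq_bigr => O _.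
  by rewrite mulNmx ge.
- move=> l l'; rewrite /average -mulrBr -sumrB normrM (ger0_norm Wi).
  rewrite ler_pdivrMl//; apply: le_trans (ler_norm_sum _ _ _) _.
  apply: (@le_trans _ _ (\sum_(O <- W) L * enorm (l - l'))).
    rewrite big_seq [leRHS]big_seq; apply: ler_sum => O /hW[OO _].
    by apply: le_trans (gL _ _) _; rewrite -mulmxBl enorm_mulmx.
  by rewrite big_const_seq count_predT iter_addr addr0 mulr_natl.
Qed.

Lemma sum_le_lists (I J : eqType) (s : seq I) (t : seq J) (f : I -> R) (h : J -> R) om :
  size s = size t -> (forall i j, i \in s -> j \in t -> f i - h j <= om) ->
  \sum_(i <- s) f i - \sum_(j <- t) h j <= (size s)%:R * om.
Proof.
elim: s t => [|i s ih] [|j t]//= => [_ _|[st] hst].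
  by rewrite !big_nil subrr mul0r.
rewrite !big_cons opprD addrACA -[X in X%:R]add1n natrD mulrDl mul1r lerD//.
  by apply: hst; rewrite inE eqxx.
by apply: ih => // i' j' si tj; apply: hst; rewrite inE ?si ?tj orbT.
Qed.

(** The term of [Q1] in the average at [x] is matched with the term of the identity at [y]: they
    differ by at most L del r. The remaining terms, matched arbitrarily, differ by at most [om]
    each. *)
Lemma oscillation_average L W g r om del : 0 <= L -> 0 <= del -> tame L g ->
  1%:M \in W -> (forall O, O \in W -> rotation O) ->
  (forall x y, enorm x = enorm y -> exists2 O, O \in W &
    enorm (x *m O - y) <= del * enorm x \/ enorm (x *m O + y) <= del * enorm x) ->
  oscillation g r om ->
  oscillation (average W g) r
    ((1 - (size W)%:R^-1) * om + (size W)%:R^-1 * (L * (del * r))).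
Proof.
move=> L0 del0 [_ _ ge gL] W1 hW cov osc x y xy xr.
have W0 : (0 < size W)%N by case: (W) W1.
have W0' : 0 < (size W)%:R :> R by rewrite ltr0n.
have [Q1 Q1W near] := cov x y xy.
have one : g (x *m Q1) - g y <= L * (del * r).
  have k (z : 'rV[R]_d) : enorm z <= del * enorm x -> L * enorm z <= L * (del * r).
    by move=> h; rewrite ler_wpM2l// (le_trans h)// ler_wpM2l.
  apply: le_trans (ler_norm _) _; case: near => [h|h].
    exact: le_trans (gL _ _) (k _ h).
  rewrite -(ge y); apply: le_trans (gL _ _) _; rewrite opprK; exact: k.
rewrite /average -mulrBr.
rewrite (perm_big _ (perm_to_rem Q1W)) [X in _ * (_ - X)](perm_big _ (perm_to_rem W1)) /=.
rewrite !big_cons mulmx1 opprD addrACA.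
have sr O : O \in W -> size (rem O W) = (size W).-1 by exact: size_rem.
have rest : \sum_(O <- rem Q1 W) g (x *m O) - \sum_(O <- rem 1%:M W) g (y *m O) <=
    ((size W)%:R - 1) * om.
  have -> : (size W)%:R - 1 = (size (rem Q1 W))%:R :> R.
    by rewrite sr// -[in LHS](prednK W0) -addn1 natrD addrK.
  apply: sum_le_lists; first by rewrite !sr.
  move=> O O' /mem_rem/hW[OO _] /mem_rem/hW[OO' _].
  by apply: osc; rewrite !enorm_mulmx.
rewrite ler_pdivrMl//.
have -> : (size W)%:R * ((1 - (size W)%:R^-1) * om + (size W)%:R^-1 * (L * (del * r))) =
  L * (del * r) + ((size W)%:R - 1) * om by field; rewrite lt0r_neq0.
exact: lerD.
Qed.

(* Whatever [x] and [y] of equal norm, some rotation of [W] moves [x] next to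
   [y] or [- y], which damps the oscillation by the factor [1 - 1 / #|W|]. *)
Lemma oscillation_iter L W g r del k : 0 <= L -> 0 <= del -> 0 <= r -> tame L g ->
  1%:M \in W -> (forall O, O \in W -> rotation O) ->
  (forall x y, enorm x = enorm y -> exists2 O, O \in W &
    enorm (x *m O - y) <= del * enorm x \/ enorm (x *m O + y) <= del * enorm x) ->
  tame L (iter k (average W) g) /\
  oscillation (iter k (average W) g) r ((1 - (size W)%:R^-1) ^+ k + L * (del * r)).
Proof.
move=> L0 del0 r0 tg W1 hW cov.
have W0 : (0 < size W)%N by case: (W) W1.
have W0' : 0 < (size W)%:R :> R by rewrite ltr0n.
elim: k => [|k [tk ok]].
  split => // x y _ _; rewrite expr0 /=; have [_ g01 _ _] := tg.
  have /andP[_ a] := g01 x; have /andP[b _] := g01 y.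
  by have : 0 <= L * (del * r); [rewrite !mulr_ge0|lra].
split; first exact: tame_average.
have := oscillation_average L0 del0 tk W1 hW cov ok; rewrite [iter _ _ _]/=.
move=> h x y xy xr; apply: le_trans (h x y xy xr) _.
rewrite exprS le_eqVlt; apply/orP; left; apply/eqP; ring.
Qed.

End averaging.

(** * Dilation for radial spectral measures *)

Section radial.
Context {R : realType} {d : nat} (alpha : R).
Context (mu : {finite_measure set (Borel R d) -> \bar R}).
Hypothesis d0 : (0 < d)%N.
Hypothesis alpha0 : 0 <= alpha.

Let m (r : R) : R := fine (mu (eball r)).

Let mB r : measurable (eball r : set (Borel R d)).
Proof. exact: measurable_eball. Qed.

Lemma RVup_of_ball_asymptotics (w : R -> R) (ka : R) : 0 < ka ->
  slowly_varying (at_right 0) w ->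
  (forall r, 0 < r -> m r = ka * r `^ alpha * w r) ->
  (forall r, 0 < r -> 0 < m r) /\ RVup (fun T => m T^-1) (- alpha).
Proof.
move=> ka0 sw mE; have [_ wpos _] := sw.
split; first by move=> r r0; rewrite mE// !mulr_gt0 ?powR_gt0 ?wpos.
move=> v e v0 e0; have [_ _ hw] := slowly_varying_inv sw.
have va : 0 < v `^ (- alpha) by rewrite powR_gt0.
have ev : 0 < e / v `^ (- alpha) by rewrite divr_gt0.
have /cvgrPdist_le/(_ _ ev)[T0 [_ hT]] := hw v v0.
exists (`|T0| + 1); split; first by rewrite ltr_wpDl.
move=> T TT; have Tp : 0 < T by apply: lt_le_trans TT; rewrite ltr_wpDl.
have vT : 0 < v * T by rewrite mulr_gt0.
have := hT T; rewrite distrC ler_norml => /(_ _)/andP[].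
  by apply: lt_le_trans TT; rewrite (le_lt_trans (ler_norm _))// ltrDl.
move=> _; rewrite lerBlDr ler_pdivrMr ?wpos ?invr_gt0// => h.
rewrite !mE ?invr_gt0// !powR_inv_base//.
rewrite powRM ?(ltW v0) ?(ltW Tp)//.
have Ta : 0 <= ka * (v `^ (- alpha) * T `^ (- alpha)) by rewrite !mulr_ge0 ?powR_ge0 ?(ltW ka0).
apply: le_trans (ler_wpM2l Ta h) _.
rewrite le_eqVlt; apply/orP; left; apply/eqP; field; exact: lt0r_neq0.
Qed.

Hypothesis hrad : radial mu.

Lemma radial_Rint_le g (O : 'M[R]_d) r : bm (g : Borel R d -> R) ->
  (forall l, 0 <= g l) -> rotation O ->
  \int[mu]_(l in eball r) g (l *m O) <= \int[mu]_(l in eball r) g l.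
Proof.
move=> bg g0 rO; have [OO O1] := rO; have [OO' _] := rotation_tr rO.
rewrite trmxK in OO'.
have i1 : mu.-integrable (eball r) (fun l : Borel R d => (g (l *m O))%:E).
  by apply: bm_integrable => //; exact: bm_rotate.
have i2 : mu.-integrable (eball r) (fun l : Borel R d => (g l)%:E).
  exact: bm_integrable.
rewrite /Rintegral -lee_fin !fineK; [|exact: integrable_fin_num|exact: integrable_fin_num].
rewrite -[leRHS]mul1e -[X in (X%:E * _)%E]mulr1.
apply: (@raw_integral_scale _ _ _ mu _ _ (fun l : 'rV[R]_d => l *m O)
  (fun l : 'rV[R]_d => l *m O^T)) => //.
- exact: measurable_mulmx.
- by move=> l; rewrite -mulmxA OO mulmx1.
- by move=> l; rewrite -mulmxA OO' mulmx1.
- by move=> A mA _; rewrite mul1e hrad.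
- by move=> l _; rewrite lee_fin.
- by move=> l _; rewrite lee_fin.
by move=> l lr; split; [rewrite /eball /= enorm_mulmx|rewrite mul1e].
Qed.

Lemma radial_Rint g (O : 'M[R]_d) r : bm (g : Borel R d -> R) ->
  (forall l, 0 <= g l) -> rotation O ->
  \int[mu]_(l in eball r) g (l *m O) = \int[mu]_(l in eball r) g l.
Proof.
move=> bg g0 rO; apply/eqP; rewrite eq_le radial_Rint_le//=.
have [OO' _] := rotation_tr rO; rewrite trmxK in OO'.
have := @radial_Rint_le (fun l => g (l *m O)) O^T r (bm_rotate O bg) (fun l => g0 _) (rotation_tr rO).
by under eq_Rintegral do rewrite -mulmxA OO' mulmx1.
Qed.

Lemma radial_Rint_average L (W : seq 'M[R]_d) g r u : tame L g -> (0 < size W)%N ->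
  (forall O, O \in W -> rotation O) ->
  \int[mu]_(l in eball r) average W g (u *: l) = \int[mu]_(l in eball r) g (u *: l).
Proof.
move=> [bg g01 _ _] W0 hW.
have bgu : bm ((fun l => g (u *: l)) : Borel R d -> R).
  have [mg [M hM]] := bg; split; last by exists M => x; exact: hM.
  exact: (measurableT_comp mg (@scale_measurable R d u)).
have W0' : 0 < (size W)%:R :> R by rewrite ltr0n.
rewrite /average RintZ//; last first.
  apply: (@bm_sum _ (Borel R d) R _ W (fun (Q : 'M[R]_d) (l : 'rV[R]_d) => g ((u *: l) *m Q))).
  move=> Q; have := bm_rotate Q bgu; congr bm; apply/funext => l.
  by rewrite scalemxAl.
rewrite (@Rint_sum _ (Borel R d) R mu _ W (fun (Q : 'M[R]_d) (l : 'rV[R]_d) => g ((u *: l) *m Q)) _ (mB r))//; last first.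
  move=> Q; have := bm_rotate Q bgu; congr bm; apply/funext => l.
  by rewrite scalemxAl.
have -> : \sum_(Q <- W) \int[mu]_(l in eball r) g ((u *: l) *m Q) =
    \sum_(Q <- W) \int[mu]_(l in eball r) g (u *: l).
  rewrite big_seq [RHS]big_seq; apply: eq_bigr => Q /hW rQ.
  rewrite -(radial_Rint _ bgu _ rQ); last by move=> l; have /andP[] := g01 (u *: l).
  by under eq_Rintegral do rewrite -scalemxAl.
rewrite big_const_seq count_predT iter_addr addr0 -[X in _ * X]mulr_natl mulKf//.
exact: lt0r_neq0.
Qed.

(* [mu] of the ball of radius [j h], with [0] instead of an atom for [j = 0]. *)
Let F (h : R) (j : nat) : R := if j == 0%N then 0 else m (j%:R * h).

(** A Riemann-Stieltjes sum over shells of width [h]. With value 0 for n = 0 instead of the integral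
    over the origin, the innermost shell is a full ball and a possible atom is counted once. *)
Lemma ring_sums g (phi : R -> R) (h v eta : R) n : 0 < h -> 0 < v ->
  bm (g : Borel R d -> R) ->
  (forall j l, (j < n)%N -> j%:R * h <= enorm l -> enorm l <= j.+1%:R * h ->
    `|g l - phi (v * (j.+1%:R * h))| <= eta) ->
  `| (if n == 0%N then 0 else \int[mu]_(l in eball (n%:R * h)) g l) -
     \sum_(j < n) phi (v * (j.+1%:R * h)) * (F h j.+1 - F h j)| <= eta * F h n.
Proof.
move=> h0 v0 bg; elim: n => [|n ih] hg.
  by rewrite big_ord0 /F eqxx subrr normr0 mulr0.
have {}ih := ih (fun j l jn => hg j l (ltnW jn)).
rewrite big_ord_recr /=.
pose B : set (Borel R d) := if n == 0%N then set0 else eball (n%:R * h).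
have mBn : measurable B by rewrite /B; case: ifP.
have BS : B `<=` eball (n.+1%:R * h).
  rewrite /B; case: ifP => [_ l []|_ l /= hl]; apply: le_trans hl _.
  by rewrite ler_wpM2r ?(ltW h0)// ler_nat.
have FB : F h n = fine (mu B) by rewrite /F /B; case: ifP => // _; rewrite measure0.
have IB : (if n == 0%N then 0 else \int[mu]_(l in eball (n%:R * h)) g l) = \int[mu]_(l in B) g l.
  by rewrite /B; case: ifP => // _; rewrite Rintegral_set0.
rewrite IB in ih.
rewrite (Rint_split _ _ mBn bg)// (setIidr BS).
have FS : F h n.+1 - F h n = fine (mu (eball (n.+1%:R * h) `\` B)).
  by rewrite FB /F /= /m (fine_muD mu (mB _) mBn) (setIidr BS) addrAC subrr add0r.
set S := \sum_(i < n) _ in ih *.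
have -> : F h n.+1 = F h n + (F h n.+1 - F h n) by rewrite addrC subrK.
rewrite FS; set D := eball (n.+1%:R * h) `\` B.
have mD : measurable (D : set (Borel R d)) by exact: measurableD.
have Din l : D l -> `|g l - phi (v * (n.+1%:R * h))| <= eta.
  move=> [l1 l2]; apply: hg => //; move: l2; rewrite /B; case: ifP => [/eqP -> _|_ /negP].
    by rewrite mul0r enorm_ge0.
  by rewrite /eball /= -ltNge => /ltW.
have h1 : \int[mu]_(l in D) g l <= (phi (v * (n.+1%:R * h)) + eta) * fine (mu D).
  by apply: Rint_le_cst => // l /Din; rewrite ler_norml => /andP[_]; rewrite lerBlDl.
have h2 : (phi (v * (n.+1%:R * h)) - eta) * fine (mu D) <= \int[mu]_(l in D) g l.
  by apply: Rint_ge_cst => // l /Din; rewrite ler_norml => /andP[+ _]; rewrite lerBrDl.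
move: ih h1 h2; rewrite !ler_norml => /andP[i1 i2] h1 h2.
rewrite mulrDr; apply/andP; split; lra.
Qed.

Hypothesis mpos : forall r, 0 < r -> 0 < m r.
Hypothesis RVM : RVup (fun T => m T^-1) (- alpha).

Lemma ball_ratio_uniform (s : seq R) e : 0 < e -> (forall c, c \in s -> 0 < c) ->
  exists T0, 0 < T0 /\ forall T, T0 <= T -> forall c, c \in s ->
  `|m (c / T) - c `^ alpha * m T^-1| <= e * m T^-1.
Proof.
move=> e0; elim: s => [|c s ih] hs; first by exists 1.
have [T1 [T10 h1]] := ih (fun c' cs => hs c' (ltac:(by rewrite inE cs orbT))).
have c0 : 0 < c by apply: hs; rewrite inE eqxx.
have ci : 0 < c^-1 by rewrite invr_gt0.
have Mpos T : 0 < T -> 0 < m T^-1 by move=> T0; rewrite mpos// invr_gt0.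
have [T2 [T20 h2]] := RVup_dist Mpos RVM ci e0.
exists (T1 + T2); split; first by rewrite addr_gt0.
move=> T TT c'; have T0 : 0 < T by lra.
rewrite inE => /predU1P[->|]; last by apply: h1; lra.
have T2T : T2 <= T by lra.
have := h2 T T2T; rewrite powR_inv_base// opprK invfM invrK => h.
have M0 := Mpos T T0.
have -> : m (c / T) - c `^ alpha * m T^-1 = (m (c / T) / m T^-1 - c `^ alpha) * m T^-1.
  by field; exact: lt0r_neq0.
by rewrite normrM (gtr0_norm M0) ler_wpM2r// ltW.
Qed.

(** The averaged function [g] has the same integrals over balls as [pow p] and is almost constant on
    spheres, so both integrals are close to sums over [n] shells of one radial profile [phi]. The
    rotations, the number of averagings and [n] are fixed before [T]; thus only finitely many ratios
    of ball masses have to converge. *)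
Lemma radial_vague_scaling : vague_scaling alpha mu.
Proof.
move=> u Q e u0 Q0 e0; have pi0 := pi_gt0 R.
have [b [C C0 growth]] := poly_growth_of_RVup mpos RVM.
pose c := 1 + Q + u * Q; have uQ : 0 < u * Q by rewrite mulr_gt0.
have [c1 cQ cuQ] : [/\ 1 <= c, Q <= c & u * Q <= c] by rewrite /c; split; lra.
have ua : 0 < u `^ (- alpha) by rewrite powR_gt0.
have ua' : 0 < u `^ alpha by rewrite powR_gt0.
have [Z Z0 ZE] : exists2 Z, 0 < Z & Z = (1 + u `^ (- alpha)) * (C * c ^+ b).
  eexists; last reflexivity; apply: mulr_gt0; first by rewrite addr_gt0.
  by rewrite mulr_gt0// exprn_gt0//; lra.
have growT T q : 0 < T -> q <= c -> m (q / T) <= C * c ^+ b * m T^-1.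
  move=> T0 qc; apply: (@le_trans _ _ (m (c / T))).
    by apply: m_le; rewrite ler_wpM2r// invr_ge0 ltW.
  have := growth T^-1 (c / T); rewrite invrK divfK ?lt0r_neq0//; apply.
    by rewrite invr_gt0.
  by rewrite -[leLHS]mul1r ler_wpM2r// invr_ge0 ltW.
(* Each of the two shell sums is off by 3 E times a ball mass of at most C c^b m(1/T); with the
   factor u^(-alpha) on the second, this totals 3 E Z m(1/T) = (3/4) e m(1/T). *)
have [E E0 EE] : exists2 E, 0 < E & E = e / (4 * Z).
  by eexists; last reflexivity; rewrite divr_gt0 ?mulr_gt0.
have [P P0 PE] : exists2 P, 0 < P & P = 8 * pi * (u * Q).
  by eexists; last reflexivity; rewrite !mulr_gt0.
have [n [n0 nE]] : exists n : nat, (0 < n)%N /\ P / n%:R <= E.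
  exists (Num.bound (P / E)).+1; split => //.
  rewrite ler_pdivrMr// mulrC -ler_pdivrMr//.
  have := archi_boundP (ltW (divr_gt0 P0 E0)) => /ltW/le_trans; apply.
  by rewrite ler_nat.
have nR : 0 < n%:R :> R by rewrite ltr0n.
have [del [del0 del1 delE]] : exists del, [/\ 0 < del, del <= 1 & P * del <= E].
  exists (Num.min 1 (E / P)); split.
  - by rewrite lt_min ltr01 divr_gt0.
  - by rewrite ge_min lexx.
  - by rewrite mulrC -ler_pdivlMr// ge_min lexx orbT.
have [W [W1 hW cov]] := @rotation_net R d del del0 del1.
have W0 : (0 < size W)%N by case: (W) W1.
have [k kE] : exists k : nat, (1 - (size W)%:R^-1) ^+ k <= E.
  have W0' : 0 < (size W)%:R :> R by rewrite ltr0n.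
  have x0 : 0 <= 1 - (size W)%:R^-1 :> R.
    by rewrite subr_ge0 invf_le1// ler1n.
  have x1 : `|1 - (size W)%:R^-1| < 1 :> R.
    by rewrite ger0_norm// ltrBlDr ltrDl invr_gt0.
  have /cvgrPdist_le/(_ _ E0)[k _ hk] := cvg_expr x1.
  exists k; have := hk k (leqnn k); rewrite sub0r normrN /= => hk'.
  exact: le_trans (ler_norm _) hk'.
pose cs := [seq Q / n%:R * j.+1%:R | j <- iota 0 n] ++
           [seq u * Q / n%:R * j.+1%:R | j <- iota 0 n].
have cs0 c' : c' \in cs -> 0 < c'.
  by rewrite mem_cat => /orP[] /mapP[j _ ->]; rewrite !mulr_gt0 ?invr_gt0 ?ltr0n.
have [ka ka0 kaE] : exists2 ka, 0 < ka &
    u `^ (- alpha) * (2 * n%:R * ((1 + u `^ alpha) * ka)) <= e / 4.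
  have y0 : 0 < u `^ (- alpha) * (2 * n%:R * (1 + u `^ alpha)).
    by rewrite mulr_gt0// mulr_gt0 ?mulr_gt0// addr_gt0.
  exists (e / 4 / (u `^ (- alpha) * (2 * n%:R * (1 + u `^ alpha)))).
    by rewrite !divr_gt0.
  rewrite le_eqVlt; apply/orP; left; apply/eqP; field.
  by rewrite !lt0r_neq0// addr_gt0.
have [T0 [T00 hT]] := ball_ratio_uniform ka0 cs0.
exists T0; split => // T TT p pp sp; have T_gt0 : 0 < T by apply: lt_le_trans TT.
have M0 : 0 < m T^-1 by rewrite mpos// invr_gt0.
pose L := 8 * pi * T; have L0 : 0 <= L by rewrite !mulr_ge0 ?(ltW pi0) ?(ltW T_gt0).
have tp : tame L (pow p).
  split; [exact: bm_pow|by move=> l; rewrite pow_ge0 pow_le1|exact: pow_even|].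
  by move=> l l'; exact: pow_lipschitz.
have r0 : 0 <= u * Q / T by rewrite divr_ge0 ?(ltW uQ) ?(ltW T_gt0).
have [tg osc] := oscillation_iter k L0 (ltW del0) r0 tp W1 hW cov.
set g := iter k (average W) (pow p) in tg osc.
have inv r v : \int[mu]_(l in eball r) g (v *: l) = \int[mu]_(l in eball r) pow p (v *: l).
  rewrite /g; elim: (k) => [|j ihj] //=.
  have [tj _] := oscillation_iter j L0 (ltW del0) r0 tp W1 hW cov.
  by rewrite (radial_Rint_average _ _ tj W0 hW).
have osc2 : oscillation g (u * Q / T) (2 * E).
  move=> x y xy xr; apply: le_trans (osc x y xy xr) _.
  have LP : L * (del * (u * Q / T)) = P * del by rewrite PE /L; move: (pi : R) => q; field; rewrite lt0r_neq0.
  by rewrite LP mulr_natl mulr2n lerD.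
have [bg g01 _ gL] := tg.
pose phi (s : R) := g (s *: delta_mx 0 (Ordinal d0)).
have phi1 s : 0 <= phi s <= 1 by exact: g01.
pose h1 := Q / n%:R / T; pose h2 := u * Q / n%:R / T.
have h10 : 0 < h1 by rewrite !divr_gt0.
have h20 : 0 < h2 by rewrite !divr_gt0.
have close l s : 0 <= s -> enorm l <= u * Q / T -> `|enorm l - s| <= u * Q / n%:R / T ->
    `|g l - phi s| <= 3 * E.
  move=> s0 lQ ls; pose z := enorm l *: (delta_mx 0 (Ordinal d0) : 'rV[R]_d).
  have ez : enorm z = enorm l by rewrite enormZ enorm_delta mulr1 ger0_norm ?enorm_ge0.
  have k1 := osc2 l z (esym ez) lQ; have k2 := osc2 z l ez (ltac:(by rewrite ez)).
  have k3 : `|g z - phi s| <= E.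
    apply: le_trans (gL _ _) _; rewrite -scalerBl enormZ enorm_delta mulr1.
    apply: le_trans (ler_wpM2l L0 ls) _; apply: le_trans nE.
    rewrite PE /L le_eqVlt; apply/orP; left; apply/eqP; move: (pi : R) => q; field.
    by rewrite !lt0r_neq0.
  move: k1 k2 k3; rewrite !ler_norml; clear => k1 k2 /andP[k3 k3']; apply/andP; split; lra.
have uh : u * h1 = h2 by rewrite /h1 /h2; ring.
have nh1 : n%:R * h1 = Q / T by rewrite /h1; field; rewrite !lt0r_neq0.
have nh2 : n%:R * h2 = u * Q / T by rewrite /h2; field; rewrite !lt0r_neq0.
have bgu : bm ((fun l => g (u *: l)) : Borel R d -> R).
  have [mg [M hM]] := bg; split; last by exists M => x; exact: hM.
  exact: (measurableT_comp mg (@scale_measurable R d u)).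
have jn (j : nat) : (j < n)%N -> j.+1%:R * h2 <= u * Q / T.
  by move=> jn; rewrite -nh2 ler_wpM2r ?(ltW h20)// ler_nat.
have j1 (j : nat) : j.+1%:R * h2 = j%:R * h2 + h2 by rewrite -natr1 mulrDl mul1r.
have S1 := @ring_sums (fun l => g (u *: l)) phi h1 u (3 * E) n h10 u0 bgu _.
have S2 := @ring_sums g phi h2 1 (3 * E) n h20 ltr01 bg _.
have {}S1 : `|\int[mu]_(l in eball (Q / T)) g (u *: l) -
    \sum_(j < n) phi (u * (j.+1%:R * h1)) * (F h1 j.+1 - F h1 j)| <= 3 * E * F h1 n.
  have := S1; rewrite (negbTE (lt0n_neq0 n0)) nh1; apply => j l jn' l1 l2.
  have k1 : j%:R * h2 <= enorm (u *: l).
    by rewrite enormZ (gtr0_norm u0) -uh mulrCA ler_wpM2l ?(ltW u0).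
  have k2 : enorm (u *: l) <= j.+1%:R * h2.
    by rewrite enormZ (gtr0_norm u0) -uh mulrCA ler_wpM2l ?(ltW u0).
  rewrite mulrCA uh; apply: close.
  - by rewrite mulr_ge0// ltW.
  - exact: le_trans (jn _ jn').
  - rewrite -/h2 ler_norml; move: (j1 j) k1 k2; clear => -> k1 k2; apply/andP; split; lra.
have {}S2 : `|\int[mu]_(l in eball (u * Q / T)) g l -
    \sum_(j < n) phi (1 * (j.+1%:R * h2)) * (F h2 j.+1 - F h2 j)| <= 3 * E * F h2 n.
  have := S2; rewrite (negbTE (lt0n_neq0 n0)) nh2; apply => j l jn' k1 k2.
  rewrite mul1r; apply: close.
  - by rewrite mulr_ge0// ltW.
  - exact: le_trans (jn _ jn').
  - rewrite -/h2 ler_norml; move: (j1 j) k1 k2; clear => -> k1 k2; apply/andP; split; lra.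
have FF j : (j <= n)%N -> `|F h2 j - u `^ alpha * F h1 j| <= (1 + u `^ alpha) * ka * m T^-1.
  case: j => [_|j jn'].
    by rewrite /F eqxx mulr0 subr0 normr0 !mulr_ge0 ?addr_ge0 ?(ltW ua') ?(ltW ka0) ?(ltW M0).
  rewrite /F /=.
  have e1 : j.+1%:R * h1 = Q / n%:R * j.+1%:R / T by rewrite /h1; ring.
  have e2 : j.+1%:R * h2 = u * Q / n%:R * j.+1%:R / T by rewrite /h2; ring.
  have c1' : Q / n%:R * j.+1%:R \in cs.
    by rewrite mem_cat; apply/orP; left; apply/mapP; exists j => //; rewrite mem_iota.
  have c2' : u * Q / n%:R * j.+1%:R \in cs.
    by rewrite mem_cat; apply/orP; right; apply/mapP; exists j => //; rewrite mem_iota.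
  have := hT T TT _ c1'; have := hT T TT _ c2'; rewrite -e1 -e2.
  have -> : u * Q / n%:R * j.+1%:R = u * (Q / n%:R * j.+1%:R) by ring.
  have q0 : 0 <= Q / n%:R * j.+1%:R by rewrite mulr_ge0// divr_ge0 ?(ltW Q0) ?(ltW nR).
  rewrite powRM ?(ltW u0)//; set y := (Q / n%:R * j.+1%:R) `^ alpha => k2 k1.
  have -> : m (j.+1%:R * h2) - u `^ alpha * m (j.+1%:R * h1) =
    (m (j.+1%:R * h2) - u `^ alpha * y * m T^-1) -
    u `^ alpha * (m (j.+1%:R * h1) - y * m T^-1) by ring.
  apply: le_trans (ler_normB _ _) _; rewrite normrM (gtr0_norm ua').
  have := lerD k2 (ler_wpM2l (ltW ua') k1); move=> /le_trans; apply.
  by rewrite le_eqVlt; apply/orP; left; apply/eqP; ring.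
have comp : \sum_(j < n) phi (u * (j.+1%:R * h1)) * (F h1 j.+1 - F h1 j) <=
    u `^ (- alpha) * \sum_(j < n) phi (1 * (j.+1%:R * h2)) * (F h2 j.+1 - F h2 j) +
    e / 4 * m T^-1.
  rewrite -lerBlDl mulr_sumr -sumrB.
  apply: (@le_trans _ _ (\sum_(j < n) u `^ (- alpha) * (2 * ((1 + u `^ alpha) * ka * m T^-1)))).
    apply: ler_sum => j _; rewrite mul1r mulrCA uh.
    have -> : phi (j.+1%:R * h2) * (F h1 j.+1 - F h1 j) -
      u `^ (- alpha) * (phi (j.+1%:R * h2) * (F h2 j.+1 - F h2 j)) =
      u `^ (- alpha) * (phi (j.+1%:R * h2) * ((F h2 j - u `^ alpha * F h1 j) -
        (F h2 j.+1 - u `^ alpha * F h1 j.+1))).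
      have := powR_mulN alpha u0; set y := u `^ alpha; set z := u `^ (- alpha) => yz.
      have yz' : y = z^-1 by rewrite -[LHS]mulr1 -(mulfV (lt0r_neq0 ua)) -/z mulrA yz mul1r.
      by rewrite yz'; field; exact: lt0r_neq0.
    rewrite ler_wpM2l ?(ltW ua)//.
    have /andP[p0 p1] := phi1 (j.+1%:R * h2).
    apply: le_trans (ler_norm _) _; rewrite normrM (ger0_norm p0).
    apply: (@le_trans _ _ (1 * (2 * ((1 + u `^ alpha) * ka * m T^-1)))); last by rewrite mul1r.
    apply: ler_pM => //; apply: le_trans (ler_normB _ _) _.
    rewrite [leRHS]mulr_natl mulr2n lerD//; apply: FF; [exact: ltnW|exact: ltn_ord].
  rewrite sumr_const card_ord -[_ *+ n]mulr_natl.
  have -> : n%:R * (u `^ (- alpha) * (2 * ((1 + u `^ alpha) * ka * m T^-1))) =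
    u `^ (- alpha) * (2 * n%:R * ((1 + u `^ alpha) * ka)) * m T^-1 by ring.
  by rewrite ler_wpM2r// ltW.
have F1 : F h1 n <= C * c ^+ b * m T^-1.
  by rewrite /F (negbTE (lt0n_neq0 n0)) nh1; exact: growT.
have F2 : F h2 n <= C * c ^+ b * m T^-1.
  by rewrite /F (negbTE (lt0n_neq0 n0)) nh2; exact: growT.
have E30 : 0 <= 3 * E by rewrite mulr_ge0// ltW.
have {}F1 := ler_wpM2l E30 F1; have {}F2 := ler_wpM2l E30 F2.
have ZM : 3 * E * (C * c ^+ b * m T^-1) + u `^ (- alpha) * (3 * E * (C * c ^+ b * m T^-1)) =
    3 / 4 * e * m T^-1.
  have -> : 3 * E * (C * c ^+ b * m T^-1) + u `^ (- alpha) * (3 * E * (C * c ^+ b * m T^-1)) =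
    3 * E * m T^-1 * Z by rewrite ZE; ring.
  by rewrite EE; field; exact: lt0r_neq0.
have I2 : \int[mu]_(l in eball (u * Q / T)) g l <= \int[mu]_l pow p l.
  have := inv (u * Q / T) 1.
  under eq_Rintegral do rewrite scale1r; under [RHS]eq_Rintegral do rewrite scale1r.
  move=> ->; apply: Rint_subset => //; first exact: bm_pow.
  by move=> l _; exact: pow_ge0.
rewrite -inv; move: S1 S2; rewrite !ler_norml => /andP[_ s1] /andP[s2 _].
have {}s2 := ler_wpM2l (ltW ua) s2; have {}F2 := ler_wpM2l (ltW ua) F2.
have {}I2 := ler_wpM2l (ltW ua) I2.
by rewrite -/(m T^-1); move: s1 s2 comp F1 F2 ZM I2; clear; rewrite mulrBr mulrN; lra.
Qed.

End radial.

(** Homogeneity holds in the extended reals and survives [fine] even for an infinite value, which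
    becomes 0 on both sides; the constant at radius 1 is left unevaluated. *)
Lemma riesz_measure_ball (R : realType) (alpha r : R) d : (0 < d)%N -> 0 <= alpha ->
  alpha < d%:R -> 0 < r ->
  fine (riesz_measure alpha (eball r : set 'rV[R]_d)) =
  r `^ alpha * fine (riesz_measure alpha (eball 1 : set 'rV[R]_d)).
Proof.
move=> d0; rewrite le_eqVlt => /predU1P[<- _ r0|a0 ad r0].
  rewrite powRr0 mul1r /riesz_measure eqxx !diracE !mem_set//.
    by rewrite /eball /= enorm0.
  by rewrite /eball /= enorm0 ltW.
have ra : 0 < r `^ alpha by rewrite powR_gt0.
have E : riesz_measure alpha (eball r : set (Borel R d)) =
    ((r `^ alpha)%:E * riesz_measure alpha (eball 1 : set (Borel R d)))%E.
  apply/eqP; rewrite eq_le; apply/andP; split.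
    by rewrite -{1}[r]mulr1; exact: riesz_measure_ball_le.
  have ri : 0 < r^-1 by rewrite invr_gt0.
  have := riesz_measure_ball_le r d0 a0 ad ri; rewrite mulVf ?lt0r_neq0//.
  by rewrite powR_inv_base// powRN lee_pdivlMl.
rewrite E; case: (riesz_measure _ _) => [x| |] //=.
  by rewrite gt0_muley ?lte_fin//= mulr0.
by rewrite gt0_muleNy ?lte_fin//= mulr0.
Qed.

(** * From the four conditions to regular variation and dilation *)

Section conditions_to_transfer.
Context {R : realType} {d : nat} (D : site_type) (alpha : R).
Context (mu : {finite_measure set (Borel R d) -> \bar R}).
Hypothesis alpha0 : 0 <= alpha.
Hypothesis alphad : alpha < d%:R.
Hypothesis carrier : mu (~` frequencies D) = 0%E.

Let d0 : (0 < d)%N. Proof. by rewrite -(ltr0n R); exact: le_lt_trans alphad. Qed.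
Let m (r : R) : R := fine (mu (eball r)).

Let regular : Prop := [/\ forall r, 0 < r -> 0 < m r,
  RVup (fun T => m T^-1) (- alpha) & transfer D alpha mu].

Let regular_of_vague : (forall r, 0 < r -> 0 < m r) ->
  RVup (fun T => m T^-1) (- alpha) -> vague_scaling alpha mu -> regular.
Proof.
move=> mpos RVM hV; split => //.
exact: (vague_transfer d0 carrier mpos (poly_growth_of_RVup mpos RVM) hV).
Qed.

Lemma atom_regular : atom_condition alpha mu -> regular.
Proof.
move=> [aE /=]; have mO := @measurable_origin R d.
have fO := fin_num_measure mu _ mO.
rewrite -(fineK fO) lte_fin => a0.
apply: regular_of_vague; first exact: atom_ball_pos.
  by rewrite aE; exact: atom_RVup.
by rewrite aE; exact: atom_vague_scaling.
Qed.

Lemma density_regular : density_condition alpha mu -> regular.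
Proof.
move=> [a0 [U [rho [oU U0 hrho [w sw hW]]]]].
apply: regular_of_vague.
- exact: (density_ball_pos d0 a0 alphad oU U0 hrho sw hW).
- by move=> v e; exact: (density_RVup d0 a0 oU U0 hrho sw hW).
- exact: (density_vague_scaling d0 a0 alphad oU U0 hrho sw hW).
Qed.

Lemma radial_regular : radial_condition alpha mu -> regular.
Proof.
move=> [hrad sw]; set w := fun r => _ in sw.
pose ka := fine (riesz_measure alpha (eball 1 : set 'rV[R]_d)).
have wE r : 0 < r -> w r = m r / (r `^ alpha * ka).
  by move=> r0; rewrite /w riesz_measure_ball.
have [_ wpos _] := sw.
(* A slowly varying function is positive at 1, which a vanishing constant would contradict. *)
have ka0 : 0 < ka.
  have := wpos 1 ltr01; rewrite wE// powR1 mul1r.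
  have [//|ka0] := ltP 0 ka.
  by rewrite ltNge mulr_ge0_le0 ?m_ge0// invr_le0.
have mE r : 0 < r -> m r = ka * r `^ alpha * w r.
  move=> r0; have ra : 0 < r `^ alpha by rewrite powR_gt0.
  by rewrite wE//; field; rewrite !lt0r_neq0.
have [mpos RVM] := RVup_of_ball_asymptotics ka0 sw mE.
apply: regular_of_vague => //.
exact: radial_vague_scaling.
Qed.

Variable K : 'rV[R]_d -> R.
Hypothesis hK : forall x, sites D x -> K x = coskernel mu x.

Lemma kernel_condition_gauge : kernel_condition D alpha K ->
  exists2 w, slowly_varying (pinfty_nbhs R) w &
    kernel_gauge D mu (fun t => t `^ (- alpha) * w t).
Proof.
move=> [w [mw wpos hw] hW]; pose b := riesz_B alpha d.
have FF : Filter (infinity_within (sites D : set 'rV[R]_d)).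
  apply: filter_from_filter; first by exists 0.
  move=> M N _ _; exists (Num.max M N) => // x [sx /=]; rewrite gt_max => /andP[xM xN].
  by split.
have hW' e : 0 < e -> exists X, 0 < X /\ forall x, sites D x -> X <= enorm x ->
    `|K x / riesz_kernel alpha x / w (enorm x) - 1| <= e.
  move=> e0; have /(@cvgrPdist_le _ _ _ _ FF)/(_ e e0) := hW.
  move=> [M _ hM]; exists (`|M| + 1); split; first by rewrite ltr_wpDl.
  move=> x sx Mx; rewrite distrC; apply: hM; split => //=.
  by apply: lt_le_trans Mx; rewrite (le_lt_trans (ler_norm _))// ltrDl.
(* As division by 0 gives 0, a vanishing constant would make the quotient 0 at arbitrarily distant
   sites, which exist because d > 0. *)
have b0 : 0 < b.
  rewrite lt_def riesz_B_ge0 andbT; apply/negP => /eqP bE.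
  have h2 : 0 < 2^-1 :> R by [].
  have [X [X0 hX]] := hW' _ h2.
  pose x : 'rV[R]_d := (Num.bound X)%:R *: delta_mx 0 (Ordinal d0).
  have ex : enorm x = (Num.bound X)%:R.
    by rewrite enormZ enorm_delta mulr1 ger0_norm.
  have sx : sites D x.
    rewrite /sites; case: D => // i; rewrite !mxE.
    by rewrite rpredM ?rpred_nat//; case: (_ && _); rewrite ?rpred1 ?rpred0.
  have := hX x sx; rewrite ex; move=> /(_ (ltW (archi_boundP (ltW X0)))).
  rewrite /riesz_kernel -/b bE mul0r invr0 mulr0 mul0r sub0r normrN1.
  by rewrite leNgt invf_lt1// ltr1n.
exists (fun t => b * w t).
  split.
  - exact: measurable_funM.
  - by move=> x x0; rewrite mulr_gt0// wpos.
  move=> u u0; apply: cvg_trans (hw u u0); apply: near_eq_cvg.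
  near=> x; have x0 : 0 < x by near: x; exact: nbhs_pinfty_gt.
  have wx := wpos x x0; by field; rewrite !lt0r_neq0.
move=> e e0; have [X [X0 hX]] := hW' e e0.
exists X; split => // x sx xX; have x0 : 0 < enorm x by apply: lt_le_trans xX.
have := hX x sx xX; rewrite -hK// /riesz_kernel -/b.
have xa : 0 < enorm x `^ (- alpha) by rewrite powR_gt0.
have wx := wpos _ x0.
have P0 : 0 < enorm x `^ (- alpha) * (b * w (enorm x)) by exact: mulr_gt0 xa (mulr_gt0 b0 wx).
have -> : K x / (b * enorm x `^ (- alpha)) / w (enorm x) - 1 =
  (K x - enorm x `^ (- alpha) * (b * w (enorm x))) / (enorm x `^ (- alpha) * (b * w (enorm x))).
  by field; rewrite !lt0r_neq0.
by rewrite normrM normfV (gtr0_norm P0) ler_pdivrMr.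
Unshelve. all: by end_near. Qed.

Lemma kernel_regular : kernel_condition D alpha K -> regular.
Proof.
move=> /kernel_condition_gauge[w sw hF]; have hG := slowly_varying_gauge alpha0 sw.
have [_ wpos _] := sw.
have Gpos t : 0 < t -> 0 < t `^ (- alpha) * w t.
  by move=> t0; rewrite mulr_gt0 ?powR_gt0 ?wpos.
(* Any exponent strictly between alpha and d would serve as [beta]. *)
have ab : alpha < (alpha + d%:R) / 2 by rewrite midf_lt.
have bd : (alpha + d%:R) / 2 < d%:R by rewrite midf_lt.
have mpos r : 0 < r -> 0 < m r.
  move=> r0; have [X [c [X0 c0 h]]] := ball_lower alpha0 ab bd Gpos hG hF carrier.
  have t0 : 0 < X + r^-1 by rewrite addr_gt0 ?invr_gt0.
  apply: (@lt_le_trans _ _ (m (X + r^-1)^-1)).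
    apply: lt_le_trans (h _ _); first by rewrite mulr_gt0// Gpos.
    by rewrite lerDl invr_ge0 ltW.
  apply: m_le; rewrite -[leRHS]invrK lef_pV2 ?posrE ?invr_gt0//.
  by rewrite lerDr ltW.
split => //.
- exact: (kernel_RVup alpha0 ab bd Gpos hG hF carrier).
- exact: (kernel_transfer alpha0 ab bd Gpos hG hF carrier).
Qed.

End conditions_to_transfer.

Theorem proposition1p3 (R : realType) (d : nat) (D : site_type) (alpha : R)
    (halpha : 0 <= alpha < d%:R)
    (dO : measure_display) (Omega : measurableType dO)
    (P : probability Omega R) (f : 'rV[R]_d -> {RV P >-> R})
    (hf : SGF D f)
    (mu : {finite_measure set (Borel R d) -> \bar R})
    (hmu : spectral_measure D (covariance_kernel f) mu)
    (hcond : [\/ kernel_condition D alpha (covariance_kernel f),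
                 density_condition alpha mu,
                 radial_condition alpha mu
               | atom_condition alpha mu]) :
  let K := covariance_kernel f in
  let m (r : R) : R := fine (mu (eball r)) in
  let Cap (T : R) : \bar R := capacity K (ball_in D T) in
  slowly_varying (at_right 0) (fun r => r `^ (- alpha) * m r) /\
  slowly_varying (pinfty_nbhs R) (fun T => T `^ (- alpha) * fine (Cap T)) /\
  (ln (m r) / ln r @[r --> 0^'+] --> alpha) /\
  (forall eps : R, 0 < eps ->
     fine (Cap (T + T `^ (1 - eps))) / fine (Cap T) @[T --> +oo] --> (1 : R)) /\
  (exists2 c : R, 0 < c & forall r : R, 0 < r -> m (2 * r) <= c * m r).
Proof.
move=> K m Cap; have /andP[alpha0 alphad] := halpha; have [carrier _ hFT] := hmu.
have hK x : sites D x -> K x = coskernel mu x.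
  by move=> /hFT; rewrite /fourier => -[].
have [mpos RVM tr] : [/\ forall r, 0 < r -> 0 < m r,
    RVup (fun T => m T^-1) (- alpha) & transfer D alpha mu].
  case: hcond => [hc|hc|hc|hc].
  - exact: (kernel_regular alpha0 alphad carrier hK hc).
  - exact: (density_regular alpha0 alphad carrier hc).
  - exact: (radial_regular alpha0 alphad carrier hc).
  - exact: (atom_regular alpha0 alphad carrier hc).
have growth := poly_growth_of_RVup mpos RVM.
have I_le := least_energy_le hK; have I_approx := least_energy_approx hK.
have CapE T : 0 < T -> fine (Cap T) = (least_energy D K T)^-1.
  move=> T0; apply: (capacityE hK) => //.
  exact: (I_pos mpos I_approx T0).
split; first exact: slowly_varying_ball.
split; first exact: (slowly_varying_capacity alpha0 mpos growth tr I_le I_approx CapE).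
split; first exact: log_ball_cvg.
split; last exact: (doubling_of_RVup mpos RVM).
move=> eps eps0.
exact: (capacity_window alpha0 mpos growth tr I_le I_approx CapE eps0).
Qed.
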